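(* Let $\mathcal S=\{y_1<\dots<y_m\}\subset(0,\infty)$ be finite, let $a:\mathbb R\to\mathbb R$ be measurable, let $q>0$, $T\in[0,\infty]$, and let $g:\mathbb R\to\mathbb R$ be a measurable function with $\{g\ge 0\}\neq\varnothing$. Let $(X,Y)$ be a strong Markov process with state space $\mathbb R\times\mathcal S$ given on a family of probability spaces $(\Omega,\mathcal F,P_{x,y})$, $(x,y)\in\mathbb R\times\mathcal S$. Assume: (0) $E_{x,y}\big[\sup_{0\le t\le T}e^{-qt}|g(X_t)|\,I(t<\infty)\big]<\infty$ for all $(x,y)\in\mathbb R\times\mathcal S$; (1) $(X,Y)$ is adapted to a filtration $(\mathcal F_t)_{t\ge0}$ of sub-$\sigma$-algebras of $\mathcal F$ and, for every $(x,y)\in\mathbb R\times\mathcal S$, there is an $\mathcal F_t$-Brownian motion $B$ on $(\Omega,\mathcal F,P_{x,y})$, independent of $Y$, such that $X_t=X_0+\int_0^t a(X_s)Y_s\,dB_s$ for all $t\ge0$, $P_{x,y}$-a.s.; (2) $Y$ is a continuous-time Markov chain on $\mathcal S$ with $Q$-matrix $(q[y_i,y_j])$; (3) the stochastic differential equation $dG=a(G)\,dW$ driven by a Brownian motion $W$ has a weakly unique strong Markov solution with state space $\mathbb R$; (4) all pairs of processes satisfying (1) and (2) (with the same initial point) have the same law; (5) $Y$ is skip-free. Fix $(x,y)\in\mathbb R\times\mathcal S$ and assume that $$v(x,y)=\sup_{\tau\in\mathcal K_T^{g+}}E_{x,y}\big[e^{-q\tau}g(X_\tau)\big].$$ Then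 $$v(x,y)\le v(x,y')\quad\text{for all } y'\in\mathcal S\text{ such that } y\le y',$$ so that $v(x,y)$ is a lower bound for $v(x,\cdot)$ on $[y,\infty)\cap\mathcal S$.
   Context: Under $P_{x,y}$ the process $(X,Y)$ starts from $X_0=x$, $Y_0=y$. The value function is $$v(x,y)=\sup_{0\le\tau\le T}E_{x,y}[e^{-q\tau}g(X_\tau)],\qquad (x,y)\in\mathbb R\times\mathcal S,$$ where the supremum is over all finite stopping times $\tau$ (with $\tau\le T$) with respect to the filtration generated by the pair $(X,Y)$. $\mathcal K_T^{g+}$ denotes the collection of all finite stopping times $\tau\le T$ with respect to the filtration generated by $(X,Y)$ such that $g(X_\tau)\ge0$. A continuous-time Markov chain with $Q$-matrix $(q[y_i,y_j])$ taking the states $y_1<\dots<y_m$ is called skip-free if its $Q$-matrix is tridiagonal. *)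

(* Defs.v *)
From HB Require Import structures.
From mathcomp Require Import all_boot all_order all_algebra.
From mathcomp Require Import all_classical all_reals all_analysis.
From mathcomp Require Import measurable_realfun.

Set Implicit Arguments.
Unset Strict Implicit.
Unset Printing Implicit Defensive.

Import Order.TTheory GRing.Theory Num.Theory.
Import numFieldNormedType.Exports.

Local Open Scope classical_set_scope.
Local Open Scope ring_scope.

(* Processes are indexed by R, but only the times t >= 0 are ever looked at;
   sub-sigma-algebras are sets of subsets of Omega. *)

Section Filtrations.
Context {R : realType} {d : measure_display} {Omega : measurableType d}.

Definition submeasurable {dE : measure_display} {E : measurableType dE}
    (G : set (set Omega)) (f : Omega -> E) : Prop :=
  forall C : set E, measurable C -> G (f @^-1` C).

Definition filtration (F : R -> set (set Omega)) : Prop :=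
  [/\ forall t : R, 0 <= t -> sigma_algebra [set: Omega] (F t),
      forall t : R, 0 <= t -> F t `<=` measurable &
      forall s t : R, 0 <= s -> s <= t -> F s `<=` F t].

Definition adapted {dE : measure_display} {E : measurableType dE}
    (F : R -> set (set Omega)) (Z : R -> Omega -> E) : Prop :=
  forall t : R, 0 <= t -> submeasurable (F t) (Z t).

Definition generated {dE : measure_display} {E : measurableType dE}
    (I : set R) (Z : R -> Omega -> E) : set (set Omega) :=
  <<s [set A | exists s (C : set E), [/\ I s, measurable C & A = Z s @^-1` C] ]>>.

Definition natural {dE : measure_display} {E : measurableType dE}
    (Z : R -> Omega -> E) (t : R) : set (set Omega) := generated `[0, t] Z.

Definition progressive (F : R -> set (set Omega)) (H : R -> Omega -> R) : Prop :=
  forall t : R, 0 <= t -> forall C : set R, measurable C ->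
    <<s [set A `*` D | A in @measurable _ R & D in F t] >>
      [set p | 0 <= p.1 <= t /\ C (H p.1 p.2)].

Definition right_continuous_paths (Z : R -> Omega -> R) : Prop :=
  forall omega (t : R), 0 <= t -> Z s omega @[s --> t^'+] --> Z t omega.

Definition stopping_time (F : R -> set (set Omega)) (tau : Omega -> \bar R) :
    Prop :=
  (forall omega, 0%E <= tau omega)%E /\
  (forall t : R, 0 <= t -> F t [set omega | (tau omega <= t%:E)%E]).

Definition stopped_sigma (F : R -> set (set Omega)) (tau : Omega -> \bar R) :
    set (set Omega) :=
  [set A | measurable A /\
    forall t : R, 0 <= t -> F t (A `&` [set omega | (tau omega <= t%:E)%E])].

End Filtrations.

Definition pair_process {R : realType} {Omega : Type} (X Y : R -> Omega -> R) :
    R -> Omega -> R * R :=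
  fun t omega => (X t omega, Y t omega).

Section Laws.
Context {R : realType} {dE : measure_display} {E : measurableType dE}.

Definition path_measurable : set (set (R -> E)) :=
  <<s [set A | exists t (C : set E),
        [/\ 0 <= t, measurable C & A = [set w : R -> E | C (w t)] ] ]>>.

Definition same_law
    {d1 : measure_display} {Omega1 : measurableType d1}
    (P1 : probability Omega1 R) (Z1 : R -> Omega1 -> E)
    {d2 : measure_display} {Omega2 : measurableType d2}
    (P2 : probability Omega2 R) (Z2 : R -> Omega2 -> E) : Prop :=
  forall A, path_measurable A ->
    P1 [set omega | A (fun t => Z1 t omega)] =
    P2 [set omega | A (fun t => Z2 t omega)].

Definition transition {d : measure_display} {Omega : measurableType d}
    (P : E -> probability Omega R) (Z : R -> Omega -> E) (t : R) (C : set E) :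
    E -> \bar R :=
  fun z => P z (Z t @^-1` C).

(* D is the state space, as a subset of E; P z is irrelevant for z outside D.
   The strong Markov property is at all stopping times of the natural
   filtration; on [tau < +oo], [fine (tau omega)] is the real number tau. *)
Definition strong_markov {d : measure_display} {Omega : measurableType d}
    (D : set E) (P : E -> probability Omega R) (Z : R -> Omega -> E) : Prop :=
  [/\ forall (t : R) omega, 0 <= t -> D (Z t omega),
      forall t : R, 0 <= t -> measurable_fun [set: Omega] (Z t),
      forall z, D z -> {ae P z, forall omega, Z 0 omega = z},
      forall (t : R) (C : set E), 0 <= t -> measurable C ->
        measurable_fun D (transition P Z t C) &
      forall z, D z -> forall tau, stopping_time (natural Z) tau ->
        forall A, stopped_sigma (natural Z) tau A ->
        forall (t : R) (C : set E), 0 <= t -> measurable C ->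
        let Afin := A `&` [set omega | (tau omega < +oo)%E] in
        P z (Afin `&` [set omega | C (Z (fine (tau omega) + t) omega)]) =
        (\int[P z]_(omega in Afin)
           transition P Z t C (Z (fine (tau omega)) omega))%E].

End Laws.

Section StochasticIntegral.
Context {R : realType} {d : measure_display} {Omega : measurableType d}.

Definition brownian_motion (P : probability Omega R)
    (F : R -> set (set Omega)) (B : R -> Omega -> R) : Prop :=
  [/\ adapted F B,
      {ae P, forall omega, B 0 omega = 0},
      {ae P, forall omega,
         {within `[0, +oo[, continuous (fun t => B t omega)}} &
      forall s t : R, 0 <= s -> s < t -> forall A, F s A ->
        forall C : set R, measurable C ->
        P (A `&` [set omega | C (B t omega - B s omega)]) =
        (P A * normal_prob 0 (Num.sqrt (t - s)) C)%E].

Definition independent_processes (P : probability Omega R)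
    (B Y : R -> Omega -> R) : Prop :=
  forall A C, generated `[0, +oo[ B A -> generated `[0, +oo[ Y C ->
    P (A `&` C) = (P A * P C)%E.

(* Convergence to 0 in probability; the measurable cover makes the definition
   meaningful without measurability of the suprema it is used for. *)
Definition cvg0_in_probability (P : probability Omega R)
    (Z : nat -> Omega -> \bar R) : Prop :=
  forall e : R, 0 < e -> exists A : nat -> set Omega,
    (forall n, measurable (A n) /\
       [set omega | (e%:E < Z n omega)%E] `<=` A n) /\
    P (A n) @[n --> \oo] --> 0%E.

Record simple_process (F : R -> set (set Omega)) := SimpleProcess {
  sp_size : nat;
  sp_time : nat -> R;
  sp_coef : nat -> Omega -> R;
  sp_time_ge0 : forall k, 0 <= sp_time k;
  sp_time_le : forall k, sp_time k <= sp_time k.+1;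
  sp_coef_bounded : exists K : R, forall k omega, `|sp_coef k omega| <= K;
  sp_coef_measurable : forall k, submeasurable (F (sp_time k)) (sp_coef k) }.

Definition sp_fun (F : R -> set (set Omega)) (h : simple_process F) :
    R -> Omega -> R :=
  fun s omega => \sum_(k < sp_size h)
    sp_coef h k omega * \1_`]sp_time h k, sp_time h k.+1] s.

Definition sp_integral (F : R -> set (set Omega)) (h : simple_process F)
    (B : R -> Omega -> R) : R -> Omega -> R :=
  fun t omega => \sum_(k < sp_size h)
    sp_coef h k omega * (B (Num.min t (sp_time h k.+1)) omega -
                         B (Num.min t (sp_time h k)) omega).

(* M_t = \int_0^t H_s dB_s for progressive H with \int_0^t H_s^2 ds < oo a.s.:
   M is the limit, uniformly on compacts in probability, of the elementary
   integrals of simple processes approximating H. *)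
Definition ito_integral (P : probability Omega R) (F : R -> set (set Omega))
    (B H M : R -> Omega -> R) : Prop :=
  [/\ progressive F H,
      {ae P, forall omega, forall t : R, 0 <= t ->
         (\int[lebesgue_measure]_(s in `[0%R, t]) ((H s omega) ^+ 2)%:E < +oo)%E} &
      exists h : nat -> simple_process F, forall t : R, 0 <= t ->
        cvg0_in_probability P (fun n omega =>
          (\int[lebesgue_measure]_(s in `[0%R, t])
             ((sp_fun (h n) s omega - H s omega) ^+ 2)%:E)%E) /\
        cvg0_in_probability P (fun n omega =>
          ereal_sup [set `|sp_integral (h n) B s omega - M s omega|%:E
                    | s in `[0, t]])].

Definition ito_equation (P : probability Omega R) (F : R -> set (set Omega))
    (B H X : R -> Omega -> R) : Prop :=
  exists2 M, ito_integral P F B H M &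
    {ae P, forall omega, forall t : R, 0 <= t -> X t omega = X 0 omega + M t omega}.

(* X_t = X_0 + \int_0^t a(X_s) Y_s dB_s with B independent of Y. *)
Definition volatility_equation (P : probability Omega R)
    (F : R -> set (set Omega)) (a : R -> R) (X Y : R -> Omega -> R) : Prop :=
  exists B, [/\ brownian_motion P F B, independent_processes P B Y &
    ito_equation P F B (fun s omega => a (X s omega) * Y s omega) X].

(* G_t = G_0 + \int_0^t a(G_s) dW_s with G_0 = x. *)
Definition sde_solution (P : probability Omega R) (F : R -> set (set Omega))
    (a : R -> R) (x : R) (G : R -> Omega -> R) : Prop :=
  [/\ filtration F, adapted F G, {ae P, forall omega, G 0 omega = x} &
    exists2 W, brownian_motion P F W &
      ito_equation P F W (fun s omega => a (G s omega)) G].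

End StochasticIntegral.

Section MarkovChain.
Context {R : realType} {m : nat}.

Definition expmx (A : 'M[R]_m) : 'M[R]_m :=
  \matrix_(i, j) limn (series (fun k => (k`!%:R)^-1 * (A ^+ k) i j)).

Definition is_Qmatrix (Q : 'M[R]_m) : Prop :=
  (forall i j, i != j -> 0 <= Q i j) /\ (forall i, \sum_j Q i j = 0).

(* Tridiagonal, for states listed in increasing order. *)
Definition skip_free (Q : 'M[R]_m) : Prop :=
  forall i j : 'I_m, ((i.+1 < j) || (j.+1 < i))%N -> Q i j = 0.

Definition markov_chain {d : measure_display} {Omega : measurableType d}
    (P : probability Omega R) (ys : 'I_m -> R) (Q : 'M[R]_m)
    (Y : R -> Omega -> R) : Prop :=
  [/\ is_Qmatrix Q,
      forall (t : R) omega, 0 <= t -> range ys (Y t omega),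
      forall t : R, 0 <= t -> measurable_fun [set: Omega] (Y t),
      right_continuous_paths Y &
      forall s t : R, 0 <= s -> 0 <= t -> forall A, natural Y s A ->
        forall i j : 'I_m,
        P (A `&` [set omega | Y s omega = ys i] `&`
                 [set omega | Y (s + t) omega = ys j]) =
        (P (A `&` [set omega | Y s omega = ys i]) * (expmx (t *: Q) i j)%:E)%E].

End MarkovChain.

Section Uniqueness.
Context {R : realType}.

Definition weakly_unique_strong_markov_sde (a : R -> R) : Prop :=
  (exists (d : measure_display) (Omega : measurableType d)
          (P : R -> probability Omega R) (G : R -> Omega -> R),
     [/\ right_continuous_paths G, strong_markov [set: R] P G &
         forall x, exists F, sde_solution (P x) F a x G]) /\
  (forall (x : R)
     (d1 : measure_display) (Omega1 : measurableType d1)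
     (P1 : probability Omega1 R) F1 (G1 : R -> Omega1 -> R)
     (d2 : measure_display) (Omega2 : measurableType d2)
     (P2 : probability Omega2 R) F2 (G2 : R -> Omega2 -> R),
     sde_solution P1 F1 a x G1 -> sde_solution P2 F2 a x G2 ->
     same_law P1 G1 P2 G2).

Definition volatility_model {d : measure_display} {Omega : measurableType d}
    (P : probability Omega R) (F : R -> set (set Omega)) (a : R -> R)
    (m : nat) (ys : 'I_m -> R) (Q : 'M[R]_m) (x y : R)
    (X Y : R -> Omega -> R) : Prop :=
  [/\ filtration F, adapted F (pair_process X Y),
      {ae P, forall omega, pair_process X Y 0 omega = (x, y)},
      volatility_equation P F a X Y &
      markov_chain P ys Q Y].

Definition unique_volatility_law (a : R -> R) (m : nat) (ys : 'I_m -> R)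
    (Q : 'M[R]_m) : Prop :=
  forall (x y : R), range ys y ->
  forall (d1 : measure_display) (Omega1 : measurableType d1)
    (P1 : probability Omega1 R) F1 (X1 Y1 : R -> Omega1 -> R)
    (d2 : measure_display) (Omega2 : measurableType d2)
    (P2 : probability Omega2 R) F2 (X2 Y2 : R -> Omega2 -> R),
    volatility_model P1 F1 a ys Q x y X1 Y1 ->
    volatility_model P2 F2 a ys Q x y X2 Y2 ->
    same_law P1 (pair_process X1 Y1) P2 (pair_process X2 Y2).

End Uniqueness.

Section Value.
Context {R : realType} {d : measure_display} {Omega : measurableType d}.
Variables (P : probability Omega R) (X Y : R -> Omega -> R).
Variables (q : R) (g : R -> R) (T : \bar R).

(* tau is a.s. finite below, so the value of [fine] at +oo is immaterial. *)
Definition reward (tau : Omega -> \bar R) : \bar R :=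
  (\int[P]_omega (expR (- q * fine (tau omega)) *
                  g (X (fine (tau omega)) omega))%:E)%E.

Definition admissible (tau : Omega -> \bar R) : Prop :=
  [/\ stopping_time (natural (pair_process X Y)) tau,
      forall omega, (tau omega <= T)%E &
      {ae P, forall omega, (tau omega < +oo)%E}].

Definition admissible_ge0 (tau : Omega -> \bar R) : Prop :=
  admissible tau /\ {ae P, forall omega, 0 <= g (X (fine (tau omega)) omega)}.

Definition value : \bar R := ereal_sup [set reward tau | tau in admissible].

Definition value_ge0 : \bar R :=
  ereal_sup [set reward tau | tau in admissible_ge0].

Definition sup_reward (omega : Omega) : \bar R :=
  ereal_sup [set (expR (- q * t) * `|g (X t omega)|)%:E
            | t in [set t | 0 <= t /\ (t%:E <= T)%E]].

End Value.

(* Main.v *)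
(* Let [G] solve [dG = a(G) dW] from [x] and let [Y] be the chain. If [G] is independent
   of [Y], then [G] run in the clock [m_t = int_0^t Y^2] together with [Y] is a
   model of (1)-(2), so by uniqueness in law it may replace [(X, Y)]. Take [Y^u]
   started at [y'] and [Y^l] started at [y <= y'], independent of each other and of
   [G]. In the clock of [Y^u], follow [Y^l] until the two paths meet and [Y^u] from then
   on: by the strong Markov property the glued path, read back in its own clock, is again
   the chain started at [y]. Since the chain is skip-free, two independent paths cannot
   cross without meeting, so up to the meeting [Y^l <= Y^u] in the common clock,
   i.e. the upper model runs along the same path of [G] at least as fast. A stopping time
   [tau] of the lower model, seen in the upper one, is thus a time [rho <= tau] at which
   the upper process sits at the same place; where [g >= 0] this only increases the
   discounted reward.
   For a fixed path of [Y^l], [rho] is a functional of the paths of the upper model and is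
   optional: [{rho < t}] is in [F_t]. It need not be a stopping time of the (not
   right-continuous) natural filtration, but [X] returns immediately to the level
   [X_rho], so [rho] is a limit of stopping times at which [X] takes this same value. *)
Require Import Defs.
From HB Require Import structures.
From mathcomp Require Import all_boot all_order all_algebra.
From mathcomp Require Import all_classical all_reals all_analysis.
From mathcomp Require Import measurable_realfun.
From mathcomp Require Import ring lra.
Set Implicit Arguments.
Unset Strict Implicit.
Unset Printing Implicit Defensive.
Import Order.TTheory GRing.Theory Num.Theory.
Import numFieldNormedType.Exports.
Local Open Scope classical_set_scope.
Local Open Scope ring_scope.

(** * Clocks and their inverses *)

(** Three times run side by side: the time [l] of the upper model, the time [s] of the lower one,
    and the driving clock [u] of [G]; [mclock], [lclock] and [rho] translate between them. The chain
    has finitely many positive states, so all rates lie between positive constants and every clock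
    is bi-Lipschitz. The delicate point in the Markov property of the glued chain is that the switch
    depends on both paths. If the paths merge between [s] and [s + t], the continuation along the
    upper path can be exchanged for one along the lower path without changing the law: at the
    merging both are in the same state and both start afresh. What is left is the Markov property of
    the lower path alone. Given the chain, its path is almost surely a step function, so integrals
    in the new clock are pathwise limits of Riemann sums. As [g] is merely measurable, the
    approximating stopping times must take the value [X_rho] exactly; coming close would not do. A
    stopping time is handled as a functional of the path, through the events that it has occurred by
    a dyadic time; this lets it move from one probability space to another. *)

Section Paths.
Context {R : realType}.

(** The codomain is arbitrary so that pairs of paths and the boolean [merged] count as
    right-constant paths too. *)
Definition rconst {T : Type} (y : R -> T) : Prop :=
  forall t, 0 <= t -> exists2 e, 0 < e & forall s, t <= s < t + e -> y s = y t.

(** The inverse of such a clock is again one, with constants [C^-1] and [c^-1], so clocks and their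
    inverses are treated alike. *)
Definition bilip (c C : R) (F : R -> R) : Prop :=
  F 0 = 0 /\ forall s t, 0 <= s -> s <= t -> c * (t - s) <= F t - F s <= C * (t - s).

(** A supremum rather than a chosen inverse: it is total, and for a bi-Lipschitz [F] and [u >= 0]
    the set is a closed interval [[0, t]] with [F t = u]. *)
Definition pinv (F : R -> R) (u : R) : R := sup [set t | 0 <= t /\ F t <= u].

Lemma bilip_le (c C : R) (F : R -> R) (s t : R) : 0 < c -> bilip c C F -> 0 <= s -> 0 <= t ->
  (F s <= F t) = (s <= t).
Proof.
move=> c0 [_ H] s0 t0; case: (leP s t) => st.
  have /andP[h _] := H s t s0 st.
  by rewrite -subr_ge0 (le_trans _ h) // mulr_ge0 ?subr_ge0 // ltW.
apply/negbTE; rewrite -ltNge; have /andP[h _] := H t s t0 (ltW st).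
by rewrite -subr_gt0 (lt_le_trans _ h) // mulr_gt0 ?subr_gt0.
Qed.

Lemma bilip_lt (c C : R) (F : R -> R) (s t : R) : 0 < c -> bilip c C F -> 0 <= s -> 0 <= t ->
  (F s < F t) = (s < t).
Proof. by move=> c0 H s0 t0; rewrite !ltNge (bilip_le c0 H). Qed.

Lemma bilip_inj (c C : R) (F : R -> R) (s t : R) : 0 < c -> bilip c C F -> 0 <= s -> 0 <= t ->
  F s = F t -> s = t.
Proof.
by move=> c0 H s0 t0 e; apply/eqP; rewrite eq_le -(bilip_le c0 H s0 t0) -(bilip_le c0 H t0 s0) e lexx.
Qed.

Lemma bilip_ge0 (c C : R) (F : R -> R) (t : R) : 0 < c -> bilip c C F -> 0 <= t -> 0 <= F t.
Proof. by move=> c0 H t0; rewrite -[0](proj1 H) (bilip_le c0 H). Qed.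

Lemma bilip_continuous (c C : R) (F : R -> R) : 0 < c -> bilip c C F ->
  {within `[0, +oo[, continuous F}.
Proof.
move=> c0 H; apply/continuous_within_itvcyP.
have lip (s t : R) : 0 <= s -> 0 <= t -> `|F s - F t| <= (`|C| + 1) * `|s - t|.
  wlog: s t / s <= t => [W s0 t0|st s0 t0].
    case: (leP s t) => [|/ltW] st; first exact: W.
    by rewrite distrC [X in _ * X]distrC; exact: W.
  have := (proj2 H) s t s0 st; rewrite distrC (distrC s) => /andP[h1 h2].
  have h0 : 0 <= F t - F s by rewrite (le_trans _ h1) // mulr_ge0 ?subr_ge0 // ltW.
  rewrite (ger0_norm h0) (@ger0_norm _ (t - s)) ?subr_ge0 // (le_trans h2) //.
  by rewrite ler_wpM2r ?subr_ge0 // (le_trans (ler_norm _)) // lerDl.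
have C1 : 0 < `|C| + 1 by have := normr_ge0 C; lra.
split => [t|].
  rewrite in_itv /= andbT => t0; apply/cvgrPdist_lt => e e0; near=> s.
  apply: (le_lt_trans (lip _ _ (ltW t0) _)); first by apply: ltW; near: s; exact: lt_nbhsr.
  rewrite -ltr_pdivlMl //; near: s.
  by apply: (@cvgr_dist_lt _ _ _ (nbhs t) _ id t) => //; rewrite mulr_gt0 ?invr_gt0.
apply/cvgrPdist_lt => e e0; near=> s.
apply: (le_lt_trans (lip _ _ (lexx _) _)); first by near: s; exact: nbhs_right_ge.
rewrite -ltr_pdivlMl // sub0r normrN gtr0_norm; last by near: s; exact: nbhs_right_gt.
by near: s; apply: nbhs_right_lt; rewrite mulr_gt0 ?invr_gt0.
Unshelve. all: by end_near. Qed.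

Lemma pinv_ex (c C : R) (F : R -> R) (u : R) : 0 < c -> bilip c C F -> 0 <= u ->
  exists2 t, 0 <= t & F t = u.
Proof.
move=> c0 H u0.
(* The lower slope [c] gives [F (u / c) >= u], the right endpoint for the intermediate value
   theorem. *)
have b0 : 0 <= u / c by rewrite divr_ge0 // ltW.
have Fb : u <= F (u / c).
  have := (proj2 H) 0 (u / c) (lexx _) b0.
  by rewrite (proj1 H) !subr0 mulrCA divff ?mulr1 ?gt_eqF // => /andP[].
have [|||t] := @IVT R F 0 (u / c) u => //.
- apply: continuous_subspaceW (bilip_continuous c0 H).
  by apply: subset_itvl.
- by rewrite ge_min le_max (proj1 H) u0 Fb orbT.
- by rewrite in_itv /= => /andP[t0 _] Ft; exists t.
Qed.

Lemma pinv_spec (c C : R) (F : R -> R) (u : R) : 0 < c -> bilip c C F -> 0 <= u ->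
  0 <= pinv F u /\ F (pinv F u) = u.
Proof.
move=> c0 H u0; have [t t0 Ft] := pinv_ex c0 H u0.
suff -> : pinv F u = t by [].
rewrite /pinv (_ : [set _ | _] = `[0, t]%classic) ?sup_itv ?bnd_simp //.
apply/seteqP; split => s /=; rewrite in_itv /=.
  by move=> [s0]; rewrite -Ft (bilip_le c0 H) // => ->; rewrite s0.
by move=> /andP[s0 st]; rewrite -Ft (bilip_le c0 H).
Qed.

Lemma pinv_ge0 (c C : R) (F : R -> R) (u : R) : 0 < c -> bilip c C F -> 0 <= u -> 0 <= pinv F u.
Proof. by move=> c0 H u0; have [] := pinv_spec c0 H u0. Qed.

Lemma pinvK (c C : R) (F : R -> R) (u : R) : 0 < c -> bilip c C F -> 0 <= u -> F (pinv F u) = u.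
Proof. by move=> c0 H u0; have [] := pinv_spec c0 H u0. Qed.

Lemma pinvE (c C : R) (F : R -> R) (t : R) : 0 < c -> bilip c C F -> 0 <= t -> pinv F (F t) = t.
Proof.
move=> c0 H t0; have [] := pinv_spec c0 H (bilip_ge0 c0 H t0) => p0.
exact: bilip_inj c0 H p0 t0.
Qed.

Lemma pinv_le (c C : R) (F : R -> R) (u t : R) : 0 < c -> bilip c C F -> 0 <= u -> 0 <= t ->
  (pinv F u <= t) = (u <= F t).
Proof.
by move=> c0 H u0 t0; have [p0 e] := pinv_spec c0 H u0; rewrite -{2}e (bilip_le c0 H).
Qed.

Lemma pinv_lt (c C : R) (F : R -> R) (u t : R) : 0 < c -> bilip c C F -> 0 <= u -> 0 <= t ->
  (pinv F u < t) = (u < F t).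
Proof.
by move=> c0 H u0 t0; have [p0 e] := pinv_spec c0 H u0; rewrite -{2}e (bilip_lt c0 H).
Qed.

Lemma pinv_bilip (c C : R) (F : R -> R) : 0 < c -> 0 < C -> bilip c C F -> bilip C^-1 c^-1 (pinv F).
Proof.
move=> c0 C0 H; split.
  by rewrite -[X in pinv F X](proj1 H) (pinvE c0 H).
move=> s t s0 st; have t0 := le_trans s0 st.
have [p0 es] := pinv_spec c0 H s0; have [q0 et] := pinv_spec c0 H t0.
have pq : pinv F s <= pinv F t by rewrite -(bilip_le c0 H) // es et.
have := (proj2 H) _ _ p0 pq; rewrite es et => /andP[h1 h2].
by rewrite ler_pdivrMl // ler_pdivlMl // h1 h2.
Qed.

Lemma rconst_comp {T : Type} (c C : R) (F : R -> R) (y : R -> T) : 0 < c -> 0 < C -> bilip c C F ->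
  rconst y -> rconst (fun t => y (F t)).
Proof.
move=> c0 C0 H ry t t0; have [e e0 he] := ry _ (bilip_ge0 c0 H t0).
exists (e / C); first by rewrite divr_gt0.
move=> s /andP[ts se]; apply: he; rewrite (bilip_le c0 H) // ?(le_trans t0) // ts /=.
have := (proj2 H) t s t0 ts => /andP[_ h].
have : s - t < e / C by lra.
by rewrite -(ltr_pM2l C0) (mulrC _ (_ / _)) divfK ?gt_eqF //; lra.
Qed.

Lemma rconst_pair {T U : Type} (y : R -> T) (z : R -> U) :
  rconst y -> rconst z -> rconst (fun t => (y t, z t)).
Proof.
move=> ry rz t t0; have [e e0 he] := ry t t0; have [f f0 hf] := rz t t0.
exists (Num.min e f); first by rewrite lt_min e0.
move=> s /andP[ts]; rewrite -ltrBlDl lt_min => /andP[h1 h2].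
by rewrite he ?hf // ts -ltrBlDl.
Qed.

Lemma rconst_fun {T U : Type} (h : T -> U) (y : R -> T) :
  rconst y -> rconst (fun t => h (y t)).
Proof. by move=> ry t t0; have [e e0 he] := ry t t0; exists e => // s /he ->. Qed.

Lemma rconst_right_cvg (y : R -> R) : rconst y ->
  forall t, 0 <= t -> y s @[s --> t^'+] --> y t.
Proof.
move=> ry t t0; have [e e0 he] := ry t t0.
apply/cvgrPdist_lt => d d0; near=> s; rewrite he ?subrr ?normr0 //.
apply/andP; split; near: s; first exact: nbhs_right_ge.
by apply: nbhs_right_lt; lra.
Unshelve. all: by end_near. Qed.

End Paths.

(** * Dyadic times and joint measurability *)

Section Grid.
Context {R : realType}.

Definition gdn (n : nat) (s : R) : R := (Num.trunc (s * 2 ^+ n))%:R / 2 ^+ n.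
(** The successor, not the ceiling: the value is strictly above [s] even when [s] is a grid point,
    as right limits along [t^'+] require. *)
Definition gup (n : nat) (s : R) : R := (Num.trunc (s * 2 ^+ n)).+1%:R / 2 ^+ n.

Lemma pow2_gt0 (n : nat) : 0 < (2 : R) ^+ n.
Proof. by rewrite exprn_gt0. Qed.
Hint Resolve pow2_gt0 : core.

Lemma pow2_small (e : R) : 0 < e -> \forall n \near \oo, ((2 : R) ^+ n)^-1 < e.
Proof.
move=> e0; near=> n; apply: (@le_lt_trans _ _ (n.+1%:R^-1)).
  rewrite lef_pV2 ?posrE // -natrX ler_nat; exact: ltn_expl.
by near: n; exact: (near_infty_natSinv_lt (PosNum e0)).
Unshelve. all: by end_near. Qed.

Lemma gupE (n : nat) (s : R) : gup n s = gdn n s + (2 ^+ n)^-1.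
Proof. by rewrite /gup /gdn -natr1 mulrDl mul1r. Qed.

Lemma gup_gt (n : nat) (s : R) : s < gup n s.
Proof. by rewrite /gup ltr_pdivlMr // truncnS_gt. Qed.

Lemma gdn_ge0 (n : nat) (s : R) : 0 <= gdn n s.
Proof. by rewrite /gdn divr_ge0 // ltW. Qed.

Lemma gdn_le (n : nat) (s : R) : 0 <= s -> gdn n s <= s.
Proof. by move=> s0; rewrite /gdn ler_pdivrMr // truncn_le mulr_ge0 // ltW. Qed.

Lemma gup_le (n : nat) (s : R) : 0 <= s -> gup n s <= s + (2 ^+ n)^-1.
Proof. by move=> s0; rewrite gupE lerD2r gdn_le. Qed.

Lemma gup_ge0 (n : nat) (s : R) : 0 <= gup n s.
Proof. by rewrite /gup divr_ge0 // ltW. Qed.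

Lemma gup_cvg (s : R) : 0 <= s -> gup n s @[n --> \oo] --> s.
Proof.
move=> s0; apply/cvgrPdist_lt => e e0; near=> n.
rewrite distrC ger0_norm ?subr_ge0 ?ltW ?gup_gt //.
have h : ((2 : R) ^+ n)^-1 < e by near: n; exact: pow2_small.
have := gup_le n s0; lra.
Unshelve. all: by end_near. Qed.

Lemma right_limit_gup (y : R -> R) (t : R) : 0 <= t ->
  y s @[s --> t^'+] --> y t -> y (gup n t) @[n --> \oo] --> y t.
Proof.
move=> t0 /cvg_at_rightP; apply; split; last exact: gup_cvg.
by move=> n; exact: gup_gt.
Qed.

End Grid.
#[export] Hint Resolve pow2_gt0 : core.

Section JointMeasurability.
Context {R : realType} {d : measure_display} {Omega : measurableType d}.

(* Joint measurability over nonnegative times, as a property of all of R * Omega. *)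
Definition jmeas {dE : measure_display} {E : measurableType dE}
    (V : R -> Omega -> E) : Prop :=
  measurable_fun [set: R * Omega] (fun p : R * Omega => V (Num.max p.1 0) p.2).

Lemma measurable_max0 : measurable_fun [set: R] (fun s : R => Num.max s 0).
Proof. exact: measurable_maxr. Qed.

Lemma measurable_trunc_eq (n k : nat) :
  measurable [set s : R | Num.trunc (Num.max s 0 * 2 ^+ n) = k].
Proof.
have mf : measurable_fun [set: R] (fun s : R => Num.max s 0 * 2 ^+ n).
  by apply: measurable_funM => //; exact: measurable_max0.
rewrite (_ : [set _ | _] = (fun s : R => Num.max s 0 * 2 ^+ n) @^-1` `[k%:R, k.+1%:R[).
  by rewrite -[X in measurable X]setTI; exact: mf.
apply/seteqP; split => s /=; rewrite in_itv /=.
  by move=> <-; apply: truncn_itv; rewrite mulr_ge0 // ?le_max ?lexx ?orbT // ltW.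
by move=> h; apply/eqP; rewrite truncn_eq // mulr_ge0 // ?le_max ?lexx ?orbT // ltW.
Qed.

Lemma measurable_grid {dE : measure_display} {E : measurableType dE}
    (V : R -> Omega -> E) (g : nat -> R) (n : nat) :
  (forall k, measurable_fun [set: Omega] (V (g k))) ->
  measurable_fun [set: R * Omega]
    (fun p : R * Omega => V (g (Num.trunc (Num.max p.1 0 * 2 ^+ n))) p.2).
Proof.
move=> mV _ C mC; rewrite setTI.
rewrite (_ : _ @^-1` _ = \bigcup_k ([set s : R | Num.trunc (Num.max s 0 * 2 ^+ n) = k]
    `*` (V (g k) @^-1` C))).
  apply: bigcupT_measurable => k; apply: measurableX; first exact: measurable_trunc_eq.
  by rewrite -[X in measurable X]setTI; exact: mV.
apply/seteqP; split => [[s w] /= h|[s w] /= [k _ /= [<-]]] //.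
by exists (Num.trunc (Num.max s 0 * 2 ^+ n)).
Qed.

(** Read at [gup n], the process is a countable gluing of its sections at grid times, hence jointly
    measurable; right continuity passes to the limit. *)
Lemma jmeas_right_continuous (V : R -> Omega -> R) :
  (forall t, 0 <= t -> measurable_fun [set: Omega] (V t)) ->
  right_continuous_paths V -> jmeas V.
Proof.
move=> mV rc; apply: (measurable_fun_cvg
  (h := fun n (p : R * Omega) => V (gup n (Num.max p.1 0)) p.2)) => [n|[s w] _ /=].
  apply: (measurable_grid (g := fun k => k.+1%:R / 2 ^+ n)) => k.
  by apply: mV; rewrite divr_ge0 // ltW.
by apply: (right_limit_gup (y := V ^~ w)); [rewrite le_max lexx orbT|apply: rc; rewrite le_max lexx orbT].
Qed.

Lemma jmeas_section {dE : measure_display} {E : measurableType dE}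
    (V : R -> Omega -> E) (t : R) : 0 <= t -> jmeas V -> measurable_fun [set: Omega] (V t).
Proof.
move=> t0 mV.
have := measurableT_comp mV (measurable_pair1 t).
by congr measurable_fun; apply/funext => w /=; rewrite max_l.
Qed.

Lemma jmeas_comp {dE : measure_display} {E : measurableType dE}
    (V : R -> Omega -> E) (F : R -> Omega -> R) :
  jmeas V -> jmeas F -> (forall t w, 0 <= t -> 0 <= F t w) ->
  jmeas (fun t w => V (F t w) w).
Proof.
move=> mV mF F0.
have := measurableT_comp mV (measurable_fun_pair mF measurable_snd).
congr measurable_fun; apply/funext => -[s w] /=.
by rewrite max_l // F0 // le_max lexx orbT.
Qed.

Lemma jmeas_random {dE : measure_display} {E : measurableType dE}
    (V : R -> Omega -> E) (r : Omega -> R) :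
  jmeas V -> measurable_fun [set: Omega] r -> (forall w, 0 <= r w) ->
  measurable_fun [set: Omega] (fun w => V (r w) w).
Proof.
move=> mV mr r0.
have := measurableT_comp mV (measurable_fun_pair mr (@measurable_id _ _ setT)).
by congr measurable_fun; apply/funext => w /=; rewrite max_l.
Qed.

End JointMeasurability.

(** * Substitution in integrals along a clock *)

Section ChangeOfVariables.

Definition pushmeasure {R : realType} {d1 d2 : measure_display} {T1 : measurableType d1}
    {T2 : measurableType d2} (m : {measure set T1 -> \bar R}) (f : T1 -> T2)
    (mf : measurable_fun [set: T1] f) : {measure set T2 -> \bar R} :=
  measure_function_pushforward__canonical__measure_function_Measure m mf.

Lemma ge0_integral_mrestr {R : realType} {d : measure_display} {T : measurableType d}
    (m : {measure set T -> \bar R}) (D : set T) (mD : measurable D) (g : T -> \bar R) :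
  measurable_fun [set: T] g -> (forall x, (0 <= g x)%E) ->
  (\int[mrestr m mD]_x g x = \int[m]_(x in D) g x)%E.
Proof.
move=> mg g0; rewrite (@ge0_negligible_integral _ _ _ _ setT (~` D)) //=; last 2 first.
- exact: measurableC.
- by rewrite /mrestr setICl measure0.
rewrite setTD setCK; apply: eq_measure_integral => A mA AD.
by rewrite /= /mrestr setIidl.
Qed.

Local Open Scope ereal_scope.
Context {R : realType}.
Notation mu := (@lebesgue_measure R).
Variables (F f : R -> R).
Hypotheses (mF : measurable_fun [set: R] F) (mf : measurable_fun [set: R] f).
Hypothesis f_ge0 : forall s, (0 <= f s)%R.
Hypothesis Ff : forall a b : R, (a < b)%R ->
  \int[mu]_(s in F @^-1` `]a, b]) (f s)%:E = (b - a)%:E.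

(** The subgraph of [f]. The measure with density [f] is realised as the product measure restricted
    to [D] and projected, so that its image under [F] is a plain pushforward. *)
Let D : set (R * R) := [set p | (0 <= p.2)%R && (p.2 < f p.1)%R].

Let mD : measurable D.
Proof.
rewrite -[D]setTI; apply: (measurable_and _ _ measurableT (Y := [set true])) => //.
- by apply: measurable_fun_ler => //; exact: measurable_snd.
- apply: measurable_fun_ltr; first exact: measurable_snd.
  by apply: measurableT_comp => //; exact: measurable_fst.
Qed.

Let Fst : R * R -> measurableTypeR R := fun p => F p.1.
Let mFst : measurable_fun [set: R * R] Fst.
Proof. by apply: measurableT_comp => //; exact: measurable_fst. Qed.

Let mFst' : measurable_fun [set: R * R] (fun p : R * R => F p.1).
Proof. exact: mFst. Qed.

Let layer_cake (g : R -> \bar R) : measurable_fun [set: R] g -> (forall s, 0 <= g s) ->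
  \int[mu \x mu]_(p in D) g (F p.1) = \int[mu]_s (g (F s) * (f s)%:E).
Proof.
move=> mg g0; rewrite integral_mkcond fubini_tonelli1 /=; last 2 first.
- have h : measurable_fun [set: R * R] (fun p : R * R => g (F p.1)).
    exact: measurableT_comp mg mFst'.
  by apply: (iffLR (measurable_restrictT _ mD)); exact: measurable_funTS h.
- by move=> p; rewrite /patch; case: ifPn.
apply: eq_integral => s _; rewrite /fubini_F.
rewrite (_ : (fun y => _) = (fun _ : R => g (F s)) \_ `[0%R, f s[); last first.
  apply/funext => r; rewrite /patch /=.
  have -> : ((s, r) \in D) = (r \in (`[0%R, f s[%classic : set R)); last by [].
  by apply/idP/idP; rewrite !inE /D /= ?in_itv /=.
rewrite -integral_mkcond integral_cst //= lebesgue_measure_itv /= lte_fin.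
have := f_ge0 s; rewrite le_eqVlt => /predU1P[<-|->]; last by rewrite sube0.
by rewrite ltxx !mule0.
Qed.

Let nu := pushmeasure (mrestr (mu \x mu) mD) mFst.

Let nu_int (g : R -> \bar R) : measurable_fun [set: R] g -> (forall s, 0 <= g s) ->
  \int[nu]_x g x = \int[mu]_s (g (F s) * (f s)%:E).
Proof.
move=> mg g0; rewrite /nu /pushmeasure ge0_integral_pushforward //= preimage_setT ge0_integral_mrestr //.
  by rewrite -layer_cake.
exact: (@measurableT_comp _ _ _ _ _ _ g _ Fst).
Qed.

(** Half-open intervals determine Lebesgue measure, so [Ff] is all that has to be known about [F]
    and [f]; no differentiability enters. *)
Let nuE (A : set R) : measurable A -> mu A = nu A.
Proof.
apply: lebesgue_measure_unique => _ [[a b] _ <-] /=.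
transitivity (\int[nu]_x (\1_(`]a, b]) x)%:E); last by rewrite integral_indic // setIT.
rewrite lebesgue_measure_itv /= lte_fin nu_int //; last by apply/measurable_EFinP.
rewrite (_ : (fun s => _) = (fun s => (f s)%:E) \_ (F @^-1` `]a, b])); last first.
  apply/funext => s; rewrite /patch indicE.
  have -> : (s \in F @^-1` `]a, b]) = (F s \in (`]a, b]%classic : set R)) by apply/idP/idP; rewrite !inE.
  case: (_ \in _) => /=.
    by rewrite mul1e.
  by rewrite mul0e.
rewrite -integral_mkcond; case: ltP => ab; first by rewrite Ff.
by rewrite set_itv_ge ?preimage_set0 ?integral_set0 // bnd_simp -leNgt.
Qed.

Lemma change_of_variables (g : R -> \bar R) : measurable_fun [set: R] g ->
  (forall s, 0 <= g s) -> \int[mu]_x g x = \int[mu]_s (g (F s) * (f s)%:E).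
Proof.
move=> mg g0; rewrite -nu_int //; apply: eq_measure_integral => A mA _; exact: nuE.
Qed.

End ChangeOfVariables.

Section Clock.
Context {R : realType}.
Notation mu := (@lebesgue_measure R).

(** Time is clipped at 0 in the measurability clause, since nothing is assumed about a path at
    negative times. *)
Definition rate (c C : R) (f : R -> R) : Prop :=
  measurable_fun [set: R] (fun s => f (Num.max s 0)) /\ forall t, 0 <= t -> c <= f t <= C.

Definition clock (f : R -> R) (t : R) : R :=
  fine (\int[mu]_(s in `[0%R, t]) (f s)%:E).

Lemma rconst_measurable (y : R -> R) : rconst y ->
  measurable_fun [set: R] (fun s => y (Num.max s 0)).
Proof.
move=> ry; have jy : jmeas (fun t (_ : R) => y t).
  apply: jmeas_right_continuous => [t _|w]; first exact: measurable_cst.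
  exact: rconst_right_cvg.
exact: (measurableT_comp jy (@measurable_pair2 _ _ R R 0)).
Qed.

Lemma rateS (c C : R) f (D : set R) : rate c C f -> D `<=` `[0, +oo[%classic ->
  measurable D -> measurable_fun D (fun s => (f s)%:E).
Proof.
move=> [mf _] DS mD; apply/measurable_EFinP.
apply: (@eq_measurable_fun _ _ R R D (fun s => f (Num.max s 0))); last exact: measurable_funTS.
by move=> s; rewrite inE => /DS /=; rewrite in_itv /= andbT => s0; rewrite max_l.
Qed.

Lemma rate_int_bound (c C : R) f (s t : R) : 0 <= c -> rate c C f -> 0 <= s -> s <= t ->
  ((c * (t - s))%:E <= \int[mu]_(r in `]s, t]) (f r)%:E <= (C * (t - s))%:E)%E.
Proof.
move=> c0 rf s0 st.
have sub : `]s, t]%classic `<=` `[0, +oo[%classic.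
  by move=> r /=; rewrite !in_itv /= andbT => /andP[sr _]; rewrite ltW // (le_lt_trans s0).
have H r : `]s, t]%classic r -> c <= f r <= C.
  by move=> /sub /=; rewrite in_itv /= andbT => /(proj2 rf).
have vol k : (\int[mu]_(r in `]s, t]) (cst k%:E) r = (k * (t - s))%:E)%E.
  rewrite integral_cst //= lebesgue_measure_itv /= lte_fin.
  by case: ltP => // ts; rewrite mule0 (_ : t = s) ?subrr ?mulr0 //; apply/eqP; rewrite eq_le st ts.
rewrite -!vol; apply/andP; split; apply: ge0_le_integral => //.
- exact: rateS rf _ _.
- by move=> r /H; rewrite lee_fin => /andP[].
- by move=> r /H; rewrite lee_fin => /andP[h _]; exact: le_trans h.
- exact: rateS rf _ _.
- by move=> r /H; rewrite lee_fin => /andP[].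
Qed.

Lemma rate_int_split (c C : R) f (s t : R) : 0 <= c -> rate c C f -> 0 <= s -> s <= t ->
  (\int[mu]_(r in `[0%R, t]) (f r)%:E =
   \int[mu]_(r in `[0%R, s]) (f r)%:E + \int[mu]_(r in `]s, t]) (f r)%:E)%E.
Proof.
move=> c0 rf s0 st.
have e : `[0, t]%classic = `[0, s]%classic `|` `]s, t]%classic :> set R.
  by rewrite -itv_bndbnd_setU // bnd_simp.
have sub : (`[0, t]%classic : set R) `<=` `[0, +oo[%classic by exact: subset_itvl.
rewrite e ge0_integral_setU //=.
- by rewrite -e; exact: rateS rf _ _.
- move=> r h; have r0 : 0 <= r.
    by case: h; rewrite in_itv /= => /andP[h _] //; exact: le_trans s0 (ltW h).
  by have /andP[h1 _] := (proj2 rf) r r0; rewrite lee_fin; exact: le_trans c0 h1.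
- apply/disj_setPS => r /=; rewrite !in_itv /= => -[/andP[_ rs] /andP[sr _]].
  by move: (le_lt_trans rs sr); rewrite ltxx.
Qed.

Lemma clock_int (c C : R) f (t : R) : 0 <= c -> rate c C f -> 0 <= t ->
  (\int[mu]_(r in `[0%R, t]) (f r)%:E = (clock f t)%:E)%E.
Proof.
move=> c0 rf t0; rewrite /clock fineK //.
have := rate_int_split c0 rf (lexx _) t0; rewrite set_itv1 integral_set1 add0e => ->.
have /andP[h1 h2] := rate_int_bound c0 rf (lexx _) t0.
by rewrite fin_real // (lt_le_trans _ h1) ?ltNyr // (le_lt_trans h2) ?ltry.
Qed.

Lemma clock_int_itv (c C : R) f (s t : R) : 0 <= c -> rate c C f -> 0 <= s -> s <= t ->
  (\int[mu]_(r in `]s, t]) (f r)%:E = (clock f t - clock f s)%:E)%E.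
Proof.
move=> c0 rf s0 st; have t0 := le_trans s0 st.
have := rate_int_split c0 rf s0 st; rewrite (clock_int c0 rf t0) (clock_int c0 rf s0).
have /andP[h1 h2] := rate_int_bound c0 rf s0 st.
have : (\int[mu]_(r in `]s, t]) (f r)%:E)%E \is a fin_num.
  by rewrite fin_real // (lt_le_trans _ h1) ?ltNyr // (le_lt_trans h2) ?ltry.
by move=> /fineK <-; rewrite -EFinD => -[->]; rewrite addrAC subrr add0r.
Qed.

Lemma clock_bilip (c C : R) f : 0 <= c -> rate c C f -> bilip c C (clock f).
Proof.
move=> c0 rf; split=> [|s t s0 st]; first by rewrite /clock set_itv1 integral_set1.
by have := rate_int_bound c0 rf s0 st; rewrite (clock_int_itv c0 rf s0 st) !lee_fin.
Qed.

Lemma eq_clock (f g : R -> R) (t : R) : (forall s, 0 <= s <= t -> f s = g s) ->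
  clock f t = clock g t.
Proof.
move=> fg; rewrite /clock; congr fine; apply: eq_integral => s.
by rewrite inE /= in_itv /= => /fg ->.
Qed.

Lemma clock_cst1 (t : R) : 0 <= t -> clock (fun=> 1) t = t.
Proof.
move=> t0; rewrite /clock integral_cst //= lebesgue_measure_itv /= lte_fin mul1e.
by move: t0; rewrite le_eqVlt => /predU1P[<-|->]; rewrite ?ltxx //= oppr0 addr0.
Qed.

(* Substitution [u = clock f s]. *)
Lemma clock_subst (c C : R) f (g : R -> \bar R) (t : R) : 0 < c -> rate c C f -> 0 <= t ->
  measurable_fun [set: R] g -> (forall u, (0 <= g u)%E) ->
  (\int[mu]_(u in `[0%R, clock f t]) g u =
   \int[mu]_(s in `[0%R, t]) (g (clock f s) * (f s)%:E))%E.
Proof.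
move=> c0 rf t0 mg g0; have bf := clock_bilip (ltW c0) rf.
have c0' := ltW c0.
(* Extended by the identity, with density 1, on the negative half-line, the clock becomes an
   increasing bijection of the whole line, as the general substitution expects. *)
pose F (s : R) := if 0 <= s then clock f s else s.
pose G (s : R) := if 0 <= s then pinv (clock f) s else s.
pose f' (s : R) := if 0 < s then f (Num.max s 0) else 1.
have FE s : 0 <= s -> F s = clock f s by rewrite /F => ->.
have mono a b : (F a <= F b) = (a <= b).
  rewrite /F; case: ifPn => a0; case: ifPn => b0 //.
  - by rewrite (bilip_le c0 bf).
  - rewrite -ltNge in b0; rewrite !leNgt (lt_le_trans b0 a0).
    by rewrite (lt_le_trans b0) ?(bilip_ge0 c0 bf).
  - rewrite -ltNge in a0; rewrite (le_trans (ltW a0) b0).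
    by rewrite (le_trans (ltW a0)) ?(bilip_ge0 c0 bf).
have FG u : F (G u) = u.
  rewrite /G; case: ifPn => u0; first by rewrite FE ?(pinvK c0 bf) ?(pinv_ge0 c0 bf).
  by rewrite /F (negbTE u0).
have mF : measurable_fun [set: R] F.
  by apply: nondecreasing_measurable => // a b ab; rewrite mono.
have mf' : measurable_fun [set: R] f'.
  apply: measurable_fun_ifT => //; last exact: (proj1 rf).
  exact: measurable_fun_ltr.
have f'0 s : 0 <= f' s.
  rewrite /f'; case: ifPn => // s0; rewrite max_l; last exact: ltW.
  by have /andP[h _] := (proj2 rf) s (ltW s0); apply: le_trans c0' h.
have K1 (a b : R) : a <= b -> b <= 0 ->
    (\int[mu]_(s in `]a, b]) (f' s)%:E = (F b - F a)%:E)%E.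
  move=> ab b0; under eq_integral.
    move=> s; rewrite inE /= in_itv /= => /andP[_ sb].
    rewrite /f' ltNge (le_trans sb b0) /=; over.
  rewrite integral_cst //= lebesgue_measure_itv /= lte_fin mul1e.
  have F_id u : u <= 0 -> F u = u.
    by rewrite le_eqVlt /F => /predU1P[->|]; [rewrite lexx (proj1 bf)|rewrite ltNge => /negbTE ->].
  rewrite !F_id ?(le_trans ab) //.
  by move: ab; rewrite le_eqVlt => /predU1P[->|->]; rewrite ?ltxx ?subrr.
have K2 (a b : R) : 0 <= a -> a <= b ->
    (\int[mu]_(s in `]a, b]) (f' s)%:E = (F b - F a)%:E)%E.
  move=> a0 ab; rewrite !FE ?(le_trans a0) // -(clock_int_itv c0' rf) //.
  apply: eq_integral => s; rewrite inE /= in_itv /= => /andP[sa _].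
  by rewrite /f' (le_lt_trans a0 sa) max_l // ltW // (le_lt_trans a0 sa).
have K (a b : R) : a <= b -> (\int[mu]_(s in `]a, b]) (f' s)%:E = (F b - F a)%:E)%E.
  move=> ab; case: (leP b 0) => b0; first exact: K1.
  case: (leP 0 a) => a0; first exact: K2.
  have e : `]a, b]%classic = `]a, 0]%classic `|` `]0, b]%classic :> set R.
    by rewrite -itv_bndbnd_setU // bnd_simp ltW.
  rewrite e ge0_integral_setU //=.
  - rewrite (K1 _ _ (ltW a0) (lexx _)) (K2 _ _ (lexx _) (ltW b0)) -EFinD.
    by congr EFin; ring.
  - by apply: measurable_funTS; apply/measurable_EFinP.
  - by move=> r _; rewrite lee_fin.
  - apply/disj_setPS => r /=; rewrite !in_itv /= => -[/andP[_ rs] /andP[sr _]].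
    by move: (le_lt_trans rs sr); rewrite ltxx.
have Ff (a b : R) : a < b ->
    (\int[mu]_(s in F @^-1` `]a, b]) (f' s)%:E = (b - a)%:E)%E.
  move=> ab; rewrite (_ : F @^-1` _ = `]G a, G b]%classic).
    by rewrite K ?FG // -mono !FG ltW.
  apply/seteqP; split => s /=; rewrite !in_itv /= -[X in X < F s]FG -[X in F s <= X](FG b).
    by rewrite mono !ltNge mono.
  by rewrite mono !ltNge mono.
pose h u := (g u * (\1_(`]0%R, clock f t]) u)%:E)%E.
have mh : measurable_fun [set: R] h.
  by apply: emeasurable_funM => //; apply/measurable_EFinP.
have h0 u : (0 <= h u)%E by rewrite mule_ge0 // lee_fin indicE.
have cv := @change_of_variables R F f' mF mf' f'0 Ff h mh h0.
rewrite -(integral_itv_obnd_cbnd (r := 0)); last exact: measurable_funTS.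
transitivity (\int[mu]_u h u)%E.
  rewrite integral_mkcond; apply: eq_integral => u _; rewrite /patch /h indicE.
  by case: (_ \in _); rewrite ?mule1 ?mule0.
rewrite {}cv -(integral_itv_obnd_cbnd (r := 0)); last first.
  apply: emeasurable_funM; last first.
    by apply: (rateS rf) => // r /=; rewrite !in_itv /= andbT => /andP[/ltW].
  apply: (@eq_measurable_fun _ _ R _ _ (fun s => g (F s))).
    by move=> r; rewrite inE /= in_itv /= => /andP[/ltW r0 _]; rewrite FE.
  by apply: measurable_funTS; exact: measurableT_comp.
rewrite [RHS]integral_mkcond; apply: eq_integral => s _; rewrite /patch /h indicE.
have -> : (F s \in (`]0, clock f t]%classic : set R)) = (s \in (`]0, t]%classic : set R)).
  rewrite -[in LHS](proj1 bf) -(FE 0) // -(FE t) //.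
  by apply/idP/idP; rewrite !inE /= !in_itv /= !ltNge !mono.
case: ifPn; rewrite ?mule0 ?mul0e // mule1 inE /= in_itv /= => /andP[s0 _].
by rewrite /f' s0 FE ?ltW // max_l // ltW.
Qed.

End Clock.

(** * Merging two paths *)

Section Merging.
Context {R : realType}.
Notation mu := (@lebesgue_measure R).

Definition gpath (c C : R) (y : R -> R) : Prop :=
  rconst y /\ forall t, 0 <= t -> c <= y t <= C.

Definition mclock (y : R -> R) : R -> R := clock (fun t => y t ^+ 2).

(* The path [z] read in the clock of the path [y]. *)
Definition psi (z y : R -> R) (l : R) : R := z (pinv (mclock z) (mclock y l)).

Definition merged (z y : R -> R) (l : R) : bool :=
  `[< exists v, 0 <= v <= l /\ psi z y v = y v >].

Definition low (z y : R -> R) (l : R) : R := if merged z y l then y l else psi z y l.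

(** Obtained from [low ^ 2 ds = y ^ 2 dl], both sides being the same increment of the driving clock:
    it is the speed at which the time of the glued path elapses in the time of [y]. *)
Definition lrate (z y : R -> R) (l : R) : R := (y l / low z y l) ^+ 2.

Definition lclock (z y : R -> R) : R -> R := clock (lrate z y).

Definition rho (z y : R -> R) : R -> R := pinv (lclock z y).

Definition glued (z y : R -> R) (s : R) : R := low z y (rho z y s).

Lemma rconst_rate (c C : R) (f : R -> R) : rconst f ->
  (forall t, 0 <= t -> c <= f t <= C) -> rate c C f.
Proof. by move=> rf H; split => //; exact: rconst_measurable. Qed.

Lemma mergedP (z y : R -> R) (l : R) :
  merged z y l <-> exists v, 0 <= v <= l /\ psi z y v = y v.
Proof. by split => [/asboolP|h]; last exact/asboolP. Qed.

Lemma merged_mono (z y : R -> R) (l l' : R) : l <= l' -> merged z y l -> merged z y l'.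
Proof.
move=> ll /mergedP[v [/andP[v0 vl] e]]; apply/mergedP; exists v; split => //.
by rewrite v0 (le_trans vl).
Qed.

Variables (c C : R).
Hypotheses (c0 : 0 < c) (cC : c <= C).
Let C0 : 0 < C. Proof. exact: lt_le_trans c0 cC. Qed.
Let c2 : 0 < c ^+ 2. Proof. exact: exprn_gt0. Qed.
Let C2 : 0 < C ^+ 2. Proof. exact: exprn_gt0. Qed.

Lemma gpath_sq_rate (y : R -> R) : gpath c C y -> rate (c ^+ 2) (C ^+ 2) (fun t => y t ^+ 2).
Proof.
move=> [ry H]; apply: rconst_rate; first exact: (rconst_fun (fun x => x ^+ 2)).
move=> t /H /andP[h1 h2]; have h0 := le_trans (ltW c0) h1.
by rewrite !lerXn2r ?nnegrE // ltW.
Qed.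

Lemma mclock_bilip (y : R -> R) : gpath c C y -> bilip (c ^+ 2) (C ^+ 2) (mclock y).
Proof. by move=> gy; apply: clock_bilip; [exact: ltW|exact: gpath_sq_rate]. Qed.

Lemma mclock_ge0 (y : R -> R) t : gpath c C y -> 0 <= t -> 0 <= mclock y t.
Proof. by move=> gy; exact: bilip_ge0 c2 (mclock_bilip gy). Qed.

Lemma pinv_mclock_ge0 (y : R -> R) u : gpath c C y -> 0 <= u -> 0 <= pinv (mclock y) u.
Proof. by move=> gy; exact: pinv_ge0 c2 (mclock_bilip gy). Qed.

Section TwoPaths.
Variables z y : R -> R.
Hypotheses (gz : gpath c C z) (gy : gpath c C y).

Let bz := mclock_bilip gz.
Let by_ := mclock_bilip gy.

Lemma psi_gpath : gpath c C (psi z y).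
Proof.
split; last by move=> t t0; apply: (proj2 gz); rewrite pinv_mclock_ge0 ?mclock_ge0.
have h : rconst (fun u => z (pinv (mclock z) u)).
  by apply: (rconst_comp _ _ (pinv_bilip c2 C2 bz)); rewrite ?invr_gt0 //; exact: (proj1 gz).
exact: (rconst_comp c2 C2 by_ h).
Qed.

(** A coincidence in [[t, s]] is already one at [t] if neither path changes on that interval. *)
Lemma merged_rconst : rconst (merged z y).
Proof.
move=> t t0; have [e e0 he] := rconst_pair (proj1 psi_gpath) (proj1 gy) t0.
exists e => // s /andP[ts se]; apply/idP/idP => [/mergedP[v [/andP[v0 vs] e']]|]; last exact: merged_mono.
apply/mergedP; case: (leP v t) => vt; first by exists v; rewrite v0.
exists t; rewrite t0 lexx; split => //.
have /he[<- <-] // : t <= v < t + e by rewrite ltW //= (le_lt_trans vs).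
Qed.

Lemma low_gpath : gpath c C (low z y).
Proof.
split; last by move=> t t0; rewrite /low; case: ifPn => _; [exact: (proj2 gy)|exact: (proj2 psi_gpath)].
have := rconst_pair merged_rconst (rconst_pair (proj1 gy) (proj1 psi_gpath)).
exact: (rconst_fun (fun p : bool * (R * R) => if p.1 then p.2.1 else p.2.2)).
Qed.

Lemma low_gt0 t : 0 <= t -> 0 < low z y t.
Proof. by move=> t0; have /andP[h _] := (proj2 low_gpath) t t0; exact: lt_le_trans h. Qed.

Definition lrate_lb : R := (c / C) ^+ 2.
Definition lrate_ub : R := (C / c) ^+ 2.

Lemma lrate_lb_gt0 : 0 < lrate_lb. Proof. by rewrite exprn_gt0 // divr_gt0. Qed.
Lemma lrate_ub_gt0 : 0 < lrate_ub. Proof. by rewrite exprn_gt0 // divr_gt0. Qed.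

Lemma lrate_rconst : rconst (lrate z y).
Proof.
exact: (rconst_fun (fun p : R * R => (p.1 / p.2) ^+ 2) (rconst_pair (proj1 gy) (proj1 low_gpath))).
Qed.

Lemma lrate_rate : rate lrate_lb lrate_ub (lrate z y).
Proof.
apply: rconst_rate; first exact: lrate_rconst.
move=> t t0; have /andP[h1 h2] := (proj2 gy) t t0.
have /andP[h3 h4] := (proj2 low_gpath) t t0.
have l0 := low_gt0 t0; have y0 := lt_le_trans c0 h1.
rewrite /lrate /lrate_lb /lrate_ub; apply/andP; split; rewrite lerXn2r ?nnegrE ?divr_ge0 ?(ltW c0) ?(ltW C0) ?(ltW l0) ?(ltW y0) //.
  by rewrite ler_pM // ?invr_ge0 ?(ltW c0) ?(ltW C0) // lef_pV2.
by rewrite ler_pM // ?invr_ge0 ?(ltW l0) ?(ltW y0) // lef_pV2.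
Qed.

Lemma lclock_bilip : bilip lrate_lb lrate_ub (lclock z y).
Proof. by apply: clock_bilip; [exact: ltW lrate_lb_gt0|exact: lrate_rate]. Qed.

Lemma rho_bilip : bilip lrate_ub^-1 lrate_lb^-1 (rho z y).
Proof. exact: pinv_bilip lrate_lb_gt0 lrate_ub_gt0 lclock_bilip. Qed.

Lemma rho_ge0 s : 0 <= s -> 0 <= rho z y s.
Proof. exact: pinv_ge0 lrate_lb_gt0 lclock_bilip. Qed.

Lemma rhoK s : 0 <= s -> lclock z y (rho z y s) = s.
Proof. exact: pinvK lrate_lb_gt0 lclock_bilip. Qed.

Lemma lclockK l : 0 <= l -> rho z y (lclock z y l) = l.
Proof. exact: pinvE lrate_lb_gt0 lclock_bilip. Qed.

Lemma lclock_ge0 l : 0 <= l -> 0 <= lclock z y l.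
Proof. exact: bilip_ge0 lrate_lb_gt0 lclock_bilip. Qed.

Lemma rho_le s l : 0 <= s -> 0 <= l -> (rho z y s <= l) = (s <= lclock z y l).
Proof. exact: pinv_le lrate_lb_gt0 lclock_bilip. Qed.

Lemma rho_lt s l : 0 <= s -> 0 <= l -> (rho z y s < l) = (s < lclock z y l).
Proof. exact: pinv_lt lrate_lb_gt0 lclock_bilip. Qed.

Lemma glued_gpath : gpath c C (glued z y).
Proof.
split; last by move=> t t0; apply: (proj2 low_gpath); exact: rho_ge0.
apply: (rconst_comp _ _ rho_bilip); rewrite ?invr_gt0 ?lrate_lb_gt0 ?lrate_ub_gt0 //.
exact: (proj1 low_gpath).
Qed.

Lemma gpath_measurable (w : R -> R) : gpath c C w ->
  measurable_fun [set: R] (fun u => (w (Num.max u 0))).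
Proof. by move=> [rw _]; exact: rconst_measurable. Qed.

(** The glued path at its time [s] and the path [y] at [rho s] have used up the same driving clock:
    the density [lrate] turns [low ^ 2] into [y ^ 2]. Hence both models see the same point of the
    path of [G]. *)
Lemma mclock_glued s : 0 <= s -> mclock (glued z y) s = mclock y (rho z y s).
Proof.
move=> s0; have gg := glued_gpath.
have e1 := clock_int (ltW c2) (gpath_sq_rate gg) s0.
have e2 := clock_int (ltW c2) (gpath_sq_rate gy) (rho_ge0 s0).
suff : (\int[mu]_(r in `[0%R, s]) (glued z y r ^+ 2)%:E =
        \int[mu]_(r in `[0%R, rho z y s]) (y r ^+ 2)%:E)%E by rewrite e1 e2 => -[].
have := clock_subst (g := fun u => (glued z y (Num.max u 0) ^+ 2)%:E) lrate_lb_gt0 lrate_rate (rho_ge0 s0).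
rewrite -[clock (lrate z y)]/(lclock z y) rhoK //.
have mg : measurable_fun [set: R] (fun u => (glued z y (Num.max u 0) ^+ 2)%:E).
  by apply/measurable_EFinP/measurable_funX; exact: gpath_measurable.
move=> /(_ mg (fun u => sqr_ge0 _)) H.
transitivity (\int[mu]_(r in `[0%R, s]) (glued z y (Num.max r 0) ^+ 2)%:E)%E.
  by apply: eq_integral => r; rewrite inE /= in_itv /= => /andP[r0 _]; rewrite max_l.
rewrite H; apply: eq_integral => r; rewrite inE /= in_itv /= => /andP[r0 _].
rewrite -EFinM max_l ?lclock_ge0 // /glued lclockK // /lrate; congr EFin.
by rewrite exprMn mulrCA -exprMn mulfV ?expr1n ?mulr1 // gt_eqF // low_gt0.
Qed.

(** Both sides are the integral of [z ^ -2] over the driving clock up to [mclock y l], written once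
    in the time of [y] and once in the time of [z]. *)
Lemma lclock_low_psi l : 0 <= l -> (forall v, 0 <= v <= l -> low z y v = psi z y v) ->
  lclock z y l = pinv (mclock z) (mclock y l).
Proof.
move=> l0 lp.
have -> : lclock z y l = clock (fun v => (y v / psi z y v) ^+ 2) l.
  by apply: eq_clock => v v0l; rewrite /lrate lp.
pose g u : \bar R := ((z (pinv (mclock z) (Num.max u 0)))^-1 ^+ 2)%:E.
have rz' : rconst (fun u => (z (pinv (mclock z) u))^-1 ^+ 2).
  apply: (rconst_fun (fun x => x^-1 ^+ 2)).
  apply: (rconst_comp _ _ (pinv_bilip c2 C2 bz)); rewrite ?invr_gt0 //.
  exact: (proj1 gz).
have mg : measurable_fun [set: R] g by apply/measurable_EFinP; exact: (rconst_measurable rz').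
have g0 u : (0 <= g u)%E by rewrite lee_fin sqr_ge0.
have S1 := clock_subst c2 (gpath_sq_rate gy) l0 mg g0.
have t0 : 0 <= pinv (mclock z) (mclock y l) by rewrite pinv_mclock_ge0 ?mclock_ge0.
have S2 := clock_subst c2 (gpath_sq_rate gz) t0 mg g0.
rewrite -[clock (fun t => z t ^+ 2)]/(mclock z) -[clock (fun t => y t ^+ 2)]/(mclock y) in S1 S2.
rewrite (pinvK c2 bz) ?mclock_ge0 // in S2.
rewrite -[RHS](clock_cst1 t0) /clock; congr fine.
transitivity (\int[mu]_(s in `[0%R, l]) (g (mclock y s) * (y s ^+ 2)%:E))%E.
  apply: eq_integral => r; rewrite inE /= in_itv /= => /andP[r0 _].
  rewrite -EFinM max_l ?mclock_ge0 // -/(psi z y r); congr EFin.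
  by rewrite exprMn mulrC.
rewrite -S1 S2; apply: eq_integral => r; rewrite inE /= in_itv /= => /andP[r0 _].
rewrite -EFinM max_l ?mclock_ge0 // (pinvE c2 bz) // -exprMn mulVf ?expr1n //.
by have /andP[h _] := (proj2 gz) r r0; rewrite gt_eqF // (lt_le_trans c0).
Qed.

Lemma lclock_premerge l : 0 <= l -> ~~ merged z y l ->
  lclock z y l = pinv (mclock z) (mclock y l).
Proof.
move=> l0 nm; apply: lclock_low_psi => // v /andP[v0 vl]; rewrite /low ifF //.
by apply/negbTE; apply: contra nm; exact: merged_mono.
Qed.

Lemma glued_premerge s : 0 <= s -> ~~ merged z y (rho z y s) -> glued z y s = z s.
Proof.
move=> s0 nm; rewrite /glued /low ifF; last exact/negbTE.
by rewrite /psi -(lclock_premerge (rho_ge0 s0) nm) rhoK.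
Qed.

(** After the merging [low] is [y], so the rate is 1 and both times advance together. *)
Lemma lclock_postmerge l v : 0 <= l -> merged z y l -> l <= v ->
  lclock z y v = lclock z y l + (v - l).
Proof.
move=> l0 ml lv; have := clock_int_itv (ltW lrate_lb_gt0) lrate_rate l0 lv.
have -> : (\int[mu]_(r in `]l, v]) (lrate z y r)%:E = \int[mu]_(r in `]l, v]) (cst 1 r))%E.
  apply: eq_integral => r; rewrite inE /= in_itv /= => /andP[lr _].
  have r0 : 0 <= r by exact: le_trans l0 (ltW lr).
  rewrite /lrate /low (merged_mono (ltW lr) ml) divff ?expr1n //.
  by have /andP[h _] := (proj2 gy) r r0; rewrite gt_eqF // (lt_le_trans c0).
rewrite integral_cst //= lebesgue_measure_itv /= lte_fin mul1e.
have -> : (if l < v then (v%:E - l%:E)%E else 0%R) = (v - l)%:E.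
  by move: lv; rewrite le_eqVlt => /predU1P[->|->]; rewrite ?ltxx ?subrr.
by move=> -[->]; rewrite -/(lclock z y); ring.
Qed.

Lemma rho_postmerge s t : 0 <= s -> 0 <= t -> merged z y (rho z y s) ->
  rho z y (s + t) = rho z y s + t.
Proof.
move=> s0 t0 m; have r0 := rho_ge0 s0.
have rt : 0 <= rho z y s + t by rewrite addr_ge0.
rewrite -[RHS]lclockK // (lclock_postmerge r0 m) ?lerDl // rhoK //.
by congr (rho z y _); ring.
Qed.

Lemma glued_postmerge s t : 0 <= s -> 0 <= t -> merged z y (rho z y s) ->
  glued z y (s + t) = y (rho z y s + t).
Proof.
move=> s0 t0 m; rewrite /glued rho_postmerge // /low (merged_mono _ m) //.
by rewrite lerDl.
Qed.

(** Where the lower path is below [y] the rate is at least 1, and after the merging it equals 1; the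
    time of the glued path therefore never lags behind that of [y]. This is where the order of the
    volatilities turns into earlier exercise. *)
Lemma rho_le_id s : (forall l, 0 <= l -> ~~ merged z y l -> psi z y l <= y l) ->
  0 <= s -> rho z y s <= s.
Proof.
move=> H s0; rewrite rho_le //.
have r1 : rate 1 1 (fun _ : R => 1 : R) by split => [|t _]; [exact: measurable_cst|rewrite lexx].
have e : s%:E = (\int[mu]_(r in `[0%R, s]) 1%:E)%E by rewrite (clock_int ler01 r1 s0) clock_cst1.
rewrite -lee_fin /lclock -(clock_int (ltW lrate_lb_gt0) lrate_rate) // e.
apply: ge0_le_integral => //.
- by apply: (rateS lrate_rate); [exact: subset_itvl|].
move=> r /=; rewrite in_itv /= => /andP[r0 _]; rewrite lee_fin /lrate.
have l0 := low_gt0 r0; rewrite -(expr1n _ 2) lerXn2r ?nnegrE ?ler01 //.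
  by rewrite divr_ge0 ?(ltW l0) //; have /andP[+ _] := (proj2 gy) r r0; apply: le_trans; exact: ltW.
by rewrite ler_pdivlMr // mul1r /low; case: ifPn => // /(H _ r0).
Qed.

(* Merging, seen from the clock of the other path. *)
Lemma merged_swap l : 0 <= l -> merged z y l = merged y z (pinv (mclock z) (mclock y l)).
Proof.
move=> l0; have m0 := mclock_ge0 gy l0.
have p0 := pinv_mclock_ge0 gz m0.
apply/idP/idP => /mergedP[v [/andP[v0 vl] e]]; apply/mergedP.
  have mv0 := mclock_ge0 gy v0.
  exists (pinv (mclock z) (mclock y v)); split.
    by rewrite pinv_mclock_ge0 //= (pinv_le c2 bz) // (pinvK c2 bz) // (bilip_le c2 by_).
  by rewrite {1}/psi (pinvK c2 bz) // (pinvE c2 by_).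
have mv0 := mclock_ge0 gz v0; have q0 := pinv_mclock_ge0 gy mv0.
exists (pinv (mclock y) (mclock z v)); split.
  rewrite q0 /= (pinv_le c2 by_) // -(pinvK c2 bz m0) (bilip_le c2 bz) //.
by rewrite {1}/psi (pinvK c2 by_) // (pinvE c2 bz).
Qed.

End TwoPaths.

(** This and the next locality lemmas are the pathwise form of non-anticipation: up to time [r] the
    construction depends on [y] only up to [r]. *)
Lemma psi_local (z y1 y2 : R -> R) (r l : R) : (forall s, 0 <= s <= r -> y1 s = y2 s) ->
  l <= r -> psi z y1 l = psi z y2 l.
Proof.
move=> H lr; rewrite /psi; congr (z (pinv _ _)); apply: eq_clock => s /andP[s0 sl].
by rewrite H // s0 (le_trans sl).
Qed.

Lemma merged_local (z y1 y2 : R -> R) (r l : R) : (forall s, 0 <= s <= r -> y1 s = y2 s) ->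
  l <= r -> merged z y1 l = merged z y2 l.
Proof.
move=> H lr; apply/idP/idP => /mergedP[v [/andP[v0 vl] e]]; apply/mergedP; exists v.
  by rewrite v0 vl -(psi_local z H) ?(le_trans vl) // -H // v0 (le_trans vl).
by rewrite v0 vl (psi_local z H) ?(le_trans vl) // H // v0 (le_trans vl).
Qed.

Lemma low_local (z y1 y2 : R -> R) (r l : R) : (forall s, 0 <= s <= r -> y1 s = y2 s) ->
  0 <= l <= r -> low z y1 l = low z y2 l.
Proof.
move=> H /andP[l0 lr]; rewrite /low (merged_local z H) // (psi_local z H) //.
by rewrite H // l0.
Qed.

Lemma lclock_local (z y1 y2 : R -> R) (r l : R) : (forall s, 0 <= s <= r -> y1 s = y2 s) ->
  l <= r -> lclock z y1 l = lclock z y2 l.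
Proof.
move=> H lr; apply: eq_clock => s /andP[s0 sl].
by rewrite /lrate H ?(low_local z H) // s0 (le_trans sl).
Qed.

End Merging.

Lemma measurable_inv_gt0 {R : realType} {d : measure_display} {T : measurableType d}
    (f : T -> R) : (forall w, 0 < f w) -> measurable_fun [set: T] f ->
  measurable_fun [set: T] (fun w => (f w)^-1).
Proof.
move=> f0 mf; apply: (@eq_measurable_fun _ _ _ _ _ (fun w => powR (f w) (-1))).
  by move=> w _; rewrite powR_inv1 // ltW.
exact: (measurableT_comp (@measurable_powR R (-1)) mf).
Qed.

(** * Measurability of clocks, merging and gluing *)

Section RandomClocks.
Context {R : realType} {d : measure_display} {Omega : measurableType d}.
Notation mu := (@lebesgue_measure R).
Implicit Types (V : R -> Omega -> R).

Lemma bilip_right_cvg (c C : R) (F : R -> R) : 0 < c -> bilip c C F ->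
  forall t, 0 <= t -> F s @[s --> t^'+] --> F t.
Proof.
move=> c0 bF t t0; have := bilip_continuous c0 bF.
move=> /continuous_within_itvcyP[h1 h2]; move: t0; rewrite le_eqVlt => /predU1P[<-//|t0].
apply: cvg_at_right_filter; apply: h1; by rewrite in_itv /= andbT.
Qed.

Lemma measurable_clock (c C : R) V t : 0 <= c -> jmeas V ->
  (forall s w, 0 <= s -> c <= V s w <= C) -> 0 <= t ->
  measurable_fun [set: Omega] (fun w => clock (V ^~ w) t).
Proof.
move=> c0 jV H t0; apply: measurableT_comp => //.
pose h (p : R * Omega) := ((V (Num.max p.1 0) p.2) * \1_(`[0%R, t]) p.1)%:E.
have mh : measurable_fun [set: R * Omega] h.
  apply/measurable_EFinP; apply: measurable_funM => //.
  by apply: measurableT_comp => //; exact: measurable_fst.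
have h0 p : (0 <= h p)%E.
  rewrite lee_fin mulr_ge0 // ?indicE //.
  have m0 : 0 <= Num.max p.1 0 by rewrite le_max lexx orbT.
  by have /andP[h1 _] := H _ p.2 m0; exact: le_trans c0 h1.
have H2 : measurable_fun [set: Omega] (fun w => \int[mu]_s h (s, w))%E.
  exact: (measurable_fun_fubini_tonelli_G (m1 := mu) h mh h0).
apply: (eq_measurable_fun _ _ H2) => w _; rewrite [RHS]integral_mkcond.
apply: eq_integral => s _; rewrite /h /patch indicE /=.
case: ifPn; rewrite ?mulr0 // mulr1 inE /= in_itv /= => /andP[s0 _].
by rewrite max_l.
Qed.

Lemma jmeas_bilip (c C : R) V : 0 < c -> (forall w, bilip c C (V ^~ w)) ->
  (forall t, 0 <= t -> measurable_fun [set: Omega] (V t)) -> jmeas V.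
Proof.
move=> c0 bV mV; apply: jmeas_right_continuous => // w t t0.
exact: (bilip_right_cvg c0 (bV w)).
Qed.

Lemma measurable_pinv (c C : R) V u : 0 < c -> (forall w, bilip c C (V ^~ w)) ->
  (forall t, 0 <= t -> measurable_fun [set: Omega] (V t)) -> 0 <= u ->
  measurable_fun [set: Omega] (fun w => pinv (V ^~ w) u).
Proof.
move=> c0 bV mV u0.
apply: (measurability (@RGenCInfty.G R)) => [|/= _ [_ [r ->] <-]].
  exact: RGenCInfty.measurableE.
rewrite setTI; case: (leP r 0) => r0.
  rewrite (_ : _ @^-1` _ = setT) //; apply/seteqP; split => // w _ /=.
  by rewrite in_itv /= andbT (le_trans r0) // (pinv_ge0 c0 (bV w)).
rewrite (_ : _ @^-1` _ = V r @^-1` `]-oo, u]).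
  by rewrite -[X in measurable X]setTI; exact: mV (ltW r0) _ _ _.
apply/seteqP; split => w /=; rewrite !in_itv /= andbT => h.
  by rewrite leNgt -(pinv_lt c0 (bV w)) ?(ltW r0) // -leNgt.
by rewrite leNgt (pinv_lt c0 (bV w)) ?(ltW r0) // -leNgt.
Qed.

End RandomClocks.

Section GoodProcesses.
Context {R : realType} {d : measure_display} {Omega : measurableType d}.
Variables (c C : R).
Hypotheses (c0 : 0 < c) (cC : c <= C).
Let C0 : 0 < C. Proof. exact: lt_le_trans c0 cC. Qed.
Let c2 : 0 < c ^+ 2. Proof. exact: exprn_gt0. Qed.
Let C2 : 0 < C ^+ 2. Proof. exact: exprn_gt0. Qed.

Definition gproc (Y : R -> Omega -> R) : Prop :=
  (forall w, gpath c C (Y ^~ w)) /\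
  forall t, 0 <= t -> measurable_fun [set: Omega] (Y t).

Lemma gproc_jmeas (Y : R -> Omega -> R) : gproc Y -> jmeas Y.
Proof.
move=> [gY mY]; apply: jmeas_right_continuous => // w.
exact: rconst_right_cvg (proj1 (gY w)).
Qed.

Lemma jmeas_mclock (Y : R -> Omega -> R) : gproc Y -> jmeas (fun t w => mclock (Y ^~ w) t).
Proof.
move=> gY; apply: (jmeas_bilip c2) => [w|t t0]; first exact: mclock_bilip (proj1 gY w).
apply: (measurable_clock (c := c ^+ 2) (C := C ^+ 2) (V := fun t w => Y t w ^+ 2)) => //.
- exact: ltW.
- exact: measurable_funX (gproc_jmeas gY).
- by move=> s w s0; exact: (proj2 (gpath_sq_rate c0 cC (proj1 gY w))).
Qed.

Lemma jmeas_pinv_mclock (Y : R -> Omega -> R) : gproc Y ->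
  jmeas (fun u w => pinv (mclock (Y ^~ w)) u).
Proof.
move=> gY; have bY w := mclock_bilip c0 cC (proj1 gY w).
apply: (jmeas_bilip (c := (C ^+ 2)^-1)) => [|w|u u0]; first by rewrite invr_gt0.
  exact: pinv_bilip c2 C2 (bY w).
apply: (measurable_pinv c2 bY) => // t t0.
exact: (jmeas_section t0 (jmeas_mclock gY)).
Qed.

Variables Z Y : R -> Omega -> R.
Hypotheses (gZ : gproc Z) (gY : gproc Y).

Lemma gproc_psi : gproc (fun l w => psi (Z ^~ w) (Y ^~ w) l).
Proof.
have h : jmeas (fun l w => psi (Z ^~ w) (Y ^~ w) l).
  apply: jmeas_comp (gproc_jmeas gZ) _ _.
    apply: (jmeas_comp (jmeas_pinv_mclock gZ) (jmeas_mclock gY)) => t w.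
    exact: (mclock_ge0 c0 cC (proj1 gY w)).
  move=> t w t0; apply: (pinv_mclock_ge0 c0 cC (proj1 gZ w)).
  exact: (mclock_ge0 c0 cC (proj1 gY w)).
split=> [w|t t0]; first exact: (psi_gpath c0 cC (proj1 gZ w) (proj1 gY w)).
exact: jmeas_section t0 h.
Qed.

(** Both paths are constant on some [[v, v + e)], so a coincidence at [v < l] persists at a rational
    time before [l]; only a coincidence at [l] itself needs a separate clause. Merging becomes a
    countable union. *)
Lemma mergedE (z y : R -> R) (l : R) : gpath c C z -> gpath c C y -> 0 <= l ->
  merged z y l <-> psi z y l = y l \/
    exists r : rat, 0 <= (ratr r : R) < l /\ psi z y (ratr r) = y (ratr r).
Proof.
move=> gz gy l0; split; last first.
  move=> h; apply/mergedP; case: h => [e|[r [/andP[r0 rl] e]]].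
    by exists l; rewrite l0 lexx.
  by exists (ratr r); rewrite r0 (ltW rl).
move=> /mergedP[v [/andP[v0 vl] e]].
move: vl; rewrite le_eqVlt => /predU1P[<-|vl]; first by left.
right; have [e' e'0 he] := rconst_pair (proj1 (psi_gpath c0 cC gz gy)) (proj1 gy) v0.
have : v < Num.min l (v + e') by rewrite lt_min vl ltrDl.
move=> /rat_in_itvoo[r]; rewrite in_itv /= lt_min => /and3P[vr rl re].
exists r; split; first by rewrite rl (le_trans v0) ?ltW.
by have := he (ratr r); rewrite (ltW vr) re => /(_ isT) [-> ->].
Qed.

Lemma measurable_merged l : 0 <= l -> measurable [set w | merged (Z ^~ w) (Y ^~ w) l].
Proof.
move=> l0.
have mE t : 0 <= t -> measurable [set w | psi (Z ^~ w) (Y ^~ w) t = Y t w].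
  move=> t0; rewrite -[X in measurable X]setTI.
  rewrite (_ : [set w | _] = [set w | psi (Z ^~ w) (Y ^~ w) t == Y t w]).
    apply: (measurable_fun_eqr _ _ measurableT (Y := [set true])) => //.
      exact: (proj2 gproc_psi).
    exact: (proj2 gY).
  by apply/seteqP; split => w /= /eqP.
rewrite (_ : [set w | _] = [set w | psi (Z ^~ w) (Y ^~ w) l = Y l w] `|`
    \bigcup_(r : rat) (if 0 <= (ratr r : R) < l then
      [set w | psi (Z ^~ w) (Y ^~ w) (ratr r) = Y (ratr r) w] else set0)).
  apply: measurableU; first exact: mE.
  apply: bigcupT_measurable_rat => r; case: ifPn => // /andP[r0 _]; exact: mE.
apply/seteqP; split => w /=.
  move=> /(mergedE (proj1 gZ w) (proj1 gY w) l0)[e|[r [rl e]]]; [by left|right].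
  by exists r => //; rewrite rl.
move=> h; apply/(mergedE (proj1 gZ w) (proj1 gY w) l0); case: h => [e|[r _]]; [by left|].
by case: ifPn => // rl e; right; exists r.
Qed.

Lemma gproc_low : gproc (fun l w => low (Z ^~ w) (Y ^~ w) l).
Proof.
split=> [w|l l0]; first exact: (low_gpath c0 cC (proj1 gZ w) (proj1 gY w)).
rewrite /low; apply: measurable_fun_ifT.
- apply: (measurable_fun_bool true); rewrite setTI; exact: measurable_merged.
- exact: (proj2 gY).
- exact: (proj2 gproc_psi).
Qed.

Let lb0 : 0 < lrate_lb c C := lrate_lb_gt0 c0 cC.
Let ub0 : 0 < lrate_ub c C := lrate_ub_gt0 c0 cC.

Lemma measurable_lclock l : 0 <= l ->
  measurable_fun [set: Omega] (fun w => lclock (Z ^~ w) (Y ^~ w) l).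
Proof.
move=> l0; apply: (measurable_clock (c := lrate_lb c C) (C := lrate_ub c C)
  (V := fun l w => lrate (Z ^~ w) (Y ^~ w) l)) => //; first exact: ltW.
  apply: jmeas_right_continuous => [t t0|w].
    apply: measurable_funX; apply: measurable_funM; first exact: (proj2 gY).
    apply: measurable_inv_gt0 => [w|]; last exact: (proj2 gproc_low).
    exact: (low_gt0 c0 cC (proj1 gZ w) (proj1 gY w)).
  exact: rconst_right_cvg (lrate_rconst c0 cC (proj1 gZ w) (proj1 gY w)).
by move=> s w s0; exact: (proj2 (lrate_rate c0 cC (proj1 gZ w) (proj1 gY w))).
Qed.

Lemma jmeas_rho : jmeas (fun s w => rho (Z ^~ w) (Y ^~ w) s).
Proof.
apply: (jmeas_bilip (c := (lrate_ub c C)^-1)) => [|w|u u0]; first by rewrite invr_gt0.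
  exact: (rho_bilip c0 cC (proj1 gZ w) (proj1 gY w)).
apply: (measurable_pinv lb0 _ measurable_lclock) => // w.
exact: (lclock_bilip c0 cC (proj1 gZ w) (proj1 gY w)).
Qed.

Lemma gproc_glued : gproc (fun s w => glued (Z ^~ w) (Y ^~ w) s).
Proof.
split=> [w|s s0]; first exact: (glued_gpath c0 cC (proj1 gZ w) (proj1 gY w)).
apply: (jmeas_section s0 (V := fun s w => glued (Z ^~ w) (Y ^~ w) s)).
apply: (jmeas_comp (gproc_jmeas gproc_low) jmeas_rho) => t w.
exact: (rho_ge0 c0 cC (proj1 gZ w) (proj1 gY w)).
Qed.

End GoodProcesses.

(** * Non-anticipation and merging times *)

Section SubSigmaAlgebras.
Context {R : realType} {d : measure_display} {Omega : measurableType d}.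

(** Turns adaptedness into ordinary measurability over the same points with [G] as sigma-algebra, so
    that every measurability result on random clocks yields one on non-anticipation. *)
Lemma submeasurableP {dE : measure_display} {E : measurableType dE}
    (G : set (set Omega)) (f : Omega -> E) : sigma_algebra [set: Omega] G ->
  submeasurable G f <-> measurable_fun [set: g_sigma_algebraType G] (f : g_sigma_algebraType G -> E).
Proof.
move=> sG; split => [h _ D mD|h D mD].
  by rewrite setTI; apply: sub_sigma_algebra; exact: h.
have := h measurableT D mD; rewrite setTI.
by rewrite /measurable /= (sigma_algebra_id sG).
Qed.

Lemma submeasurable_set (G : set (set Omega)) (A : set Omega) : sigma_algebra [set: Omega] G ->
  G A <-> measurable (A : set (g_sigma_algebraType G)).
Proof. by move=> sG; rewrite /measurable /= (sigma_algebra_id sG). Qed.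

Lemma sigma_algebra_T (G : set (set Omega)) : sigma_algebra [set: Omega] G -> G setT.
Proof. by move=> sG; apply/(submeasurable_set _ sG). Qed.

Lemma sigma_algebra_I (G : set (set Omega)) (A B : set Omega) : sigma_algebra [set: Omega] G ->
  G A -> G B -> G (A `&` B).
Proof.
by move=> sG /(submeasurable_set _ sG) mA /(submeasurable_set _ sG) mB;
  apply/(submeasurable_set _ sG); exact: measurableI.
Qed.

Lemma sigma_algebra_C (G : set (set Omega)) (A : set Omega) : sigma_algebra [set: Omega] G ->
  G A -> G (~` A).
Proof.
by move=> sG /(submeasurable_set _ sG) mA; apply/(submeasurable_set _ sG); exact: measurableC.
Qed.

(** All values of the path frozen at [r] are known at time [r], and it agrees with the original up
    to [r]; with the locality lemmas this gives adaptedness of merging, clocks and gluing. *)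
Definition stopped {T : Type} (r : R) (y : R -> T) : R -> T := fun t => y (Num.min t r).

Lemma stopped_gpath (c C r : R) (y : R -> R) : 0 <= r -> gpath c C y -> gpath c C (stopped r y).
Proof.
move=> r0 [ry H]; split; last by move=> t t0; apply: H; rewrite le_min t0.
move=> t t0; rewrite /stopped; case: (ltP t r) => tr.
  have [e e0 he] := ry t t0; exists (Num.min e (r - t)); first by rewrite lt_min e0 subr_gt0.
  move=> s; rewrite -ltrBlDl lt_min ltrD2r => /and3P[ts se sr].
  by rewrite min_l ?(ltW sr) // he // ts -ltrBlDl.
by exists 1 => // s /andP[ts _]; rewrite min_r // (le_trans tr).
Qed.

Variables (c C : R).
Hypotheses (c0 : 0 < c) (cC : c <= C).
Variables (G : set (set Omega)) (Y : R -> Omega -> R) (r : R).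
Hypotheses (sG : sigma_algebra [set: Omega] G) (r0 : 0 <= r).
Hypotheses (gY : forall w, gpath c C (Y ^~ w)).
Hypotheses (mY : forall t, 0 <= t -> t <= r -> submeasurable G (Y t)).

Lemma stopped_gproc :
  gproc c C (fun t (w : g_sigma_algebraType G) => stopped r (Y ^~ w) t).
Proof.
split=> [w|t t0]; first exact: (stopped_gpath r0 (gY w)).
rewrite /stopped; apply/(submeasurableP _ sG); apply: mY; first by rewrite le_min t0.
by rewrite ge_min lexx orbT.
Qed.

Variable z : R -> R.
Hypothesis gz : gpath c C z.

Lemma cst_gproc : gproc c C (fun t (_ : g_sigma_algebraType G) => z t).
Proof. by split => // t t0; exact: measurable_cst. Qed.

Let agree w s : 0 <= s <= r -> Y s w = stopped r (Y ^~ w) s.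
Proof. by move=> /andP[_ sr]; rewrite /stopped min_l. Qed.

Lemma merged_submeasurable l : 0 <= l -> l <= r -> G [set w | merged z (Y ^~ w) l].
Proof.
move=> l0 lr; apply/(submeasurable_set _ sG).
have := measurable_merged c0 cC cst_gproc stopped_gproc l0.
congr measurable; apply/seteqP; split => w /=; rewrite (merged_local z (@agree w)) //.
Qed.

Lemma lclock_submeasurable l : 0 <= l -> l <= r ->
  submeasurable G (fun w => lclock z (Y ^~ w) l).
Proof.
move=> l0 lr; apply/(submeasurableP _ sG).
rewrite (_ : (fun w => _) = (fun w => lclock z (stopped r (Y ^~ w)) l)).
  exact: (measurable_lclock c0 cC cst_gproc stopped_gproc l0).
by apply/funext => w; rewrite (lclock_local z (@agree w)).
Qed.

End SubSigmaAlgebras.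

Section MergeTime.
Context {R : realType}.
Variables (c C : R).
Hypotheses (c0 : 0 < c) (cC : c <= C).
Variables (z y : R -> R).
Hypotheses (gz : gpath c C z) (gy : gpath c C y).
Let c2 : 0 < c ^+ 2. Proof. exact: exprn_gt0. Qed.
Let lb0 : 0 < lrate_lb c C := lrate_lb_gt0 c0 cC.

Definition mtime (z y : R -> R) : \bar R :=
  ereal_inf [set l%:E | l in [set l | 0 <= l /\ merged z y l]].

Lemma mtime_ge0 (z' y' : R -> R) : (0 <= mtime z' y')%E.
Proof. by apply: le_ereal_inf_tmp => _ [l [l0 _] <-]; rewrite lee_fin. Qed.

(** Right constancy of [merged] puts the infimum into the set; as nothing coincides earlier, the
    coincidence takes place exactly there. *)
Lemma mtime_attained : (mtime z y < +oo)%E ->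
  exists l : R, [/\ 0 <= l, mtime z y = l%:E, merged z y l, psi z y l = y l &
    forall v, v < l -> ~~ merged z y v].
Proof.
move=> /ereal_inf_lt[_ [l1 [l10 m1] <-] _].
pose S := [set l | 0 <= l /\ merged z y l].
have S0 : S l1 by split.
have lbS : has_lbound S by exists 0 => v [].
have hS : has_inf S by split; [exists l1|].
have i0 : 0 <= inf S by apply: lb_le_inf; [exists l1|move=> v []].
have mi : merged z y (inf S).
  have [e e0 he] := merged_rconst c0 cC gz gy i0.
  have [v Sv vi] := inf_adherent e0 hS.
  rewrite -(he v) ?(proj2 Sv) //; apply/andP; split=> //.
  by apply: ge_inf.
have lei v : v < inf S -> ~~ merged z y v.
  move=> vi; apply/negP => mv; case: (leP 0 v) => v0.
    by have := ge_inf lbS (conj v0 mv); rewrite leNgt vi.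
  move: mv => /mergedP[u [/andP[u0 uv] _]].
  by move: (le_lt_trans u0 (le_lt_trans uv v0)); rewrite ltxx.
exists (inf S); split => //.
  apply/eqP; rewrite eq_le; apply/andP; split.
    by apply: ereal_inf_lbound; exists (inf S).
  apply: le_ereal_inf_tmp => _ [l Sl <-]; rewrite lee_fin; exact: ge_inf.
have /mergedP[u [/andP[u0]]] := mi; rewrite le_eqVlt => /predU1P[<-//|ui e].
by exfalso; move: (lei _ ui) => /negP; apply; apply/mergedP; exists u; rewrite u0 lexx.
Qed.

Lemma mtime_le t : 0 <= t -> (mtime z y <= t%:E)%E = merged z y t.
Proof.
move=> t0; apply/idP/idP => [h|m]; last by apply: ereal_inf_lbound; exists t.
have [l [l0 e m _ _]] := mtime_attained (le_lt_trans h (ltry _)).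
by move: h; rewrite e lee_fin => lt; exact: merged_mono lt m.
Qed.

(** At the merging instant the two branches of [low] agree, so the formula for [psi] holds up to and
    including [l]. *)
Lemma low_at_merge l : 0 <= l -> psi z y l = y l -> (forall v, v < l -> ~~ merged z y v) ->
  forall v, 0 <= v <= l -> low z y v = psi z y v.
Proof.
move=> l0 e nm v /andP[v0]; rewrite le_eqVlt => /predU1P[->|vl].
  by rewrite /low e; case: ifP.
by rewrite /low (negbTE (nm _ vl)).
Qed.

End MergeTime.

Section MergeTimes.
Context {R : realType}.
Variables (c C : R).
Hypotheses (c0 : 0 < c) (cC : c <= C).
Variables (z y : R -> R).
Hypotheses (gz : gpath c C z) (gy : gpath c C y).
Let c2 : 0 < c ^+ 2. Proof. exact: exprn_gt0. Qed.
Let lb0 : 0 < lrate_lb c C := lrate_lb_gt0 c0 cC.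

(** The left side asks about the clock of [y] at the image of [s], the right side about the clock of
    [z] at [s]. With it, merging can be decided from the past of either path in that path's own
    time. *)
Lemma merged_rho s : 0 <= s -> merged z y (rho z y s) = merged y z s.
Proof.
move=> s0; have r0 := rho_ge0 c0 cC gz gy s0; apply/idP/idP => m; last first.
  apply/negPn/negP => nm; have e := lclock_premerge c0 cC gz gy r0 nm.
  rewrite (rhoK c0 cC gz gy s0) in e.
  by move: nm; rewrite (merged_swap c0 cC gz gy r0) -e m.
have h : (mtime z y < +oo)%E.
  by apply: le_lt_trans (ltry (rho z y s)); rewrite (mtime_le c0 cC gz gy r0).
have [l [l0 e ml pl nm]] := mtime_attained c0 cC gz gy h.
have lr : l <= rho z y s by rewrite -lee_fin -e (mtime_le c0 cC gz gy r0).
have el := lclock_low_psi c0 cC gz gy l0 (low_at_merge l0 pl nm).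
have ls : lclock z y l <= s.
  by rewrite -[leRHS](rhoK c0 cC gz gy s0) (bilip_le lb0 (lclock_bilip c0 cC gz gy)).
apply: merged_mono ls _; by rewrite el -(merged_swap c0 cC gz gy l0).
Qed.

(* The two merging times are the same event read in the two clocks. *)
Lemma mtime_swap : (mtime y z < +oo)%E ->
  [/\ (mtime z y < +oo)%E, mtime y z = (lclock z y (fine (mtime z y)))%:E,
      rho z y (fine (mtime y z)) = fine (mtime z y) &
      z (fine (mtime y z)) = y (fine (mtime z y))].
Proof.
move=> h; have [s [s0 es ms ps nms]] := mtime_attained c0 cC gy gz h.
have r0 := rho_ge0 c0 cC gz gy s0.
have mr : merged z y (rho z y s) by rewrite merged_rho.
have h' : (mtime z y < +oo)%E.
  by apply: le_lt_trans (ltry (rho z y s)); rewrite (mtime_le c0 cC gz gy r0).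
have [l [l0 el ml pl nml]] := mtime_attained c0 cC gz gy h'.
have elp := lclock_low_psi c0 cC gz gy l0 (low_at_merge l0 pl nml).
have L0 := lclock_ge0 c0 cC gz gy l0.
have E : s = lclock z y l.
  apply/eqP; rewrite eq_le; apply/andP; split; rewrite leNgt; apply/negP => lt.
    by move: (nms _ lt); rewrite -merged_rho // (lclockK c0 cC gz gy l0) ml.
  have := nml (rho z y s); rewrite mr (rho_lt c0 cC gz gy s0 l0) => /(_ lt).
  by [].
split => //; first by rewrite es el /= E.
  by rewrite es el /= E (lclockK c0 cC gz gy l0).
by rewrite es el /= -pl /psi E elp.
Qed.

Lemma rho_local (y2 : R -> R) (r s : R) : gpath c C y2 ->
  (forall v, 0 <= v <= r -> y v = y2 v) -> 0 <= r -> 0 <= s ->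
  s <= lclock z y r -> rho z y s = rho z y2 s.
Proof.
move=> gy2 H r0 s0 sr.
have q0 := rho_ge0 c0 cC gz gy s0.
have qr : rho z y s <= r by rewrite (rho_le c0 cC gz gy).
rewrite -[LHS](lclockK c0 cC gz gy2) // -(lclock_local z H qr).
by rewrite (rhoK c0 cC gz gy).
Qed.

Lemma glued_local (y2 : R -> R) (r s : R) : gpath c C y2 ->
  (forall v, 0 <= v <= r -> y v = y2 v) -> 0 <= r -> 0 <= s ->
  s <= lclock z y r -> glued z y s = glued z y2 s.
Proof.
move=> gy2 H r0 s0 sr; rewrite /glued -(rho_local gy2 H r0 s0 sr).
apply: low_local H _; rewrite (rho_ge0 c0 cC gz gy s0) /=.
by rewrite (rho_le c0 cC gz gy).
Qed.

End MergeTimes.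

(** * Limits of events, values at stopping times, product measures *)

Section Probability.
Context {R : realType} {d : measure_display} {Omega : measurableType d}.
Variable P : probability Omega R.

(** Dominated convergence for indicators: pathwise statements valid from some discretisation level
    on become limits of probabilities. *)
Lemma cvg_prob (A : nat -> set Omega) (B : set Omega) :
  (forall n, measurable (A n)) -> measurable B ->
  {ae P, forall w, \forall n \near \oo, A n w <-> B w} ->
  P (A n) @[n --> \oo] --> P B.
Proof.
move=> mA mB H.
have E (D : set Omega) : measurable D -> P D = (\int[P]_w (\1_D w)%:E)%E.
  by move=> mD; rewrite integral_indic // setIT.
rewrite E //; under eq_fun do rewrite E //.
have := @dominated_convergence _ _ _ P setT measurableT
  (fun n w => (\1_(A n) w)%:E) (fun w => (\1_B w)%:E) (cst 1%E).
case.
- by move=> n; apply/measurable_EFinP; exact: measurable_indic.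
- by apply/measurable_EFinP; exact: measurable_indic.
- apply: filterS H => w [N _ HN] _; apply/cvg_EFin; first by near=> n.
  apply/cvgrPdist_lt => e e0; exists N => // n /HN h /=.
  suff -> : (\1_(A n) w : R) = \1_B w by rewrite subrr normr0.
  by rewrite !indicE; congr ((_ : bool)%:R); apply/idP/idP; rewrite !inE => /h.
- exact: finite_measure_integrable_cst.
- by apply: aeW => w n _; rewrite /= lee_fin indicE; case: (_ \in _); rewrite ?normr1 ?normr0.
by [].
Unshelve. all: by end_near. Qed.

Lemma prob_setI1 (A B : set Omega) : measurable A -> measurable B -> P B = 1%E ->
  P (A `&` B) = P A.
Proof.
move=> mA mB PB.
have nB : P (~` B) = 0%E by rewrite probability_setC // PB subee.
have := measureU0 (mu := P) (measurableI _ _ mA mB) (measurableI _ _ mA (measurableC mB)).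
rewrite -setIUr setUCr setIT => -> //.
apply: (subset_measure0 _ _ _ nB); [by apply: measurableI => //; exact: measurableC|exact: measurableC|by []].
Qed.

Lemma ae_prob1 (A : set Omega) : measurable A -> {ae P, forall w, A w} -> P A = 1%E.
Proof.
move=> mA h; have nA : P (~` A) = 0%E.
  case: h => N [mN PN sub]; apply: (subset_measure0 _ mN _ PN) => //; exact: measurableC.
have := probability_setC P mA; rewrite nA => /esym/eqP.
have := fin_num_measure P A mA => /fineK <-.
by rewrite -EFinB eqe subr_eq0 => /eqP <-.
Qed.

End Probability.

Section StoppedValues.
Context {R : realType} {d : measure_display} {Omega : measurableType d}.
Variables (F : R -> set (set Omega)) (tau : Omega -> \bar R).
Hypotheses (sF : forall t, 0 <= t -> sigma_algebra [set: Omega] (F t)).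
Hypothesis (incF : forall s t, 0 <= s -> s <= t -> F s `<=` F t).
Hypothesis (stau : stopping_time F tau).

Let tmin t w : R := fine (Order.min (tau w) t%:E).

Let tau0 w : (0 <= tau w)%E. Proof. exact: (proj1 stau). Qed.

Let tminE t w : 0 <= t -> (tmin t w)%:E = Order.min (tau w) t%:E.
Proof.
move=> t0; rewrite fineK // fin_real // (lt_le_trans (ltNyr 0)) ?le_min ?tau0 ?lee_fin //=.
by rewrite gt_min ltry orbT.
Qed.

Let tmin_ge0 t w : 0 <= t -> 0 <= tmin t w.
Proof. by move=> t0; rewrite -lee_fin tminE // le_min tau0 lee_fin. Qed.

Let tmin_le t w : 0 <= t -> tmin t w <= t.
Proof. by move=> t0; rewrite -lee_fin tminE // ge_min lexx orbT. Qed.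

Let tmin_fine t w : (tau w <= t%:E)%E -> tmin t w = fine (tau w).
Proof. by move=> h; rewrite /tmin min_l. Qed.

Lemma stopping_min t : 0 <= t -> submeasurable (F t) (fun w => tmin t w).
Proof.
move=> t0; apply/(submeasurableP _ (sF t0)).
apply: (measurability (@RGenOInfty.G R)) => [|/= _ [_ [r ->] <-]].
  exact: RGenOInfty.measurableE.
rewrite setTI; apply/(submeasurable_set _ (sF t0)).
case: (ltP r 0) => r0.
  rewrite (_ : _ @^-1` _ = setT); first exact: (sigma_algebra_T (sF t0)).
  by apply/seteqP; split => // w _ /=; rewrite in_itv /= andbT (lt_le_trans r0) ?tmin_ge0.
case: (leP t r) => tr.
  rewrite (_ : _ @^-1` _ = ~` setT).
    exact: (sigma_algebra_C (sF t0) (sigma_algebra_T (sF t0))).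
  apply/seteqP; split => w /=; rewrite in_itv /= andbT // => h.
  by move: (lt_le_trans h (le_trans (tmin_le w t0) tr)); rewrite ltxx.
rewrite (_ : _ @^-1` _ = ~` [set w | (tau w <= r%:E)%E]).
  apply: (sigma_algebra_C (sF t0)); apply: (incF r0 (ltW tr)); exact: (proj2 stau).
apply/seteqP; split => w /=; rewrite in_itv /= andbT -lte_fin tminE // lt_min lte_fin tr andbT.
  by rewrite ltNge => /negP.
by move/negP; rewrite -ltNge.
Qed.

(** The process frozen at [t] is jointly measurable over [F t], and so is the minimum of [tau] and
    [t]; where [tau <= t] their composition is the value at [tau]. *)
Lemma stopped_value (V : R -> Omega -> R) (t : R) (D : set R) :
  right_continuous_paths V -> adapted F V -> 0 <= t -> measurable D ->
  F t ([set w | D (V (fine (tau w)) w)] `&` [set w | (tau w <= t%:E)%E]).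
Proof.
move=> rV aV t0 mD.
pose W : R -> g_sigma_algebraType (F t) -> R := fun s w => V (Num.min s t) w.
have jW : jmeas W.
  apply: jmeas_right_continuous => [s s0|w s s0].
    apply/(submeasurableP _ (sF t0)) => B mB.
    have st0 : 0 <= Num.min s t by rewrite le_min s0.
    have st : Num.min s t <= t by rewrite ge_min lexx orbT.
    exact: (incF st0 st (aV _ st0 _ mB)).
  rewrite /W; case: (ltP s t) => st.
    apply: cvg_trans (rV w s s0).
    apply: near_eq_cvg; near=> u; rewrite min_l //; near: u.
    exact: nbhs_right_le.
  by apply: cvg_near_cst; near=> u; rewrite min_r // (le_trans st) //; near: u; exact: nbhs_right_ge.
have mm : measurable_fun [set: g_sigma_algebraType (F t)] (fun w => tmin t w : R).
  exact/(submeasurableP _ (sF t0))/stopping_min.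
have := jmeas_random jW mm (fun w => tmin_ge0 w t0).
move=> /(submeasurableP _ (sF t0)) /(_ _ mD) h.
rewrite (_ : _ `&` _ = ((fun w => W (tmin t w) w) @^-1` D) `&` [set w | (tau w <= t%:E)%E]).
  by apply: (sigma_algebra_I (sF t0)) => //; exact: (proj2 stau).
apply/seteqP; split => w /= [h1 h2]; split => //; move: h1.
  by rewrite /W min_l ?tmin_le // tmin_fine.
by rewrite /W min_l ?tmin_le // tmin_fine.
Unshelve. all: by end_near. Qed.

End StoppedValues.

Section ProductSections.
Context {R : realType} {d1 d2 : measure_display}.
Context {T1 : measurableType d1} {T2 : measurableType d2}.
Variables (P1 : probability T1 R) (P2 : probability T2 R).

Lemma prod_xsection (A : set (T1 * T2)) :
  ((P1 \x P2) A = \int[P1]_x P2 (xsection A x))%E.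
Proof. by []. Qed.

Lemma prod_ysection (A : set (T1 * T2)) : measurable A ->
  ((P1 \x P2) A = \int[P2]_y P1 (ysection A y))%E.
Proof.
move=> mA; have := indic_fubini_tonelli P1 P2 mA.
rewrite /fubini_F /fubini_G => h.
transitivity (\int[P1]_x \int[P2]_y (\1_A (x, y))%:E)%E.
  rewrite prod_xsection; apply: eq_integral => x _.
  by have := congr1 (@^~ x) (indic_fubini_tonelli_FE P2 mA); rewrite /fubini_F /= => <-.
rewrite h; apply: eq_integral => y _.
by have := congr1 (@^~ y) (indic_fubini_tonelli_GE P1 mA); rewrite /fubini_G /= => <-.
Qed.

(** The form of Fubini used for Markov properties: an identity with constant factor [k], proved with
    one coordinate frozen, holds for the product. *)
Lemma prod_xsection_scale (A B : set (T1 * T2)) (k : R) : 0 <= k ->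
  measurable A -> measurable B ->
  (forall x, P2 (xsection A x) = P2 (xsection B x) * k%:E)%E ->
  ((P1 \x P2) A = (P1 \x P2) B * k%:E)%E.
Proof.
move=> k0 mA mB H; rewrite !prod_xsection -ge0_integralZr //.
- by apply: eq_integral => x _; rewrite H.
- exact: measurable_fun_xsection.
Qed.

Lemma prod_ysection_scale (A B : set (T1 * T2)) (k : R) : 0 <= k ->
  measurable A -> measurable B ->
  (forall y, P1 (ysection A y) = P1 (ysection B y) * k%:E)%E ->
  ((P1 \x P2) A = (P1 \x P2) B * k%:E)%E.
Proof.
move=> k0 mA mB H; rewrite !prod_ysection // -ge0_integralZr //.
- by apply: eq_integral => x _; rewrite H.
- exact: measurable_fun_ysection.
Qed.

End ProductSections.

(** * The glued chain *)

Section NaturalFiltrations.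
Context {R : realType} {d : measure_display} {Omega : measurableType d}.

Lemma generated_sub {dE : measure_display} {E : measurableType dE} (I : set R)
    (Z : R -> Omega -> E) (G : set (set Omega)) : sigma_algebra [set: Omega] G ->
  (forall t, I t -> submeasurable G (Z t)) -> generated I Z `<=` G.
Proof.
by move=> sG H; apply: smallest_sub => // _ [s [D [Is mD ->]]]; exact: H.
Qed.

Lemma generated_mem {dE : measure_display} {E : measurableType dE} (I : set R)
    (Z : R -> Omega -> E) t : I t -> submeasurable (generated I Z) (Z t).
Proof. by move=> It D mD; apply: sub_sigma_algebra; exists t, D. Qed.

Lemma natural_sigma_algebra {dE : measure_display} {E : measurableType dE}
    (Z : R -> Omega -> E) t : sigma_algebra [set: Omega] (natural Z t).
Proof. exact: smallest_sigma_algebra. Qed.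

Lemma natural_mem {dE : measure_display} {E : measurableType dE}
    (Z : R -> Omega -> E) s t : 0 <= s -> s <= t -> submeasurable (natural Z t) (Z s).
Proof. by move=> s0 st; apply: generated_mem; rewrite /= in_itv /= s0. Qed.

Lemma natural_mono {dE : measure_display} {E : measurableType dE}
    (Z : R -> Omega -> E) s t : s <= t -> natural Z s `<=` natural Z t.
Proof.
move=> st; apply: generated_sub; first exact: natural_sigma_algebra.
by move=> r /=; rewrite in_itv /= => /andP[r0 rs]; exact: natural_mem (le_trans rs st).
Qed.

Lemma natural_measurable {dE : measure_display} {E : measurableType dE}
    (Z : R -> Omega -> E) t : (forall s, 0 <= s -> measurable_fun [set: Omega] (Z s)) ->
  natural Z t `<=` measurable.
Proof.
move=> mZ; apply: generated_sub; first exact: sigma_algebra_measurable.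
move=> r /=; rewrite in_itv /= => /andP[r0 _] D mD.
by rewrite -[X in measurable X]setTI; exact: mZ.
Qed.

Lemma natural_pair (X Y : R -> Omega -> R) t : natural Y t `<=` natural (pair_process X Y) t.
Proof.
apply: generated_sub; first exact: natural_sigma_algebra.
move=> r /=; rewrite in_itv /= => /andP[r0 rt] D mD.
have := natural_mem (Z := pair_process X Y) r0 rt (measurableX measurableT mD).
by congr (natural _ _ _); apply/seteqP; split => w //= [].
Qed.

(** Inclusions between sigma-algebras on the trace of an event can thereby be checked on
    generators. *)
Lemma trace_sigma {T : Type} (G : set (set Omega)) (f : Omega -> T) (S : set Omega) :
  sigma_algebra [set: Omega] G -> G S ->
  sigma_algebra [set: T] [set A | G ((f @^-1` A) `&` S)].
Proof.
move=> sG GS; split => /=.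
- by rewrite preimage_set0 set0I; case: sG.
- move=> A GA; rewrite (_ : _ `&` _ = S `&` ~` ((f @^-1` A) `&` S)).
    by apply: (sigma_algebra_I sG) => //; exact: (sigma_algebra_C sG).
  apply/seteqP; split => w /=; first by move=> [[_ nA] Sw]; split => // -[].
  by move=> [Sw n]; split => //; split => // Aw; apply: n.
- move=> A GA; rewrite preimage_bigcup setI_bigcupl.
  by case: sG => _ _; apply.
Qed.

End NaturalFiltrations.

Section FiniteStates.
Context {R : realType} {m : nat}.
Variable ys : 'I_m -> R.

Lemma states_bounds : (forall i, 0 < ys i) ->
  exists c C : R, [/\ 0 < c, c <= C & forall i, c <= ys i <= C].
Proof.
move=> y0; exists (\big[Num.min/1]_i ys i), (\big[Num.max/1]_i ys i); split.
- by apply: lt_bigmin.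
- by apply: (@le_trans _ _ 1); [exact: bigmin_le_id|exact: bigmax_ge_id].
- by move=> i; apply/andP; split; [exact: bigmin_le|exact: le_bigmax].
Qed.

(** Finitely many states are isolated from each other, so right continuity already forces right
    constancy. *)
Lemma range_gpath (c C : R) (y : R -> R) : (forall i, c <= ys i <= C) ->
  (forall t, 0 <= t -> range ys (y t)) ->
  (forall t, 0 <= t -> y s @[s --> t^'+] --> y t) -> gpath c C y.
Proof.
move=> H ry cy; split; last by move=> t /ry[i _ <-].
move=> t t0.
have : \forall s \near t^'+, forall i, ys i != y t -> y s != ys i.
  apply: filter_forall => i; case: (eqVneq (ys i) (y t)) => [_|ne]; first exact: nearW.
  have e0 : 0 < `|y t - ys i| by rewrite normr_gt0 subr_eq0 eq_sym.
  have /cvgrPdist_lt /(_ _ e0) := cy t t0.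
  apply: filterS => s hs _; apply/eqP => e; move: hs; rewrite e ltxx //.
move=> [e /= e0 he]; exists e => // s /andP[ts se].
move: ts; rewrite le_eqVlt => /predU1P[->//|ts].
have [i _ ei] := ry s (le_trans t0 (ltW ts)).
have := he s; rewrite /= ltr0_norm ?subr_lt0 // opprB ltrBlDl => /(_ se ts i).
by rewrite ei eqxx; case: eqP => [->//|_ /(_ isT)].
Qed.

Lemma prob_sum_states {d : measure_display} {T : measurableType d} (P : probability T R)
    (A : set T) (U : T -> R) : injective ys -> measurable A -> measurable_fun [set: T] U ->
  (forall w, A w -> range ys (U w)) ->
  (P A = \sum_(i \in [set: 'I_m]) P (A `&` [set w | U w = ys i]))%E.
Proof.
move=> inj mA mU HU.
have mi i : measurable [set w | U w = ys i].
  have := mU measurableT [set ys i] (measurable_set1 _); rewrite setTI; apply.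
rewrite -measure_fin_bigcup //; last 3 first.
- exact: finite_finset.
- apply/trivIsetP => i j _ _ ij; apply/seteqP; split => // w [[_ /= e1] [_ /= e2]].
  by move: ij; rewrite -(inj _ _ (etrans (esym e1) e2)) eqxx.
- by move=> i _; exact: measurableI.
congr (P _); apply/seteqP; split => w.
  by move=> Aw; have [i _ e] := HU w Aw; exists i => //.
by move=> [i _ []].
Qed.

Lemma prob_eq_states {d : measure_display} {T : measurableType d} (P : probability T R)
    (A B : set T) (U : T -> R) : injective ys -> measurable A -> measurable B ->
  measurable_fun [set: T] U -> (forall w, range ys (U w)) ->
  (forall i, P (A `&` [set w | U w = ys i]) = P (B `&` [set w | U w = ys i])) ->
  P A = P B.
Proof.
move=> inj mA mB mU HU H; rewrite (prob_sum_states P inj mA mU) //.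
by rewrite (prob_sum_states P inj mB mU) //; apply: eq_fsbigr => i _.
Qed.

End FiniteStates.

(** Passes from deterministic times to the random time [r]: [r] is replaced by the next dyadic time,
    on whose level sets the hypothesis applies, and right constancy removes the error in the
    limit. *)
Lemma post_law {R : realType} {d : measure_display}
    {T : measurableType d} (P : probability T R) (N : set T) (r : T -> R)
    (V1 V2 : R -> T -> R) (v : R) :
  measurable N -> measurable_fun [set: T] r -> (forall w, 0 <= r w) ->
  (forall w, rconst (V1 ^~ w)) -> (forall w, rconst (V2 ^~ w)) ->
  (forall t, 0 <= t -> measurable_fun [set: T] (V1 t)) ->
  (forall t, 0 <= t -> measurable_fun [set: T] (V2 t)) ->
  (forall B t, measurable B -> 0 <= t ->
     P (N `&` (r @^-1` B) `&` [set w | V1 t w = v]) =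
     P (N `&` (r @^-1` B) `&` [set w | V2 t w = v])) ->
  P (N `&` [set w | V1 (r w) w = v]) = P (N `&` [set w | V2 (r w) w = v]).
Proof.
move=> mN mr r0 rV1 rV2 mV1 mV2 H.
have mrB B : measurable B -> measurable (r @^-1` B).
  by move=> mB; rewrite -[X in measurable X]setTI; exact: mr.
have meq (U : T -> R) : measurable_fun [set: T] U -> measurable [set w | U w = v].
  by move=> mU; have := mU measurableT [set v] (measurable_set1 _); rewrite setTI; apply.
have rc (V : R -> T -> R) : (forall w, rconst (V ^~ w)) -> right_continuous_paths V.
  by move=> rV w; exact: (rconst_right_cvg (rV w)).
pose E (V : R -> T -> R) n := N `&` [set w | V (gup n (r w)) w = v].
have gr n : measurable_fun [set: T] (fun w => gup n (r w)).
  apply: (measurableT_comp _ mr); apply: nondecreasing_measurable => // a b ab.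
  by rewrite /gup ler_pM2r ?invr_gt0 // ler_nat ltnS; apply: le_truncn; rewrite ler_pM2r.
have L (V : R -> T -> R) : (forall w, rconst (V ^~ w)) ->
    (forall t, 0 <= t -> measurable_fun [set: T] (V t)) ->
    P (E V n) @[n --> \oo] --> P (N `&` [set w | V (r w) w = v]).
  move=> rV mV; have jV : jmeas V by apply: jmeas_right_continuous => //; exact: rc.
  apply: cvg_prob.
  - move=> n; apply: measurableI => //; apply: meq.
    by apply: (jmeas_random jV) => // w; exact: gup_ge0.
  - by apply: measurableI => //; apply: meq; exact: (jmeas_random jV).
  apply: aeW => w; have [e e0 he] := rV w _ (r0 w).
  near=> n; suff h : V (gup n (r w)) w = V (r w) w.
    by rewrite /E /=; split => -[]; rewrite h.
  apply: he; rewrite (ltW (gup_gt _ _)) /= (le_lt_trans (gup_le _ (r0 w))) // ltrD2l.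
  by near: n; exact: pow2_small.
have e n : P (E V1 n) = P (E V2 n).
  pose B k := [set s : R | Num.trunc (Num.max s 0 * 2 ^+ n) = k].
  have mB k : measurable (B k) by exact: measurable_trunc_eq.
  have S (V : R -> T -> R) : (forall t, 0 <= t -> measurable_fun [set: T] (V t)) ->
      (P (E V n) = \sum_(k <oo) P (N `&` (r @^-1` B k) `&` [set w | V (k.+1%:R / 2 ^+ n)%R w = v]))%E.
    move=> mV.
    have mF k : measurable (N `&` (r @^-1` B k) `&` [set w | V (k.+1%:R / 2 ^+ n) w = v]).
      apply: measurableI; first by apply: measurableI => //; exact: mrB.
      by apply: meq; apply: mV; rewrite divr_ge0 // ltW.
    rewrite -measure_semi_bigcup //; last 2 first.
    - apply/trivIsetP => i j _ _ ij; apply/seteqP; split => // w [[[_ /= e1] _] [[_ /= e2] _]].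
      by move: ij; rewrite -e1 -e2 eqxx.
    - exact: bigcupT_measurable.
    congr (P _); apply/seteqP; split => w.
      move=> [Nw /= ew]; exists (Num.trunc (Num.max (r w) 0 * 2 ^+ n)) => //.
      by split; [split|rewrite /= max_l].
    by move=> [k _ [[Nw /= ek] /= ew]]; split => //=; rewrite /gup -ew -ek max_l.
  rewrite !S //; apply: eq_eseriesr => k _; apply: H; first exact: mB.
  by rewrite divr_ge0 // ltW.
have := L _ rV1 mV1; under eq_fun do rewrite e.
by move=> h; apply: (cvg_unique _ h (L _ rV2 mV2)).
Unshelve. all: by end_near. Qed.

Section ChainStrongMarkov.
Context {R : realType} {m : nat} (ys : 'I_m -> R) (Q : 'M[R]_m).
Context {d : measure_display} {Omega : measurableType d}.
Variables (P : R * R -> probability Omega R) (X Y : R -> Omega -> R).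
Hypothesis ys_inj : injective ys.
Hypotheses (X_rc : right_continuous_paths X) (Y_rc : right_continuous_paths Y).
Hypothesis XY_markov : strong_markov ([set: R] `*` range ys) P (pair_process X Y).
Hypothesis h2 : forall x y, range ys y -> markov_chain (P (x, y)) ys Q Y.

Notation pt t i j := (expmx (t *: Q) i j).

Lemma X_measurable t : 0 <= t -> measurable_fun [set: Omega] (X t).
Proof.
by move=> t0; case: XY_markov => _ mZ _ _ _; exact: (measurableT_comp measurable_fst (mZ t t0)).
Qed.

Lemma Y_measurable t : 0 <= t -> measurable_fun [set: Omega] (Y t).
Proof.
by move=> t0; case: XY_markov => _ mZ _ _ _; exact: (measurableT_comp measurable_snd (mZ t t0)).
Qed.

Lemma Y_range t w : 0 <= t -> range ys (Y t w).
Proof. by move=> t0; case: XY_markov => /(_ t w t0) []. Qed.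

Lemma Y_eq_measurable t v : 0 <= t -> measurable [set w | Y t w = v].
Proof.
move=> t0; have := Y_measurable t0 measurableT (measurable_set1 v).
by rewrite setTI.
Qed.

Lemma start_at x i : P (x, ys i) [set w | Y 0 w = ys i] = 1%E.
Proof.
apply: ae_prob1; first exact: Y_eq_measurable.
case: XY_markov => _ _ h _ _; have /h : ([set: R] `*` range ys) (x, ys i) by split => //; exists i.
by apply: filterS => w [].
Qed.

Lemma transition_prob x i j t : 0 <= t ->
  P (x, ys i) [set w | Y t w = ys j] = (pt t i j)%:E.
Proof.
move=> t0; have yi : range ys (ys i) by exists i.
have [_ _ _ _ H] := h2 x yi.
have := H 0 t (lexx _) t0 setT (sigma_algebra_T (natural_sigma_algebra _ _)) i j.
rewrite setTI start_at mul1e add0r => <-; rewrite setIC; apply/esym/prob_setI1.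
- exact: Y_eq_measurable.
- exact: Y_eq_measurable.
- exact: start_at.
Qed.

Lemma pt_ge0 t i j : 0 <= t -> 0 <= pt t i j.
Proof. by move=> t0; rewrite -lee_fin -(transition_prob 0). Qed.

(** The transition function of the pair, at a point with second coordinate [ys i], gives the chain
    probability whatever the first coordinate is; the integrand of the strong Markov property is
    thus constant on [A]. *)
Lemma strong_markov_chain (z : R * R) (tau : Omega -> \bar R) (A : set Omega) (t : R) i j :
  range ys z.2 -> stopping_time (natural Y) tau -> stopped_sigma (natural Y) tau A ->
  0 <= t -> A `<=` [set w | (tau w < +oo)%E] -> A `<=` [set w | Y (fine (tau w)) w = ys i] ->
  P z (A `&` [set w | Y (fine (tau w) + t) w = ys j]) = (P z A * (pt t i j)%:E)%E.
Proof.
move=> zr st [mA sA] t0 Afin Ai.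
have [_ _ _ _ SM] := XY_markov.
have st' : stopping_time (natural (pair_process X Y)) tau.
  by split; [exact: (proj1 st)|move=> s s0; apply: natural_pair; exact: (proj2 st)].
have sA' : stopped_sigma (natural (pair_process X Y)) tau A.
  by split => // s s0; apply: natural_pair; exact: sA.
have Dz : ([set: R] `*` range ys) z by split.
have := SM z Dz tau st' A sA' t (setT `*` [set ys j]) t0 (measurableX measurableT (measurable_set1 _)).
rewrite /= (setIidl Afin).
have -> : A `&` [set w | [set: R] (X (fine (tau w) + t) w) /\ Y (fine (tau w) + t) w = ys j] =
    A `&` [set w | Y (fine (tau w) + t) w = ys j].
  by apply/seteqP; split => w [Aw /=]; [case=> _|]; split.
move=> ->; under eq_integral => w.
  rewrite inE => /Ai /= e.
  rewrite /transition /pair_process e.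
  have -> : (fun omega => (X t omega, Y t omega)) @^-1` ([set: R] `*` [set ys j]) =
     [set w | Y t w = ys j] by apply/seteqP; split => w' //= [].
  rewrite transition_prob //; over.
by rewrite integral_cst // muleC.
Qed.

End ChainStrongMarkov.

Lemma set_transport {T : Type} (G : set (set T)) (A B : set T) :
  (forall w, A w <-> B w) -> G A -> G B.
Proof. by move=> AB; rewrite (_ : A = B) //; apply/seteqP; split => w /AB. Qed.

Lemma measurable_ge0_times {R : realType} {d : measure_display} {T : measurableType d}
    (tau : T -> \bar R) : (forall w, (0 <= tau w)%E) ->
  (forall t : R, 0 <= t -> measurable [set w | (tau w <= t%:E)%E]) ->
  measurable_fun [set: T] tau.
Proof.
move=> tau0 H; apply: (measurability (@ErealGenOInfty.G R)) => [|/= _ [_ [r ->] <-]].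
  exact: ErealGenOInfty.measurableE.
rewrite setTI; case: (ltP r 0) => r0.
  rewrite (_ : _ @^-1` _ = setT) //; apply/seteqP; split => // w _ /=.
  by rewrite in_itv /= andbT (lt_le_trans _ (tau0 w)) // lte_fin.
rewrite (_ : _ @^-1` _ = ~` [set w | (tau w <= r%:E)%E]); first exact: measurableC (H r r0).
apply/seteqP; split => w /=; rewrite in_itv /= andbT ltNge; first by move/negP.
by move/negP.
Qed.

Section GluedChain.
Context {R : realType} {m : nat} (ys : 'I_m -> R) (Q : 'M[R]_m).
Context {d : measure_display} {Omega : measurableType d}.
Variables (P : R * R -> probability Omega R) (X Y : R -> Omega -> R).
Hypothesis ys_inj : injective ys.
Hypotheses (X_rc : right_continuous_paths X) (Y_rc : right_continuous_paths Y).
Hypothesis XY_markov : strong_markov ([set: R] `*` range ys) P (pair_process X Y).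
Hypothesis h2 : forall x y, range ys y -> markov_chain (P (x, y)) ys Q Y.
Variables (c C : R).
Hypotheses (c0 : 0 < c) (cC : c <= C) (cysC : forall i, c <= ys i <= C).
Variables (z1 z2 : R * R).
Hypotheses (z1_in : range ys z1.2) (z2_in : range ys z2.2).

Notation pt t i j := (expmx (t *: Q) i j).
Notation T := (Omega * Omega)%type.
Notation Pr := (P z1 \x P z2)%E.

Lemma Y_gpath w : gpath c C (Y ^~ w).
Proof.
apply: range_gpath cysC _ _ => t t0; last exact: Y_rc.
exact: (Y_range XY_markov).
Qed.

(* The first coordinate carries the path to be followed after merging. *)
Definition glued_process (t : R) (w : T) : R := glued (Y ^~ w.2) (Y ^~ w.1) t.

Lemma upper_gproc : gproc c C (fun t (w : T) => Y t w.1).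
Proof.
split=> [w|t t0]; first exact: Y_gpath.
exact: (measurableT_comp (Y_measurable XY_markov t0) measurable_fst).
Qed.

Lemma lower_gproc : gproc c C (fun t (w : T) => Y t w.2).
Proof.
split=> [w|t t0]; first exact: Y_gpath.
exact: (measurableT_comp (Y_measurable XY_markov t0) measurable_snd).
Qed.

Lemma glued_process_gproc : gproc c C glued_process.
Proof. exact: (gproc_glued c0 cC lower_gproc upper_gproc). Qed.

Lemma low_range (z y : R -> R) : gpath c C z -> gpath c C y ->
  (forall t, 0 <= t -> range ys (z t)) -> (forall t, 0 <= t -> range ys (y t)) ->
  forall t, 0 <= t -> range ys (low z y t).
Proof.
move=> gz gy rz ry t t0; rewrite /low; case: ifP => _; first exact: ry.
by apply: rz; rewrite (pinv_mclock_ge0 c0 cC gz) // (mclock_ge0 c0 cC gy).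
Qed.

Lemma glued_process_range t w : 0 <= t -> range ys (glued_process t w).
Proof.
move=> t0; apply: low_range; try exact: Y_gpath; try by move=> s s0; exact: (Y_range XY_markov).
exact: (rho_ge0 c0 cC (Y_gpath _) (Y_gpath _)).
Qed.

Let sN u : sigma_algebra [set: Omega] (natural Y u).
Proof. exact: natural_sigma_algebra. Qed.

Let Nmeas u : natural Y u `<=` measurable.
Proof. by apply: natural_measurable => t; exact: (Y_measurable XY_markov). Qed.

(** With the lower path frozen, [s <= lclock u] means [rho s <= u]. An event of the glued past up to
    [s] is then known to the upper chain at time [u]; this makes [rho s] a stopping time and the
    event one of its stopped sigma-algebra. *)
Lemma glued_section_upper s A w2 u : 0 <= s -> 0 <= u -> natural glued_process s A ->
  natural Y u ([set w1 | A (w1, w2)] `&` [set w1 | s <= lclock (Y ^~ w2) (Y ^~ w1) u]).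
Proof.
move=> s0 u0; have g2 := Y_gpath w2.
have mlc : natural Y u [set w1 | s <= lclock (Y ^~ w2) (Y ^~ w1) u].
  have := lclock_submeasurable c0 cC (sN u) u0 Y_gpath (@natural_mem _ _ _ _ _ Y ^~ u) g2 u0 (lexx u).
  move=> /(_ `[s, +oo[%classic (measurable_itv _)); apply: set_transport => w /=.
  by rewrite in_itv /= andbT.
have sg := trace_sigma (fun w1 : Omega => (w1, w2)) (sN u) mlc.
apply: (smallest_sub sg) => _ [r [D [/= + mD ->]]]; rewrite in_itv /= => /andP[r0 rs].
have agree w1 t : 0 <= t <= u -> Y t w1 = stopped u (Y ^~ w1) t.
  by move=> /andP[_ tu]; rewrite /stopped min_l.
have gs := stopped_gproc (sN u) u0 Y_gpath (@natural_mem _ _ _ _ _ Y ^~ u).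
have gc := cst_gproc (natural Y u) g2.
have mg : submeasurable (natural Y u) (fun w1 => glued (Y ^~ w2) (stopped u (Y ^~ w1)) r).
  apply/(submeasurableP _ (sN u)).
  exact: (proj2 (gproc_glued c0 cC gc gs) r r0).
have E w1 : s <= lclock (Y ^~ w2) (Y ^~ w1) u ->
    glued_process r (w1, w2) = glued (Y ^~ w2) (stopped u (Y ^~ w1)) r.
  move=> h; apply: (glued_local c0 cC g2 (Y_gpath w1) (stopped_gpath u0 (Y_gpath w1)) (@agree w1) u0 r0).
  exact: le_trans rs h.
apply: set_transport (sigma_algebra_I (sN u) (mg D mD) mlc) => w1.
split => -[h1 h2']; (split; last exact: h2'); move: h1; rewrite /preimage /mkset.
  by rewrite (E w1 h2').
by rewrite (E w1 h2').
Qed.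

(** Before the merging the glued path is the lower path in its own time, so its past is a past of
    the second coordinate alone. *)
Lemma glued_premerge_event s A : 0 <= s -> natural glued_process s A ->
  exists2 A', natural Y s A' & forall w, ~~ merged (Y ^~ w.1) (Y ^~ w.2) s -> A w <-> A' w.2.
Proof.
move=> s0; pose G := [set A | exists2 A', natural Y s A' &
  forall w : T, ~~ merged (Y ^~ w.1) (Y ^~ w.2) s -> A w <-> A' w.2].
suff : natural glued_process s `<=` G by apply.
apply: smallest_sub.
  split.
  - by exists set0 => //; case: (sN s).
  - move=> B [B' nB' H]; exists (~` B'); first exact: (sigma_algebra_C (sN s)).
    by move=> w nm; rewrite setTD /setC /=; split => n h; apply: n; apply/(H w nm).
  - move=> B /(_ _)/cid2 HB; exists (\bigcup_n (s2val (HB n))).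
      case: (sN s) => _ _; apply=> n; exact: (s2valP (HB n)).
    move=> w nm; split => -[n _ Bn]; exists n => //.
      exact/(s2valP' (HB n) w nm).
    exact/(s2valP' (HB n) w nm).
move=> _ [r [D [/= + mD ->]]]; rewrite in_itv /= => /andP[r0 rs].
exists (Y r @^-1` D); first exact: natural_mem.
move=> w nm; rewrite /preimage /mkset /glued_process.
rewrite (glued_premerge c0 cC (Y_gpath _) (Y_gpath _) r0) //.
rewrite (merged_rho c0 cC (Y_gpath _) (Y_gpath _) r0).
by apply: contra nm; exact: merged_mono.
Qed.

(** With the lower path frozen, the glued path after time [s] is the upper chain after the stopping
    time [rho s], and the strong Markov property of the upper chain applies there. *)
Lemma glued_prob_merged s t A i j : 0 <= s -> 0 <= t -> natural glued_process s A ->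
  A `<=` [set w | glued_process s w = ys i] ->
  (Pr (A `&` [set w | merged (Y ^~ w.1) (Y ^~ w.2) s] `&` [set w | glued_process (s + t) w = ys j]) =
   Pr (A `&` [set w | merged (Y ^~ w.1) (Y ^~ w.2) s]) * (pt t i j)%:E)%E.
Proof.
move=> s0 t0 nA Ai; have st0 : 0 <= s + t by rewrite addr_ge0.
have mA : measurable A.
  by apply: natural_measurable nA; exact: (proj2 glued_process_gproc).
have mM : measurable [set w : T | merged (Y ^~ w.1) (Y ^~ w.2) s].
  exact: (measurable_merged c0 cC upper_gproc lower_gproc s0).
have mE : measurable [set w | glued_process (s + t) w = ys j].
  have := proj2 glued_process_gproc _ st0 measurableT [set ys j] (measurable_set1 _).
  by rewrite setTI.
apply: prod_ysection_scale.
- exact: (pt_ge0 XY_markov h2).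
- by apply: measurableI => //; exact: measurableI.
- exact: measurableI.
move=> w2; have g2 := Y_gpath w2.
pose tau (w1 : Omega) : \bar R := (rho (Y ^~ w2) (Y ^~ w1) s)%:E.
have stau : stopping_time (natural Y) tau.
  split=> [w1|u u0]; first by rewrite lee_fin (rho_ge0 c0 cC g2 (Y_gpath w1)).
  have := glued_section_upper w2 s0 u0 (sigma_algebra_T (natural_sigma_algebra _ _)).
  apply: set_transport => w1 /=; rewrite lee_fin (rho_le c0 cC g2 (Y_gpath w1)) //.
  by split=> [[]|].
set As := ysection (A `&` _) w2.
have AsE w1 : As w1 <-> A (w1, w2) /\ merged (Y ^~ w2) (Y ^~ w1) (rho (Y ^~ w2) (Y ^~ w1) s).
  rewrite /As /ysection /= inE /= (merged_rho c0 cC g2 (Y_gpath w1) s0).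
  by split=> -[].
have mAs : measurable As by apply: measurable_ysection; exact: measurableI.
have sAs : stopped_sigma (natural Y) tau As.
  split => // u u0.
  have agree w1 t' : 0 <= t' <= u -> Y t' w1 = stopped u (Y ^~ w1) t'.
    by move=> /andP[_ tu]; rewrite /stopped min_l.
  have gs := stopped_gproc (sN u) u0 Y_gpath (@natural_mem _ _ _ _ _ Y ^~ u).
  have gc := cst_gproc (natural Y u) g2.
  have mm : natural Y u [set w1 | merged (stopped u (Y ^~ w1)) (Y ^~ w2) s].
    apply/(submeasurable_set _ (sN u)); exact: (measurable_merged c0 cC gs gc s0).
  apply: set_transport (sigma_algebra_I (sN u) (glued_section_upper w2 s0 u0 nA) mm) => w1 /=.
  split.
    move=> [[Aw sl] mw]; split; last by rewrite lee_fin (rho_le c0 cC g2 (Y_gpath w1)).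
    apply/AsE; split => //; rewrite (merged_rho c0 cC g2 (Y_gpath w1) s0).
    rewrite -(merged_rho c0 cC g2 (Y_gpath w1) s0).
    have gw := stopped_gpath u0 (Y_gpath w1).
    rewrite (merged_local _ (@agree w1)) ?(rho_le c0 cC g2 (Y_gpath w1)) //.
    by rewrite (rho_local c0 cC g2 (Y_gpath w1) gw (@agree w1)) // (merged_rho c0 cC g2 gw s0).
  move=> [/AsE[Aw mw]]; rewrite lee_fin => ru; have sl := ru.
  rewrite (rho_le c0 cC g2 (Y_gpath w1)) // in sl; split => //.
  have gw := stopped_gpath u0 (Y_gpath w1).
  rewrite -(merged_rho c0 cC g2 gw s0) -(rho_local c0 cC g2 (Y_gpath w1) gw (@agree w1)) //.
  by rewrite -(merged_local _ (@agree w1)).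
have Afin : As `<=` [set w1 | (tau w1 < +oo)%E] by move=> w1 _; rewrite /= ltry.
have Ati : As `<=` [set w1 | Y (fine (tau w1)) w1 = ys i].
  move=> w1 /AsE[/Ai /= + mw]; rewrite /glued_process /glued /low /=.
  by rewrite mw.
rewrite -(strong_markov_chain XY_markov h2 j z1_in stau sAs t0 Afin Ati).
congr (P z1 _); apply/seteqP; split => w1.
  rewrite /ysection /= inE /= => -[[Aw mw] e]; split.
    by rewrite /As /ysection /= inE.
  rewrite -e /glued_process /= (glued_postmerge c0 cC g2 (Y_gpath w1)) //.
  by rewrite (merged_rho c0 cC g2 (Y_gpath w1) s0).
move=> [Asw e]; have [Aw mw] := (AsE w1).1 Asw.
rewrite /ysection /= inE /=; split.
  by split => //; rewrite -(merged_rho c0 cC g2 (Y_gpath w1) s0).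
by rewrite -e /glued_process /= (glued_postmerge c0 cC g2 (Y_gpath w1)).
Qed.

Let mergeT t : measurable_fun [set: T] (fun w : T => fine (mtime (Y ^~ w.2) (Y ^~ w.1)) + t).
Proof.
apply: measurable_funD => //; apply: measurableT_comp => //.
apply: measurable_ge0_times => [w|r r0]; first exact: mtime_ge0.
apply: set_transport (measurable_merged c0 cC lower_gproc upper_gproc r0) => w /=.
by rewrite (mtime_le c0 cC (Y_gpath _) (Y_gpath _) r0).
Qed.

Let mergeT' t : measurable_fun [set: T] (fun w : T => fine (mtime (Y ^~ w.1) (Y ^~ w.2)) + t).
Proof.
apply: measurable_funD => //; apply: measurableT_comp => //.
apply: measurable_ge0_times => [w|r r0]; first exact: mtime_ge0.
apply: set_transport (measurable_merged c0 cC upper_gproc lower_gproc r0) => w /=.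
by rewrite (mtime_le c0 cC (Y_gpath _) (Y_gpath _) r0).
Qed.

Let fine_mtime_ge0 (z y : R -> R) : 0 <= fine (mtime z y).
Proof. by rewrite fine_ge0 // mtime_ge0. Qed.

Let window s t (w : T) : Prop :=
  ~~ merged (Y ^~ w.1) (Y ^~ w.2) s /\ merged (Y ^~ w.1) (Y ^~ w.2) (s + t).

(** The time left from the merging until [s + t]. The maximum with 0 matters off the window only,
    where [post_law] still asks for a nonnegative time. *)
Let remaining s t (w : T) : R := Num.max 0 (s + t - fine (mtime (Y ^~ w.1) (Y ^~ w.2))).

Let measurable_window s t : 0 <= s -> 0 <= t -> measurable [set w | window s t w].
Proof.
move=> s0 t0; have st0 : 0 <= s + t by rewrite addr_ge0.
have m1 := measurable_merged c0 cC upper_gproc lower_gproc s0.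
have m2 := measurable_merged c0 cC upper_gproc lower_gproc st0.
apply: set_transport (measurableI _ _ (measurableC m1) m2) => w /=.
by split => -[h1 h2']; split => //; apply/negP.
Qed.

(** [st] is the merging time in the time of the lower path, [su] the same instant in the time of the
    upper path. *)
Let windowP s t w : 0 <= s -> 0 <= t -> window s t w ->
  exists st su : R, [/\ mtime (Y ^~ w.1) (Y ^~ w.2) = st%:E, mtime (Y ^~ w.2) (Y ^~ w.1) = su%:E,
    s < st <= s + t, 0 <= su & [/\ rho (Y ^~ w.2) (Y ^~ w.1) st = su, Y st w.2 = Y su w.1,
    lclock (Y ^~ w.2) (Y ^~ w.1) su = st & merged (Y ^~ w.2) (Y ^~ w.1) su]].
Proof.
move=> s0 t0 [nm ms]; have st0 : 0 <= s + t by rewrite addr_ge0.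
have g1 := Y_gpath w.1; have g2 := Y_gpath w.2.
have h : (mtime (Y ^~ w.1) (Y ^~ w.2) < +oo)%E.
  by apply: le_lt_trans (ltry (s + t)); rewrite (mtime_le c0 cC g1 g2).
have [h' e1 e2 e3] := mtime_swap c0 cC g2 g1 h.
have [l [l0 el ml _ _]] := mtime_attained c0 cC g2 g1 h'.
have [v [v0 ev mv _ _]] := mtime_attained c0 cC g1 g2 h.
move: e1 e2 e3; rewrite ev el /= => -[e1] e2 e3.
exists v, l; split; [by []|by []| |by []|by split; rewrite -?e1].
rewrite -!lte_fin -!lee_fin -ev (mtime_le c0 cC g1 g2) // ms andbT.
by rewrite ltNge (mtime_le c0 cC g1 g2).
Qed.

Let stopping_upper w2 : stopping_time (natural Y) (fun w1 : Omega => mtime (Y ^~ w2) (Y ^~ w1)).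
Proof.
have g2 := Y_gpath w2; split=> [w1|u u0]; first exact: mtime_ge0.
have := merged_submeasurable c0 cC (sN u) u0 Y_gpath (@natural_mem _ _ _ _ _ Y ^~ u) g2 u0 (lexx u).
by apply: set_transport => w1 /=; rewrite (mtime_le c0 cC g2 (Y_gpath w1) u0).
Qed.

(** The requirement [s <= tau] lets an event known at [s] be counted as known at [tau]; [V] carries
    one further quantity read at [tau], from which the remaining time is recovered. *)
Let strong_markov_event (z : R * R) (tau : Omega -> \bar R) (V : R -> Omega -> R) (W : set R)
    (s u : R) (A : set Omega) k j :
  range ys z.2 -> stopping_time (natural Y) tau -> right_continuous_paths V ->
  adapted (natural Y) V -> measurable W -> 0 <= s -> natural Y s A -> 0 <= u ->
  let S := [set w | [/\ A w, (s%:E <= tau w)%E, W (V (fine (tau w)) w),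
    Y (fine (tau w)) w = ys k & (tau w < +oo)%E]] in
  measurable S /\
  P z (S `&` [set w | Y (fine (tau w) + u) w = ys j]) = (P z S * (pt u k j)%:E)%E.
Proof.
move=> zr stau rV aV mW s0 nA u0 S.
have inc a b : 0 <= a -> a <= b -> natural Y a `<=` natural Y b by move=> _; exact: natural_mono.
have sv V' D t : right_continuous_paths V' -> adapted (natural Y) V' -> 0 <= t -> measurable D ->
    natural Y t ([set w | D (V' (fine (tau w)) w)] `&` [set w | (tau w <= t%:E)%E]).
  exact: (@stopped_value _ _ _ (natural Y) tau (fun t _ => sN t) inc stau V' t D).
have aY : adapted (natural Y) Y by move=> t t0; exact: natural_mem (lexx t).
have St t : 0 <= t -> natural Y t (S `&` [set w | (tau w <= t%:E)%E]).
  move=> t0; case: (ltP t s) => ts.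
    rewrite (_ : _ `&` _ = set0); first by case: (sN t).
    apply/seteqP; split => // w [[_ h _ _ _] /= h'].
    by move: (le_trans h h'); rewrite lee_fin leNgt ts.
  have h1 := sv V W t rV aV t0 mW.
  have h3 := sv Y [set ys k] t Y_rc aY t0 (measurable_set1 _).
  have h4 : natural Y t ([set w | [set x | s <= x] (fine (tau w))] `&` [set w | (tau w <= t%:E)%E]).
    apply: (sv (fun r _ => r) [set x | s <= x]) => //.
    - by move=> w r _; exact: cvg_at_right_filter cvg_id.
    - move=> r _ D mD; case: (pselect (D r)) => Dr.
        rewrite (_ : _ @^-1` _ = setT); first exact: (sigma_algebra_T (sN r)).
        by apply/seteqP; split.
      rewrite (_ : _ @^-1` _ = set0); first by case: (sN r).
      by apply/seteqP; split.
    - rewrite (_ : [set x | _] = `[s, +oo[%classic) //.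
      by apply/seteqP; split => x /=; rewrite in_itv /= andbT.
  apply: set_transport (sigma_algebra_I (sN t) (inc s t s0 ts _ nA)
    (sigma_algebra_I (sN t) h1 (sigma_algebra_I (sN t) h3 h4))) => w.
  have fE : (tau w <= t%:E)%E -> tau w = (fine (tau w))%:E.
    move=> h; rewrite fineK // ge0_fin_numE; last exact: (proj1 stau).
    exact: le_lt_trans h (ltry _).
  split.
    move=> [Aw [[Ww h] [[e _] [sx _]]]]; split => //; split => //.
      by rewrite (fE h) lee_fin.
    exact: le_lt_trans h (ltry _).
  move=> [[Aw sx Ww e _] h]; split => //; split; [by split|split; split => //].
  by move: sx; rewrite (fE h) lee_fin.
have mS : measurable S.
  rewrite (_ : S = \bigcup_n (S `&` [set w | (tau w <= n%:R%:E)%E])).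
    by apply: bigcupT_measurable => n; apply: Nmeas; apply: St; exact: ler0n.
  apply/seteqP; split => w; last by move=> [n _ []].
  move=> Sw; have [_ _ _ _ fw] := Sw.
  have : (0 <= tau w)%E by exact: (proj1 stau).
  move: fw; case e : (tau w) => [x||] // _ x0.
  exists (Num.trunc x).+1 => //; split => //=; rewrite e lee_fin.
  exact: ltW (truncnS_gt _).
split => //; apply: (strong_markov_chain XY_markov h2 j zr stau (conj mS St) u0).
  by move=> w [].
by move=> w [].
Qed.

(** After the merging the glued path follows the upper chain; following the lower chain instead
    gives the same law. Both restart from the common state, and the remaining time is known at the
    merging to either chain once the other path is frozen. *)
Let glued_prob_window s t A i j : 0 <= s -> 0 <= t -> natural glued_process s A ->
  A `<=` [set w | glued_process s w = ys i] ->
  Pr (A `&` [set w | window s t w] `&` [set w | glued_process (s + t) w = ys j]) =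
  Pr (A `&` [set w | window s t w] `&` [set w | Y (s + t) w.2 = ys j]).
Proof.
move=> s0 t0 nA Ai; have st0 : 0 <= s + t by rewrite addr_ge0.
have mA : measurable A by apply: natural_measurable nA; exact: (proj2 glued_process_gproc).
have mW := measurable_window s0 t0.
pose V1 u (w : T) := Y (fine (mtime (Y ^~ w.2) (Y ^~ w.1)) + u) w.1.
pose V2 u (w : T) := Y (fine (mtime (Y ^~ w.1) (Y ^~ w.2)) + u) w.2.
pose N := A `&` [set w | window s t w].
have E1 : N `&` [set w | glued_process (s + t) w = ys j] =
    N `&` [set w | V1 (remaining s t w) w = ys j].
  suff E w : N w -> glued_process (s + t) w = V1 (remaining s t w) w.
    by apply/seteqP; split => w [Nw /= e]; split => //; rewrite /= -e E.
  move=> [_ /(windowP s0 t0)[st [su [e1 e2 /andP[h1 h3] su0 [e3 e4 e5 e6]]]]].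
  have v0 : 0 <= st by exact: ltW (le_lt_trans s0 h1).
  have r0 : 0 <= s + t - st by rewrite subr_ge0.
  have mst : merged (Y ^~ w.2) (Y ^~ w.1) (rho (Y ^~ w.2) (Y ^~ w.1) st) by rewrite e3; exact: e6.
  have := glued_postmerge c0 cC (Y_gpath w.2) (Y_gpath w.1) v0 r0 mst.
  have -> : st + (s + t - st) = s + t by ring.
  rewrite /V1 /remaining e1 e2 /= (max_r r0) e3; exact: id.
have E2 : N `&` [set w | Y (s + t) w.2 = ys j] = N `&` [set w | V2 (remaining s t w) w = ys j].
  suff E w : N w -> Y (s + t) w.2 = V2 (remaining s t w) w.
    by apply/seteqP; split => w [Nw /= e]; split => //; rewrite /= -e E.
  move=> [_ /(windowP s0 t0)[st [su [e1 e2 /andP[h1 h3] su0 _]]]].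
  by rewrite /V2 /remaining e1 /= max_r ?subr_ge0 //; congr (Y _ _); ring.
rewrite -/N E1 E2; have mN' : measurable N by exact: measurableI.
have mr : measurable_fun [set: T] (remaining s t).
  apply: measurable_maxr => //; apply: measurable_funB => //.
  by have := mergeT' 0; apply: eq_measurable_fun => w _; rewrite addr0.
have rshift (a : R) w : 0 <= a -> rconst (fun u => Y (a + u) w).
  move=> a0 u u0; have [e e0 he] := proj1 (Y_gpath w) _ (addr_ge0 a0 u0).
  by exists e => // v /andP[h1 h3]; rewrite he // lerD2l h1 /= -addrA ltrD2l.
apply: (post_law mN' mr).
- by move=> w; rewrite /remaining le_max lexx.
- by move=> w; exact: rshift.
- by move=> w; exact: rshift.
- move=> u u0; apply: (jmeas_random (gproc_jmeas upper_gproc) (mergeT u)) => w.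
  by rewrite addr_ge0.
- move=> u u0; apply: (jmeas_random (gproc_jmeas lower_gproc) (mergeT' u)) => w.
  by rewrite addr_ge0.
move=> B u mB u0.
have mrB : measurable (remaining s t @^-1` B) by rewrite -[X in measurable X]setTI; exact: mr.
have mV1 v : 0 <= v -> measurable_fun [set: T] (V1 v).
  move=> v0; apply: (jmeas_random (gproc_jmeas upper_gproc) (mergeT v)) => w.
  by rewrite addr_ge0.
have mV2 v : 0 <= v -> measurable_fun [set: T] (V2 v).
  move=> v0; apply: (jmeas_random (gproc_jmeas lower_gproc) (mergeT' v)) => w.
  by rewrite addr_ge0.
have meq (U : T -> R) v : measurable_fun [set: T] U -> measurable [set w | U w = v].
  by move=> mU; have := mU measurableT [set v] (measurable_set1 _); rewrite setTI; apply.
have mNB : measurable (N `&` remaining s t @^-1` B) by exact: measurableI.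
have m10 := mV1 0 (lexx _).
apply: (prob_eq_states (P := Pr) (U := V1 0) ys_inj) => //.
- by apply: measurableI => //; apply: meq; exact: mV1.
- by apply: measurableI => //; apply: meq; exact: mV2.
- by move=> w; apply: (Y_range XY_markov); rewrite addr_ge0.
(* Condition on the common state at the merging. [V1 0] is that state on the upper path, and it is
   also the state of the lower path there. *)
move=> k; set NB := N `&` remaining s t @^-1` B.
rewrite (setIAC NB [set w | V1 u w = ys j]) (setIAC NB [set w | V2 u w = ys j]).
set Nk := NB `&` _.
have mNk : measurable Nk by apply: measurableI => //; exact: meq.
have [A' nA' HA'] := glued_premerge_event s0 nA.
have kk : 0 <= pt u k j by exact: (pt_ge0 XY_markov h2).
(* Both probabilities equal this product: the upper continuation with the lower path frozen, the
   lower continuation with the upper path frozen. *)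
transitivity (Pr Nk * (pt u k j)%:E)%E.
  apply: prod_ysection_scale => //; first by apply: measurableI => //; apply: meq; exact: mV1.
  move=> w2; case: (pselect (A' w2)) => A'w2; last first.
    have e0 : ysection Nk w2 = set0.
      apply/seteqP; split => // w1; rewrite /ysection /= inE => -[[[Aw [nm _]] _] _].
      by case: A'w2; apply/(HA' (w1, w2) nm).
    rewrite e0 measure0 mul0e; apply: (subset_measure0 _ _ _ (measure0 (P z1))) => //.
      by apply: measurable_ysection; apply: measurableI => //; apply: meq; exact: mV1.
    by rewrite -e0 => w1; rewrite /ysection /= !inE => -[].
  (* Here [x] is [lclock] at the merging time of the upper chain, that is, the merging time of the
     lower path; [W] prescribes both the window and the remaining time. *)
  pose W := [set x | [/\ s < x, x <= s + t & B (Num.max 0 (s + t - x))]].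
  have mW' : measurable W.
    have mB' : measurable ((fun x => Num.max 0 (s + t - x)) @^-1` B).
      rewrite -[X in measurable X]setTI.
      have mf : measurable_fun [set: R] (fun x : R => Num.max 0 (s + t - x)).
        by apply: measurable_maxr => //; exact: measurable_funB.
      exact: mf.
    apply: set_transport (measurableI _ _ (measurable_itv `]s, s + t]) mB') => x /=.
    by rewrite in_itv /=; split => [[/andP[]]|[-> ->]].
  have g2 := Y_gpath w2.
  have rV : right_continuous_paths (fun t w1 => lclock (Y ^~ w2) (Y ^~ w1) t).
    move=> w1 v v0; apply: (bilip_right_cvg (lrate_lb_gt0 c0 cC) (lclock_bilip c0 cC g2 (Y_gpath w1))).
    exact: v0.
  have aV : adapted (natural Y) (fun t w1 => lclock (Y ^~ w2) (Y ^~ w1) t).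
    by move=> v v0; exact: (lclock_submeasurable c0 cC (sN v) v0 Y_gpath (@natural_mem _ _ _ _ _ Y ^~ v) g2 v0 (lexx v)).
  have [_] := strong_markov_event k j z1_in (stopping_upper w2) rV aV mW' (lexx 0)
    (sigma_algebra_T (sN 0)) u0.
  set S := [set w | _] => SM.
  have eS w1 : S w1 <-> Nk (w1, w2).
    rewrite /S /Nk /N /W; split.
      move=> [_ _ /= [W1 W2 W3] e h].
      have [h' e1 e2 e3] := mtime_swap c0 cC (Y_gpath w1) g2 h.
      have [_ e1' _ _] := mtime_swap c0 cC g2 (Y_gpath w1) h'.
      have nm : ~~ merged (Y ^~ w1) (Y ^~ w2) s.
        by rewrite -(mtime_le c0 cC (Y_gpath w1) g2 s0) e1' lee_fin -ltNge.
      have ms : merged (Y ^~ w1) (Y ^~ w2) (s + t).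
        by rewrite -(mtime_le c0 cC (Y_gpath w1) g2 st0) e1' lee_fin.
      split; last by rewrite /V1 /= addr0.
      split; last by rewrite /preimage /mkset /remaining /= e1'.
      by split => //; apply/(HA' (w1, w2) nm).
    move=> [[[Aw ww] Bw] V1w]; have [st [su [e1 e2 /andP[h1 h3] su0 [e3 e4 e5 e6]]]] := windowP s0 t0 ww.
    rewrite /= in e1 e2 e3 e4 e5 e6.
    split => //=; rewrite ?e2 /= ?ltry //.
    - rewrite e5; split => //; move: Bw; rewrite /preimage /mkset /remaining /= e1 //.
    - by move: V1w; rewrite /V1 /= e2 /= addr0.
  have -> : ysection Nk w2 = S.
    by apply/seteqP; split => w1; rewrite /ysection /= inE => /eS.
  rewrite -SM; congr (P z1 _); apply/seteqP; split => w1.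
    by rewrite /ysection /= inE => -[/eS].
  by move=> [/eS h1 h3]; rewrite /ysection /= inE; split.
apply/esym; apply: prod_xsection_scale => //; first by apply: measurableI => //; apply: meq; exact: mV2.
move=> w1; have g1 := Y_gpath w1.
(* The bound [s < x] is absent: that the paths have not merged by [s] is an event of the lower past
   and enters through [nA'']. *)
pose W := [set x | x <= s + t /\ B (Num.max 0 (s + t - x))].
have mW' : measurable W.
  have mB' : measurable ((fun x => Num.max 0 (s + t - x)) @^-1` B).
    rewrite -[X in measurable X]setTI.
    have mf : measurable_fun [set: R] (fun x : R => Num.max 0 (s + t - x)).
      by apply: measurable_maxr => //; exact: measurable_funB.
    exact: mf.
  apply: set_transport (measurableI _ _ (measurable_itv `]-oo, s + t]) mB') => x /=.
  by rewrite in_itv /=; split.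
have rV : right_continuous_paths (fun (t : R) (_ : Omega) => t).
  by move=> w r _; exact: cvg_at_right_filter cvg_id.
have aV : adapted (natural Y) (fun (t : R) (_ : Omega) => t).
  move=> r _ D mD; case: (pselect (D r)) => Dr.
    rewrite (_ : _ @^-1` _ = setT); first exact: (sigma_algebra_T (sN r)).
    by apply/seteqP; split.
  rewrite (_ : _ @^-1` _ = set0); first by case: (sN r).
  by apply/seteqP; split.
have nA'' : natural Y s (A' `&` [set w2 | ~~ merged (Y ^~ w1) (Y ^~ w2) s]).
  apply: (sigma_algebra_I (sN s)) => //.
  have := merged_submeasurable c0 cC (sN s) s0 Y_gpath (@natural_mem _ _ _ _ _ Y ^~ s) g1 s0 (lexx s).
  by move=> /(sigma_algebra_C (sN s)); apply: set_transport => w2 /=; split => [/negP|/negP].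
have [_] := strong_markov_event k j z2_in (stopping_upper w1) rV aV mW' s0 nA'' u0.
set S := [set w | _] => SM.
have eS w2 : S w2 <-> Nk (w1, w2).
  rewrite /S /Nk /N /W; split.
    move=> [[Aw nm] _ /= [W2 W3] e h].
    have [h' e1 e2 e3] := mtime_swap c0 cC (Y_gpath w2) g1 h.
    split; last by rewrite /V1 /= addr0 -e3 -[RHS]e.
    split; last by rewrite /preimage /mkset /remaining /=.
    split; first exact/(HA' (w1, w2) nm).
    split => //=; rewrite -(mtime_le c0 cC g1 (Y_gpath w2) st0).
    by rewrite -(@fineK _ (mtime (Y ^~ w1) (Y ^~ w2))) ?lee_fin // ge0_fin_numE // mtime_ge0.
  move=> [[[Aw ww] Bw] V1w]; have [st [su [e1 e2 /andP[h1 h3] su0 [e3 e4 e5 e6]]]] := windowP s0 t0 ww.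
  rewrite /= in e1 e2 e3 e4 e5 e6.
  split => /=; rewrite ?e1 /= ?ltry ?lee_fin ?(ltW h1) //.
  - by split; [apply/(HA' (w1, w2)); case: ww|case: ww].
  - by split => //; move: Bw; rewrite /preimage /mkset /remaining /= e1.
  - by move: V1w; rewrite /V1 /= e2 /= addr0 e4.
have -> : xsection Nk w1 = S.
  by apply/seteqP; split => w2; rewrite /xsection /= inE => /eS.
rewrite -SM; congr (P z2 _); apply/seteqP; split => w2.
  by rewrite /xsection /= inE => -[/eS].
by move=> [/eS h1 h3]; rewrite /xsection /= inE; split.
Qed.

(** If the paths have merged by [s], the upper chain supplies the Markov property at [rho s]. If
    not, the value at [s + t] is first exchanged for that of the lower chain, whose Markov property
    at [s] then concludes. *)
Lemma glued_markov_chain : markov_chain Pr ys Q glued_process.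
Proof.
have [isQ _ _ _ _] := h2 z2.1 z2_in.
split => //.
- by move=> t w t0; exact: glued_process_range.
- exact: (proj2 glued_process_gproc).
- by move=> w; exact: (rconst_right_cvg (proj1 (proj1 glued_process_gproc w))).
move=> s t s0 t0 A nA i j; have st0 : 0 <= s + t by rewrite addr_ge0.
have meq (U : T -> R) v : measurable_fun [set: T] U -> measurable [set w | U w = v].
  by move=> mU; have := mU measurableT [set v] (measurable_set1 _); rewrite setTI; apply.
have mY v : 0 <= v -> measurable_fun [set: T] (glued_process v) := proj2 glued_process_gproc v.
have nA1 : natural glued_process s (A `&` [set w | glued_process s w = ys i]).
  apply: (sigma_algebra_I (natural_sigma_algebra _ _)) => //.
  exact: (natural_mem s0 (lexx s) (measurable_set1 (ys i))).
have A1i : A `&` [set w | glued_process s w = ys i] `<=` [set w | glued_process s w = ys i].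
  by move=> w [].
move: nA1 A1i; set A1 := A `&` _ => nA1 A1i.
have mA1 : measurable A1 by apply: natural_measurable nA1; exact: mY.
have mM : measurable [set w : T | merged (Y ^~ w.1) (Y ^~ w.2) s].
  exact: (measurable_merged c0 cC upper_gproc lower_gproc s0).
have mMt : measurable [set w : T | merged (Y ^~ w.1) (Y ^~ w.2) (s + t)].
  exact: (measurable_merged c0 cC upper_gproc lower_gproc st0).
have mG : measurable [set w | glued_process (s + t) w = ys j] by apply: meq; exact: mY.
have mL : measurable [set w : T | Y (s + t) w.2 = ys j].
  by apply: (meq (fun w : T => Y (s + t) w.2)); exact: (proj2 lower_gproc).
have split_prob (E D : set T) : measurable E -> measurable D ->
    (Pr E = Pr (E `&` D) + Pr (E `\` D))%E.
  by move=> mE mD; rewrite addeC -measureDI.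
set M := [set w : T | merged (Y ^~ w.1) (Y ^~ w.2) s].
set G := [set w | glued_process (s + t) w = ys j].
set L := [set w : T | Y (s + t) w.2 = ys j].
have mA1G : measurable (A1 `&` G) by exact: measurableI.
change (Pr (A1 `&` G) = (Pr A1 * (pt t i j)%:E)%E).
rewrite (split_prob (A1 `&` G) M) // (split_prob A1 M) //.
rewrite setIAC (glued_prob_merged j s0 t0 nA1 A1i).
have Pr0 (E : set T) : (0 <= Pr E)%E by exact: (measure_ge0 Pr E).
rewrite [RHS](ge0_muleDl _ (Pr0 _) (Pr0 _)).
congr (_ + _)%E.
have nm w : (~ M w) -> ~~ merged (Y ^~ w.1) (Y ^~ w.2) s by move=> h; apply/negP.
(* Still apart at [s]: on merging by [s + t] the window lemma makes the exchange, and otherwise the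
   two values at [s + t] are equal. *)
transitivity (Pr ((A1 `\` M) `&` L)).
  have mD : measurable (A1 `\` M) by exact: measurableD.
  have -> : (A1 `&` G) `\` M = (A1 `\` M) `&` G by rewrite !setDE setIAC.
  rewrite (split_prob ((A1 `\` M) `&` G) [set w : T | merged (Y ^~ w.1) (Y ^~ w.2) (s + t)]) //; last exact: measurableI.
  rewrite [RHS](split_prob _ [set w : T | merged (Y ^~ w.1) (Y ^~ w.2) (s + t)]) //; last exact: measurableI.
  congr (_ + _)%E.
    have E (H : set T) : (A1 `\` M) `&` H `&` [set w : T | merged (Y ^~ w.1) (Y ^~ w.2) (s + t)] =
        A1 `&` [set w | window s t w] `&` H.
      apply/seteqP; split => w.
        by move=> [[[Aw nMw] Hw] mw]; split => //; split => //; split => //; exact: nm.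
      by move=> [[Aw [nmw mw]] Hw]; split => //; split => //; split => //; move/negP: nmw.
    by rewrite !E (glued_prob_window j s0 t0 nA1 A1i).
  have EL w : ~ merged (Y ^~ w.1) (Y ^~ w.2) (s + t) -> glued_process (s + t) w = Y (s + t) w.2.
    move=> nMt; rewrite /glued_process (glued_premerge c0 cC (Y_gpath _) (Y_gpath _) st0) //.
    by rewrite (merged_rho c0 cC (Y_gpath _) (Y_gpath _) st0); apply/negP.
  congr (Pr _); apply/seteqP; split => w [[Dw e] nMt]; (split; last exact: nMt);
    (split; first exact: Dw); move: e; rewrite /G /L /mkset (EL w nMt); exact: id.
have [A' nA' HA'] := glued_premerge_event s0 nA1.
apply: prod_xsection_scale.
- exact: (pt_ge0 XY_markov h2).
- by apply: measurableI => //; exact: measurableD.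
- exact: measurableD.
move=> w1; have g1 := Y_gpath w1.
have [_ _ _ _ MC] := h2 z2.1 z2_in.
have nB : natural Y s (A' `&` [set w2 | ~~ merged (Y ^~ w1) (Y ^~ w2) s]).
  apply: (sigma_algebra_I (sN s)) => //.
  have := merged_submeasurable c0 cC (sN s) s0 Y_gpath (@natural_mem _ _ _ _ _ Y ^~ s) g1 s0 (lexx s).
  by move=> /(sigma_algebra_C (sN s)); apply: set_transport => w2 /=; split => [/negP|/negP].
have := MC s t s0 t0 _ nB i j; rewrite -surjective_pairing.
have Yi w : A1 w -> ~~ merged (Y ^~ w.1) (Y ^~ w.2) s -> Y s w.2 = ys i.
  move=> [_ /= e] nmw; rewrite -e /glued_process (glued_premerge c0 cC (Y_gpath _) (Y_gpath _) s0) //.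
  by rewrite (merged_rho c0 cC (Y_gpath _) (Y_gpath _) s0).
have E : xsection (A1 `\` M) w1 = A' `&` [set w2 | ~~ merged (Y ^~ w1) (Y ^~ w2) s] `&` [set w2 | Y s w2 = ys i].
  apply/seteqP; split => w2; rewrite /xsection /= inE.
    move=> [Aw /nm nMw]; split; last exact: (Yi (w1, w2)).
    by split => //; apply/(HA' (w1, w2)).
  by move=> [[Aw nmw] _]; split; [apply/(HA' (w1, w2))|move/negP: nmw].
rewrite E => <-; congr (P z2 _); apply/seteqP; split => w2; rewrite /xsection /= inE.
  move=> [[Aw /nm nMw] Lw]; split => //; split; last exact: (Yi (w1, w2)).
  by split => //; apply/(HA' (w1, w2)).
by move=> [[[Aw nmw] _] Lw]; split => //; split; [apply/(HA' (w1, w2))|move/negP: nmw].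
Qed.

End GluedChain.

(** * Skip-free chains do not cross before merging *)

Section MatrixExponential.
Context {R : realType} {m : nat}.
Variable Q : 'M[R]_m.

Let a : R := \sum_i \sum_j `|Q i j|.

Let a_ge0 : 0 <= a. Proof. by apply: sumr_ge0 => i _; apply: sumr_ge0. Qed.

Let Qk_bound k i j : `|(Q ^+ k) i j| <= a ^+ k.
Proof.
elim: k i j => [|k IH] i j.
  by rewrite expr0 mxE expr0; case: (i == j) => /=; rewrite ?normr1 ?normr0 ?ler01.
rewrite exprS mxE (le_trans (ler_norm_sum _ _ _)) // exprS.
apply: (@le_trans _ _ (\sum_l `|Q i l| * a ^+ k)).
  by apply: ler_sum => l _; rewrite normrM ler_wpM2l.
have ai : \sum_l `|Q i l| <= a.
  rewrite /a [leRHS](bigD1 i) //= lerDl.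
  by apply: sumr_ge0 => l _; apply: sumr_ge0.
by rewrite -mulr_suml; apply: ler_wpM2r; rewrite ?exprn_ge0.
Qed.

Let u (t : R) i j k : R := (k`!%:R)^-1 * ((t *: Q) ^+ k) i j.

Let uE t i j k : u t i j k = (k`!%:R)^-1 * (t ^+ k * (Q ^+ k) i j).
Proof.
rewrite /u (_ : (t *: Q) ^+ k = t ^+ k *: Q ^+ k) ?mxE //.
elim: k => [|k IH]; first by rewrite !expr0 scale1r.
by rewrite !exprS IH -[LHS]/(mulmx _ _) -scalemxAl -scalemxAr scalerA.
Qed.

Let u_bound t i j k : 0 <= t -> `|u t i j k| <= exp_coeff (a * t) k.
Proof.
move=> t0; have f0 : 0 <= (k`!%:R : R)^-1 by rewrite invr_ge0.
have tk : 0 <= t ^+ k by rewrite exprn_ge0.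
rewrite uE normrM (ger0_norm f0) normrM (ger0_norm tk) /exp_coeff /= mulrC.
apply: ler_wpM2r => //; rewrite exprMn mulrC.
exact: ler_wpM2r.
Qed.

Lemma expmx_cvg t i j : 0 <= t -> cvgn (series (u t i j)).
Proof.
move=> t0; apply: normed_cvg; apply: (series_le_cvg (v_ := exp_coeff (a * t))).
- by move=> n; exact: normr_ge0.
- by move=> n; apply: exp_coeff_ge0; rewrite mulr_ge0.
- by move=> n; exact: u_bound.
- exact: is_cvg_series_exp_coeff.
Qed.

(** The entries of [Q ^+ k] are at most [a ^+ k], so for [t <= 1] the remainder is [t ^+ 2] times a
    tail of the exponential series of [a]. *)
Lemma expmx_second_order t i j : 0 <= t <= 1 ->
  `|expmx (t *: Q) i j - (i == j)%:R - t * Q i j| <= t ^+ 2 * expR a.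
Proof.
move=> /andP[t0 t1]; rewrite /expmx mxE -/(u t i j).
have cu : cvgn (series (u t i j)) by exact: expmx_cvg.
pose s n := series (u t i j) n - (i == j)%:R - t * Q i j.
have cs : s n @[n --> \oo] --> limn (series (u t i j)) - (i == j)%:R - t * Q i j.
  by apply: cvgB; [apply: cvgB => //; exact: cvg_cst|exact: cvg_cst].
have b n : `|s n.+2| <= t ^+ 2 * expR a.
  rewrite /s /series /= big_nat_recl // big_nat_recl //= !uE fact0 expr0 mul1r invr1 mul1r.
  rewrite mul1r !expr1 (expr0 Q) mxE.
  rewrite [X in `|X|](_ : _ = \sum_(0 <= k < n) u t i j k.+2); last by ring.
  rewrite (le_trans (ler_norm_sum _ _ _)) //.
  apply: (@le_trans _ _ (\sum_(0 <= k < n) t ^+ 2 * exp_coeff a k.+2)).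
    apply: ler_sum => k _; have f0 : 0 <= (k.+2`!%:R : R)^-1 by rewrite invr_ge0.
    have tk : 0 <= t ^+ k.+2 by rewrite exprn_ge0.
    rewrite uE normrM (ger0_norm f0) normrM (ger0_norm tk) /exp_coeff /=.
    rewrite [leRHS]mulrA [leRHS]mulrC; apply: ler_wpM2l => //.
    apply: ler_pM => //; rewrite -[k.+2]/(2 + k)%N exprD -[leRHS]mulr1.
    by apply: ler_wpM2l; rewrite ?exprn_ge0 // exprn_ile1.
  rewrite -mulr_sumr ler_wpM2l ?exprn_ge0 //.
  have h : series (exp_coeff a) n.+2 <= expR a.
    apply: nondecreasing_cvgn_le; last exact: is_cvg_series_exp_coeff.
    by apply: nondecreasing_series => k _ _; exact: exp_coeff_ge0.
  rewrite (le_trans _ h) // /series /= big_nat_recl // big_nat_recl //= addrA lerDr.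
  by rewrite addr_ge0 // exp_coeff_ge0.
apply: (cvgr_to_le (cvg_norm cs)); near=> n.
have n2 : (2 <= n)%N by near: n; exact: nbhs_infty_ge.
by rewrite -(subnK n2) addn2; exact: b.
Unshelve. all: by end_near. Qed.

Lemma expmx_small : exists K d0 : R, [/\ 0 < K, 0 < d0, d0 <= 1 & [/\
  forall t i j, 0 <= t <= d0 -> i != j -> expmx (t *: Q) i j <= K * t,
  forall t i j, 0 <= t <= d0 -> i != j -> Q i j = 0 -> expmx (t *: Q) i j <= K * t ^+ 2 &
  forall t j, 0 <= t <= d0 -> 2^-1 <= expmx (t *: Q) j j]].
Proof.
pose K := a + expR a.
have K0 : 0 < K by rewrite ltr_wpDl ?expR_gt0.
have Qa i j : `|Q i j| <= a by have := Qk_bound 1 i j; rewrite !expr1.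
(* Small enough for [K * t <= 1 / 2], which keeps the diagonal above one half; it is also at most 1,
   as the second-order bound needs. *)
exists K, (2 * K + 1)^-1; have d0 : 0 < (2 * K + 1)^-1 by rewrite invr_gt0; lra.
have d1 : (2 * K + 1)^-1 <= 1 by rewrite invf_le1; lra.
have E t : 0 <= t <= (2 * K + 1)^-1 -> t ^+ 2 <= t.
  by move=> /andP[t0 td]; rewrite expr2 ler_piMl // (le_trans td).
have B t i j : 0 <= t <= (2 * K + 1)^-1 -> `|expmx (t *: Q) i j - (i == j)%:R| <= K * t.
  move=> tt; have /andP[t0 td] := tt.
  have := expmx_second_order i j (t := t); rewrite t0 (le_trans td d1) => /(_ isT) h.
  rewrite (_ : _ - _ = (expmx (t *: Q) i j - (i == j)%:R - t * Q i j) + t * Q i j); last by ring.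
  rewrite (le_trans (ler_normD _ _)) // (le_trans (lerD h (lexx _))) //.
  rewrite normrM (ger0_norm t0) /K mulrDl addrC lerD //.
    by rewrite mulrC ler_wpM2r.
  by rewrite mulrC ler_wpM2l ?expR_ge0 // E.
split => //; split.
- move=> t i j tt /negbTE ij; have := B t i j tt; rewrite ij subr0 => h.
  exact: le_trans (ler_norm _) h.
- move=> t i j tt /negbTE ij Q0; have /andP[t0 td] := tt.
  have := expmx_second_order i j (t := t); rewrite t0 (le_trans td d1) => /(_ isT).
  rewrite ij Q0 mulr0 !subr0 => h; apply: (le_trans (ler_norm _)); apply: (le_trans h).
  by rewrite mulrC ler_wpM2r ?sqr_ge0 // /K lerDr.
- move=> t j tt; have := B t j j tt; rewrite eqxx -[true%:R]/(1 : R) => h.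
  have /andP[t0 td] := tt.
  have Kt : K * t <= 2^-1.
    apply: (@le_trans _ _ (K * (2 * K + 1)^-1)); first by rewrite ler_pM2l.
    by rewrite ler_pdivrMr; lra.
  have := ler_norm (- (expmx (t *: Q) j j - 1)); rewrite normrN => h2.
  have := le_trans h2 (le_trans h Kt); lra.
Qed.

End MatrixExponential.

(** * Order reversals of two independent chains in clock time *)

Section Crossing.
Context {R : realType} {m : nat} (ys : 'I_m -> R) (Q : 'M[R]_m).
Context {d : measure_display} {Omega : measurableType d}.
Variables (P : R * R -> probability Omega R) (X Y : R -> Omega -> R).
Hypothesis ys_incr : forall i j : 'I_m, (i < j)%N -> ys i < ys j.
Hypotheses (X_rc : right_continuous_paths X) (Y_rc : right_continuous_paths Y).
Hypothesis XY_markov : strong_markov ([set: R] `*` range ys) P (pair_process X Y).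
Hypothesis h2 : forall x y, range ys y -> markov_chain (P (x, y)) ys Q Y.
Hypothesis h5 : skip_free Q.
Variables (c C : R).
Hypotheses (c0 : 0 < c) (cC : c <= C) (cysC : forall i, c <= ys i <= C).

Notation pt t i j := (expmx (t *: Q) i j).

Lemma ys_lt i j : (ys i < ys j) = (i < j)%N.
Proof.
apply/idP/idP => [h|]; last exact: ys_incr.
rewrite ltnNge leq_eqVlt; apply/negP => /orP[/eqP/val_inj e|ji].
  by move: h; rewrite e ltxx.
by move: (lt_trans h (ys_incr ji)); rewrite ltxx.
Qed.

Lemma ys_inj : injective ys.
Proof.
move=> i j e; case: (ltngtP i j) => [||/val_inj //]; rewrite -ys_lt e ltxx //.
Qed.

Let c2 : 0 < c ^+ 2. Proof. exact: exprn_gt0. Qed.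
Let Yg w : gpath c C (Y ^~ w).
Proof. by apply: range_gpath cysC _ _ => t t0; [exact: (Y_range XY_markov)|exact: Y_rc]. Qed.
Let bY w := mclock_bilip c0 cC (Yg w).
Let gY : gproc c C Y.
Proof. by split=> [w|t t0]; [exact: Yg|exact: (Y_measurable XY_markov)]. Qed.

(* The inverse clock, and the chain read in clock time. *)
Definition iclock (u : R) (w : Omega) : R := pinv (mclock (Y ^~ w)) u.
Definition clocked (u : R) (w : Omega) : R := Y (iclock u w) w.

Let iclock_ge0 u w : 0 <= u -> 0 <= iclock u w.
Proof. exact: (pinv_mclock_ge0 c0 cC (Yg w)). Qed.

Let jclocked : jmeas clocked.
Proof. by apply: (jmeas_comp (gproc_jmeas gY) (jmeas_pinv_mclock c0 cC gY)) => t w; exact: iclock_ge0. Qed.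

Lemma clocked_measurable u : 0 <= u -> measurable_fun [set: Omega] (clocked u).
Proof. by move=> u0; exact: jmeas_section u0 jclocked. Qed.

Lemma iclock_stopping u : 0 <= u -> stopping_time (natural Y) (fun w => (iclock u w)%:E).
Proof.
move=> u0; split=> [w|t t0]; first by rewrite lee_fin iclock_ge0.
have sN : sigma_algebra [set: Omega] (natural Y t) by exact: natural_sigma_algebra.
have gs := stopped_gproc sN t0 Yg (@natural_mem _ _ _ _ _ Y ^~ t).
have mt : measurable_fun [set: g_sigma_algebraType (natural Y t)]
    (fun w => mclock (stopped t (Y ^~ w)) t : R).
  exact: jmeas_section t0 (jmeas_mclock c0 cC gs).
apply/(submeasurable_set _ sN).
have := mt measurableT _ (measurable_itv `[u, +oo[); rewrite setTI.
apply: set_transport => w /=; rewrite in_itv /= andbT lee_fin (pinv_le c2 (bY w)) //.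
rewrite (_ : mclock (stopped t (Y ^~ w)) t = mclock (Y ^~ w) t) //.
by apply: eq_clock => s /andP[_ st]; rewrite /stopped min_l.
Qed.

Lemma stopped_event (tau : Omega -> R) (V : R -> Omega -> R) D :
  stopping_time (natural Y) (fun w => (tau w)%:E) -> (forall w, 0 <= tau w) ->
  right_continuous_paths V -> adapted (natural Y) V -> measurable D ->
  stopped_sigma (natural Y) (fun w => (tau w)%:E) [set w | D (V (tau w) w)].
Proof.
move=> st t0 rV aV mD.
have K t : 0 <= t -> natural Y t ([set w | D (V (tau w) w)] `&` [set w | ((tau w)%:E <= t%:E)%E]).
  move=> tt; apply: (@stopped_value _ _ _ (natural Y) (fun w => (tau w)%:E) _ _ st V t D) => //.
    by move=> s _; exact: natural_sigma_algebra.
  by move=> a b _; exact: natural_mono.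
split => //; rewrite (_ : [set w | _] = \bigcup_n ([set w | D (V (tau w) w)] `&`
    [set w | ((tau w)%:E <= n%:R%:E)%E])).
  apply: bigcupT_measurable => n; apply: natural_measurable (K _ (ler0n _ _)).
  by move=> s s0; exact: (Y_measurable XY_markov).
apply/seteqP; split => w; last by move=> [n _ []].
move=> Dw; exists (Num.trunc (tau w)).+1 => //; split => //=; rewrite lee_fin.
exact: ltW (truncnS_gt _).
Qed.

Let aY : adapted (natural Y) Y.
Proof. by move=> t t0; exact: natural_mem (lexx t). Qed.

(** A chain in state [j] at [tau] is there again after a short delay [r], known at [tau], with
    conditional probability at least one half. At the price of a factor 2 an event at [tau] is moved
    to the more convenient time [tau + r]. *)
Lemma still_there (z : R * R) (tau : Omega -> R) (A : set Omega) (r : Omega -> R) (d0 : R) j :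
  range ys z.2 -> 0 < d0 -> (forall t j, 0 <= t <= d0 -> 2^-1 <= pt t j j) ->
  stopping_time (natural Y) (fun w => (tau w)%:E) -> (forall w, 0 <= tau w) ->
  (forall B, measurable B -> stopped_sigma (natural Y) (fun w => (tau w)%:E) (A `&` (r @^-1` B))) ->
  A `<=` [set w | Y (tau w) w = ys j] ->
  measurable_fun [set: Omega] r -> measurable_fun [set: Omega] tau ->
  (forall w, 0 <= r w) -> (forall w, A w -> r w <= d0 / 2) ->
  (P z A <= 2%:E * P z (A `&` [set w | Y (tau w + r w) w = ys j]))%E.
Proof.
move=> zr d00 Hpt st t0 sA Aj mr mt r0 rd.
have mA : measurable A.
  by have [+ _] := sA setT measurableT; rewrite preimage_setT setIT.
have meq (U : Omega -> R) v : measurable_fun [set: Omega] U -> measurable [set w | U w = v].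
  by move=> mU; have := mU measurableT [set v] (measurable_set1 _); rewrite setTI; apply.
have mV (f : Omega -> R) : measurable_fun [set: Omega] f -> (forall w, 0 <= f w) ->
    measurable_fun [set: Omega] (fun w => Y (tau w + f w) w).
  move=> mf f0; apply: (jmeas_random (gproc_jmeas gY)) => [|w]; last by rewrite addr_ge0.
  exact: measurable_funD.
have mgup n : measurable_fun [set: Omega] (fun w => gup n (r w)).
  apply: (measurableT_comp _ mr); apply: nondecreasing_measurable => // a b ab.
  by rewrite /gup ler_pM2r ?invr_gt0 // ler_nat ltnS; apply: le_truncn; rewrite ler_pM2r.
pose E n := A `&` [set w | Y (tau w + gup n (r w)) w = ys j].
have mE n : measurable (E n).
  by apply: measurableI => //; apply: meq; apply: mV => // w; exact: gup_ge0.
have cvE : P z (E n) @[n --> \oo] --> P z (A `&` [set w | Y (tau w + r w) w = ys j]).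
  apply: cvg_prob => //; first by apply: measurableI => //; apply: meq; exact: mV.
  apply: aeW => w; have [e e0 he] := proj1 (Yg w) _ (addr_ge0 (t0 w) (r0 w)).
  near=> n; suff h : Y (tau w + gup n (r w)) w = Y (tau w + r w) w.
    by rewrite /E /=; split => -[]; rewrite h.
  apply: he; rewrite lerD2l (ltW (gup_gt _ _)) /= -addrA ltrD2l.
  rewrite (le_lt_trans (gup_le _ (r0 w))) // ltrD2l.
  by near: n; exact: pow2_small.
have low : \forall n \near \oo, ((2^-1)%:E * P z A <= P z (E n))%E.
  near=> n.
  pose B k := [set s : R | Num.trunc (Num.max s 0 * 2 ^+ n) = k].
  have mB k : measurable (B k) by exact: measurable_trunc_eq.
  pose Ak k := A `&` (r @^-1` B k).
  have mAk k : measurable (Ak k) by have [] := sA (B k) (mB k).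
  have tk : trivIset setT Ak.
    apply/trivIsetP => i k _ _ ik; apply/seteqP; split => // w [[_ /= e1] [_ /= e2]].
    by move: ik; rewrite -e1 -e2 eqxx.
  have AE : A = \bigcup_k Ak k.
    apply/seteqP; split => w; last by move=> [k _ []].
    by move=> Aw; exists (Num.trunc (Num.max (r w) 0 * 2 ^+ n)).
  have EE : E n = \bigcup_k (Ak k `&` [set w | Y (tau w + k.+1%:R / 2 ^+ n) w = ys j]).
    apply/seteqP; split => w.
      move=> [Aw /= e]; exists (Num.trunc (Num.max (r w) 0 * 2 ^+ n)) => //.
      by split => //=; rewrite -e /gup max_l.
    by move=> [k _ [[Aw /= ek] /= e]]; split => //=; rewrite -e /gup -ek max_l.
  have k0 (k : nat) : 0 <= k.+1%:R / 2 ^+ n :> R by rewrite divr_ge0 // ltW.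
  have mEk k : measurable (Ak k `&` [set w | Y (tau w + k.+1%:R / 2 ^+ n) w = ys j]).
    by apply: measurableI => //; apply: meq; exact: mV.
  rewrite EE {1}AE measure_semi_bigcup //; last exact: bigcupT_measurable.
  rewrite measure_semi_bigcup //; last 2 first.
  - apply/trivIsetP => i k _ _ ik; apply/seteqP; split => // w [[[_ /= e1] _] [[_ /= e2] _]].
    by move: ik; rewrite -e1 -e2 eqxx.
  - exact: bigcupT_measurable.
  rewrite -nneseriesZl //.
  apply: lee_nneseries => [k _|k _]; first by rewrite mule_ge0 // lee_fin.
  have Akfin : Ak k `<=` [set w | ((tau w)%:E < +oo)%E] by move=> w _ /=; rewrite ltry.
  have Akj : Ak k `<=` [set w | Y (tau w) w = ys j] by move=> w [/Aj].
  have := strong_markov_chain XY_markov h2 j zr st (sA _ (mB k)) (k0 k) Akfin Akj.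
  rewrite -/(Ak k) /= => ->; rewrite muleC.
  (* The rounded delay exceeds [r] by less than [d0 / 2], and [r <= d0 / 2]; the other case is
     therefore empty. *)
  case: (leP (k.+1%:R / 2 ^+ n) d0) => kd.
    by apply: lee_wpmul2l; [exact: measure_ge0|rewrite lee_fin Hpt // k0].
  rewrite (_ : Ak k = set0) ?measure0 ?mul0e //; apply/seteqP; split => // w [Aw /= ek].
  have := rd w Aw; have h : gup n (r w) = k.+1%:R / 2 ^+ n by rewrite /gup -ek max_l.
  have := gup_le n (r0 w); rewrite h => h1 h3.
  have h4 : (2 ^+ n)^-1 < d0 / 2 by near: n; apply: pow2_small; rewrite divr_gt0.
  lra.
have h := cvge_ge low cvE.
rewrite -[X in (X <= _)%E]mul1e (_ : 1%E = (2%:E * (2^-1)%:E)%E); last by rewrite -EFinM divff.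
by rewrite -muleA; apply: lee_wpmul2l => //; exact: h.
Unshelve. all: by end_near. Qed.

(** An increment [h] of the clock takes a random time of at most [h / c ^+ 2]. Waiting for the rest
    of that span costs a factor 2 and ends at a deterministic delay after the stopping time
    [iclock u], where the strong Markov property gives the transition probability. *)
Lemma clocked_transition (z : R * R) (u h d0 : R) i j : range ys z.2 -> 0 <= u -> 0 <= h ->
  0 < d0 -> (forall t j, 0 <= t <= d0 -> 2^-1 <= pt t j j) -> h / c ^+ 2 <= d0 / 2 ->
  (P z [set w | clocked u w = ys i /\ clocked (u + h) w = ys j] <= (2 * pt (h / c ^+ 2) i j)%:E)%E.
Proof.
move=> zr u0 h0 d00 Hpt hd.
have uh0 : 0 <= u + h by rewrite addr_ge0.
have del0 : 0 <= h / c ^+ 2 by rewrite divr_ge0 // ltW.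
(* Chosen so that [tau + r] is [iclock u] plus the deterministic span [h / c ^+ 2]. *)
pose tau w := iclock (u + h) w; pose r w := h / c ^+ 2 - (tau w - iclock u w).
(* The part of [iclock u] known at time [s]; at [s = tau] it is [iclock u] itself. Functions of it
   are adapted and right continuous, so the state at [iclock u] and the delay [r] are known at
   [tau]. *)
pose W s w := Num.min (iclock u w) s.
have i0 w : 0 <= iclock u w by exact: iclock_ge0.
have itau w : iclock u w <= tau w.
  have -> : (iclock u w <= tau w) = (u <= mclock (Y ^~ w) (tau w)) := pinv_le c2 (bY w) u0 (iclock_ge0 w uh0).
  by rewrite (pinvK c2 (bY w) uh0) lerDl.
have r0 w : 0 <= r w.
  have /andP[+ _] := proj2 (bY w) _ _ (i0 w) (itau w).
  rewrite (pinvK c2 (bY w) u0) (pinvK c2 (bY w) uh0) -/(iclock u w) => h1.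
  by rewrite subr_ge0 ler_pdivlMr // mulrC; lra.
have aW : adapted (natural Y) W.
  move=> s s0; have := stopping_min (F := natural Y) _ _ (iclock_stopping u0) s0.
  rewrite (_ : (fun w => fine _) = W s).
    by apply=> *; [exact: natural_sigma_algebra|exact: natural_mono].
  by apply/funext => w; rewrite /W -EFin_min.
pose V s w := Y (W s w) w.
have W0 s w : 0 <= s -> 0 <= W s w by move=> s0; rewrite le_min i0.
have Wtau w : W (tau w) w = iclock u w by rewrite /W min_l.
have aV : adapted (natural Y) V.
  move=> s s0; have sN : sigma_algebra [set: Omega] (natural Y s) by exact: natural_sigma_algebra.
  have gs := stopped_gproc sN s0 Yg (@natural_mem _ _ _ _ _ Y ^~ s).
  apply/(submeasurableP _ sN).
  rewrite (_ : V s = fun w => stopped s (Y ^~ w) (W s w)).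
    apply: (jmeas_random (gproc_jmeas gs)) => [|w]; last exact: W0.
    by apply/(submeasurableP _ sN); exact: aW.
  by apply/funext => w; rewrite /stopped min_l // /W ge_min lexx orbT.
have rV : right_continuous_paths V.
  move=> w; apply: rconst_right_cvg => s s0.
  have [e e0 he] := proj1 (Yg w) _ (W0 s w s0); exists e => // s' /andP[ss' s'e].
  apply: he; rewrite /W; case: (leP (iclock u w) s) => a1; case: (leP (iclock u w) s') => a2; lra.
have aU : adapted (natural Y) (fun s w => h / c ^+ 2 - (s - W s w)).
  move=> s s0; have sN : sigma_algebra [set: Omega] (natural Y s) by exact: natural_sigma_algebra.
  apply/(submeasurableP _ sN); apply: measurable_funB => //; apply: measurable_funB => //.
  by apply/(submeasurableP _ sN); exact: aW.
have rU : right_continuous_paths (fun s w => h / c ^+ 2 - (s - W s w)).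
  move=> w s s0; apply: cvg_at_right_filter; apply: cvgB; first exact: cvg_cst.
  apply: cvgB; first exact: cvg_id.
  by apply: (@continuous_min _ _ (cst (iclock u w)) id) => //; exact: cvg_cst.
have stau : stopping_time (natural Y) (fun w => (tau w)%:E) by exact: iclock_stopping.
have t0 w : 0 <= tau w by exact: iclock_ge0.
have sgI A B : stopped_sigma (natural Y) (fun w => (tau w)%:E) A ->
    stopped_sigma (natural Y) (fun w => (tau w)%:E) B ->
    stopped_sigma (natural Y) (fun w => (tau w)%:E) (A `&` B).
  move=> [mA sA] [mB sB]; split; first exact: measurableI.
  move=> s s0; rewrite setIIl; have sN := natural_sigma_algebra Y s.
  exact: (sigma_algebra_I sN (sA s s0) (sB s s0)).
pose A := [set w | clocked u w = ys i] `&` [set w | clocked (u + h) w = ys j].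
have s1 : stopped_sigma (natural Y) (fun w => (tau w)%:E) A.
  apply: sgI; last exact: (stopped_event stau t0 Y_rc aY (measurable_set1 (ys j))).
  have := stopped_event stau t0 rV aV (measurable_set1 (ys i)).
  rewrite (_ : [set w | [set ys i] (V (tau w) w)] = [set w | clocked u w = ys i]) //.
  by apply/seteqP; split => w; rewrite /V /= Wtau.
have mtau v : 0 <= v -> measurable_fun [set: Omega] (iclock v).
  by move=> v0; exact: jmeas_section v0 (jmeas_pinv_mclock c0 cC gY).
have s2 B : measurable B -> stopped_sigma (natural Y) (fun w => (tau w)%:E) (A `&` (r @^-1` B)).
  move=> mB; apply: sgI => //; have := stopped_event stau t0 rU aU mB.
  rewrite (_ : [set w | B _] = r @^-1` B) //.
  by apply/seteqP; split => w; rewrite /= /r Wtau.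
have mr : measurable_fun [set: Omega] r.
  by apply: measurable_funB => //; apply: measurable_funB; exact: mtau.
have rd w : A w -> r w <= d0 / 2.
  by move=> _; apply: le_trans hd; rewrite /r; have := itau w; lra.
have := still_there zr d00 Hpt stau t0 s2 (fun w => @proj2 _ _) mr (mtau _ uh0) r0 rd.
move/le_trans; apply; rewrite EFinM; apply: lee_wpmul2l => //.
have stu := iclock_stopping u0.
have su := stopped_event stu i0 Y_rc aY (measurable_set1 (ys i)).
have := strong_markov_chain XY_markov h2 j zr stu su del0 (fun w _ => ltry _) (fun w => id).
move=> e; apply: (@le_trans _ _ (P z ([set w | [set ys i] (Y (iclock u w) w)] `&`
    [set w | Y (iclock u w + h / c ^+ 2) w = ys j]))).
  apply: le_measure; rewrite ?inE.
  - apply: measurableI; first by have [] := s1.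
    have mZ := jmeas_random (gproc_jmeas gY) (measurable_funD (mtau _ uh0) mr)
      (fun w => addr_ge0 (t0 w) (r0 w)).
    by have := mZ measurableT _ (measurable_set1 (ys j)); rewrite setTI.
  - apply: measurableI; first by have [] := su.
    have mZ := jmeas_random (gproc_jmeas gY) (measurable_funD (mtau _ u0) (@measurable_cst _ _ _ _ setT (h / c ^+ 2)))
      (fun w => addr_ge0 (i0 w) del0).
    by have := mZ measurableT _ (measurable_set1 (ys j)); rewrite setTI.
  - move=> w [[/= e1 _] e2]; split => //=; rewrite -[RHS]e2; congr (Y _ w).
    by rewrite /r; ring.
rewrite /= in e; rewrite e -[leRHS]mul1e; apply: lee_wpmul2r; last exact: probability_le1 (proj1 su).
by rewrite lee_fin (pt_ge0 XY_markov h2).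
Qed.

Let zt (z : R -> R) u : R := z (pinv (mclock z) u).

(** The infimum of the clock times at which [z] is above [y] is attained, by right constancy. At a
    fine level some grid point just after it shows [z] above [y]; the grid point preceding the first
    such one lies at or before the infimum, and since the paths have not merged the order there is
    strictly the original one. *)
Lemma crossing_seen (z y : R -> R) (l : R) (N : nat) : gpath c C z -> gpath c C y ->
  z 0 <= y 0 -> 0 <= l -> ~~ merged z y l -> y l < psi z y l -> mclock y l + 1 <= N%:R ->
  \forall n \near \oo, exists2 k, (k < N * 2 ^ n)%N &
    zt z (k%:R / 2 ^+ n) < zt y (k%:R / 2 ^+ n) /\
    zt y (k.+1%:R / 2 ^+ n) < zt z (k.+1%:R / 2 ^+ n).
Proof.
move=> gz gy zy l0 nm lpsi uN.
have bz := mclock_bilip c0 cC gz; have by_ := mclock_bilip c0 cC gy.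
have C2 : 0 < C ^+ 2 by rewrite exprn_gt0 // (lt_le_trans c0).
have u0 := mclock_ge0 c0 cC gy l0; set u := mclock y l in u0 uN *.
have zyl : zt y u = y l by rewrite /zt /u (pinvE c2 by_).
have zzl : zt z u = psi z y l by [].
have ne v : 0 <= v <= u -> zt z v != zt y v.
  move=> /andP[v0 vu]; apply: contra nm => /eqP e; apply/mergedP.
  have p0 := pinv_mclock_ge0 c0 cC gy v0.
  exists (pinv (mclock y) v); rewrite p0 (pinv_le c2 by_) // vu; split => //.
  by rewrite /psi (pinvK c2 by_).
have rz : rconst (zt z).
  by apply: (rconst_comp _ _ (pinv_bilip c2 C2 bz)); rewrite ?invr_gt0 //; exact: (proj1 gz).
have ry : rconst (zt y).
  by apply: (rconst_comp _ _ (pinv_bilip c2 C2 by_)); rewrite ?invr_gt0 //; exact: (proj1 gy).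
pose S := [set v | 0 <= v <= u /\ zt y v < zt z v].
have Su : S u by split; rewrite ?u0 ?lexx //= zyl zzl.
have lbS : has_lbound S by exists 0 => v [/andP[]].
have hS : has_inf S by split => //; exists u.
pose s := inf S.
have s0 : 0 <= s by apply: lb_le_inf; [exists u|move=> v [/andP[]]].
have su : s <= u by exact: ge_inf.
have [e e0 he] := rconst_pair rz ry s0.
have [v Sv vs] := inf_adherent e0 hS.
have sv : s <= v by exact: ge_inf.
have [ezs eys] : zt z v = zt z s /\ zt y v = zt y s by have /he[] : s <= v < s + e by rewrite sv.
have Ss : zt y s < zt z s by have [_] := Sv; rewrite ezs eys.
have z0y0 : zt z 0 < zt y 0.
  have p0 x : gpath c C x -> zt x 0 = x 0.
    by move=> gx; rewrite /zt -[X in pinv _ X](proj1 (mclock_bilip c0 cC gx)) (pinvE c2 (mclock_bilip c0 cC gx)).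
  have := ne 0; rewrite lexx u0 => /(_ isT); rewrite !p0 // => h.
  by rewrite lt_neqAle h.
near=> n.
have p2 : 0 < (2 : R) ^+ n by [].
have gs : gup n s < s + e.
  by rewrite (le_lt_trans (gup_le _ s0)) // ltrD2l; near: n; exact: pow2_small.
pose K := (Num.trunc (s * 2 ^+ n)).+1.
have KE : K%:R / 2 ^+ n = gup n s by [].
have PK : zt y (K%:R / 2 ^+ n) < zt z (K%:R / 2 ^+ n).
  by have /he[-> ->] : s <= gup n s < s + e by rewrite (ltW (gup_gt _ _)).
have ex : exists k, zt y (k%:R / 2 ^+ n) < zt z (k%:R / 2 ^+ n) by exists K.
have [k Pk mk] := ex_minnP ex.
have kK : (k <= K)%N by exact: mk.
case: k => [|k] in Pk mk kK *.
  by move: Pk; rewrite mul0r ltNge (ltW z0y0).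
have ks : k%:R / 2 ^+ n <= s.
  apply: le_trans (gdn_le n s0); rewrite /gdn ler_pM2r ?invr_gt0 // ler_nat.
  by rewrite /K ltnS in kK.
exists k; last first.
  split => //; rewrite lt_neqAle ne; last by rewrite divr_ge0 // ?(ltW p2) //= (le_trans ks).
  by rewrite leNgt; apply/negP => /mk; rewrite ltnn.
rewrite -(ltr_nat R) natrM natrX -ltr_pdivrMr //; apply: le_lt_trans ks _.
by apply: le_lt_trans su _; lra.
Unshelve. all: by end_near. Qed.

Lemma prob_finite_union {dO : measure_display} {O : measurableType dO}
    (Pr : probability O R) {I : Type} (r : seq I) (A : I -> set O) (b : R) :
  (forall i, measurable (A i)) -> (forall i, Pr (A i) <= b%:E)%E ->
  (Pr (\big[setU/set0]_(i <- r) A i) <= ((size r)%:R * b)%:E)%E.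
Proof.
move=> mA bA; elim: r => [|i r IH]; first by rewrite big_nil measure0 mul0r.
have mr : measurable (\big[setU/set0]_(i <- r) A i) by exact: bigsetU_measurable.
rewrite big_cons (le_trans (measureU2 _ (mA i) mr)) //= -natr1 mulrDl mul1r addrC EFinD.
exact: leeD.
Qed.

(** A reversal of the order within one grid cell has probability of order [4 ^ - n], because the
    chain is skip-free. There are a multiple of [N * 2 ^ n] cells up to clock time [N], so the
    chance of a reversal seen at level [n] tends to 0; yet a crossing would be seen at all large
    levels. *)
Lemma never_crosses (z1 z2 : R * R) : range ys z1.2 -> range ys z2.2 -> z2.2 <= z1.2 ->
  {ae (P z1 \x P z2)%E, forall w, forall l, 0 <= l -> ~~ merged (Y ^~ w.2) (Y ^~ w.1) l ->
     psi (Y ^~ w.2) (Y ^~ w.1) l <= Y l w.1}.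
Proof.
move=> zr1 zr2 z21.
have [K [d0 [K0 d00 d01 [B1 B2 B3]]]] := expmx_small Q.
pose St u i := [set w | clocked u w = ys i].
have mSt u i : 0 <= u -> measurable (St u i).
  by move=> u0; have := clocked_measurable u0 measurableT (measurable_set1 (ys i)); rewrite setTI.
pose D n k (q : 'I_m * 'I_m * ('I_m * 'I_m)) : set (Omega * Omega) :=
  if ((q.2.1 < q.1.1) && (q.1.2 < q.2.2))%N then
  (St (k%:R / 2 ^+ n) q.1.1 `&` St (k.+1%:R / 2 ^+ n) q.1.2) `*`
  (St (k%:R / 2 ^+ n) q.2.1 `&` St (k.+1%:R / 2 ^+ n) q.2.2) else set0.
have kn0 (n k : nat) : 0 <= (k%:R / 2 ^+ n : R) by rewrite divr_ge0 // ltW.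
have mD n k q : measurable (D n k q).
  by rewrite /D; case: ifP => // _; apply: measurableX; apply: measurableI; exact: mSt.
(* With step [x = 2 ^ - n / c ^ 2], the term [2 K] covers a jump over two states or more and
   [4 K ^ 2] two simultaneous jumps; [c ^ 4] comes from [x ^ 2]. *)
pose K2 : R := (2 * K + 4 * K ^+ 2) / c ^+ 4.
have bD : \forall n \near \oo, forall k q, ((P z1 \x P z2)%E (D n k q) <= (K2 / 4 ^+ n)%:E)%E.
  near=> n; have hd : (2 ^+ n)^-1 / c ^+ 2 <= d0 / 2.
    by rewrite ler_pdivrMr // ltW //; near: n; apply: pow2_small; rewrite !mulr_gt0 // invr_gt0.
  move=> k [[i i'] [j j']]; rewrite /D /=.
  have K20 : 0 <= K2 / 4 ^+ n by rewrite !divr_ge0 // ?exprn_ge0 // ?(ltW c0) // addr_ge0 // mulr_ge0 // ?exprn_ge0 // ltW.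
  case: ifPn => [/andP[ji ij']|_]; last by rewrite measure0 lee_fin.
  pose h : R := (2 ^+ n)^-1; have h0 : 0 <= h by rewrite invr_ge0 ltW.
  have hd0 : 0 <= h / c ^+ 2 <= d0 by rewrite divr_ge0 // ?(ltW c2) // (le_trans hd) // ler_pdivrMr //; lra.
  have kS : k.+1%:R / 2 ^+ n = k%:R / 2 ^+ n + h :> R by rewrite -natr1 mulrDl mul1r.
  have tr z a b : range ys z.2 ->
      (P z (St (k%:R / 2 ^+ n)%R a `&` St (k.+1%:R / 2 ^+ n)%R b) <= (2 * pt (h / c ^+ 2) a b)%:E)%E.
    by move=> zr; rewrite kS; exact: (clocked_transition a b zr (kn0 n k) h0 d00 B3 hd).
  have mm a b : measurable (St (k%:R / 2 ^+ n) a `&` St (k.+1%:R / 2 ^+ n) b).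
    by apply: measurableI; exact: mSt.
  pose p1 := P z1 (St (k%:R / 2 ^+ n) i `&` St (k.+1%:R / 2 ^+ n) i').
  pose p2 := P z2 (St (k%:R / 2 ^+ n) j `&` St (k.+1%:R / 2 ^+ n) j').
  have -> : (P z1 \x P z2)%E ((St (k%:R / 2 ^+ n) i `&` St (k.+1%:R / 2 ^+ n) i') `*`
      (St (k%:R / 2 ^+ n) j `&` St (k.+1%:R / 2 ^+ n) j')) = (p1 * p2)%E.
    exact: product_measure1E (mm _ _) (mm _ _).
  have [p10 p20] : (0 <= p1 /\ 0 <= p2)%E by split; exact: measure_ge0.
  have [p11 p21] : (p1 <= 1 /\ p2 <= 1)%E by split; apply: probability_le1; exact: mm.
  pose x := h / c ^+ 2; have x0 : 0 <= x by case/andP: hd0.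
  have x2 : x ^+ 2 = (4 ^+ n)^-1 / c ^+ 4.
    rewrite /x expr_div_n -exprM; congr (_ / _); rewrite /h exprVn -exprM mulnC exprM.
    by congr ((_ ^+ n)^-1); rewrite -natrX.
  have K2x : K2 / 4 ^+ n = (2 * K + 4 * K ^+ 2) * x ^+ 2 by rewrite x2 /K2; ring.
  have one p p' a b : (0 <= p)%E -> (0 <= p')%E -> (p' <= 1)%E -> (p <= (2 * pt x a b)%:E)%E -> a != b -> Q a b = 0 ->
      (p * p' <= (K2 / 4 ^+ n)%:E)%E.
    move=> pp0 pp'0 pp' hp ab Qab; apply: (@le_trans _ _ (p * 1)%E); first exact: lee_wpmul2l.
    rewrite mule1 (le_trans hp) // lee_fin K2x.
    have := B2 x a b hd0 ab Qab => hb.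
    have : 0 <= K ^+ 2 * x ^+ 2 by rewrite mulr_ge0 // sqr_ge0.
    by rewrite mulrDl => ?; nra.
  (* If one path keeps its state, the other passes over that state and so moves by at least two: its
     rate vanishes and its probability is of second order. If both move, two first-order
     probabilities multiply. *)
  case: (eqVneq i i') => [ii|ii'].
    rewrite muleC; apply: (one _ _ j j') => //; first exact: tr.
      by rewrite neq_ltn (ltn_trans ji) // ii.
    by apply: h5; rewrite (leq_ltn_trans ji) // ii.
  case: (eqVneq j j') => [jj|jj'].
    apply: (one _ _ i i') => //; first exact: tr.
    by apply: h5; rewrite (leq_ltn_trans ij') ?orbT // -jj.
  apply: (@le_trans _ _ ((2 * K * x)%:E * (2 * K * x)%:E)%E).
    apply: lee_pmul => //; (apply: le_trans; first exact: tr); rewrite lee_fin -mulrA ler_pM2l //; exact: B1.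
  rewrite -EFinM lee_fin K2x.
  by have : 0 <= K * x ^+ 2; [rewrite mulr_ge0 ?sqr_ge0 // ltW|nra].
pose q5 := index_enum (('I_m * 'I_m * ('I_m * 'I_m))%type : finType).
pose E N n : set (Omega * Omega) := \big[setU/set0]_(p <- [seq (k, q) | k <- iota 0 (N * 2 ^ n), q <- q5]) D n p.1 p.2.
have mE N n : measurable (E N n) by apply: bigsetU_measurable => p _; exact: mD.
have bE N : \forall n \near \oo, ((P z1 \x P z2)%E (E N n) <= ((N%:R * (size q5)%:R * K2) / 2 ^+ n)%:E)%E.
  near=> n; apply: le_trans.
    apply: (@prob_finite_union _ _ _ _ _ (fun p => D n p.1 p.2) (K2 / 4 ^+ n)) => p; first exact: mD.
    by move: p.1 p.2; near: n; apply: filterS bD => n h a b; exact: h.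
  rewrite lee_fin size_allpairs size_iota !natrM natrX.
  rewrite (_ : 4 = 2 * 2 :> R); last by ring.
  rewrite exprMn le_eqVlt; apply/orP; left; apply/eqP; field.
  by rewrite expf_neq0.
have hL N n0 : measurable (\bigcap_(n in [set n | (n0 <= n)%N]) E N n).
  by apply: bigcap_measurable => //; exists n0 => /=.
have Z N n0 : (P z1 \x P z2)%E (\bigcap_(n in [set n | (n0 <= n)%N]) E N n) = 0%E.
  apply/eqP; rewrite eq_le measure_ge0 andbT; apply/lee_addgt0Pr => e e0; rewrite add0e.
  have NK : 0 <= N%:R * (size q5)%:R * K2.
    by rewrite !mulr_ge0 // ?invr_ge0 ?exprn_ge0 // ?(ltW c0) // addr_ge0 // mulr_ge0 // ?exprn_ge0 // ltW.
  have [n n0n hn] : exists2 n, (n0 <= n)%N & ((P z1 \x P z2)%E (E N n) <= e%:E)%E.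
    near \oo => n; exists n; first by near: n; exact: nbhs_infty_ge.
    apply: (@le_trans _ _ ((N%:R * (size q5)%:R * K2) / 2 ^+ n)%:E).
      by near: n; exact: bE.
    rewrite lee_fin; have : ((2 : R) ^+ n)^-1 < e / (N%:R * (size q5)%:R * K2 + 1).
      by near: n; apply: pow2_small; rewrite divr_gt0 //; lra.
    rewrite ltr_pdivlMr; last lra.
    have : 0 < ((2 : R) ^+ n)^-1 by [].
    by nra.
  by apply: le_trans hn; apply: le_measure; rewrite ?inE //; exact: bigcap_inf.
have st zz : range ys zz.2 -> P zz (~` [set w | Y 0 w = zz.2]) = 0%E.
  case: zz => a b /= [i _ <-]; rewrite probability_setC; last exact: (Y_eq_measurable XY_markov).
  by rewrite (start_at XY_markov) subee.
have Y0m v : measurable [set w | Y 0 w = v] by exact: (Y_eq_measurable XY_markov).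
have H1 : {ae (P z1 \x P z2)%E, forall w, Y 0 w.1 = z1.2}.
  exists ((~` [set w | Y 0 w = z1.2]) `*` setT); split => [||[w1 w2] /= h]; last by split.
    by apply: measurableX => //; exact: measurableC.
  have -> : (P z1 \x P z2)%E ((~` [set w | Y 0 w = z1.2]) `*` setT) =
      (P z1 (~` [set w | Y 0 w = z1.2]) * P z2 setT)%E.
    exact: product_measure1E (measurableC (Y0m _)) measurableT.
  by rewrite st ?mul0e.
have H2 : {ae (P z1 \x P z2)%E, forall w, Y 0 w.2 = z2.2}.
  exists (setT `*` (~` [set w | Y 0 w = z2.2])); split => [||[w1 w2] /= h]; last by split.
    by apply: measurableX => //; exact: measurableC.
  have -> : (P z1 \x P z2)%E (setT `*` (~` [set w | Y 0 w = z2.2])) =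
      (P z1 setT * P z2 (~` [set w | Y 0 w = z2.2]))%E.
    exact: product_measure1E measurableT (measurableC (Y0m _)).
  by rewrite st ?mule0.
have H3 : {ae (P z1 \x P z2)%E, forall w, forall N n0, ~ (\bigcap_(n in [set n | (n0 <= n)%N]) E N n) w}.
  apply: ae_foralln => N; apply: ae_foralln => n0.
  by exists (\bigcap_(n in [set n | (n0 <= n)%N]) E N n); split => [||w /= /contrapT] //; exact: Z.
apply: filterS3 H1 H2 H3 => -[w1 w2] /= e1 e2 H l l0 nm.
rewrite leNgt; apply/negP => lpsi.
have y00 : Y 0 w2 <= Y 0 w1 by rewrite e1 e2.
have [N hN] : exists N : nat, mclock (Y ^~ w1) l + 1 <= N%:R.
  by exists (Num.trunc (mclock (Y ^~ w1) l + 1)).+1; exact: ltW (truncnS_gt _).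
have [n0 _ h] := crossing_seen (Yg w2) (Yg w1) y00 l0 nm lpsi hN.
apply: (H N n0) => n /= n0n; have [k kN [h1 h2']] := h n n0n.
have yst u w : 0 <= u -> exists i, Y u w = ys i.
  by move=> u0; have [i _ <-] := Y_range XY_markov w u0; exists i.
have [i ei] := yst _ w2 (iclock_ge0 w2 (kn0 n k)); have [i' ei'] := yst _ w2 (iclock_ge0 w2 (kn0 n k.+1)).
have [j ej] := yst _ w1 (iclock_ge0 w1 (kn0 n k)); have [j' ej'] := yst _ w1 (iclock_ge0 w1 (kn0 n k.+1)).
have dw : D n k ((j, j'), (i, i')) (w1, w2).
  rewrite /D /= -!ys_lt -ei -ei' -ej -ej' {1}h1 {1}h2' /=; split; split => //=.
rewrite /E -bigcup_seq; exists (k, ((j, j'), (i, i'))) => //=.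
by apply/allpairsP; exists (k, ((j, j'), (i, i'))); rewrite mem_iota /= kN mem_index_enum.
Unshelve. all: by end_near. Qed.

End Crossing.

(** * Pathwise integrals of step functions *)

Section StepFunctions.
Context {R : realType}.

(** Compactness of [[a, b]] in the form of an induction, convenient for paths whose jump times are
    not listed. *)
Lemma real_induction (Q : R -> Prop) (a b : R) : a <= b -> Q a ->
  (forall t, a <= t < b -> Q t -> exists u, t < u <= b /\ Q u) ->
  (forall t, a < t <= b -> (forall s, s < t -> exists v, [/\ s < v, a <= v <= t & Q v]) -> Q t) ->
  Q b.
Proof.
move=> ab Qa Qr Ql; pose S := [set v | a <= v <= b /\ Q v].
have Sa : S a by split; rewrite ?lexx.
have ubS : has_ubound S by exists b => v [/andP[]].
have hS : has_sup S by split => //; exists a.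
pose p := sup S.
have ap : a <= p by exact: ub_le_sup.
have pb : p <= b by apply: ge_sup; [exists a|move=> v [/andP[]]].
have Qp : Q p.
  move: ap; rewrite le_eqVlt => /predU1P[<- //|ap]; apply: Ql => [|s sp]; first by rewrite ap.
  have ps : 0 < p - s by rewrite subr_gt0.
  have [v [/andP[av vb] Qv] sv] := sup_adherent ps hS.
  exists v; split => //; first by move: sv; rewrite subKr.
  by rewrite av; apply: ub_le_sup => //; split => //; rewrite av.
case: (ltP p b) => [plb|bp]; last by rewrite (_ : b = p) //; apply: le_anti; rewrite pb bp.
have [u [/andP[pu ub] Qu]] := Qr p (introT andP (conj ap plb)) Qp.
have : u <= p by apply: ub_le_sup => //; split => //; rewrite ub (le_trans ap) // ltW.
by rewrite leNgt pu.
Qed.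

Definition lconst {T : Type} (y : R -> T) : Prop :=
  forall t, 0 < t -> exists2 s, 0 <= s < t & forall r, s <= r < t -> y r = y s.

(** Constancy on both sides of each point amounts to finitely many jumps on bounded intervals,
    without naming the jumps. *)
Definition stepwise {T : Type} (y : R -> T) : Prop := rconst y /\ lconst y.

(** Takes the place of a sum over jumps: a property of intervals that can be concatenated need only
    be checked where the path is constant. *)
Lemma stepwise_ind {T : Type} (y : R -> T) (Pr : R -> R -> Prop) : stepwise y ->
  (forall s u t, 0 <= s -> s <= u -> u <= t -> Pr s u -> Pr u t -> Pr s t) ->
  (forall s t, 0 <= s -> s <= t -> (forall u, s <= u < t -> y u = y s) -> Pr s t) ->
  forall s t, 0 <= s -> s <= t -> Pr s t.
Proof.
move=> [ry ly] Pcat Pcst s t s0 st; apply: (real_induction st).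
- by apply: Pcst => // u /andP[su /(le_lt_trans su)]; rewrite ltxx.
- move=> u /andP[su ut] Pu; have u0 := le_trans s0 su.
  have [e e0 he] := ry u u0; exists (Num.min t (u + e)).
  have uv : u < Num.min t (u + e) by rewrite lt_min ut ltrDl.
  rewrite uv ge_min lexx; split => //; apply: Pcat Pu _ => //; first exact: ltW.
  apply: Pcst => //; first exact: ltW.
  by move=> v /andP[uv' vm]; apply: he; rewrite uv' (lt_le_trans vm) // ge_min lexx orbT.
- move=> u /andP[su ut] H; have u0 := le_lt_trans s0 su.
  have [r /andP[r0 ru] hr] := ly u u0.
  have [v [rv /andP[sv vu] Pv]] := H r ru; have v0 := le_trans s0 sv.
  move: vu; rewrite le_eqVlt => /predU1P[<- //|vu].
  apply: (Pcat s v u) => //; first exact: ltW.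
  apply: Pcst => //; first exact: ltW.
  move=> w /andP[vw wu]; rewrite hr; last by rewrite (le_trans (ltW rv)).
  by rewrite (hr v) // (ltW rv).
Qed.

Lemma stepwise_pair {T U : Type} (y : R -> T) (z : R -> U) :
  stepwise y -> stepwise z -> stepwise (fun t => (y t, z t)).
Proof.
move=> [ry ly] [rz lz]; split; first exact: rconst_pair.
move=> t t0; have [s /andP[s0 st] hs] := ly t t0; have [r /andP[r0 rt] hr] := lz t t0.
exists (Num.max s r); first by rewrite le_max s0 gt_max st.
move=> v /andP[]; rewrite ge_max => /andP[sv rv] vt.
have sm : s <= Num.max s r by rewrite le_max lexx.
have rm : r <= Num.max s r by rewrite le_max lexx orbT.
have mt : Num.max s r < t by rewrite gt_max st.
by rewrite hs ?sv // hr ?rv // (hs (Num.max s r)) ?sm // (hr (Num.max s r)) // rm.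
Qed.

Lemma stepwise_fun {T U : Type} (h : T -> U) (y : R -> T) :
  stepwise y -> stepwise (fun t => h (y t)).
Proof.
move=> [ry ly]; split; first exact: rconst_fun.
by move=> t t0; have [s s0 hs] := ly t t0; exists s => // r /hs ->.
Qed.

Lemma stepwise_comp {T : Type} (c C : R) (F : R -> R) (y : R -> T) : 0 < c -> 0 < C ->
  bilip c C F -> stepwise y -> stepwise (fun t => y (F t)).
Proof.
move=> c0 C0 bF [ry ly]; split; first exact: rconst_comp bF ry.
move=> t t0; have Ft : 0 < F t by rewrite -(proj1 bF) (bilip_lt c0 bF) // ltW.
have [s /andP[s0 st] hs] := ly _ Ft.
have [p0 e] := pinv_spec c0 bF s0.
exists (pinv F s); first by rewrite p0 -(bilip_lt c0 bF) ?e // ltW.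
move=> r /andP[sr rt]; rewrite e; apply: hs; have r0 := le_trans p0 sr.
by rewrite -{1}e (bilip_le c0 bF) // sr (bilip_lt c0 bF) // ltW.
Qed.

Lemma within_near (b : R -> R) (p e : R) : {within `[0, +oo[, continuous b} -> 0 <= p -> 0 < e ->
  exists2 r, 0 < r & forall x, 0 <= x -> `|x - p| < r -> `|b x - b p| <= e.
Proof.
move=> /subspace_continuousP cb p0 e0.
have /cb /cvgrPdist_le /(_ e e0) : (`[0, +oo[%classic : set R) p by rewrite /= in_itv /= p0.
rewrite near_withinE => -[r /= r0 hr]; exists r => // x x0 xp.
by rewrite distrC; apply: hr; rewrite /= ?in_itv /= ?x0 // distrC.
Qed.

Lemma near_within (b : R -> R) : (forall p e, 0 <= p -> 0 < e ->
  exists2 r, 0 < r & forall x, 0 <= x -> `|x - p| < r -> `|b x - b p| <= e) ->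
  {within `[0, +oo[, continuous b}.
Proof.
move=> H; apply/subspace_continuousP => p; rewrite /= in_itv /= andbT => p0.
apply/cvgrPdist_le => e e0; have [r r0 hr] := H p e p0 e0.
rewrite near_withinE; exists r => //= x xp; rewrite in_itv /= andbT => x0.
by rewrite distrC; apply: hr => //; rewrite distrC.
Qed.

(** Uniform continuity on [[0, N]], by real induction: a modulus on [[0, v]] extends past [p] if
    local closeness around [p] overlaps it. *)
Lemma uniform_modulus (b : R -> R) (N e : R) : {within `[0, +oo[, continuous b} -> 0 <= N -> 0 < e ->
  exists2 d, 0 < d & forall x y, 0 <= x <= N -> 0 <= y <= N -> `|x - y| <= d -> `|b x - b y| <= e.
Proof.
move=> cb N0 e0; have e2 : 0 < e / 2 by rewrite divr_gt0.
pose Q v := exists2 d, 0 < d & forall x y, 0 <= x <= v -> 0 <= y <= v ->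
    `|x - y| <= d -> `|b x - b y| <= e.
have step p r v : 0 < r -> 0 <= p -> (forall x, 0 <= x -> `|x - p| < r -> `|b x - b p| <= e / 2) ->
    p - r < v -> Q v -> forall u, u < p + r -> Q u.
  move=> r0 p0 hr pv [d d0 hd] u up.
  exists (Num.min d ((v - (p - r)) / 2)); first by rewrite lt_min d0 divr_gt0 // subr_gt0.
  move=> x y; wlog xy : x y / x <= y => [W hx hy h|].
    case: (leP x y) => [xy|/ltW yx]; first exact: W.
    by rewrite distrC; apply: W => //; rewrite distrC.
  move=> /andP[x0 xu] /andP[y0 yu]; rewrite le_min => /andP[h1 h2].
  case: (leP y v) => yv; first by apply: hd => //; rewrite ?x0 ?y0 //= (le_trans xy).
  have h3 : y - x <= (v - (p - r)) / 2 by rewrite (le_trans _ h2) // distrC ler_norm.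
  have hx : `|x - p| < r by rewrite ltr_norml; lra.
  have hy : `|y - p| < r by rewrite ltr_norml; lra.
  have -> : b x - b y = (b x - b p) - (b y - b p) by ring.
  have := hr x x0 hx; have := hr y y0 hy => k1 k2.
  by rewrite (le_trans (ler_normB _ _)) //; lra.
suff : Q N by [].
apply: (@real_induction Q 0 N) => //.
- by exists 1 => // x y ? ? _; rewrite (_ : x = y) ?subrr ?normr0 ?ltW //; lra.
- move=> t /andP[t0 tN] Qt; have [r r0 hr] := within_near cb t0 e2.
  exists (Num.min N (t + r / 2)); rewrite lt_min tN ltrDl divr_gt0 // ge_min lexx; split => //.
  apply: (step t r t r0 t0 hr) => //; first by lra.
  by rewrite gt_min; apply/orP; right; lra.
- move=> t /andP[t0 tN] H; have [r r0 hr] := within_near cb (ltW t0) e2.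
  have [v [v1 /andP[v2 v3] Qv]] := H (t - r) ltac:(lra).
  by apply: (step t r v r0 (ltW t0) hr) => //; lra.
Qed.

(* Riemann sum of [H db] over the dyadic grid of level [j], up to time [t] < [N]. *)
Definition rsum (j N : nat) (H b : R -> R) (t : R) : R :=
  \sum_(i < N * 2 ^ j) H (i%:R / 2 ^+ j) *
    (b (Num.min t (i.+1%:R / 2 ^+ j)) - b (Num.min t (i%:R / 2 ^+ j))).

Lemma grid_le (j i k : nat) : (i%:R / 2 ^+ j <= k%:R / 2 ^+ j :> R) = (i <= k)%N.
Proof. by rewrite ler_pM2r ?invr_gt0 // ler_nat. Qed.

Lemma grid_end (j N : nat) : ((N * 2 ^ j)%:R / 2 ^+ j = N%:R :> R).
Proof. by rewrite natrM natrX mulfK // gt_eqF. Qed.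

Lemma rsum0 j N H b : rsum j N H b 0 = 0.
Proof. by rewrite /rsum big1 // => i _; rewrite !min_l ?divr_ge0 // subrr mulr0. Qed.

Lemma rsum_widen j N N' H b t : t <= N%:R -> (N <= N')%N -> rsum j N' H b t = rsum j N H b t.
Proof.
move=> tN NN'; rewrite /rsum -!(big_mkord predT (fun i => H (i%:R / 2 ^+ j) *
    (b (Num.min t (i.+1%:R / 2 ^+ j)) - b (Num.min t (i%:R / 2 ^+ j))))).
rewrite (big_cat_nat (n := N * 2 ^ j)) //= ?leq_mul // [X in _ + X]big1_seq ?addr0 // => i.
rewrite mem_index_iota => /andP[_ /andP[Ni _]]; rewrite !min_l ?subrr ?mulr0 //.
  by rewrite (le_trans tN) // -(grid_end j) grid_le.
by rewrite (le_trans tN) // -(grid_end j) grid_le // (leq_trans Ni).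
Qed.

(** On an interval where the integrand is constant, only the cell straddling [s] can contribute an
    error, since its left endpoint precedes [s]. *)
Lemma rsum_const j N (H b : R -> R) (K e s t : R) : 0 <= s -> s <= t -> t <= N%:R ->
  (forall r, s <= r < t -> H r = H s) -> (forall r, 0 <= r -> `|H r| <= K) ->
  (forall x y, 0 <= x <= N%:R -> 0 <= y <= N%:R -> `|x - y| <= (2 ^+ j)^-1 -> `|b x - b y| <= e) ->
  forall u, s <= u <= t ->
  `|rsum j N H b u - rsum j N H b s - H s * (b u - b s)| <= 2 * K * e.
Proof.
move=> s0 st tN Hc HK be u /andP[su ut].
have u0 := le_trans s0 su; have uN := le_trans ut tN.
pose x i : R := i%:R / 2 ^+ j.
have x0 i : 0 <= x i by rewrite divr_ge0.
have xS i : x i.+1 = x i + (2 ^+ j)^-1 by rewrite /x -natr1 mulrDl mul1r.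
have tel r : 0 <= r -> r <= N%:R -> \sum_(i < N * 2 ^ j) (b (Num.min r (x i.+1)) - b (Num.min r (x i))) = b r - b 0.
  move=> r0 rN; rewrite -(big_mkord predT (fun i => b (Num.min r (x i.+1)) - b (Num.min r (x i)))).
  rewrite (telescope_sumr (fun i => b (Num.min r (x i)))) // {1}/x grid_end min_l //.
  by rewrite /x mul0r min_r.
pose D i : R := b (Num.min u (x i.+1)) - b (Num.min u (x i)) - (b (Num.min s (x i.+1)) - b (Num.min s (x i))).
have E : rsum j N H b u - rsum j N H b s - H s * (b u - b s) = \sum_(i < N * 2 ^ j) (H (x i) - H s) * D i.
  rewrite (_ : b u - b s = \sum_(i < N * 2 ^ j) D i); last first.
    by rewrite /D sumrB tel // tel // ?(le_trans su) //; ring.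
  rewrite /rsum mulr_sumr -!sumrB; apply: eq_bigr => i _; rewrite -/(x i) -/(x i.+1) /D.
  by ring.
have K0 : 0 <= K by exact: le_trans (HK 0 (lexx _)).
have e0 : 0 <= e.
  apply: le_trans (be 0 0 _ _ _) => //; rewrite ?lexx ?subrr ?normr0 ?invr_ge0 //.
    exact: le_trans u0 uN.
  exact: le_trans u0 uN.
(* The one cell that starts at or before [s] and ends after it. *)
pose i0 := Num.trunc (s * 2 ^+ j).
have Z i : i != i0 -> (H (x i) - H s) * D i = 0.
  move=> ii0; case: (leP s (x i)) => sx.
    case: (ltP (x i) t) => xt; first by rewrite Hc ?sx // subrr mul0r.
    have xi1 : x i <= x i.+1 by rewrite xS lerDl invr_ge0.
    by rewrite /D !min_l ?subrr ?mulr0 //; lra.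
  have xs : x i.+1 <= s.
    move: ii0; rewrite neq_ltn => /orP[ii0|i0i].
      by apply: le_trans (gdn_le j s0); rewrite grid_le.
    have := gup_gt j s; rewrite /gup -/i0 => h.
    by have := lt_le_trans h (_ : _ <= x i); rewrite grid_le ltNge (ltW sx) => /(_ i0i).
  have xs' : x i <= s by exact: ltW.
  by rewrite /D !min_r ?subrr ?mulr0 //; lra.
have T i : i = i0 -> `|(H (x i) - H s) * D i| <= 2 * K * e.
  move=> ei; have xis : x i <= s by rewrite ei; exact: gdn_le.
  have six : s < x i.+1 by rewrite ei; exact: gup_gt.
  rewrite /D (min_r (xis)) (min_l (ltW six)) (min_r (le_trans xis su)).
  rewrite (_ : _ - _ - _ = b (Num.min u (x i.+1)) - b s); last by ring.
  rewrite normrM ler_pM //.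
    by rewrite (le_trans (ler_normB _ _)) // (_ : 2 * K = K + K); [rewrite lerD ?HK|ring].
  have h : s <= Num.min u (x i.+1) by rewrite le_min su ltW.
  apply: be; first by rewrite (le_trans s0 h) ge_min uN.
    by rewrite s0 (le_trans su).
  rewrite ger0_norm ?subr_ge0 // lerBlDr ge_min; apply/orP; right.
  by rewrite xS; lra.
rewrite E; case: (ltnP i0 (N * 2 ^ j)) => i0N.
  rewrite (bigD1 (Ordinal i0N)) //= big1 ?addr0 ?T // => i /eqP ii; apply: Z.
  by apply/eqP => e'; apply: ii; exact: val_inj.
rewrite big1 ?normr0 ?mulr_ge0 // => i _; apply: Z.
by rewrite neq_ltn (leq_trans (ltn_ord i)).
Qed.

Section Convergence.
Context {T : Type}.
Variables (y : R -> T) (H b : R -> R) (K : R).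
Hypotheses (sy : stepwise y) (cb : {within `[0, +oo[, continuous b}).
Hypothesis HK : forall r, 0 <= r -> `|H r| <= K.
Hypothesis Hy : forall s t, 0 <= s -> s <= t -> (forall u, s <= u < t -> y u = y s) ->
  forall u, s <= u < t -> H u = H s.

Let small (N : nat) (e : R) : 0 < e -> \forall j \near \oo,
  forall s t, 0 <= s -> s <= t -> t <= N%:R -> (forall r, s <= r < t -> y r = y s) ->
  forall u, s <= u <= t -> `|rsum j N H b u - rsum j N H b s - H s * (b u - b s)| <= e.
Proof.
move=> e0; have K0 : 0 <= K by exact: le_trans (HK (lexx 0)).
have e1 : 0 < e / (2 * K + 1) by rewrite divr_gt0 //; lra.
have [d d0 hd] := uniform_modulus cb (ler0n R N) e1.
near=> j; move=> s t s0 st tN yc u hu.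
have hj : ((2 : R) ^+ j)^-1 < d by near: j; exact: pow2_small.
apply: le_trans (rsum_const (K := K) (e := e / (2 * K + 1)) s0 st tN _ _ _ hu) _ => //.
- exact: Hy.
- by move=> x z hx hz xz; apply: hd => //; rewrite (le_trans xz) // ltW.
- by rewrite mulrA ler_pdivrMr; nra.
Unshelve. all: by end_near. Qed.

(** Any function with the right increments on constancy intervals is the limit, uniformly on bounded
    intervals. This identifies the integral with a process already at hand. *)
Lemma rsum_cvg_uniform (J : R -> R) : (forall s t, 0 <= s -> s <= t ->
    (forall u, s <= u < t -> y u = y s) -> J t - J s = H s * (b t - b s)) ->
  forall N e, 0 < e -> \forall j \near \oo, forall u, 0 <= u <= N%:R ->
  `|rsum j N H b u - (J u - J 0)| <= e.
Proof.
move=> HJ N.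
have P : forall s t, 0 <= s -> s <= t -> t <= N%:R -> forall e, 0 < e -> \forall j \near \oo,
    forall u, s <= u <= t -> `|rsum j N H b u - rsum j N H b s - (J u - J s)| <= e.
  apply: (stepwise_ind sy).
    move=> s u t s0 su ut P1 P2 tN e e0; have e2 : 0 < e / 2 by rewrite divr_gt0.
    apply: filterS2 (P1 (le_trans ut tN) _ e2) (P2 tN _ e2) => j h1 h2 v /andP[sv vt].
    case: (leP v u) => vu; first by rewrite (le_trans (h1 v _)) ?sv //; lra.
    have := h1 u; have := h2 v; rewrite su lexx (ltW vu) vt => /(_ isT) k2 /(_ isT) k1.
    rewrite (_ : _ - _ = (rsum j N H b v - rsum j N H b u - (J v - J u)) +
      (rsum j N H b u - rsum j N H b s - (J u - J s))); last by ring.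
    by rewrite (le_trans (ler_normD _ _)) //; lra.
  move=> s t s0 st yc tN e e0; apply: filterS (small N e0) => j h u /andP[su ut].
  rewrite (HJ s u) //; first by apply: (h s t); rewrite ?su.
  by move=> v /andP[sv vu]; apply: yc; rewrite sv (lt_le_trans vu).
move=> e e0; have := P 0 N%:R (lexx _) (ler0n _ _) (lexx _) e e0.
by apply: filterS => j h u hu; have := h u hu; rewrite rsum0 subr0.
Qed.

Lemma rsum_is_cvg (N : nat) t : 0 <= t -> t <= N%:R -> cvgn (fun j => rsum j N H b t).
Proof.
move=> t0; have P : forall s t, 0 <= s -> s <= t -> t <= N%:R ->
    cvgn (fun j => rsum j N H b t - rsum j N H b s).
  apply: (stepwise_ind sy) => [s u v s0 su uv P1 P2 vN|s u s0 su yc uN].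
    rewrite (_ : (fun j => _) = (fun j => (rsum j N H b v - rsum j N H b u) + (rsum j N H b u - rsum j N H b s))).
      by apply: is_cvgD; [exact: P2|exact: P1 (le_trans uv vN)].
    by apply/funext => j; ring.
  apply/cvg_ex; exists (H s * (b u - b s)); apply/cvgrPdist_le => e e0.
  apply: filterS (small N e0) => j h; rewrite distrC.
  by apply: (h s u); rewrite ?su ?lexx.
move=> tN; have := P 0 t (lexx _) t0 tN.
by under eq_fun do rewrite rsum0 subr0.
Qed.

(* The pathwise integral of [H] against [b]. *)
Definition pathint (t : R) : R := limn (fun j => rsum j (Num.trunc t).+1 H b t).

Lemma pathintE (N : nat) t : 0 <= t -> t <= N%:R -> rsum j N H b t @[j --> \oo] --> pathint t.
Proof.
move=> t0 tN; have tt := ltW (truncnS_gt t).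
have e j : rsum j N H b t = rsum j (Num.trunc t).+1 H b t.
  by case: (leqP N (Num.trunc t).+1) => h; [rewrite -(rsum_widen _ _ _ tN h)|rewrite (rsum_widen _ _ _ tt (ltnW h))].
rewrite (_ : (fun j => _) = (fun j => rsum j (Num.trunc t).+1 H b t)); last exact/funext.
exact: rsum_is_cvg.
Qed.

Lemma pathint0 : pathint 0 = 0.
Proof. by rewrite /pathint; under eq_fun do rewrite rsum0; exact: lim_cst. Qed.

Lemma pathint_const s t : 0 <= s -> s <= t -> (forall u, s <= u < t -> y u = y s) ->
  pathint t - pathint s = H s * (b t - b s).
Proof.
move=> s0 st yc; pose N := (Num.trunc t).+1; have tN : t <= N%:R by exact: ltW (truncnS_gt t).
have c1 := pathintE (le_trans s0 st) tN; have c2 := pathintE s0 (le_trans st tN).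
apply: (cvg_unique _ (cvgB c1 c2)) => //; apply/cvgrPdist_le => e e0.
apply: filterS (small N e0) => j h; rewrite distrC.
by apply: (h s t); rewrite ?st ?lexx.
Qed.

Lemma pathint_continuous : {within `[0, +oo[, continuous pathint}.
Proof.
apply: near_within => p e p0 e0; have [ry ly] := sy.
have K0 : 0 <= K by exact: le_trans (HK (lexx 0)).
have e1 : 0 < e / (K + 1) by rewrite divr_gt0 //; lra.
have [r1 r10 h1] := within_near cb p0 e1; have [r2 r20 h2] := ry p p0.
have bnd q v : 0 <= q -> `|b v - b p| <= e / (K + 1) -> `|H q * (b v - b p)| <= e.
  move=> q0 hv; rewrite normrM; apply: (@le_trans _ _ (K * (e / (K + 1)))).
    by apply: ler_pM => //; exact: HK.
  by rewrite mulrA ler_pdivrMr; nra.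
have right x : p <= x -> `|x - p| < r1 -> x < p + r2 -> `|pathint x - pathint p| <= e.
  move=> px xr xr2; rewrite (pathint_const p0 px); first exact: bnd (h1 x (le_trans p0 px) xr).
  by move=> u /andP[pu ux]; apply: h2; rewrite pu (lt_trans ux).
move: (p0); rewrite le_eqVlt => /predU1P[p00|pgt].
  exists (Num.min r1 r2); first by rewrite lt_min r10.
  move=> x x0; rewrite lt_min => /andP[x1 x2]; apply: right => //; first by rewrite -p00.
  by move: x2; rewrite ltr_norml; lra.
have [s /andP[s0 sp] hs] := ly p pgt.
exists (Num.min (Num.min r1 r2) (p - s)); first by rewrite !lt_min r10 r20 subr_gt0.
move=> x x0; rewrite !lt_min => /andP[/andP[x1 x2] x3].
case: (leP p x) => px; first by apply: right => //; move: x2; rewrite ltr_norml; lra.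
have sx : s <= x by move: x3; rewrite ltr_norml; lra.
rewrite distrC (pathint_const x0 (ltW px)).
  by rewrite -normrN -mulrN opprB; apply: bnd => //; exact: h1.
by move=> u /andP[xu up]; rewrite !hs ?sx ?(le_trans sx).
Qed.

End Convergence.

Definition changes (y : R -> R) (k j : nat) : nat :=
  \sum_(i < j) (y (i.+1%:R / 2 ^+ k) != y (i%:R / 2 ^+ k)).

Lemma changes_mono y k i j : (i <= j)%N -> (changes y k i <= changes y k j)%N.
Proof.
move=> ij; rewrite /changes -!(big_mkord predT (fun i => nat_of_bool (y (i.+1%:R / 2 ^+ k) != y (i%:R / 2 ^+ k)))).
by rewrite [leqRHS](big_cat_nat (n := i)) //= leq_addr.
Qed.

Lemma changes_refine y k j : (changes y k j <= changes y k.+1 (j * 2))%N.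
Proof.
rewrite /changes; elim: j => [|j IH]; first by rewrite !big_ord0.
rewrite big_ord_recr /= mulSn add2n !big_ord_recr /= -addnA leq_add //.
have e i : (i * 2)%:R / 2 ^+ k.+1 = i%:R / 2 ^+ k :> R.
  by rewrite natrM exprS; field; rewrite gt_eqF.
rewrite -(e j) -(e j.+1) mulSn add2n.
case: (eqVneq (y ((j * 2).+2%:R / 2 ^+ k.+1)) (y ((j * 2)%:R / 2 ^+ k.+1))) => //= h.
case: (eqVneq (y ((j * 2).+1%:R / 2 ^+ k.+1)) (y ((j * 2)%:R / 2 ^+ k.+1))) => //= h2.
by rewrite h2 h.
Qed.

Lemma changes_refineD y k l j : (changes y k j <= changes y (k + l) (j * 2 ^ l))%N.
Proof.
elim: l => [|l IH]; first by rewrite addn0 muln1.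
by rewrite addnS expnSr mulnA (leq_trans IH) // changes_refine.
Qed.

Lemma changes_lt y k i j : (i <= j)%N -> y (j%:R / 2 ^+ k) != y (i%:R / 2 ^+ k) ->
  (changes y k i < changes y k j)%N.
Proof.
elim: j => [|j IH]; first by rewrite leqn0 => /eqP ->; rewrite eqxx.
rewrite leq_eqVlt => /predU1P[-> |]; first by rewrite eqxx.
rewrite ltnS => ij ne; rewrite {2}/changes big_ord_recr /= -/(changes y k j).
case: (eqVneq (y (j.+1%:R / 2 ^+ k)) (y (j%:R / 2 ^+ k))) => e /=.
  by rewrite addn0; apply: IH => //; rewrite -e.
by rewrite addn1 ltnS changes_mono.
Qed.

(** The counts at grid points before [t] are bounded, hence attain a maximum at some grid point. A
    later change before [t] would, by right constancy, show on a finer grid and raise the count. *)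
Lemma changes_lconst (y : R -> R) : rconst y ->
  (forall N : nat, exists n, forall k, (changes y k (N * 2 ^ k) <= n)%N) -> lconst y.
Proof.
move=> ry bc t t0; pose N := (Num.trunc t).+1; have tN : t < N%:R by exact: truncnS_gt.
have [n hn] := bc N.
pose Pv v := `[< exists k i, i%:R / 2 ^+ k < t /\ changes y k i = v >].
have iN k i : i%:R / 2 ^+ k < t -> (i <= N * 2 ^ k)%N.
  move=> h; rewrite -(grid_le k) grid_end; apply: ltW; exact: lt_trans h tN.
have exP : exists v, Pv v by exists (changes y 0 0); apply/asboolP; exists 0%N, 0%N; rewrite mul0r.
have ubP v : Pv v -> (v <= n)%N.
  by move=> /asboolP[k [i [h <-]]]; rewrite (leq_trans _ (hn k)) // changes_mono // iN.
have [v /asboolP[k0 [i0 [h0 e0]]] mv] := ex_maxnP exP ubP.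
exists (i0%:R / 2 ^+ k0); first by rewrite divr_ge0.
move=> r /andP[sr rt]; apply/eqP/negPn/negP => ne.
have r0 : 0 <= r by apply: le_trans sr; rewrite divr_ge0.
have [e e_gt0 he] := ry r r0.
have [l hl] : exists l, ((2 : R) ^+ (k0 + l))^-1 < Num.min e (t - r).
  have m0 : 0 < Num.min e (t - r) by rewrite lt_min e_gt0 subr_gt0.
  have [M _ hM] := pow2_small m0; exists M; apply: hM; exact: leq_addl.
move: hl; rewrite lt_min => /andP[l1 l2].
set k := (k0 + l)%N in l1 l2; pose i := (Num.trunc (r * 2 ^+ k)).+1.
have gi : i%:R / 2 ^+ k = gup k r by [].
have g1 := gup_gt k r; have g2 := gup_le k r0.
have gt : i%:R / 2 ^+ k < t by rewrite gi; lra.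
have yi : y (i%:R / 2 ^+ k) = y r by apply: he; rewrite gi (ltW g1) /=; lra.
have ei : i0%:R / 2 ^+ k0 = (i0 * 2 ^ l)%:R / 2 ^+ k :> R.
  by rewrite natrM natrX /k exprD; field; rewrite !gt_eqF.
have ii : (i0 * 2 ^ l <= i)%N by rewrite -(grid_le k) -ei gi (le_trans sr) // ltW.
have := @changes_lt y k _ _ ii; rewrite yi -ei => /(_ ne) h.
have Pi : Pv (changes y k i) by apply/asboolP; exists k, i.
have := mv _ Pi; rewrite leqNgt => /negP; apply.
by rewrite -e0 (leq_ltn_trans (changes_refineD y k0 l i0)).
Qed.

End StepFunctions.

(** * Brownian motion *)

Section NormalScaling.
Context {R : realType}.
Notation mu := (@lebesgue_measure R).
Variables (k : R).
Hypothesis k0 : k != 0.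

Let mk : measurable_fun [set: R] (fun x : R => k * x).
Proof. exact: measurable_funM. Qed.

Let nu : {measure set (measurableTypeR R) -> \bar R} :=
  @pushmeasure R _ _ (measurableTypeR R) (measurableTypeR R) (mscale (NngNum (normr_ge0 k)) mu) _ mk.

Let nuE (A : set R) : measurable A -> mu A = nu A.
Proof.
move=> mA; apply: (@lebesgue_measure_unique R nu) => // _ [[a b] _ <-] /=.
rewrite /nu /pushmeasure /= /pushforward /mscale /= lebesgue_measure_itv /= lte_fin.
case: (ltgtP k 0) => [kn|kp|k0']; last by move: k0; rewrite k0' eqxx.
- rewrite (_ : _ @^-1` _ = `[b / k, a / k[%classic); last first.
    apply/seteqP; split => x /=; rewrite !in_itv /= ler_ndivrMr // ltr_ndivlMr // ![_ * k]mulrC; by rewrite andbC.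
  rewrite lebesgue_measure_itv /= lte_fin ltr_nM2r ?invr_lt0 //.
  case: ifPn => _; last by rewrite mule0.
  rewrite -!EFinD -EFinM; congr (_%:E); rewrite ltr0_norm //; field; exact: k0.
- rewrite (_ : _ @^-1` _ = `]a / k, b / k]%classic); last first.
    by apply/seteqP; split => x /=; rewrite !in_itv /= ltr_pdivrMr // ler_pdivlMr // ![_ * k]mulrC.
  rewrite lebesgue_measure_itv /= lte_fin ltr_pM2r ?invr_gt0 //.
  case: ifPn => _; last by rewrite mule0.
  rewrite -!EFinD -EFinM; congr (_%:E); rewrite gtr0_norm //; field; exact: k0.
Qed.

(** Lebesgue measure times [|k|], pushed forward by [x -> k x], is Lebesgue measure. The sign of [k]
    is left free so that [k = -1], together with [normal_opp], yields the symmetry of the centred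
    law. *)
Lemma normal_scale (s : R) (C : set R) : s != 0 -> measurable C ->
  normal_prob 0 (k * s) C = normal_prob 0 s [set y | C (k * y)].
Proof.
move=> s0 mC; have mC' : measurable [set y | C (k * y)].
  by have := mk measurableT mC; rewrite setTI.
transitivity (\int[nu]_(x in C) (normal_pdf 0 (k * s) x)%:E)%E.
  by apply: eq_measure_integral => A mA _; exact: nuE.
transitivity (\int[mu]_(x in [set y | C (k * y)%R]) (normal_pdf 0 s x)%:E)%E => //.
have mpdf (t : R) : measurable_fun [set: R] (fun x => (normal_pdf 0 t x)%:E).
  by apply/measurable_EFinP; exact: measurable_normal_pdf.
have pdf0 (t x : R) : (0 <= (normal_pdf 0 t x)%:E)%E by rewrite lee_fin normal_pdf_ge0.
transitivity (\int[mscale (NngNum (normr_ge0 k)) mu]_(x in [set y | C (k * y)%R]) (normal_pdf 0 (k * s) (k * x)%R)%:E)%E.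
  apply: (@ge0_integral_pushforward _ _ (measurableTypeR R) (measurableTypeR R) R (fun x => k * x) mk
    (mscale (NngNum (normr_ge0 k)) mu) C (fun x => (normal_pdf 0 (k * s) x)%:E) mC) => //.
  by apply: measurable_funTS; exact: mpdf.
have mc : measurable_fun [set y | C (k * y)] (fun x => (normal_pdf 0 (k * s) (k * x)%R)%:E).
  apply: measurable_funTS; apply/measurable_EFinP.
  exact: measurableT_comp (measurable_normal_pdf _ _) mk.
rewrite (@ge0_integral_mscale _ (measurableTypeR R) R mu _ mC' (NngNum (normr_ge0 k)) _ mc) //.
rewrite -(@ge0_integralZl_EFin _ (measurableTypeR R) R mu) //=.
apply: eq_integral => x _; rewrite -EFinM; congr (_%:E).
rewrite /normal_pdf (negbTE s0) mulf_eq0 (negbTE k0) (negbTE s0) /= /normal_fun /normal_peak !subr0.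
have kk : 0 < `|k| by rewrite normr_gt0.
rewrite mulrA; congr (_ * _).
  have -> : (k * s) ^+ 2 * pi *+ 2 = k ^+ 2 * (s ^+ 2 * pi *+ 2) by ring.
  by rewrite sqrtrM ?sqr_ge0 // sqrtr_sqr invfM mulrA mulfV ?mul1r // gt_eqF.
by congr (expR _); rewrite !exprMn; field; rewrite k0 s0.
Qed.

Lemma normal_opp (s : R) (C : set R) : normal_prob 0 (- s) C = normal_prob 0 s C.
Proof.
apply: eq_integral => x _; congr (_%:E).
by rewrite /normal_pdf /normal_fun /normal_peak oppr_eq0 sqrrN.
Qed.

End NormalScaling.

(** * Gaussian increments and independence of the past *)

Section JointLaw.
Context {R : realType} {d : measure_display} {Omega : measurableType d}.
Variable Pr : probability Omega R.

(** Agreement on rectangles determines the joint law. The mass [k] is kept apart from [nu0] because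
    the independence proof compares two events under which the laws of [V] are multiples of one
    [nu0]. *)
Lemma joint_law_scaled (nu0 : {measure set (measurableTypeR R) -> \bar R})
    (N : probability (measurableTypeR R) R) (k : {nonneg R})
    (D : set Omega) (V U : Omega -> R) (mD : measurable D) (mV : measurable_fun [set: Omega] V)
    (mU : measurable_fun [set: Omega] U) :
  (forall E, measurable E -> Pr (D `&` V @^-1` E) = (k%:num%:E * nu0 E)%E) ->
  (forall E C, measurable E -> measurable C ->
     Pr (D `&` V @^-1` E `&` U @^-1` C) = (Pr (D `&` V @^-1` E) * N C)%E) ->
  forall S : set (R * R), measurable S ->
  Pr (D `&` [set w | S (V w, U w)]) = (k%:num%:E * \int[nu0]_v N (xsection S v))%E.
Proof.
move=> HV HU S mS.
have mVU : measurable_fun [set: Omega] (fun w => (V w, U w)) by exact: measurable_fun_pair.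
pose m1 : {measure set (measurableTypeR R * measurableTypeR R) -> \bar R} :=
  @pushmeasure R _ _ _ (measurableTypeR R * measurableTypeR R)%type (mrestr Pr mD) _ mVU.
pose m2 : {measure set (measurableTypeR R * measurableTypeR R) -> \bar R} := mscale k (nu0 \x N)%E.
have e : m1 S = m2 S.
  apply: (measure_unique [set A `*` B | A in @measurable _ (measurableTypeR R) & B in @measurable _ (measurableTypeR R)] (fun _ => setT)) => //.
  - exact: measurable_prod_measurableType.
  - move=> _ _ [A1 mA1 [B1 mB1 <-]] [A2 mA2 [B2 mB2 <-]]; rewrite -setXI.
    by exists (A1 `&` A2); [exact: measurableI|exists (B1 `&` B2) => //; exact: measurableI].
  - by move=> _; exists setT => //; exists setT => //; rewrite setXTT.
  - by rewrite bigcup_const.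
  - move=> _ [A mA [B mB <-]]; rewrite /m2 /= /mscale /= product_measure1E // muleA -HV // -HU //.
    change (Pr ([set w | (A `*` B) (V w, U w)] `&` D) = Pr (D `&` V @^-1` A `&` U @^-1` B)).
    by congr (Pr _); apply/seteqP; split => w /=; tauto.
  - by move=> _; rewrite /m1 /pushmeasure /= /pushforward /mrestr setTI (le_lt_trans (probability_le1 _ mD)) ?ltry.
by have := e; rewrite /m1 /pushmeasure /= /pushforward /mrestr setIC => ->.
Qed.

End JointLaw.

Section GaussianIncrements.
Context {R : realType} {d : measure_display} {Omega : measurableType d}.
Variable P : probability Omega R.

(** Both centred normal with variance [v] and independent of [G]. *)
Definition gaussian_given (G : set (set Omega)) (U : Omega -> R) (v : R) : Prop :=
  forall A, G A -> forall C, measurable C ->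
  P (A `&` U @^-1` C) = (P A * normal_prob 0 (Num.sqrt v) C)%E.

Definition sum_law (a b : R) (C : set R) : \bar R :=
  (\int[(normal_prob 0 (Num.sqrt a) : probability (measurableTypeR R) R)]_v
     normal_prob 0 (Num.sqrt b) (xsection [set p : R * R | C (p.1 + p.2)%R] v))%E.

Let mS (C : set R) : measurable C -> measurable [set p : R * R | C (p.1 + p.2)].
Proof.
move=> mC; have m : measurable_fun [set: R * R] (fun p => p.1 + p.2) by exact: measurable_funD.
by have := m measurableT C mC; rewrite setTI.
Qed.

Lemma gaussian_given_sum (G G' : set (set Omega)) (U V : Omega -> R) (a b : R) :
  sigma_algebra [set: Omega] G' -> G' `<=` measurable -> G `<=` G' ->
  submeasurable G' U -> measurable_fun [set: Omega] V ->
  gaussian_given G U a -> gaussian_given G' V b ->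
  forall A, G A -> forall C, measurable C ->
  P (A `&` (U \+ V) @^-1` C) = (P A * sum_law a b C)%E.
Proof.
move=> sG' mG' GG' mU mV gU gV A GA C mC; have mA := mG' _ (GG' _ GA).
have mU' : measurable_fun [set: Omega] U by move=> _ D mD; rewrite setTI; apply: mG'; exact: mU.
have fA : P A = ((fine (P A))%:E)%E by rewrite fineK // fin_num_measure.
pose k : {nonneg R} := NngNum (fine_ge0 (measure_ge0 P A)).
have := @joint_law_scaled R d Omega P
  (normal_prob 0 (Num.sqrt a) : probability (measurableTypeR R) R)
  (normal_prob 0 (Num.sqrt b) : probability (measurableTypeR R) R) k A U V mA mU' mV.
move=> /(_ _ _ _ (mS mC)) -> //=.
- by rewrite -fA.
- by move=> E mE; rewrite gU // {1}fA.
- by move=> E D mE mD; rewrite gV //; apply: sigma_algebra_I => //; [exact: GG'|exact: mU].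
Qed.

Lemma bm_gaussian (F : R -> set (set Omega)) (B : R -> Omega -> R) (s t : R) :
  brownian_motion P F B -> 0 <= s -> s < t -> gaussian_given (F s) (fun w => B t w - B s w) (t - s).
Proof. by move=> [_ _ _ h] s0 st A FA C mC; exact: h. Qed.

Lemma bm_submeasurable (F : R -> set (set Omega)) (B : R -> Omega -> R) (s t : R) :
  filtration F -> adapted F B -> 0 <= s -> s <= t ->
  submeasurable (F t) (fun w => B t w - B s w).
Proof.
move=> [sF mF incF] aB s0 st; have t0 := le_trans s0 st.
apply/(submeasurableP _ (sF t t0)); apply: measurable_funB; apply/(submeasurableP _ (sF t t0)).
  exact: aB.
by move=> C mC; apply: (incF s t) => //; exact: aB.
Qed.

Lemma bm_measurable (F : R -> set (set Omega)) (B : R -> Omega -> R) (t : R) :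
  filtration F -> adapted F B -> 0 <= t -> measurable_fun [set: Omega] (B t).
Proof. by move=> [_ mF _] aB t0 _ C mC; rewrite setTI; apply: (mF t) => //; exact: aB. Qed.

(* The convolution of two centred normal laws is read off the Brownian motion itself. *)
Lemma bm_sum_law (F : R -> set (set Omega)) (B : R -> Omega -> R) (a b : R) (C : set R) :
  filtration F -> brownian_motion P F B -> 0 < a -> 0 < b -> measurable C ->
  sum_law a b C = normal_prob 0 (Num.sqrt (a + b)) C.
Proof.
move=> fF bB a0 b0 mC; have [aB _ _ _] := bB; have [sF mF incF] := fF.
have ab : 0 < a + b by rewrite addr_gt0.
have FT : F 0 [set: Omega] by apply: sigma_algebra_T; exact: sF.
have g1 := bm_gaussian bB (lexx 0) a0; rewrite subr0 in g1.
have aab : a < a + b by rewrite ltrDl.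
have g2 := bm_gaussian bB (ltW a0) aab; rewrite (addrC a b) addrK in g2.
have g3 := bm_gaussian bB (lexx 0) ab; rewrite subr0 in g3.
have := @gaussian_given_sum (F 0) (F a) _ _ a b (sF a (ltW a0)) (mF a (ltW a0)) (incF 0 a (lexx _) (ltW a0))
  (bm_submeasurable fF aB (lexx 0) (ltW a0)) _ g1 g2 setT FT C mC.
rewrite (_ : (_ \+ _) = (fun w => B (a + b) w - B 0 w)); last first.
  by apply/funext => w /=; rewrite [b + a]addrC; ring.
rewrite (g3 _ FT _ mC) probability_setT !mul1e => <- //.
apply: measurable_funB; apply: (bm_measurable fF aB); last exact: ltW.
by rewrite addrC ltW.
Qed.

Lemma gaussian_given_add (G G' : set (set Omega)) (U V : Omega -> R) (a b : R) :
  (forall C, measurable C -> sum_law a b C = normal_prob 0 (Num.sqrt (a + b)) C) ->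
  sigma_algebra [set: Omega] G' -> G' `<=` measurable -> G `<=` G' ->
  submeasurable G' U -> measurable_fun [set: Omega] V ->
  gaussian_given G U a -> gaussian_given G' V b -> gaussian_given G (U \+ V) (a + b).
Proof.
move=> hs sG' mG' GG' mU mV gU gV A GA C mC.
by rewrite (gaussian_given_sum sG' mG' GG' mU mV gU gV GA mC) hs.
Qed.

Lemma gaussian_given_scale (G : set (set Omega)) (U : Omega -> R) (k v : R) :
  0 < k -> 0 < v -> gaussian_given G U v -> gaussian_given G (fun w => k * U w) (k ^+ 2 * v).
Proof.
move=> k0 v0 gU A GA C mC.
have mk : measurable [set y | C (k * y)].
  have m : measurable_fun [set: R] (fun x => k * x) by exact: measurable_funM.
  by have := m measurableT C mC; rewrite setTI.
rewrite sqrtrM ?sqr_ge0 // sqrtr_sqr gtr0_norm // normal_scale ?gt_eqF ?sqrtr_gt0 //.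
exact: gU.
Qed.

Section Independence.
Variables (F : R -> set (set Omega)) (B : R -> Omega -> R).
Hypotheses (fF : filtration F) (bB : brownian_motion P F B).

Definition cylinder (ts : seq R) (C : R -> set R) : set Omega :=
  [set w | forall t, t \in ts -> C t (B t w)].

Let aB : adapted F B. Proof. by case: bB. Qed.

Lemma cylinder_cons ts t C : cylinder (t :: ts) C = cylinder ts C `&` (B t @^-1` C t).
Proof.
apply/seteqP; split => w.
  by move=> h; split => [r rts|]; apply: h; rewrite inE ?eqxx ?rts ?orbT.
by move=> [h1 h2] r; rewrite inE => /predU1P[-> //|]; exact: h1.
Qed.

Lemma cylinder_F (s : R) ts C : 0 <= s -> (forall t, t \in ts -> 0 <= t <= s) ->
  (forall t, measurable (C t)) -> F s (cylinder ts C).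
Proof.
move=> s0; have [sF _ incF] := fF; elim: ts => [|t ts IH] hts mC.
  rewrite (_ : cylinder _ _ = setT); first exact: sigma_algebra_T (sF s s0).
  by apply/seteqP; split => // w _ r.
have /andP[t0 ts'] : 0 <= t <= s by apply: hts; rewrite inE eqxx.
rewrite cylinder_cons; apply: sigma_algebra_I; first exact: sF.
  by apply: IH => // r rts; apply: hts; rewrite inE rts orbT.
by apply: (incF t s) => //; apply: aB.
Qed.

Variable D : set Omega.
Hypothesis FD : F 0 D.

Let indep (A : set Omega) : Prop := P (D `&` A) = (P D * P A)%E.

Let mD : measurable D. Proof. by have [_ mF _] := fF; exact: (mF 0 (lexx _) _ FD). Qed.

Let indep_step (u s : R) (A : set Omega) (C : set R) : 0 <= u -> u < s -> F u A -> measurable C ->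
  (forall E, measurable E -> indep (A `&` B u @^-1` E)) -> indep (A `&` B s @^-1` C).
Proof.
move=> u0 us FA mC IH; have [sF mF incF] := fF; have mA := mF u u0 _ FA.
have s0 : 0 <= s by exact: ltW (le_lt_trans u0 us).
have mBu := bm_measurable fF aB u0; have mBs := bm_measurable fF aB s0.
pose nu0 : {measure set (measurableTypeR R) -> \bar R} :=
  @pushmeasure R _ _ _ (measurableTypeR R) (mrestr P mA) _ mBu.
have nuE E : nu0 E = P (A `&` B u @^-1` E) by rewrite setIC.
pose U w := B s w - B u w.
have mU : measurable_fun [set: Omega] U by exact: measurable_funB.
have g := bm_gaussian bB u0 us.
have key (A' : set Omega) (k : {nonneg R}) : F u A' ->
    (forall E, measurable E -> P (A' `&` B u @^-1` E) = (k%:num%:E * nu0 E)%E) ->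
    P (A' `&` B s @^-1` C) = (k%:num%:E * \int[nu0]_v (normal_prob 0 (Num.sqrt (s - u)) : probability (measurableTypeR R) R)
      (xsection [set p : R * R | C (p.1 + p.2)%R] v))%E.
  move=> FA' h; have mA' := mF u u0 _ FA'.
  rewrite -(@joint_law_scaled R d Omega P nu0 (normal_prob 0 (Num.sqrt (s - u)) : probability (measurableTypeR R) R)
     k A' (B u) U mA' mBu mU h _ _ (mS mC)).
    by congr (P (_ `&` _)); apply/seteqP; split => w /=; rewrite /U addrC subrK.
  move=> E C' mE mC'; apply: g => //; apply: sigma_algebra_I; [exact: sF|by []|exact: aB].
have fD : P D = ((fine (P D))%:E)%E by rewrite fineK // fin_num_measure.
rewrite /indep setIA (key _ (NngNum (fine_ge0 (measure_ge0 P D)))) /=; last 2 first.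
- by apply: sigma_algebra_I => //; [exact: sF|exact: (incF 0 u)].
- by move=> E mE; rewrite -fD nuE -setIA; exact: IH.
rewrite -fD; congr (_ * _)%E; rewrite (key A 1%:nng) //= ?mul1e //.
by move=> E mE; rewrite mul1e nuE.
Qed.

Let indep0 (C : set R) : measurable C -> indep (B 0 @^-1` C).
Proof.
move=> mC; have [_ mF _] := fF; have [_ B0 _ _] := bB; rewrite /indep.
have mB : measurable (B 0 @^-1` C) by apply: (mF 0) => //; apply: aB.
have [c0|nc0] := pselect (C 0).
  have e1 : P (B 0 @^-1` C) = 1%E by apply: ae_prob1 => //; apply: filterS B0 => w /= ->.
  by rewrite prob_setI1 // e1 mule1.
have e0 : P (~` (B 0 @^-1` C)) = 1%E.
  by apply: ae_prob1; [exact: measurableC|apply: filterS B0 => w /= ->].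
have z : P (B 0 @^-1` C) = 0%E.
  by rewrite -[B 0 @^-1` _]setCK probability_setC ?e0 ?subee //; exact: measurableC.
by rewrite z mule0; apply: (subset_measure0 _ mB _ z) => //; exact: measurableI.
Qed.

(** Induction with the latest time at the head of the list: given the value at the previous time
    [u], the last increment is independent of all of [F u], to which [D] belongs as well. *)
Let indep_cylinder (s : R) ts C : (forall t, measurable (C t)) ->
  (forall t, t \in s :: ts -> 0 <= t) -> path >%R s ts -> indep (cylinder (s :: ts) C).
Proof.
have [sF mF incF] := fF; elim: ts s C => [|u ts IH] s C mC ge0 /=.
  have s0 : 0 <= s by apply: ge0; rewrite inE.
  rewrite (_ : cylinder [:: s] C = setT `&` B s @^-1` C s); last first.
    by rewrite cylinder_cons; congr (_ `&` _); apply/seteqP; split.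
  move: s0; rewrite le_eqVlt => /predU1P[<- _|s0 _]; first by rewrite setTI; exact: indep0.
  apply: (indep_step (lexx 0) s0) => //; first exact: sigma_algebra_T (sF 0 (lexx _)).
  by move=> E mE; rewrite setTI; exact: indep0.
move=> /andP[us pu]; have u0 : 0 <= u by apply: ge0; rewrite !inE eqxx orbT.
have ge0' t : t \in u :: ts -> 0 <= t by move=> h; apply: ge0; rewrite inE h orbT.
have leu t : t \in u :: ts -> t <= u.
  rewrite inE => /predU1P[-> //|tin]; apply: ltW.
  by move: pu => /(order_path_min (rev_trans lt_trans)) /allP /(_ t tin).
rewrite cylinder_cons; apply: (indep_step u0 us) => //.
  by apply: cylinder_F => // t tin; rewrite ge0' ?leu.
(* The extra constraint [E] at time [u] is absorbed into the cylinder, so the induction hypothesis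
   must range over all families of sets. *)
move=> E mE; pose C' r := if r == u then C r `&` E else C r.
rewrite (_ : _ `&` _ = cylinder (u :: ts) C').
  by apply: IH => // t; rewrite /C'; case: ifP => // _; exact: measurableI.
apply/seteqP; split => w.
  by move=> [h1 h2] t tin; rewrite /C'; case: eqP => [->|_]; [split => //|]; apply: h1; rewrite ?inE ?eqxx.
move=> h; split; first by move=> t tin; have := h t tin; rewrite /C'; case: eqP => // _ [].
by have := h u; rewrite /C' eqxx inE eqxx => /(_ isT) [].
Qed.

(** Meant for a filtration whose sigma-algebra at time 0 already contains the whole chain;
    independence of Brownian motion and chain then needs no further computation. *)
Lemma bm_independent (A : set Omega) : generated `[0, +oo[ B A -> P (D `&` A) = (P D * P A)%E.
Proof.
have [sF mF incF] := fF.
pose Pi := [set A | exists (ts : seq R) C, [/\ (forall t, t \in ts -> 0 <= t),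
  (forall t, measurable (C t)) & A = cylinder ts C]].
pose H := [set A | measurable A /\ indep A].
have cylN : cylinder [::] (fun=> setT) = setT by apply/seteqP; split.
have PiI : setI_closed Pi.
  move=> _ _ [t1 [C1 [h1 m1 ->]]] [t2 [C2 [h2 m2 ->]]].
  exists (t1 ++ t2), (fun t => (if t \in t1 then C1 t else setT) `&` (if t \in t2 then C2 t else setT)); split.
  - by move=> t; rewrite mem_cat => /orP[/h1|/h2].
  - by move=> t; apply: measurableI; case: ifP.
  - apply/seteqP; split => w.
      by move=> [k1 k2] t _; split; case: ifP => // h; [exact: k1|exact: k2].
    move=> h; split => t tin; have := h t; rewrite mem_cat tin ?orbT => /(_ isT) []; by rewrite ?tin.
have PiH : Pi `<=` H.
  move=> _ [ts [C [ge0 mC ->]]].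
  have fin : exists s, 0 <= s /\ (forall t, t \in ts -> 0 <= t <= s).
    exists (\sum_(t <- ts) `|t|); split; first by apply: sumr_ge0.
    by move=> t tin; rewrite ge0 //= (big_rem t) //= (le_trans (ler_norm t)) // lerDl sumr_ge0.
  have [s [s0 hs]] := fin; split; first by apply: (mF s s0); exact: cylinder_F.
  pose us := rev (sort <=%R (undup ts)).
  have eus : us =i ts by move=> t; rewrite mem_rev mem_sort mem_undup.
  have -> : cylinder ts C = cylinder us C.
    by apply/seteqP; split => w h t tin; apply: h; move: tin; rewrite eus.
  have so : sorted >%R us.
    by rewrite /us rev_sorted sort_lt_sorted undup_uniq.
  case: us so eus => [_ _|u us /= pu eus].
    by rewrite (_ : cylinder _ _ = setT) /indep ?setIT ?probability_setT ?mule1 //; apply/seteqP; split.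
  by apply: indep_cylinder => // t; rewrite eus; exact: ge0.
have lamH : lambda_system setT H.
  apply/dynkin_lambda_system; split.
  - by split => //; rewrite /indep setIT probability_setT mule1.
  - move=> A' [mA hA]; split; first exact: measurableC.
    have e : P D = (P (D `&` A') + P (D `&` ~` A'))%E.
      rewrite -measureU; last 3 first.
      + exact: measurableI.
      + by apply: measurableI => //; exact: measurableC.
      + by rewrite setIACA setICr setI0.
      by rewrite -setIUr setUCr setIT.
    have fA : P A' \is a fin_num by exact: fin_num_measure.
    have fD : P D \is a fin_num by exact: fin_num_measure.
    have fDA : P (D `&` A') \is a fin_num by apply: fin_num_measure; exact: measurableI.
    rewrite /indep probability_setC // -(fineK fA) -(fineK fD) -EFinB -EFinM mulrBr mulr1 EFinB EFinM.
    by rewrite !fineK // -hA e addeAC subee // add0e.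
  - move=> A' tA HA; split; first by apply: bigcupT_measurable => n; have [] := HA n.
    rewrite /indep setI_bigcupr measure_semi_bigcup //; last 3 first.
    + by move=> n; apply: measurableI => //; have [] := HA n.
    + by apply: trivIset_setIl.
    + by apply: bigcupT_measurable => n; apply: measurableI => //; have [] := HA n.
    rewrite measure_semi_bigcup //; last 2 first.
    + by move=> n; have [] := HA n.
    + by apply: bigcupT_measurable => n; have [] := HA n.
    rewrite (eq_eseriesr (g := fun n => (P D * P (A' n))%E)); last by move=> n _; have [] := HA n.
    have fD : P D = ((fine (P D))%:E)%E by rewrite fineK // fin_num_measure.
    by rewrite fD nneseriesZl.
move=> gA; have gsub : generated `[0, +oo[ B `<=` <<s Pi >>.
  apply: generated_sub => [|t]; first exact: smallest_sigma_algebra.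
  rewrite /= in_itv /= andbT => t0 C mC; apply: sub_sigma_algebra.
  exists [:: t], (fun=> C); split => // [r|]; first by rewrite inE => /eqP ->.
  by apply/seteqP; split => w /=; [move=> h r; rewrite inE => /eqP ->|move=> h; apply: (h t); rewrite inE].
have := lambda_system_subset PiI lamH PiH (fun X _ => @subsetT _ X).
by move=> /(_ A (gsub A gA)) [].
Qed.

End Independence.

End GaussianIncrements.

(** * Finitely many jumps of the chain *)

Section FiniteJumps.
Context {R : realType} {m : nat} (ys : 'I_m -> R) (Q : 'M[R]_m).
Context {d : measure_display} {Omega : measurableType d}.
Variables (P : probability Omega R) (Y : R -> Omega -> R).
Hypothesis mcY : markov_chain P ys Q Y.
Variables c C : R.
Hypothesis gY : gproc c C Y.

Let Y_range t w : 0 <= t -> exists i, Y t w = ys i.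
Proof. by move=> t0; case: mcY => _ h _ _ _; have [i _ <-] := h t w t0; exists i. Qed.

Let mY t : 0 <= t -> measurable_fun [set: Omega] (Y t).
Proof. exact: (proj2 gY). Qed.

Let mYi t v : 0 <= t -> measurable [set w | Y t w = v].
Proof. by move=> t0; have := mY t0 measurableT (measurable_set1 v); rewrite setTI. Qed.

Let jump s t : set Omega := [set w | Y t w != Y s w].

Let mjump s t : 0 <= s -> 0 <= t -> measurable (jump s t).
Proof.
move=> s0 t0; have mD : measurable_fun [set: Omega] (fun w => Y t w - Y s w).
  by apply: measurable_funB; exact: mY.
have := mD measurableT _ (measurableC (measurable_set1 0)); rewrite setTI.
apply: set_transport => w /=; rewrite /jump /= -subr_eq0; split => [/eqP //|/eqP //].
Qed.

Lemma jump_prob : exists K d0 : R, [/\ 0 <= K, 0 < d0 & forall s h, 0 <= s -> 0 <= h <= d0 ->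
  (P (jump s (s + h)) <= (K * h)%:E)%E].
Proof.
have [K [d0 [K0 d00 _ [B _ _]]]] := expmx_small Q.
pose q2 := index_enum ('I_m * 'I_m)%type.
exists ((size q2)%:R * K), d0; split => //; first by rewrite mulr_ge0 // ltW.
move=> s h s0 hh; have /andP[h0 _] := hh; have sh0 : 0 <= s + h by rewrite addr_ge0.
pose A (p : 'I_m * 'I_m) := if ys p.1 == ys p.2 then set0 else
  [set w | Y s w = ys p.1] `&` [set w | Y (s + h) w = ys p.2].
have mA p : measurable (A p) by rewrite /A; case: ifP => // _; apply: measurableI; exact: mYi.
have bA p : (P (A p) <= (K * h)%:E)%E.
  rewrite /A; case: ifPn => [_|ne]; first by rewrite measure0 lee_fin mulr_ge0 // ltW.
  have [_ _ _ _ H] := mcY.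
  have NT : natural Y s [set: Omega] by apply: sigma_algebra_T; exact: natural_sigma_algebra.
  have := H s h s0 h0 setT NT p.1 p.2; rewrite setTI => ->.
  have mi := mYi (ys p.1) s0.
  apply: (@le_trans _ _ (1 * (K * h)%:E)%E); last by rewrite mul1e.
  apply: (@le_trans _ _ (P [set w | Y s w = ys p.1] * (K * h)%:E)%E).
    apply: lee_wpmul2l; first exact: measure_ge0.
    by rewrite lee_fin; apply: B => //; apply: contraNneq ne => ->.
  by apply: lee_wpmul2r; [rewrite lee_fin mulr_ge0 // ltW|exact: probability_le1].
rewrite -mulrA; apply: le_trans (prob_finite_union q2 mA bA).
apply: le_measure; rewrite ?inE; [exact: mjump|exact: bigsetU_measurable|].
move=> w /= ne; have [i ei] := Y_range w s0; have [j ej] := Y_range w sh0.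
rewrite -bigcup_seq; exists (i, j); first by rewrite /= mem_index_enum.
by rewrite /A /= ifN //; rewrite -ei -ej eq_sym.
Qed.

Let g0 (k i : nat) : 0 <= (i%:R / 2 ^+ k : R).
Proof. by rewrite divr_ge0 // ltW. Qed.

Let many N n k : set Omega := [set w | (n < changes (Y ^~ w) k (N * 2 ^ k))%N].

Let changesE k j w : (changes (Y ^~ w) k j)%:R = \sum_(i < j) \1_(jump (i%:R / 2 ^+ k) (i.+1%:R / 2 ^+ k)) w :> R.
Proof.
rewrite /changes natr_sum; apply: eq_bigr => i _; rewrite indicE; congr ((nat_of_bool _)%:R).
by apply/idP/idP; rewrite inE.
Qed.

Let mmany N n k : measurable (many N n k).
Proof.
have mS : measurable_fun [set: Omega] (fun w => \sum_(i < N * 2 ^ k)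
    (\1_(jump (i%:R / 2 ^+ k) (i.+1%:R / 2 ^+ k)) w : R)).
  by apply: measurable_sum => i; apply: measurable_indic; exact: mjump.
have := mS measurableT _ (measurable_itv `]n%:R, +oo[); rewrite setTI.
by apply: set_transport => w /=; rewrite in_itv /= andbT -changesE ltr_nat.
Qed.

(** The expected number of changes seen on a fine grid up to [N] is at most [N * K]. By the Markov
    inequality the number is almost surely bounded over all levels, and [changes_lconst] applies. *)
Lemma chain_stepwise : exists V : set Omega, [/\ measurable V, P V = 1%E &
  forall w, V w -> stepwise (Y ^~ w)].
Proof.
have [K [d0 [K0 d00 hK]]] := jump_prob.
pose Bad N n := \bigcup_k many N n k.
have mBad N n : measurable (Bad N n) by apply: bigcupT_measurable => k; exact: mmany.
(* Refining the grid only reveals further changes, so these events increase and their union obeys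
   the same bound. *)
have many_mono N n w k l : (k <= l)%N -> many N n k w -> many N n l w.
  move=> kl /= h; rewrite /many /=; apply: (leq_trans h).
  by have := changes_refineD (Y ^~ w) k (l - k) (N * 2 ^ k); rewrite subnKC // -mulnA -expnD subnKC.
have pBad N n : (P (Bad N n) <= ((N%:R * K) / n.+1%:R)%:E)%E.
  have cv : P (many N n k) @[k --> \oo] --> P (Bad N n).
    apply: cvg_prob => //; apply: aeW => w.
    have [[k _ mk]|nB] := pselect (Bad N n w).
      by exists k => // l /= kl; split => _; [exists k|exact: many_mono kl mk].
    by near=> l; split => // h; case: nB; exists l.
  apply: (cvge_le _ cv); near=> k.
  have hk : ((2 : R) ^+ k)^-1 < d0 by near: k; exact: pow2_small.
  rewrite -(@lee_pmul2l _ n.+1%:R%:E) // ?lte_fin //.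
  rewrite -EFinM (_ : n.+1%:R * _ = N%:R * K); last by rewrite mulrC divfK // pnatr_eq0.
  have mJ i : measurable (jump (i%:R / 2 ^+ k) (i.+1%:R / 2 ^+ k)) by exact: mjump.
  have -> : (n.+1%:R%:E * P (many N n k) = \int[P]_w (n.+1%:R%:E * (\1_(many N n k) w)%:E))%E.
    rewrite ge0_integralZl_EFin //; last first.
      by apply/measurable_EFinP; exact: measurable_indic.
    by rewrite integral_indic // setIT.
  apply: (@le_trans _ _ (\int[P]_w (\sum_(i < N * 2 ^ k)
      (\1_(jump (i%:R / 2 ^+ k) (i.+1%:R / 2 ^+ k)) w)%:E))%E).
    apply: ge0_le_integral => //.
    - by apply: measurable_funeM; apply/measurable_EFinP; exact: measurable_indic.
    - by apply: emeasurable_sum => i; apply/measurable_EFinP; exact: measurable_indic.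
    - move=> w _; rewrite sumEFin -changesE -EFinM lee_fin indicE.
      case: (boolP (w \in many N n k)); last by rewrite mulr0.
      by rewrite inE /many /= mulr1 ler_nat.
  rewrite ge0_integral_sum //; last by move=> i; apply/measurable_EFinP; exact: measurable_indic.
  apply: (@le_trans _ _ (\sum_(i < N * 2 ^ k) (K / 2 ^+ k)%:E)%E).
    apply: lee_sum => i _; rewrite integral_indic // setIT.
    rewrite (_ : i.+1%:R / 2 ^+ k = i%:R / 2 ^+ k + (2 ^+ k)^-1); last by rewrite -natr1 mulrDl mul1r.
    by apply: hK => //; apply/andP; split; [rewrite invr_ge0 ltW|exact: ltW].
  rewrite sumEFin lee_fin sumr_const card_ord -[leLHS]mulr_natl natrM natrX.
  by rewrite le_eqVlt; apply/orP; left; apply/eqP; field; rewrite gt_eqF.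
have nul N : P (\bigcap_n Bad N n) = 0%E.
  apply/eqP; rewrite eq_le measure_ge0 andbT; apply/lee_addgt0Pr => e e0; rewrite add0e.
  have NK : 0 <= N%:R * K by rewrite mulr_ge0.
  have [n hn] : exists n : nat, N%:R * K / e < n.+1%:R.
    by exists (Num.trunc (N%:R * K / e)); exact: truncnS_gt.
  apply: (@le_trans _ _ (P (Bad N n))).
    by apply: le_measure; rewrite ?inE //; [exact: bigcapT_measurable|exact: bigcap_inf].
  apply: le_trans (pBad N n) _; rewrite lee_fin ler_pdivrMr // [e * _]mulrC -ler_pdivrMr //.
  exact: ltW.
exists (~` \bigcup_N \bigcap_n Bad N n); split.
- by apply: measurableC; apply: bigcupT_measurable => N; exact: bigcapT_measurable.
- rewrite probability_setC; last by apply: bigcupT_measurable => N; exact: bigcapT_measurable.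
  have : P.-negligible (\bigcup_N \bigcap_n Bad N n).
    apply: negligible_bigcup => N; exists (\bigcap_n Bad N n).
    by split; [exact: bigcapT_measurable|exact: nul|].
  have mU : measurable (\bigcup_N \bigcap_n Bad N n).
    by apply: bigcupT_measurable => N; exact: bigcapT_measurable.
  by move=> /(negligibleP _ mU) ->; rewrite sube0.
- move=> w nB; have ry := proj1 (proj1 gY w); split => //; apply: changes_lconst => // N.
  have [n hn] : exists n, ~ Bad N n w.
    by apply/existsNP => h; apply: nB; exists N => // n _; exact: h.
  by exists n => k; rewrite leqNgt; apply/negP => h; apply: hn; exists k.
Unshelve. all: by end_near. Qed.

End FiniteJumps.

Section RegularBrownian.
Context {R : realType} {d : measure_display} {Omega : measurableType d}.
Variable P : probability Omega R.

Lemma prob_off_null (N A B : set Omega) : measurable N -> P N = 0%E -> measurable A ->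
  measurable B -> A `&` ~` N = B `&` ~` N -> P A = P B.
Proof.
move=> mN N0 mA mB e; have N1 : P (~` N) = 1%E by rewrite probability_setC // N0 sube0.
have mC := measurableC mN.
by rewrite -(prob_setI1 mA mC N1) e prob_setI1.
Qed.

Lemma ae_null (Q : Omega -> Prop) : {ae P, forall w, Q w} ->
  exists N, [/\ measurable N, P N = 0%E & forall w, ~ N w -> Q w].
Proof.
move=> [N [mN N0 sub]]; exists N; split => // w nN; apply/not_notP => nQ; apply: nN.
exact: sub.
Qed.

(* Off a null set [N], which is adjoined to the filtration, the Brownian motion is unchanged. *)
Lemma regular_brownian (F : R -> set (set Omega)) (W : R -> Omega -> R) :
  filtration F -> brownian_motion P F W ->
  exists N F' W', [/\ measurable N /\ P N = 0%E, filtration F' /\ (forall t, 0 <= t -> F t `<=` F' t),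
    brownian_motion P F' W',
    forall w, W' 0 w = 0 /\ {within `[0, +oo[, continuous (W' ^~ w)} &
    forall w t, ~ N w -> W' t w = W t w].
Proof.
move=> fF bW; have [sF mF incF] := fF; have [aW W0 Wc Wi] := bW.
have [N1 [mN1 N10 h1]] := ae_null W0; have [N2 [mN2 N20 h2]] := ae_null Wc.
pose N := N1 `|` N2; have mN : measurable N by exact: measurableU.
have N0 : P N = 0%E by rewrite /N measureU0.
pose F' t := [set A | measurable A /\ exists2 A', F t A' & A `&` ~` N = A' `&` ~` N].
pose W' t w := if w \in N then 0 else W t w.
have FF' t : 0 <= t -> F t `<=` F' t by move=> t0 A FA; split; [exact: mF FA|exists A].
have eW t C : (W' t @^-1` C) `&` ~` N = (W t @^-1` C) `&` ~` N.
  by apply/seteqP; split => w /= [+ nN]; rewrite /W' memNset.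
have mW t : 0 <= t -> measurable_fun [set: Omega] (W t) by move=> t0; exact: bm_measurable fF aW t0.
have mW' t : 0 <= t -> measurable_fun [set: Omega] (W' t).
  move=> t0; rewrite (_ : W' t = fun w => W t w * \1_(~` N) w).
    by apply: measurable_funM; [exact: mW|apply: measurable_indic; exact: measurableC].
  apply/funext => w; rewrite /W' indicE in_setC.
  by case: (w \in N); rewrite ?mulr0 ?mulr1.
have fF' : filtration F'.
  split.
  - move=> t t0; split.
    + by split => //; exists set0 => //; have [] := sF t t0.
    + move=> A [mA [A' FA' e]]; split; first by rewrite setTD; exact: measurableC.
      exists (~` A'); first exact: sigma_algebra_C (sF t t0) FA'.
      apply/seteqP; split => w [hw nN]; split => //.
        move=> hA; have : (A' `&` ~` N) w by split.
        by rewrite -e => -[hA2 _]; case: hw.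
      split => // hA; have : (A `&` ~` N) w by split.
      by rewrite e => -[hA2 _]; exact: hw.
    + move=> A hA; split; first by apply: bigcupT_measurable => n; have [] := hA n.
      have /choice[A' hA'] : forall n, exists A', F t A' /\ A n `&` ~` N = A' `&` ~` N.
        by move=> n; have [_ [A' FA' e]] := hA n; exists A'.
      exists (\bigcup_n A' n); last by rewrite !setI_bigcupl; apply: eq_bigcupr => n _; exact: (proj2 (hA' n)).
      by have [_ _ sU] := sF t t0; apply: sU => n; exact: (proj1 (hA' n)).
  - by move=> t t0 A [].
  - move=> s t s0 st A [mA [A' FA' e]]; split => //; exists A' => //; exact: incF st _ FA'.
exists N, F', W'; split => //.
- split.
  + move=> t t0 C mC; split; last by exists (W t @^-1` C); [exact: aW|exact: eW].
    by have := mW' t t0 measurableT C mC; rewrite setTI.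
  + apply: filterS W0 => w e; rewrite /W'; case: ifP => //.
  + apply: aeW => w; rewrite /W'; case: (boolP (w \in N)) => wN.
      by apply: near_within => p e p0 e0; exists 1 => // x _ _; rewrite subrr normr0 ltW.
    by apply: h2 => h; move: wN; rewrite notin_setE; apply; right.
  + move=> s t s0 st A [mA [A' FA' e]] C mC; have t0 : 0 <= t by exact: ltW (le_lt_trans s0 st).
    have mA' := mF s s0 _ FA'.
    have m1 : measurable [set w | C (W t w - W s w)].
      have m := measurable_funB (mW t t0) (mW s s0).
      by have := m measurableT C mC; rewrite setTI.
    have m2 : measurable [set w | C (W' t w - W' s w)].
      have m := measurable_funB (mW' t t0) (mW' s s0).
      by have := m measurableT C mC; rewrite setTI.
    rewrite (prob_off_null mN N0 mA mA' e) -Wi //.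
    apply: (prob_off_null mN N0); [exact: measurableI|exact: measurableI|].
    apply/seteqP; split => w /= [[hA hC] nN]; (split; last exact: nN).
      have : (A `&` ~` N) w by []. rewrite e => -[hA' _]; split => //.
      by move: hC; rewrite /W' memNset.
    have : (A' `&` ~` N) w by []. rewrite -e => -[hA' _]; split => //=.
    by rewrite /W' memNset.
- move=> w; rewrite /W'; case: (boolP (w \in N)) => wN.
    split => //; apply: near_within => p e p0 e0; exists 1 => // x _ _.
    by rewrite subrr normr0 ltW.
  split; first by apply: h1 => h; move: wN; rewrite notin_setE; apply; left.
  by apply: h2 => h; move: wN; rewrite notin_setE; apply; right.
- by move=> w t nN; rewrite /W' memNset.
Qed.

End RegularBrownian.

(** * Running the diffusion in the clock of the chain *)

Section StepIntegrands.
Context {R : realType}.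
Notation mu := (@lebesgue_measure R).

Lemma stepwise_cst {T : Type} (z : T) : stepwise (fun _ : R => z).
Proof.
split=> t t0; first by exists 1.
by exists 0; rewrite ?lexx.
Qed.

Lemma stepwise_le (p : R) : stepwise (fun t => p <= t).
Proof.
split=> t t0.
  case: (leP p t) => pt.
    by exists 1 => // s /andP[ts _]; rewrite (le_trans pt).
  exists (p - t); first by rewrite subr_gt0.
  by move=> s /andP[_ st]; apply/negbTE; rewrite -ltNge; lra.
case: (ltP p t) => pt.
  exists (Num.max p 0); first by rewrite le_max lexx orbT gt_max pt.
  by move=> s /andP[]; rewrite ge_max => /andP[ps _] _; rewrite ps le_max lexx.
exists 0; first by rewrite lexx.
move=> s /andP[_ st]; rewrite !leNgt (lt_le_trans st pt) (_ : 0 < p) //.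
exact: lt_le_trans pt.
Qed.

(** Recording which marks have been passed makes a partition into a path: its constancy intervals
    are those containing no mark, and [stepwise_ind] applies to simple integrands. *)
Lemma stepwise_marks (p : nat -> R) (ks : seq nat) :
  stepwise (fun t => [seq p k <= t | k <- ks]).
Proof.
elim: ks => [|k ks IH] /=; first exact: stepwise_cst.
exact: (stepwise_fun (fun q : bool * seq bool => q.1 :: q.2) (stepwise_pair (stepwise_le (p k)) IH)).
Qed.

(* The left endpoints make this the integrand of [rsum]. *)
Definition stepfun (j N : nat) (H : R -> R) (r : R) : R :=
  \sum_(i < N * 2 ^ j) H (i%:R / 2 ^+ j) * \1_(`](i%:R / 2 ^+ j), (i.+1%:R / 2 ^+ j)]%classic) r.

Let cell (j i : nat) (r : R) : R := \1_(`](i%:R / 2 ^+ j), (i.+1%:R / 2 ^+ j)]%classic) r.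

(** The cells partition []0, N]]; written as differences of indicators, they telescope. *)
Let cell_sum j N r : 0 < r -> r <= N%:R -> \sum_(i < N * 2 ^ j) cell j i r = 1.
Proof.
move=> r0 rN; pose u (i : nat) : R := (r <= i%:R / 2 ^+ j)%R%:R.
have cE i : cell j i r = u i.+1 - u i.
  rewrite /cell /u indicE (_ : (r \in _) = (i%:R / 2 ^+ j < r <= i.+1%:R / 2 ^+ j)); last first.
    by apply/idP/idP; rewrite inE /= in_itv.
  have xx : i%:R / 2 ^+ j <= i.+1%:R / 2 ^+ j :> R by rewrite grid_le.
  case: (leP r (i%:R / 2 ^+ j)) => h1 /=.
    by rewrite (le_trans h1 xx) subrr.
  by rewrite subr0.
under eq_bigr do rewrite cE.
rewrite -(big_mkord predT (fun i => u i.+1 - u i)) telescope_sumr //.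
by rewrite /u grid_end rN mul0r leNgt r0 /= subr0.
Qed.

Lemma stepfun_bound j N (H : R -> R) K r : (forall t, 0 <= t -> `|H t| <= K) ->
  0 < r -> r <= N%:R -> `|stepfun j N H r| <= K.
Proof.
move=> HK r0 rN; rewrite /stepfun (le_trans (ler_norm_sum _ _ _)) //.
apply: (@le_trans _ _ (\sum_(i < N * 2 ^ j) K * cell j i r)); last first.
  by rewrite -mulr_sumr cell_sum // mulr1.
apply: ler_sum => i _; rewrite normrM -/(cell j i r) ler_pM // ?HK ?divr_ge0 //.
by rewrite ger0_norm // /cell indicE.
Qed.

Lemma stepfun_const j N (H : R -> R) (s t r : R) : (forall u, s <= u < t -> H u = H s) ->
  0 <= s -> s + (2 ^+ j)^-1 < r -> r < t -> r <= N%:R -> stepfun j N H r = H s.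
Proof.
move=> Hc s0 sr rt rN; have i0 : 0 < ((2 : R) ^+ j)^-1 by rewrite invr_gt0.
have r0 : 0 < r by lra.
transitivity (\sum_(i < N * 2 ^ j) H s * cell j i r); last by rewrite -mulr_sumr cell_sum // mulr1.
rewrite /stepfun; apply: eq_bigr => i _; rewrite /cell indicE.
case: (boolP (r \in _)) => [|_]; last by rewrite !mulr0.
rewrite inE /= in_itv /= => /andP[h1 h2]; congr (_ * _); apply: Hc.
move: h2; rewrite -natr1 mulrDl mul1r => h2; apply/andP; split; lra.
Qed.

Lemma stepfun_measurable j N H : measurable_fun [set: R] (stepfun j N H).
Proof.
rewrite /stepfun; apply: measurable_sum => i; exact: measurable_funM.
Qed.

Section Error.
Context {T : Type}.
Variables (y : R -> T) (H : R -> R) (K : R).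
Hypothesis sy : stepwise y.
Hypothesis HK : forall r, 0 <= r -> `|H r| <= K.
Hypothesis Hy : forall s t, 0 <= s -> s <= t -> (forall u, s <= u < t -> y u = y s) ->
  forall u, s <= u < t -> H u = H s.
Hypothesis mH : measurable_fun [set: R] (fun r => H (Num.max r 0)).

Let sq (j N : nat) (r : R) : \bar R := ((stepfun j N H r - H r) ^+ 2)%:E.

Lemma stepfun_sq_measurable j N (D : set R) : D `<=` `[0, +oo[%classic -> measurable D ->
  measurable_fun D (sq j N).
Proof.
move=> DS mD; apply/measurable_EFinP.
apply: (@eq_measurable_fun _ _ R R D (fun r => (stepfun j N H r - H (Num.max r 0)) ^+ 2)).
  by move=> r; rewrite inE => /DS /=; rewrite in_itv /= andbT => r0; rewrite max_l.
apply: measurable_funTS; apply: measurable_funX; apply: measurable_funB => //.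
exact: stepfun_measurable.
Qed.

(** On a constancy interval the sampled integrand is wrong only during the first mesh width, by at
    most [2 * K]; the squared error is then at most [(2 * K) ^+ 2] times the mesh. *)
Lemma stepfun_error (N : nat) (e : R) : 0 < e -> \forall j \near \oo,
  (\int[mu]_(r in `]0%R, N%:R]) sq j N r <= e%:E)%E.
Proof.
have K0 : 0 <= K by exact: le_trans (HK (lexx 0)).
have sub (s t : R) b1 b2 : 0 <= s -> ([set` Interval (BSide b1 s) (BSide b2 t)] : set R) `<=` `[0, +oo[%classic.
  move=> s0 r /=; rewrite !in_itv /= andbT => /andP[+ _]; case: b1 => /=; first exact: le_trans.
  by move=> sr; exact: ltW (le_lt_trans s0 sr).
have sq0 j r : (0 <= sq j N r)%E by rewrite lee_fin sqr_ge0.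
have P : forall s t, 0 <= s -> s <= t -> t <= N%:R -> forall e, 0 < e -> \forall j \near \oo,
    (\int[mu]_(r in `]s, t]) sq j N r <= e%:E)%E.
  apply: (stepwise_ind sy).
    move=> s u t s0 su ut P1 P2 tN {}e e0; have e2 : 0 < e / 2 by rewrite divr_gt0.
    have u0 := le_trans s0 su.
    apply: filterS2 (P1 (le_trans ut tN) _ e2) (P2 tN _ e2) => j h1 h2.
    have ee : `]s, t]%classic = `]s, u]%classic `|` `]u, t]%classic :> set R.
      apply/seteqP; split => r /=; rewrite !in_itv /=.
        by move=> /andP[sr rt]; case: (leP r u) => h; [left; rewrite sr|right].
      by case=> /andP[h3 h4]; apply/andP; split => //; [exact: le_trans ut|exact: le_lt_trans h3].
    rewrite ee ge0_integral_setU //=; last 2 first.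
    - rewrite -ee; apply: stepfun_sq_measurable => //; exact: sub.
    - apply/disj_setPS => r [] /=; rewrite !in_itv /= => /andP[_ ru] /andP[ur _].
      by move: (le_lt_trans ru ur); rewrite ltxx.
    by rewrite [e]splitr EFinD leeD.
  move=> s t s0 st yc tN {}e e0; have Hc := Hy s0 st yc.
  near=> j; have hj : ((2 : R) ^+ j)^-1 * (2 * K) ^+ 2 <= e.
    have : ((2 : R) ^+ j)^-1 < e / ((2 * K) ^+ 2 + 1).
      near: j; apply: pow2_small; rewrite divr_gt0 //; have := sqr_ge0 (2 * K); lra.
    rewrite ltr_pdivlMr; last by have := sqr_ge0 (2 * K); lra.
    have : 0 < ((2 : R) ^+ j)^-1 by [].
    by lra.
  rewrite -integral_itv_bndo_bndc; last by apply: stepfun_sq_measurable => //; exact: sub.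
  pose E : set R := `]s, (s + (2 ^+ j)^-1)]%classic.
  have mE : measurable E by exact: measurable_itv.
  apply: (@le_trans _ _ (\int[mu]_(r in `]s, t[) (((2 * K) ^+ 2)%:E * (\1_E r)%:E))%E).
    apply: ge0_le_integral => //.
    - by apply: stepfun_sq_measurable => //; exact: sub.
    - by apply: measurable_funeM; apply/measurable_EFinP; exact: measurable_indic.
    move=> r /=; rewrite in_itv /= => /andP[sr rt]; rewrite -EFinM lee_fin indicE.
    case: (leP r (s + (2 ^+ j)^-1)) => h.
      rewrite mem_set /E /= ?in_itv /= ?sr // mulr1 -real_normK ?num_real //.
      rewrite lerXn2r ?nnegrE // ?mulr_ge0 // (le_trans (ler_normB _ _)) //.
      have rr : 0 < r by lra.
      rewrite (_ : 2 * K = K + K); last by ring.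
      by rewrite lerD ?HK ?(ltW rr) // stepfun_bound //; lra.
    rewrite (stepfun_const Hc s0 h rt); last by lra.
    by rewrite Hc ?subrr ?expr0n ?mulr_ge0 ?sqr_ge0 // ltW.
  apply: (@le_trans _ _ (\int[mu]_r (((2 * K) ^+ 2)%:E * (\1_E r)%:E))%E).
    apply: ge0_subset_integral => //.
      by apply: measurable_funeM; apply/measurable_EFinP; exact: measurable_indic.
    by move=> r _; rewrite mule_ge0 // lee_fin ?sqr_ge0.
  rewrite ge0_integralZl_EFin ?sqr_ge0 //; last first.
    by apply/measurable_EFinP; exact: measurable_indic.
  have lE : mu E = ((2 ^+ j)^-1)%:E.
    by rewrite lebesgue_measure_itv /= lte_fin ltrDl invr_gt0 pow2_gt0 -EFinD addrAC subrr add0r.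
  rewrite integral_indic // setIT; change (((2 * K) ^+ 2)%:E * mu E <= e%:E)%E.
  by rewrite lE -EFinM lee_fin mulrC.
by move=> e0; exact: (P 0 N%:R (lexx _) (ler0n _ _) (lexx _) e e0).
Unshelve. all: by end_near. Qed.

End Error.

Section SimpleIncrements.
Variables (p : nat -> R) (K : nat) (w : R -> R) (f : nat -> R).
Hypothesis p_le : forall k, p k <= p k.+1.

(** The cells are closed on the left, unlike those of [sp_fun], so that the integrand is
    right-constant; the two differ at finitely many times only. *)
Definition right_step (u : R) : R := \sum_(k < K) f k * ((p k <= u) && (u < p k.+1))%:R.

Definition step_sum (u : R) : R :=
  \sum_(k < K) f k * (w (Num.min u (p k.+1)) - w (Num.min u (p k))).

Lemma step_sum_const (u v : R) : u <= v ->
  (forall r, u <= r < v -> [seq p k <= r | k <- iota 0 K.+1] = [seq p k <= u | k <- iota 0 K.+1]) ->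
  step_sum v - step_sum u = right_step u * (w v - w u).
Proof.
move=> uv hc; have h k : (k <= K)%N -> p k <= u \/ v <= p k.
  move=> kK; case: (leP (p k) u) => pu; first by left.
  right; rewrite leNgt; apply/negP => pv.
  have := hc (p k); rewrite (ltW pu) pv => /(_ isT)/eq_in_map/(_ k).
  rewrite mem_iota /= add0n ltnS kK lexx => /(_ isT) e.
  by move: pu; rewrite ltNge -e.
have d k : (k <= K)%N -> w (Num.min v (p k)) - w (Num.min u (p k)) = (~~ (p k <= u))%:R * (w v - w u).
  move=> kK; case: (h k kK) => pk.
    by rewrite pk mul0r !min_r ?(le_trans pk) // subrr.
  rewrite !min_l ?(le_trans uv) //.
  case: (leP (p k) u) => pu; last by rewrite mul1r.
  by rewrite mul0r (_ : v = u) ?subrr //; lra.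
rewrite /step_sum /right_step mulr_suml -sumrB; apply: eq_bigr => k _.
rewrite -mulrBr -mulrA; congr (_ * _).
have kK := ltn_ord k.
transitivity ((w (Num.min v (p k.+1)) - w (Num.min u (p k.+1))) - (w (Num.min v (p k)) - w (Num.min u (p k)))).
  by ring.
rewrite (d _ kK) (d _ (ltnW kK)) -mulrBl; congr (_ * _).
have := p_le k; case: (leP (p k) u) => a1; case: (leP (p k.+1) u) => a2 //= a3; rewrite ?subrr ?subr0 //.
by lra.
Qed.

End SimpleIncrements.

End StepIntegrands.

Section ContinuousOnHalfLine.
Context {R : realType}.
Implicit Types f g : R -> R.

Lemma within_comp f g : {within `[0, +oo[, continuous f} -> {within `[0, +oo[, continuous g} ->
  (forall t, 0 <= t -> 0 <= g t) -> {within `[0, +oo[, continuous (fun t => f (g t))}.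
Proof.
move=> cf cg g0; apply: near_within => p e p0 e0.
have [r r0 hr] := within_near cf (g0 p p0) e0.
have [q q0 hq] := within_near cg p0 (divr_gt0 r0 (ltr0n _ 2)).
exists q => // x x0 xp; apply: hr; first exact: g0.
by apply: le_lt_trans (hq x x0 xp) _; lra.
Qed.

Lemma within_min g (y : R) : {within `[0, +oo[, continuous g} ->
  {within `[0, +oo[, continuous (fun t => Num.min (g t) y)}.
Proof.
move=> cg; apply: near_within => p e p0 e0; have [r r0 hr] := within_near cg p0 e0.
exists r => // x x0 xp; have := hr x x0 xp; rewrite !ler_norml => /andP[h1 h2].
by case: (leP (g x) y) => a1; case: (leP (g p) y) => a2; apply/andP; split; lra.
Qed.

Lemma within_sum n (a : nat -> R) (F : nat -> R -> R) :
  (forall i, {within `[0, +oo[, continuous (F i)}) ->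
  {within `[0, +oo[, continuous (fun u => \sum_(i < n) a i * F i u)}.
Proof.
move=> cF; elim: n => [|n IH].
  by apply: near_within => p e p0 e0; exists 1 => // x _ _; rewrite !big_ord0 subrr normr0 ltW.
apply/subspace_continuousP => x hx.
rewrite (_ : (fun u => _) = (fun u => \sum_(i < n) a i * F i u + a n * F n u)); last first.
  by apply/funext => u; rewrite big_ord_recr.
apply: cvgD; first by move/subspace_continuousP: IH => /(_ x hx).
by apply: cvgMr; move: (cF n) => /subspace_continuousP/(_ x hx).
Qed.

Lemma within_sub f g : {within `[0, +oo[, continuous f} -> {within `[0, +oo[, continuous g} ->
  {within `[0, +oo[, continuous (fun u => f u - g u)}.
Proof.
move=> /subspace_continuousP cf /subspace_continuousP cg; apply/subspace_continuousP => x hx.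
by apply: cvgB; [exact: cf|exact: cg].
Qed.

Lemma within_id : {within `[0, +oo[, continuous (fun u : R => u)}.
Proof.
apply: near_within => p e p0 e0; exists e => // x _ h; exact: ltW.
Qed.

Lemma within_stop f (y : R) : 0 <= y -> {within `[0, +oo[, continuous f} ->
  {within `[0, +oo[, continuous (fun t => f (Num.min t y))}.
Proof.
move=> y0 cf; apply: (@within_comp f (fun t => Num.min t y) cf) => [|t t0]; last by rewrite le_min t0.
exact: (@within_min (fun u => u) y within_id).
Qed.

(** A bound on a whole interval is reduced to countably many times, which makes the events below
    measurable. *)
Lemma within_dyadic f (N e : R) : {within `[0, +oo[, continuous f} ->
  (forall k i : nat, i%:R / 2 ^+ k <= N -> `|f (i%:R / 2 ^+ k)| <= e) ->
  forall u, 0 <= u <= N -> `|f u| <= e.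
Proof.
move=> cf hf u /andP[u0 uN]; apply/ler_addgt0Pr => q q0.
have [r r0 hr] := within_near cf u0 q0.
have [k _ hk] := pow2_small r0; have := hk k (leqnn k) => {}hk.
have g0 := gdn_ge0 k u; have g1 := gdn_le k u0; have g2 := gup_gt k u; rewrite gupE in g2.
have := hr (gdn k u) g0 _; rewrite ler0_norm; last lra.
move=> /(_ ltac:(lra)) h; rewrite -(subrK (f (gdn k u)) (f u)) (le_trans (ler_normD _ _)) //.
by rewrite addrC lerD // 1?distrC //; apply: hf; exact: le_trans uN.
Qed.

End ContinuousOnHalfLine.

(** * Brownian motion and Ito equation after the time change *)

Section TimeChange.
Context {R : realType} {d1 d2 : measure_display}.
Context {O1 : measurableType d1} {O2 : measurableType d2}.
Variables (P1 : probability O1 R) (P2 : probability O2 R).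
Variables (F1 : R -> set (set O1)) (W : R -> O1 -> R).
Hypotheses (fF1 : filtration F1) (bW : brownian_motion P1 F1 W).
Hypothesis W_reg : forall w, W 0 w = 0 /\ {within `[0, +oo[, continuous (W ^~ w)}.
Variables (c C : R) (Y2 : R -> O2 -> R) (V : set O2).
Hypotheses (c0 : 0 < c) (cC : c <= C) (gY : gproc c C Y2).
Hypotheses (mV : measurable V) (PV : P2 V = 1%E) (stV : forall w, V w -> stepwise (Y2 ^~ w)).

Notation T := (O1 * O2)%type.
Notation Pr := (P1 \x P2)%E.

Let m t w := mclock (Y2 ^~ w) t.
Let gYw w : gpath c C (Y2 ^~ w). Proof. exact: (proj1 gY w). Qed.
Let c2 : 0 < c ^+ 2. Proof. exact: exprn_gt0. Qed.
Let C0 : 0 < C. Proof. exact: lt_le_trans cC. Qed.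
Let bm w : bilip (c ^+ 2) (C ^+ 2) (m ^~ w). Proof. exact (mclock_bilip c0 cC (gYw w)). Qed.
Let m_ge0 t w : 0 <= t -> 0 <= m t w. Proof. exact: bilip_ge0 c2 (bm w). Qed.
Let m_le s t w : 0 <= s -> s <= t -> m s w <= m t w.
Proof. by move=> s0 st; rewrite (bilip_le c2 (bm w)) // (le_trans s0). Qed.
Let Y_gt0 t w : 0 <= t -> 0 < Y2 t w.
Proof. by move=> t0; have /andP[h _] := proj2 (gYw w) t t0; exact: lt_le_trans h. Qed.
Let sF t : 0 <= t -> sigma_algebra [set: O1] (F1 t). Proof. by case: fF1 => h _ _; exact: h. Qed.
Let mF t : 0 <= t -> F1 t `<=` measurable. Proof. by case: fF1 => _ h _; exact: h. Qed.
Let incF s t : 0 <= s -> s <= t -> F1 s `<=` F1 t. Proof. by case: fF1 => _ _ h; exact: h. Qed.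
Let aW : adapted F1 W. Proof. by case: bW. Qed.

Lemma ysectionE {T1 T2 : Type} (A : set (T1 * T2)) (y : T2) : ysection A y = [set x | A (x, y)].
Proof. by apply/seteqP; split => x; rewrite /ysection /= inE. Qed.

(* At time [t] the chain is known for ever, and the driving space up to the clock. *)
Definition tcF (t : R) : set (set T) :=
  [set A | measurable A /\ forall w2, F1 (m t w2) [set w1 | A (w1, w2)]].

Lemma tcF_filtration : filtration tcF.
Proof.
split.
- move=> t t0; split.
  + split => // w2; have [h _ _] := sF (m_ge0 w2 t0); exact: h.
  + move=> A [mA hA]; rewrite setTD; split; first exact: measurableC.
    by move=> w2; exact: sigma_algebra_C (sF (m_ge0 w2 t0)) (hA w2).
  + move=> A hA; split; first by apply: bigcupT_measurable => n; have [] := hA n.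
    move=> w2; have [_ _ h] := sF (m_ge0 w2 t0).
    by apply: (h (fun n => [set w1 | A n (w1, w2)])) => n; have [_] := hA n; exact.
- by move=> t t0 A [].
- move=> s t s0 st A [mA hA]; split => // w2; apply: incF (hA w2); first exact: m_ge0.
  exact: m_le.
Qed.

Lemma tcF_submeasurable {dE : measure_display} {E : measurableType dE} (t : R) (f : T -> E) :
  0 <= t -> measurable_fun [set: T] f ->
  (forall w2, submeasurable (F1 (m t w2)) (fun w1 => f (w1, w2))) -> submeasurable (tcF t) f.
Proof.
move=> t0 mf hf D mD; split; first by have := mf measurableT D mD; rewrite setTI.
by move=> w2; exact: hf.
Qed.

Lemma jmeas_fst {dE : measure_display} {E : measurableType dE} (Z : R -> O1 -> E) :
  jmeas Z -> jmeas (fun t (w : T) => Z t w.1).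
Proof.
move=> jZ; have h : measurable_fun [set: R * T] (fun p : R * T => (p.1, p.2.1)).
  apply: measurable_fun_pair; first exact: measurable_fst.
  exact: measurableT_comp measurable_fst measurable_snd.
exact: measurableT_comp jZ h.
Qed.

Lemma gproc_snd : gproc c C (fun t (w : T) => Y2 t w.2).
Proof.
split=> [w|t t0]; first exact: gYw.
exact: (measurableT_comp (proj2 gY t t0) measurable_snd).
Qed.

Lemma jmeas_clocked {dE : measure_display} {E : measurableType dE} (Z : R -> O1 -> E) :
  jmeas Z -> jmeas (fun t (w : T) => Z (m t w.2) w.1).
Proof.
move=> jZ; apply: (jmeas_comp (jmeas_fst jZ) (jmeas_mclock c0 cC gproc_snd)) => t w t0.
exact: m_ge0.
Qed.

Lemma adapted_clocked (Z : R -> O1 -> R) : right_continuous_paths Z -> adapted F1 Z ->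
  adapted tcF (fun t (w : T) => Z (m t w.2) w.1).
Proof.
move=> rZ aZ t t0; apply: tcF_submeasurable => // [|w2]; last exact: aZ (m_ge0 w2 t0).
apply: jmeas_section t0 (jmeas_clocked _).
by apply: jmeas_right_continuous => // s s0; exact: bm_measurable fF1 aZ s0.
Qed.

Lemma adapted_chain t : 0 <= t -> forall s, 0 <= s -> submeasurable (tcF t) (fun w : T => Y2 s w.2).
Proof.
move=> t0 s s0; apply: tcF_submeasurable => // [|w2 D mD].
  exact: (measurableT_comp (proj2 gY s s0) measurable_snd).
have sG := sF (m_ge0 w2 t0).
have [h|h] := pselect (D (Y2 s w2)).
  by rewrite (_ : _ @^-1` _ = setT); [exact: sigma_algebra_T sG|apply/seteqP; split].
by rewrite (_ : _ @^-1` _ = set0); [case: sG|apply/seteqP; split].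
Qed.

Let W_rc : right_continuous_paths W.
Proof.
move=> w t t0; apply/cvgrPdist_le => e e0; have [r r0 hr] := within_near (proj2 (W_reg w)) t0 e0.
near=> x; rewrite distrC; have tx : t < x by near: x; exact: nbhs_right_gt.
apply: hr; first by rewrite ltW // (le_lt_trans t0).
rewrite ger0_norm ?subr_ge0 ?ltW // ltrBlDl; near: x; apply: nbhs_right_lt.
by rewrite ltrDl.
Unshelve. all: by end_near. Qed.

Let jW : jmeas W.
Proof. by apply: jmeas_right_continuous => // s s0; exact: bm_measurable fF1 aW s0. Qed.

Let b (w : T) t := W (m t w.2) w.1.
Let H (w : T) t := (Y2 t w.2)^-1.

(** The Brownian motion of the new model: [G] in the clock follows [dX = a(X) dW_m], and
    [dW_m = Y dB] forces [dB = Y^-1 dW_m]. Off [V], where the chain path need not be a step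
    function, the value is set to 0. *)
Definition tcB (t : R) (w : T) : R := if w.2 \in V then pathint (H w) (b w) t else 0.

Let cb w : {within `[0, +oo[, continuous (b w)}.
Proof.
apply: near_within => p e p0 e0.
have [r r0 hr] := within_near (proj2 (W_reg w.1)) (m_ge0 w.2 p0) e0.
have [r' r'0 hr'] := within_near (bilip_continuous c2 (bm w.2)) p0 (divr_gt0 r0 (ltr0n _ 2)).
exists r' => // x x0 xp; apply: hr; first exact: m_ge0.
by apply: le_lt_trans (hr' x x0 xp) _; lra.
Qed.

Let HK w r : 0 <= r -> `|H w r| <= c^-1.
Proof.
move=> r0; have h := Y_gt0 w.2 r0; have /andP[h1 _] := proj2 (gYw w.2) r r0.
by rewrite /H gtr0_norm ?invr_gt0 // lef_pV2.
Qed.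

Let HY w (s t : R) : 0 <= s -> s <= t -> (forall u, s <= u < t -> Y2 u w.2 = Y2 s w.2) ->
  forall u, s <= u < t -> H w u = H w s.
Proof. by move=> s0 st h u hu; rewrite /H h. Qed.

Lemma mclock_const (y : R -> R) (s t : R) : gpath c C y -> 0 <= s -> s <= t ->
  (forall u, s <= u < t -> y u = y s) -> mclock y t - mclock y s = y s ^+ 2 * (t - s).
Proof.
move=> gy s0 st yc; have := clock_int_itv (ltW c2) (gpath_sq_rate c0 cC gy) s0 st.
rewrite -integral_itv_bndo_bndc; last first.
  apply: (rateS (gpath_sq_rate c0 cC gy)) => // u /=; rewrite !in_itv /= andbT => /andP[su _].
  exact: ltW (le_lt_trans s0 su).
rewrite (eq_integral (fun=> (y s ^+ 2)%:E)); last first.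
  by move=> u; rewrite inE /= in_itv /= => /andP[su ut]; rewrite yc // ltW.
rewrite integral_cst //= lebesgue_measure_itv /= lte_fin.
move: st; rewrite le_eqVlt => /predU1P[<-|->]; first by rewrite !subrr mulr0.
by rewrite -EFinD -EFinM => -[->].
Qed.

Lemma tcB0 w : tcB 0 w = 0.
Proof. by rewrite /tcB pathint0; case: ifP. Qed.

Lemma tcB_const w (s t : R) : V w.2 -> 0 <= s -> s <= t ->
  (forall u, s <= u < t -> Y2 u w.2 = Y2 s w.2) ->
  tcB t w - tcB s w = H w s * (b w t - b w s).
Proof.
move=> Vw s0 st yc; rewrite /tcB mem_set //.
exact: (pathint_const (y := Y2 ^~ w.2) (H := H w) (b := b w) (K := c^-1) (stV Vw) (@cb w) (@HK w) (@HY w) s0 st yc).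
Qed.

Lemma tcB_continuous w : {within `[0, +oo[, continuous (fun t => tcB t w)}.
Proof.
have [Vw|nV] := pselect (V w.2).
  have := pathint_continuous (y := Y2 ^~ w.2) (H := H w) (b := b w) (K := c^-1) (stV Vw) (@cb w) (@HK w) (@HY w).
  by rewrite /tcB mem_set.
rewrite /tcB memNset //; apply: near_within => p e p0 e0; exists 1 => // x _ _.
by rewrite subrr normr0 ltW.
Qed.

Let rs (j : nat) (t : R) (w : T) : R :=
  if w.2 \in V then rsum j (Num.trunc t).+1 (H w) (b w) t else 0.

Let rs_cvg t w : 0 <= t -> rs j t w @[j --> \oo] --> tcB t w.
Proof.
move=> t0; rewrite /rs /tcB; case: (boolP (w.2 \in V)) => [|_]; last exact: cvg_cst.
rewrite inE => Vw.
exact: (pathintE (y := Y2 ^~ w.2) (H := H w) (b := b w) (K := c^-1) (stV Vw) (@cb w) (@HK w) (@HY w) t0 (ltW (truncnS_gt t))).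
Qed.

Let mgrid (j i : nat) : 0 <= (i%:R / 2 ^+ j : R). Proof. by rewrite divr_ge0 // ltW. Qed.

Let mb t : 0 <= t -> measurable_fun [set: T] (fun w => b w t).
Proof. by move=> t0; exact: jmeas_section t0 (jmeas_clocked jW). Qed.

Let mH t : 0 <= t -> measurable_fun [set: T] (fun w => H w t).
Proof.
move=> t0; have h := proj2 gproc_snd t t0.
rewrite (_ : (fun w => H w t) = fun w : T => ((fun w : T => Num.max (Y2 t w.2) c) w)^-1).
  apply: measurable_inv_gt0; first by move=> w; rewrite lt_max c0 orbT.
  exact: measurable_maxr.
by apply/funext => w; rewrite /H max_l //; have /andP[] := proj2 (gYw w.2) t t0.
Qed.

Lemma tcB_measurable t : 0 <= t -> measurable_fun [set: T] (tcB t).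
Proof.
move=> t0; apply: (measurable_fun_cvg (h := fun j => rs j t)) => [j|w _]; last exact: rs_cvg.
rewrite (_ : rs j t = fun w => rsum j (Num.trunc t).+1 (H w) (b w) t * \1_(setT `*` V) w).
  apply: measurable_funM; last by apply: measurable_indic; exact: measurableX.
  rewrite /rsum; apply: measurable_sum => i; apply: measurable_funM; first exact: mH.
  by apply: measurable_funB; apply: mb; rewrite le_min t0 mgrid.
apply/funext => w; rewrite /rs indicE.
rewrite (_ : (w \in setT `*` V) = (w.2 \in V)); last by apply/idP/idP; rewrite !inE => // -[].
by case: (w.2 \in V); rewrite ?mulr1 ?mulr0.
Qed.

Lemma tcB_section t w2 : 0 <= t -> submeasurable (F1 (m t w2)) (fun w1 => tcB t (w1, w2)).
Proof.
move=> t0; have sG := sF (m_ge0 w2 t0); apply/(submeasurableP _ sG).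
apply: (measurable_fun_cvg (h := fun j (w1 : g_sigma_algebraType (F1 (m t w2))) => rs j t (w1, w2))) => [j|w _]; last exact: rs_cvg.
rewrite /rs /=; case: (w2 \in V); last exact: measurable_cst.
have mbs r : 0 <= r -> r <= t -> measurable_fun [set: g_sigma_algebraType (F1 (m t w2))] (fun w1 => b (w1, w2) r).
  move=> r0 rt; apply/(submeasurableP _ sG) => D mD.
  by apply: (incF (m_ge0 w2 r0) (m_le w2 r0 rt)); exact: aW (m_ge0 w2 r0) _ mD.
rewrite /rsum; apply: measurable_sum => i; apply: measurable_funM.
  by rewrite /H /=; exact: measurable_cst.
by apply: measurable_funB; apply: mbs; rewrite ?le_min ?t0 ?mgrid // ge_min lexx.
Qed.

Lemma tcB_adapted : adapted tcF tcB.
Proof.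
move=> t t0; apply: tcF_submeasurable => // [|w2]; first exact: tcB_measurable.
exact: tcB_section.
Qed.

(** For a fixed chain path: while the chain is constant the increment is a scaled increment of [W],
    with variance the elapsed time since [m] grows at speed [Y ^ 2]; convolution glues consecutive
    intervals. *)
Lemma tcB_gaussian w2 (s t : R) : V w2 -> 0 <= s -> s < t ->
  gaussian_given P1 (F1 (m s w2)) (fun w1 => tcB t (w1, w2) - tcB s (w1, w2)) (t - s).
Proof.
move=> Vw s0 st; move: (st); pose G u v := u < v ->
  gaussian_given P1 (F1 (m u w2)) (fun w1 => tcB v (w1, w2) - tcB u (w1, w2)) (v - u).
have msec v : 0 <= v -> measurable_fun [set: O1] (fun w1 => tcB v (w1, w2)).
  by move=> v0 _ D mD; rewrite setTI; apply: (mF (m_ge0 w2 v0)); exact: tcB_section.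
apply: (@stepwise_ind _ _ _ G (stV Vw) _ _ s t s0 (ltW st)).
- move=> u v r u0 uv vr G1 G2 ur.
  move: (uv); rewrite le_eqVlt => /predU1P[e|uv']; first by rewrite e in G2 ur *; exact: G2.
  move: (vr); rewrite le_eqVlt => /predU1P[e|vr']; first by rewrite -e in ur *; exact: G1.
  have v0 := le_trans u0 uv; have r0 := le_trans v0 vr.
  have -> : (fun w1 => tcB r (w1, w2) - tcB u (w1, w2)) =
      (fun w1 => tcB v (w1, w2) - tcB u (w1, w2)) \+ (fun w1 => tcB r (w1, w2) - tcB v (w1, w2)).
    by apply/funext => w1 /=; ring.
  have -> : r - u = (v - u) + (r - v) by ring.
  apply: (gaussian_given_add (G' := F1 (m v w2))) => //.
  + by move=> D mD; apply: (bm_sum_law fF1 bW) => //; rewrite subr_gt0.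
  + exact: sF (m_ge0 w2 v0).
  + exact: mF (m_ge0 w2 v0).
  + exact: incF (m_ge0 w2 u0) (m_le w2 u0 uv).
  + have sG := sF (m_ge0 w2 v0); apply/(submeasurableP _ sG); apply: measurable_funB.
      by apply/(submeasurableP _ sG); exact: tcB_section.
    apply/(submeasurableP _ sG) => D mD; apply: (incF (m_ge0 w2 u0) (m_le w2 u0 uv)).
    exact: tcB_section.
  + by apply: measurable_funB; exact: msec.
  + exact: G1.
  + exact: G2.
- move=> u v u0 uv yc uv'; have Yu := Y_gt0 w2 u0; have v0 := le_trans u0 uv.
  have mm : m u w2 < m v w2 by rewrite (bilip_lt c2 (bm w2)).
  have mc := mclock_const (gYw w2) u0 uv yc.
  have -> : (fun w1 => tcB v (w1, w2) - tcB u (w1, w2)) =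
      (fun w1 => (Y2 u w2)^-1 * (W (m v w2) w1 - W (m u w2) w1)).
    by apply/funext => w1; rewrite (@tcB_const (w1, w2) u v Vw u0 uv yc).
  have -> : v - u = (Y2 u w2)^-1 ^+ 2 * (m v w2 - m u w2).
    by rewrite /m mc; field; rewrite gt_eqF.
  apply: gaussian_given_scale; rewrite ?invr_gt0 ?subr_gt0 //.
  exact: bm_gaussian bW (m_ge0 w2 u0) mm.
Qed.

Lemma tcB_brownian : brownian_motion Pr tcF tcB.
Proof.
split; first exact: tcB_adapted.
- by apply: aeW => w; rewrite tcB0.
- by apply: aeW => w; exact: tcB_continuous.
move=> s t s0 st A [mA hA] D mD; have t0 := ltW (le_lt_trans s0 st).
have mE : measurable (A `&` [set w | D (tcB t w - tcB s w)]).
  apply: measurableI => //; have h := measurable_funB (tcB_measurable t0) (tcB_measurable s0).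
  by have := h measurableT D mD; rewrite setTI.
pose U : set T := setT `*` V.
have mU : measurable U by exact: measurableX.
have PU : Pr U = 1%E.
  have -> : Pr U = (P1 setT * P2 V)%E by exact: product_measure1E.
  by rewrite PV probability_setT mul1e.
have offU (E : set T) : measurable E -> Pr E = Pr (E `&` U).
  by move=> mE'; rewrite (prob_setI1 mE' mU PU).
change (Pr (A `&` [set w | D (tcB t w - tcB s w)]) = (Pr A * normal_prob 0 (Num.sqrt (t - s)) D)%E).
rewrite (offU _ mE) (offU _ mA).
have fN : normal_prob 0 (Num.sqrt (t - s)) D = (fine (normal_prob 0 (Num.sqrt (t - s)) D))%:E.
  rewrite fineK //; exact: (fin_num_measure (normal_prob 0 (Num.sqrt (t - s)) : probability (measurableTypeR R) R)).
rewrite fN; apply: prod_ysection_scale.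
- by rewrite fine_ge0 //; exact: (measure_ge0 (normal_prob 0 (Num.sqrt (t - s)) : probability (measurableTypeR R) R)).
- exact: measurableI.
- exact: measurableI.
move=> w2; rewrite !ysectionE; have [Vw|nV] := pselect (V w2); last first.
  have -> : [set x | (A `&` [set w | D (tcB t w - tcB s w)] `&` U) (x, w2)] = set0.
    by apply/seteqP; split => // x [_ []].
  have -> : [set x | (A `&` U) (x, w2)] = set0 by apply/seteqP; split => // x [_ []].
  by rewrite measure0 mul0e.
have -> : [set x | (A `&` [set w | D (tcB t w - tcB s w)] `&` U) (x, w2)] =
    [set w1 | A (w1, w2)] `&` (fun w1 => tcB t (w1, w2) - tcB s (w1, w2)) @^-1` D.
  by apply/seteqP; split => x /=; [case=> -[]|case=> h1 h2; split => //; split].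
have -> : [set x | (A `&` U) (x, w2)] = [set w1 | A (w1, w2)].
  by apply/seteqP; split => x /=; [case|move=> h; split => //; split].
by rewrite (tcB_gaussian Vw s0 st (hA w2) mD) fN.
Qed.

(** The whole chain is known to [tcF] at time 0. *)
Lemma tcB_independent : independent_processes Pr tcB (fun t (w : T) => Y2 t w.2).
Proof.
move=> A D gA gD; rewrite setIC muleC.
apply: (bm_independent tcF_filtration tcB_brownian _ gA).
apply: generated_sub gD; first by have [h _ _] := tcF_filtration; exact: h.
by move=> t; rewrite /= in_itv /= andbT; exact: adapted_chain.
Qed.

Notation mu := (@lebesgue_measure R).

Let bmY w t : 0 <= t -> c <= Y2 t w <= C. Proof. exact: (proj2 (gYw w)). Qed.

Let jm : jmeas (fun t (w : T) => m t w.2). Proof. exact: (jmeas_mclock c0 cC gproc_snd). Qed.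

Let jY : jmeas (fun t (w : T) => Y2 t w.2). Proof. exact: gproc_jmeas gproc_snd. Qed.

Lemma jmeas_path (U : R -> T -> R) w : jmeas U -> measurable_fun [set: R] (fun r => U (Num.max r 0) w).
Proof. by move=> jU; exact: (measurableT_comp jU (measurable_pair2 w)). Qed.

Lemma measurable_int_sq (U : R -> T -> R) (N : R) : jmeas U ->
  measurable_fun [set: T] (fun w => \int[mu]_(r in `]0%R, N]) (U r w ^+ 2)%:E)%E.
Proof.
move=> jU; pose h (p : R * T) := ((U (Num.max p.1 0) p.2) ^+ 2 * \1_(`]0%R, N]) p.1)%:E.
have mh : measurable_fun [set: R * T] h.
  apply/measurable_EFinP; apply: measurable_funM; first exact: measurable_funX.
  by apply: measurableT_comp => //; exact: measurable_fst.
have h0 p : (0 <= h p)%E by rewrite lee_fin mulr_ge0 // ?sqr_ge0 // indicE.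
have H2 : measurable_fun [set: T] (fun w => \int[mu]_s h (s, w))%E.
  exact: (measurable_fun_fubini_tonelli_G (m1 := mu) h mh h0).
apply: (eq_measurable_fun _ _ H2) => w _; rewrite [RHS]integral_mkcond.
apply: eq_integral => s _; rewrite /h /patch indicE /=.
case: ifPn; rewrite ?mulr0 // mulr1 inE /= in_itv /= => /andP[s0 _].
by rewrite max_l // ltW.
Qed.

Section OneSimple.
Variables (F0 : R -> set (set O1)) (h : simple_process F0).
Hypothesis F0F1 : forall t, 0 <= t -> F0 t `<=` F1 t.

Notation sz := (sp_size h).
Notation tk := (sp_time h).
Notation co := (sp_coef h).

Let co_meas k t : tk k <= t -> submeasurable (F1 t) (co k).
Proof.
move=> kt D mD; have k0 := sp_time_ge0 h k; apply: (incF k0 kt); apply: F0F1 => //.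
exact: (sp_coef_measurable h).
Qed.

Let mco k : measurable_fun [set: O1] (co k).
Proof.
move=> _ D mD; rewrite setTI; apply: (mF (sp_time_ge0 h k)).
exact: (co_meas (lexx _) mD).
Qed.

Let hp (u : R) (w1 : O1) : R := right_step tk sz (co ^~ w1) u.

Let hp_bound : exists2 K, 0 <= K & forall u w1, `|hp u w1| <= K.
Proof.
have [K0 hK] := sp_coef_bounded h; pose K := Num.max K0 0.
exists (sz%:R * K); first by rewrite mulr_ge0 // le_max lexx orbT.
move=> u w1; rewrite /hp /right_step (le_trans (ler_norm_sum _ _ _)) //.
apply: (@le_trans _ _ (\sum_(k < sz) K)); last by rewrite sumr_const card_ord mulr_natl.
apply: ler_sum => k _; rewrite normrM; have h1 : `|co k w1| <= K by rewrite /K le_max hK.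
have K00 : 0 <= K by rewrite /K le_max lexx orbT.
by case: (tk k <= u < tk k.+1)%R; rewrite ?normr1 ?normr0 ?mulr1 ?mulr0.
Qed.

Let Hs (w : T) (t : R) : R := hp (m t w.2) w.1 * Y2 t w.2.

Let Hs_bound : exists2 K, 0 <= K & forall w r, 0 <= r -> `|Hs w r| <= K.
Proof.
have [K K0 hK] := hp_bound; exists (K * C); first by rewrite mulr_ge0 // ltW.
move=> w r r0; rewrite /Hs normrM ler_pM //.
by have /andP[_ h2] := bmY w.2 r0; rewrite gtr0_norm // Y_gt0.
Qed.

Let jHs : jmeas (fun t w => Hs w t).
Proof.
apply: measurable_funM => //; rewrite /hp /right_step; apply: measurable_sum => k.
apply: measurable_funM.
  exact: (measurableT_comp (mco k) (measurableT_comp measurable_fst measurable_snd)).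
rewrite (_ : (fun p => _) = (fun p : R * T => \1_(`[tk k, tk k.+1[%classic) (m (Num.max p.1 0) p.2.2))).
  by apply: measurableT_comp => //; exact: jm.
apply/funext => p; rewrite indicE; congr ((nat_of_bool _)%:R).
by apply/idP/idP; rewrite inE /= in_itv.
Qed.

Let mHs t : 0 <= t -> measurable_fun [set: T] (fun w => Hs w t).
Proof. by move=> t0; exact: (jmeas_section t0 jHs). Qed.

Let Hs_sub t : 0 <= t -> submeasurable (tcF t) (fun w => Hs w t).
Proof.
move=> t0; apply: tcF_submeasurable => // [|w2]; first exact: mHs.
have sG := sF (m_ge0 w2 t0); apply/(submeasurableP _ sG).
rewrite /Hs /=; apply: measurable_funM; last exact: measurable_cst.
rewrite /hp /right_step; apply: measurable_sum => k.
case: (leP (tk k) (m t w2)) => kt /=.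
  apply: measurable_funM; last exact: measurable_cst.
  by apply/(submeasurableP _ sG); exact: co_meas.
rewrite (_ : (fun w1 => _) = cst 0); first exact: measurable_cst.
by apply/funext => w1; rewrite mulr0.
Qed.

Let J (w : T) (t : R) : R := sp_integral h W (m t w.2) w.1.

Let mJ t : 0 <= t -> measurable_fun [set: T] (fun w => J w t).
Proof.
move=> t0; rewrite /J /sp_integral; apply: measurable_sum => k.
apply: measurable_funM; first exact: (measurableT_comp (mco k) measurable_fst).
have mW x : 0 <= x -> measurable_fun [set: T] (fun w : T => W (Num.min (m t w.2) x) w.1).
  move=> x0; apply: (jmeas_random (jmeas_fst jW)) => [|w]; last by rewrite le_min m_ge0.
  by apply: measurable_minr => //; exact: jmeas_section t0 jm.
by apply: measurable_funB; apply: mW; exact: sp_time_ge0.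
Qed.

Let marks (w : T) (t : R) := (Y2 t w.2, [seq tk k <= m t w.2 | k <- iota 0 sz.+1]).

Let marks_stepwise w : V w.2 -> stepwise (marks w).
Proof.
move=> Vw; apply: stepwise_pair; first exact: stV.
have C2 : 0 < C ^+ 2 by rewrite exprn_gt0.
exact: (stepwise_comp c2 C2 (bm w.2) (stepwise_marks tk (iota 0 sz.+1))).
Qed.

Let marksE w (s t : R) : 0 <= s -> s <= t -> (forall u, s <= u < t -> marks w u = marks w s) ->
  (forall u, s <= u < t -> Y2 u w.2 = Y2 s w.2) /\
  (forall r, m s w.2 <= r < m t w.2 -> [seq tk k <= r | k <- iota 0 sz.+1] =
     [seq tk k <= m s w.2 | k <- iota 0 sz.+1]).
Proof.
move=> s0 st hc; split=> [u /hc[] //|r /andP[r1 r2]].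
have r0 : 0 <= r by apply: le_trans r1; exact: m_ge0.
have [p0 pe] := pinv_spec c2 (bm w.2) r0.
have t0 := le_trans s0 st.
have : s <= pinv (m ^~ w.2) r < t.
  by rewrite -(bilip_le c2 (bm w.2)) // -(bilip_lt c2 (bm w.2)) // pe r1.
by move=> /hc e; move: (congr1 snd e); rewrite /marks; cbn [snd]; rewrite pe.
Qed.

Let marks_Hs w (s t : R) : 0 <= s -> s <= t -> (forall u, s <= u < t -> marks w u = marks w s) ->
  forall u, s <= u < t -> Hs w u = Hs w s.
Proof.
move=> s0 st hc u hu; have [h1 _] := marksE s0 st hc; rewrite /Hs (h1 u hu); congr (_ * _).
have := congr1 snd (hc u hu); rewrite /marks; cbn [snd]; move=> e; rewrite /hp /right_step; apply: eq_bigr => k _.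
have f (i : nat) : (i <= sz)%N -> (tk i <= m u w.2) = (tk i <= m s w.2).
  by move=> iz; move/eq_in_map: e => /(_ i); rewrite mem_iota /= add0n ltnS iz => /(_ isT).
by have kz := ltn_ord k; rewrite !(ltNge _ (tk _)) !f // ltnW.
Qed.

Let marks_J w (s t : R) : V w.2 -> 0 <= s -> s <= t -> (forall u, s <= u < t -> marks w u = marks w s) ->
  J w t - J w s = Hs w s * (tcB t w - tcB s w).
Proof.
move=> Vw s0 st hc; have [h1 h2] := marksE s0 st hc.
rewrite (tcB_const Vw s0 st h1).
have := @step_sum_const R tk sz (W ^~ w.1) (co ^~ w.1) (sp_time_le h) _ _ (m_le w.2 s0 st) h2.
rewrite /J /sp_integral -/(step_sum _ _ _ _ _) => e.
have Ys := Y_gt0 w.2 s0.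
transitivity (hp (m s w.2) w.1 * (W (m t w.2) w.1 - W (m s w.2) w.1)); first exact: e.
by rewrite /Hs /b /H; field; rewrite gt_eqF.
Qed.

Let J0 w : J w 0 = 0.
Proof.
rewrite /J /sp_integral big1 // => k _; have -> : m 0 w.2 = 0 by exact: (proj1 (bm w.2)).
by rewrite !min_l ?sp_time_ge0 // subrr mulr0.
Qed.

Let Kcoef (j : nat) (i : nat) (w : T) : R := Hs w (i%:R / 2 ^+ j).

Let Kp_le (j k : nat) : k%:R / 2 ^+ j <= k.+1%:R / 2 ^+ j :> R.
Proof. by rewrite grid_le. Qed.

Let Kp_bounded j : exists K : R, forall k w, `|Kcoef j k w| <= K.
Proof. by have [K _ hK] := Hs_bound; exists K => k w; exact: hK. Qed.

Let Kp_sub j k : submeasurable (tcF (k%:R / 2 ^+ j)) (Kcoef j k).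
Proof. exact: Hs_sub. Qed.

(** In the new clock the jump times of [h] depend on the chain, while a simple process has
    deterministic times; the integrand is therefore sampled on a dyadic grid. Its integral against
    [tcB] is a Riemann sum. *)
Definition clocked_simple (j N : nat) : simple_process tcF :=
  @SimpleProcess R _ T tcF (N * 2 ^ j) (fun k => k%:R / 2 ^+ j) (Kcoef j)
    (mgrid j) (Kp_le j) (Kp_bounded j) (Kp_sub j).

Let Kp_integral j N w t : sp_integral (clocked_simple j N) tcB t w = rsum j N (Hs w) (tcB ^~ w) t.
Proof. by []. Qed.

Let wc_b w1 x : {within `[0, +oo[, continuous (fun u => W (Num.min u x) w1)}.
Proof.
have [x0|x0] := leP 0 x; last first.
  apply: near_within => p e p0 e0; exists 1 => // y y0 _; rewrite !min_r ?subrr ?normr0 ?(ltW e0) //.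
    exact: ltW (lt_le_trans x0 p0).
  exact: ltW (lt_le_trans x0 y0).
exact: (@within_stop R (W ^~ w1) x x0 (proj2 (W_reg w1))).
Qed.

Let wc_J w : {within `[0, +oo[, continuous (J w)}.
Proof.
have cm : {within `[0, +oo[, continuous (m ^~ w.2)} by exact: bilip_continuous c2 (bm w.2).
apply: (@within_comp R (fun u => sp_integral h W u w.1) (m ^~ w.2)) => //; last by move=> t; exact: m_ge0.
apply: (@within_sum R sz (co ^~ w.1) (fun k u => W (Num.min u (tk k.+1)) w.1 - W (Num.min u (tk k)) w.1)).
by move=> k; apply: within_sub; exact: wc_b.
Qed.

Let wc_rsum j N w : {within `[0, +oo[, continuous (rsum j N (Hs w) (tcB ^~ w))}.
Proof.
apply: (@within_sum R (N * 2 ^ j) (fun i => Hs w (i%:R / 2 ^+ j))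
  (fun i u => tcB (Num.min u (i.+1%:R / 2 ^+ j)) w - tcB (Num.min u (i%:R / 2 ^+ j)) w)) => i.
by apply: within_sub; apply: (@within_stop R (tcB ^~ w)) => //; exact: tcB_continuous.
Qed.

Let mrsum j N t : 0 <= t -> measurable_fun [set: T] (fun w => rsum j N (Hs w) (tcB ^~ w) t).
Proof.
move=> t0; rewrite /rsum; apply: measurable_sum => i; apply: measurable_funM; first exact: mHs.
by apply: measurable_funB; apply: tcB_measurable; rewrite le_min t0 mgrid.
Qed.

Let jerr j N : jmeas (fun r (w : T) => stepfun j N (Hs w) r - Hs w r).
Proof.
apply: measurable_funB => //; rewrite /stepfun; apply: measurable_sum => i; apply: measurable_funM.
  by apply: (measurableT_comp (mHs (mgrid _ _))); exact: measurable_snd.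
apply: (@measurableT_comp _ _ _ _ _ _ (\1_(`](i%:R / 2 ^+ j), (i.+1%:R / 2 ^+ j)]%classic) : R -> R)) => //.
by apply: measurable_maxr => //; exact: measurable_fst.
Qed.

(** Every point over [V] satisfies both estimates for all large [j], by the pathwise convergence of
    Riemann sums; hence the good events have probability tending to 1 and one [j] suffices for the
    tolerance [del]. *)
Lemma clocked_simple_close (N : nat) (e del : R) : 0 < e -> 0 < del -> exists j (S : set T),
  [/\ measurable S, (Pr (~` S) <= del%:E)%E,
   forall w, S w -> V w.2 /\ forall u, 0 <= u <= N%:R ->
     `|sp_integral (clocked_simple j N) tcB u w - sp_integral h W (m u w.2) w.1| <= e &
   forall w, S w -> (\int[mu]_(r in `]0%R, N%:R])
     ((sp_fun (clocked_simple j N) r w - right_step tk sz (co ^~ w.1) (m r w.2) * Y2 r w.2) ^+ 2)%:E <= e%:E)%E].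
Proof.
move=> e0 del0.
(* Only dyadic times are tested, to keep the event measurable; continuity extends the bound. *)
pose D j k i : set T := if i%:R / 2 ^+ k <= N%:R :> R then
  [set w | `|rsum j N (Hs w) (tcB ^~ w) (i%:R / 2 ^+ k) - J w (i%:R / 2 ^+ k)| <= e] else setT.
pose I j : set T := [set w | (\int[mu]_(r in `]0%R, N%:R]) ((stepfun j N (Hs w) r - Hs w r) ^+ 2)%:E <= e%:E)%E].
pose U : set T := setT `*` V.
pose S j := U `&` (\bigcap_k \bigcap_i D j k i) `&` I j.
have mU : measurable U by exact: measurableX.
have mD j k i : measurable (D j k i).
  rewrite /D; case: ifP => // _.
  have hm := measurable_funB (mrsum j N (mgrid k i)) (mJ (mgrid k i)).
  have := hm measurableT _ (measurable_itv `[- e, e]).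
  by rewrite setTI; apply: set_transport => w /=; rewrite in_itv /= ler_norml.
have mI j : measurable (I j).
  have := measurable_int_sq N%:R (jerr j N) measurableT (emeasurable_itv `]-oo, e%:E]).
  by rewrite setTI; apply: set_transport => w /=; rewrite in_itv.
have mS j : measurable (S j).
  apply: measurableI => //; apply: measurableI => //.
  by do 2 apply: bigcapT_measurable => ?.
have PU : Pr U = 1%E.
  have -> : Pr U = (P1 setT * P2 V)%E by exact: product_measure1E.
  by rewrite PV probability_setT mul1e.
have cvS : Pr (S j) @[j --> \oo] --> Pr U.
  apply: cvg_prob => //; apply: aeW => w.
  have [Vw|nV] := pselect (V w.2); last first.
    by exists 0%N => // j _ /=; split => [[[[_ h1] _] _]|[_ h1]]; exfalso; exact: nV.
  have [K K0 hK] := Hs_bound.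
  have HKw r : 0 <= r -> `|Hs w r| <= K by exact: hK.
  have a1 := rsum_cvg_uniform (y := marks w) (H := Hs w) (b := tcB ^~ w) (K := K)
    (marks_stepwise Vw) (@tcB_continuous w) HKw (@marks_Hs w) (fun s t => @marks_J w s t Vw) N e0.
  have a2 := stepfun_error (y := marks w) (H := Hs w) (K := K) (marks_stepwise Vw) HKw
    (@marks_Hs w) (jmeas_path w jHs) N e0.
  apply: filterS2 a1 a2 => j h1 h2'; split => [[[hU _] _] //|hU].
  split; last exact: h2'.
  split => // k _ i _; rewrite /D; case: ifP => // hki /=.
  by have := h1 (i%:R / 2 ^+ k); rewrite mgrid hki J0 subr0; apply.
have [j hj] : exists j, (1 - del%:E <= Pr (S j))%E.
  apply: contrapT => /forallNP hN; rewrite PU in cvS.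
  have : (1 <= 1 - del%:E :> \bar R)%E.
    apply: (cvge_le _ cvS); apply: nearW => j; apply: ltW; rewrite ltNge; apply/negP; exact: hN.
  by rewrite -EFinB lee_fin; lra.
exists j, (S j); split => //.
- rewrite probability_setC //; set p := (X in (1 - X)%E); change (is_true (1 - del%:E <= p)%E) in hj.
  move: hj; case: p => [r| |] //=; first by rewrite -!EFinB !lee_fin; lra.
  by move=> _; exact: leNye.
- move=> w [[[_ Vw] hD] _]; split => // u hu; rewrite Kp_integral.
  apply: (@within_dyadic R (fun u => rsum j N (Hs w) (tcB ^~ w) u - J w u) N%:R e) => //.
    by apply: within_sub; [exact: wc_rsum|exact: wc_J].
  by move=> k i hki; have := hD k Logic.I i Logic.I; rewrite /D hki.
- by move=> w [_ hI]; exact: hI.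
Qed.

End OneSimple.

Section Ito.
Variables (F0 : R -> set (set O1)) (W0 : R -> O1 -> R) (Nn : set O1) (G : R -> O1 -> R) (a : R -> R).
Hypothesis F0F1 : forall t, 0 <= t -> F0 t `<=` F1 t.
Hypotheses (mN : measurable Nn) (PN : P1 Nn = 0%E).
Hypothesis W_eq : forall w t, ~ Nn w -> W t w = W0 t w.
Hypotheses (G_rc : right_continuous_paths G) (aG : adapted F1 G).
Hypothesis a_meas : measurable_fun [set: R] a.
Hypothesis hG : ito_equation P1 F0 W0 (fun s w => a (G s w)) G.

Let X (t : R) (w : T) : R := G (m t w.2) w.1.

Let jG : jmeas G.
Proof. by apply: jmeas_right_continuous => // s s0; exact: bm_measurable fF1 aG s0. Qed.

Let jX : jmeas X. Proof. exact: jmeas_clocked jG. Qed.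

Lemma clocked_right_continuous : right_continuous_paths X.
Proof.
move=> w t t0; apply/cvgrPdist_lt => e e0.
have /cvgrPdist_lt/(_ e e0) := @G_rc w.1 (m t w.2) (m_ge0 w.2 t0); rewrite near_withinE => -[r /= r0 hr].
have C2 : 0 < C ^+ 2 by rewrite exprn_gt0.
near=> s; have ts : t < s by near: s; exact: nbhs_right_gt.
have := proj2 (bm w.2) t s t0 (ltW ts) => /andP[h1 h2].
have h3 : 0 < c ^+ 2 * (s - t) by rewrite mulr_gt0 // subr_gt0.
apply: hr => /=; last lra.
rewrite distrC ger0_norm; last lra.
apply: le_lt_trans h2 _; rewrite -ltr_pdivlMl //; near: s.
suff : \forall s \near t^'+, s < t + (C ^+ 2)^-1 * r by apply: filterS => s; lra.
by apply: nbhs_right_lt; rewrite ltrDl mulr_gt0 // invr_gt0.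
Unshelve. all: by end_near. Qed.

Lemma clocked_progressive : progressive tcF (fun s w => a (X s w) * Y2 s w.2).
Proof.
move=> t t0 D mD; have [sT _ incT] := tcF_filtration; have sG := sT t t0.
pose G' := g_sigma_algebraType (tcF t).
have min0 s : 0 <= s -> 0 <= Num.min s t by move=> s0; rewrite le_min s0.
have mint s : Num.min s t <= t by rewrite ge_min lexx orbT.
have rmin (Z : R -> T -> R) : right_continuous_paths Z -> right_continuous_paths (fun s w => Z (Num.min s t) w).
  move=> rZ w s s0; case: (ltP s t) => st.
    apply: cvg_trans (rZ w s s0); apply: near_eq_cvg.
    by near=> v; rewrite min_l // ltW //; near: v; exact: nbhs_right_lt.
  apply: cvg_near_cst; near=> v; rewrite min_r //.
  by apply: le_trans st _; apply: ltW; near: v; exact: nbhs_right_gt.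
have jX' : jmeas (fun s (w : G') => X (Num.min s t) w).
  apply: jmeas_right_continuous => [s s0|]; last exact: rmin clocked_right_continuous.
  apply/(submeasurableP _ sG) => E mE; apply: (incT _ t (min0 s s0) (mint s)).
  exact: (adapted_clocked G_rc aG (min0 s s0) mE).
have jY' : jmeas (fun s (w : G') => Y2 (Num.min s t) w.2).
  apply: jmeas_right_continuous => [s s0|].
    by apply/(submeasurableP _ sG); exact: (adapted_chain t0 (min0 s s0)).
  apply: (rmin (fun s (w : T) => Y2 s w.2)) => w s s0.
  exact: (rconst_right_cvg (proj1 (gYw w.2)) s0).
pose Z (p : R * G') := a (X (Num.min (Num.max p.1 0) t) p.2) * Y2 (Num.min (Num.max p.1 0) t) p.2.2.
have mZ : measurable_fun [set: R * G'] Z.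
  by apply: measurable_funM => //; exact: (measurableT_comp a_meas jX').
have mB : measurable ((`[0, t]%classic `*` [set: G']) `&` (Z @^-1` D)).
  apply: measurableI; first exact: measurableX.
  by have := mZ measurableT D mD; rewrite setTI.
have : <<s [set A `*` D0 | A in @measurable _ R & D0 in @measurable _ G'] >>
    ((`[0, t]%classic `*` [set: G']) `&` (Z @^-1` D)).
  by rewrite -measurable_prod_measurableType.
have -> : @measurable _ G' = tcF t by exact: sigma_algebra_id.
apply: set_transport => -[s w] /=; rewrite in_itv /= /Z /=; split.
  by move=> [[/andP[s0 st] _]]; rewrite max_l // min_l // s0 st.
by move=> [/andP[s0 st]] h; rewrite max_l // min_l // s0 st.
Unshelve. all: by end_near. Qed.

Lemma ae_fst (E : O1 -> Prop) : {ae P1, forall w, E w} -> {ae Pr, forall w : T, E w.1}.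
Proof.
move=> [A [mA A0 sub]]; exists (A `*` setT); split.
- exact: measurableX.
- have -> : Pr (A `*` setT) = (P1 A * P2 setT)%E by exact: product_measure1E.
  by rewrite A0 mul0e.
- by move=> w h; split => //; exact: sub.
Qed.

Let gg (w1 : O1) (f : R -> R) (u : R) : \bar R := ((f u - a (G (Num.max u 0) w1)) ^+ 2)%:E.

Let gg_meas w1 f : measurable_fun [set: R] f -> measurable_fun [set: R] (gg w1 f).
Proof.
move=> mf; apply/measurable_EFinP; apply: measurable_funX; apply: measurable_funB => //.
by apply: (measurableT_comp a_meas); exact: (measurableT_comp jG (measurable_pair2 w1)).
Qed.

Let subst w (f : R -> R) t : 0 <= t -> measurable_fun [set: R] f ->
  (\int[mu]_(s in `[0%R, t]) ((f (m s w.2) * Y2 s w.2 - a (X s w) * Y2 s w.2) ^+ 2)%:E =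
   \int[mu]_(u in `[0%R, m t w.2]) ((f u - a (G u w.1)) ^+ 2)%:E)%E.
Proof.
move=> t0 mf.
have e1 : (\int[mu]_(u in `[0%R, m t w.2]) ((f u - a (G u w.1)) ^+ 2)%:E =
    \int[mu]_(u in `[0%R, m t w.2]) gg w.1 f u)%E.
  by apply: eq_integral => u; rewrite inE /= in_itv /= => /andP[u0 _]; rewrite /gg max_l.
rewrite e1 (clock_subst c2 (gpath_sq_rate c0 cC (gYw w.2)) t0 (gg_meas w.1 mf)); last first.
  by move=> u; rewrite lee_fin sqr_ge0.
apply: eq_integral => s; rewrite inE /= in_itv /= => /andP[s0 _].
rewrite /gg max_l; last exact: m_ge0.
rewrite -EFinM; congr (_%:E).
by change (clock (fun t1 : R => Y2 t1 w.2 ^+ 2) s) with (m s w.2); rewrite /X; ring.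
Qed.

Lemma right_step_measurable p K (f : nat -> R) : measurable_fun [set: R] (right_step p K f).
Proof.
rewrite /right_step; apply: measurable_sum => k; apply: measurable_funM => //.
rewrite (_ : (fun p => _) = \1_(`[p k, p k.+1[%classic)) //.
apply/funext => u; rewrite indicE; congr ((nat_of_bool _)%:R).
by apply/idP/idP; rewrite inE /= in_itv.
Qed.

(** The two step functions differ at most at the finitely many jump times, a null set. *)
Lemma sp_fun_right_step (h : simple_process F0) w1 (U : R) : 0 <= U ->
  (\int[mu]_(u in `[0%R, U]) ((right_step (sp_time h) (sp_size h) (sp_coef h ^~ w1) u - a (G u w1)) ^+ 2)%:E =
   \int[mu]_(u in `[0%R, U]) ((sp_fun h u w1 - a (G u w1)) ^+ 2)%:E)%E.
Proof.
move=> U0; pose E : set R := [set` [seq sp_time h k | k <- iota 0 (sp_size h).+1]].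
have muE : mu E = 0%E by apply: countable_lebesgue_measure0; apply: finite_set_countable; exact: finite_seq.
have msp : measurable_fun [set: R] (fun u => sp_fun h u w1).
  by rewrite /sp_fun; apply: measurable_sum => k; exact: measurable_funM.
have toG (f : R -> R) : measurable_fun [set: R] f ->
    measurable_fun `[0, U]%classic (fun u : R => ((f u - a (G u w1)) ^+ 2)%:E).
  move=> mf; apply: (eq_measurable_fun (gg w1 f)); last exact: measurable_funTS (gg_meas w1 mf).
  by move=> u; rewrite inE /= in_itv /= => /andP[u0 _]; rewrite /gg max_l.
apply: ae_eq_integral => //; [exact: toG (right_step_measurable _ _ _)|exact: toG msp|].
exists E; split => //; first by apply: countable_measurable => //; apply: finite_set_countable; exact: finite_seq.
move=> u /= hu; apply: contrapT => nE; apply: hu => _; congr ((( _ - _) ^+ 2)%:E).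
rewrite /right_step /sp_fun; apply: eq_bigr => k _; congr (_ * _).
have ne i : (i <= sp_size h)%N -> u != sp_time h i.
  move=> iz; apply/eqP => e; have : u \in [seq sp_time h k0 | k0 <- iota 0 (sp_size h).+1].
    by apply/mapP; exists i => //; rewrite mem_iota /= add0n ltnS.
  exact: nE.
have kz := ltn_ord k; rewrite indicE; congr ((nat_of_bool _)%:R).
have n1 := ne _ (ltnW kz); have n2 := ne _ kz.
apply/idP/idP; rewrite inE /= in_itv /= => /andP[u1 u2].
  by rewrite lt_neqAle eq_sym n1 u1 ltW.
by rewrite ltW // lt_neqAle n2 u2.
Qed.

(** The estimates hold from [n0] on, but convergence in probability asks for a cover at every [n];
    before [n0] the whole space serves. *)
Lemma cover_cvg (A1 : nat -> set O1) (E0 : set O1) (S : nat -> set T) (n0 : nat) :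
  (forall n, measurable (A1 n)) -> P1 (A1 n) @[n --> \oo] --> 0%E ->
  measurable E0 -> P1 E0 = 0%E -> (forall n, measurable (S n)) ->
  (forall n, Pr (~` S n) <= (n.+1%:R^-1)%:E)%E ->
  let A n := if (n < n0)%N then setT else ((A1 n `|` E0) `*` setT) `|` ~` S n in
  (forall n, measurable (A n)) /\ Pr (A n) @[n --> \oo] --> 0%E.
Proof.
move=> mA1 cA1 mE0 PE0 mS PS A; have mA n : measurable (A n).
  rewrite /A; case: ifP => // _; apply: measurableU; last exact: measurableC.
  by apply: measurableX => //; exact: measurableU.
split => //.
have ch : (n.+1%:R^-1 : R)%:E @[n --> \oo] --> 0%E.
  by apply: cvg_EFin; [exact: nearW|exact: cvg_harmonic].
have cs : (P1 (A1 n) + (n.+1%:R^-1 : R)%:E)%E @[n --> \oo] --> 0%E.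
  by rewrite -[X in _ --> X]adde0; apply: cvgeD.
apply: (squeeze_cvge _ (cvg_cst 0%E) cs); near=> n.
have n0n : (n0 <= n)%N by near: n; exact: nbhs_infty_ge.
rewrite measure_ge0 /= /A ltnNge n0n /=.
have mB : measurable ((A1 n `|` E0) `*` [set: O2]).
  by apply: measurableX => //; exact: measurableU.
apply: (le_trans (measureU2 _ mB (measurableC (mS n)))); apply: leeD; last exact: PS.
have e1 : Pr ((A1 n `|` E0) `*` setT) = (P1 (A1 n `|` E0) * P2 setT)%E.
  by apply: product_measure1E => //; exact: measurableU.
change (Pr ((A1 n `|` E0) `*` setT) <= P1 (A1 n))%E.
by rewrite e1 probability_setT mule1 measureU0.
Unshelve. all: by end_near. Qed.

(** The simple processes approximating the integral of [G] are carried to the new clock.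
    Substitution turns the new squared error into the old one over the longer interval
    [[0, C ^ 2 t]], and a supremum in the new time is one over clock times. *)
Lemma time_change_ito : ito_equation Pr tcF tcB (fun s w => a (X s w) * Y2 s w.2) X.
Proof.
have [M [_ fin [h hh]] eqM] := hG.
have C2 : 0 < C ^+ 2 by rewrite exprn_gt0.
(* Taking the increment of [X] itself as the integral makes the equation an identity; the content
   lies in its being an Ito integral. *)
exists (fun t w => X t w - X 0 w); last by apply: aeW => w t t0; ring.
split; first exact: clocked_progressive.
  apply: filterS (ae_fst fin) => w hw t t0.
  have := hw (m t w.2) (m_ge0 w.2 t0).
  have e0 := subst w t0 (@measurable_cst _ _ _ _ setT (0 : R)).
  have e1 : (\int[mu]_(s in `[0%R, t]) ((a (X s w) * Y2 s w.2) ^+ 2)%:E =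
      \int[mu]_(s in `[0%R, t]) ((cst 0 (m s w.2) * Y2 s w.2 - a (X s w) * Y2 s w.2) ^+ 2)%:E)%E.
    by apply: eq_integral => s _; rewrite /= mul0r sub0r sqrrN.
  have e2 : (\int[mu]_(u in `[0%R, m t w.2]) ((cst 0 u - a (G u w.1)) ^+ 2)%:E =
      \int[mu]_(u in `[0%R, m t w.2]) ((a (G u w.1)) ^+ 2)%:E)%E.
    by apply: eq_integral => s _; rewrite /= sub0r sqrrN.
  by rewrite e1 e0 e2.
have i0 n : 0 < (n.+1%:R^-1 : R) by rewrite invr_gt0.
have /choice[jj /choice[S hS]] := fun n => clocked_simple_close (h n) F0F1 n (i0 n) (i0 n).
have mS n : measurable (S n) by have [] := hS n.
have PS n : (Pr (~` S n) <= (n.+1%:R^-1)%:E)%E by have [] := hS n.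
exists (fun n => clocked_simple (h n) F0F1 (jj n) n) => t t0.
(* The largest value that the clock can have reached by time [t]. *)
pose U := C ^+ 2 * t; have U0 : 0 <= U by rewrite mulr_ge0 // ltW.
have mU s w2 : 0 <= s -> s <= t -> m s w2 <= U.
  move=> s0 st; apply: le_trans (m_le w2 s0 st) _.
  by have := proj2 (bm w2) 0 t (lexx _) t0; rewrite (proj1 (bm w2)) !subr0 => /andP[].
have thr (e : R) : 0 < e -> exists n0 : nat, forall n, (n0 <= n)%N -> t <= n%:R /\ n.+1%:R^-1 <= e.
  move=> e0; exists (maxn (Num.trunc t).+1 (Num.trunc e^-1)) => n; rewrite geq_max => /andP[h1 h2]; split.
    by apply: le_trans (ltW (truncnS_gt t)) _; rewrite ler_nat.
  rewrite -[e]invrK lef_pV2 ?posrE ?invr_gt0 //; apply: le_trans (ltW (truncnS_gt e^-1)) _.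
  by rewrite ler_nat ltnS.
have [hA hB] := hh U U0; split=> e e0.
(* From [(f1 + f2) ^ 2 <= 2 f1 ^ 2 + 2 f2 ^ 2]: two errors of [e / 8] give [e / 2], strictly below
   [e]. *)
- have e8 : 0 < e / 8 by rewrite divr_gt0.
  have [A1 [hA1 cA1]] := hA _ e8; have [n0 hn0] := thr _ e8.
  pose A n := if (n < n0)%N then setT else ((A1 n `|` set0) `*` setT) `|` ~` S n.
  have [mA cA] := cover_cvg n0 (fun n => proj1 (hA1 n)) cA1 measurable0 (measure0 P1) mS PS.
  exists A; split => // n; split; first exact: mA.
  move=> w /= hw; rewrite /A; case: ltnP => [//|n0n]; apply: contrapT => /not_orP[nA /contrapT Sw].
  have nA1 : ~ A1 n w.1 by move=> h1; apply: nA; split => //; left.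
  have [tn ie] := hn0 n n0n; have [_ _ _ hI] := hS n; have {}hI := hI w Sw.
  set K := clocked_simple _ _ _ _ in hw hI.
  pose rst := right_step (sp_time (h n)) (sp_size (h n)) (sp_coef (h n) ^~ w.1).
  pose f1 r : R := sp_fun K r w - rst (m r w.2) * Y2 r w.2.
  pose f2 r : R := rst (m r w.2) * Y2 r w.2 - a (X r w) * Y2 r w.2.
  have mrst : measurable_fun [set: R] rst by exact: right_step_measurable.
  have mp r : 0 <= r -> m (Num.max r 0) w.2 = m r w.2 by move=> r0; rewrite max_l.
  have mY : measurable_fun [set: R] (fun r => Y2 (Num.max r 0) w.2) by exact: (jmeas_path w jY).
  have mm : measurable_fun [set: R] (fun r => m (Num.max r 0) w.2) by exact: (jmeas_path w jm).
  have mX' : measurable_fun [set: R] (fun r => X (Num.max r 0) w) by exact: (jmeas_path w jX).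
  have toD (D : set R) (f f' : R -> R) : measurable D -> D `<=` `[0, +oo[%classic ->
      measurable_fun [set: R] f' -> (forall r, 0 <= r -> f r = f' r) ->
      measurable_fun D (fun r => ((f r) ^+ 2)%:E).
    move=> mD DS mf' ff; apply/measurable_EFinP; apply: measurable_funX.
    apply: (eq_measurable_fun f'); last exact: measurable_funTS.
    by move=> r; rewrite inE => /DS /=; rewrite in_itv /= andbT => r0; rewrite ff.
  have mK : measurable_fun [set: R] (fun r => sp_fun K r w).
    by rewrite /sp_fun; apply: measurable_sum => k; exact: measurable_funM.
  have mf1 (D : set R) : measurable D -> D `<=` `[0, +oo[%classic -> measurable_fun D (fun r => ((f1 r) ^+ 2)%:E).
    move=> mD DS; apply: (toD D f1 (fun r => sp_fun K r w - rst (m (Num.max r 0) w.2) * Y2 (Num.max r 0) w.2)) => //.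
      apply: measurable_funB => //; apply: measurable_funM => //; exact: measurableT_comp mrst mm.
    by move=> r r0; rewrite max_l.
  have mf2 (D : set R) : measurable D -> D `<=` `[0, +oo[%classic -> measurable_fun D (fun r => ((f2 r) ^+ 2)%:E).
    move=> mD DS; apply: (toD D f2 (fun r => rst (m (Num.max r 0) w.2) * Y2 (Num.max r 0) w.2 -
      a (X (Num.max r 0) w) * Y2 (Num.max r 0) w.2)) => //.
      apply: measurable_funB => //; apply: measurable_funM => //; first exact: measurableT_comp mrst mm.
      exact: measurableT_comp a_meas mX'.
    by move=> r r0; rewrite max_l.
  have D0 : `[0, t]%classic `<=` (`[0, +oo[%classic : set R).
    by move=> r /=; rewrite !in_itv /= andbT => /andP[].
  have I1 : (\int[mu]_(r in `[0%R, t]) ((f1 r) ^+ 2)%:E <= (n.+1%:R^-1)%:E)%E.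
    apply: le_trans hI.
    rewrite -(integral_itv_obnd_cbnd (r := 0%R)); last first.
      by apply: mf1 => // r /=; rewrite !in_itv /= andbT => /andP[/ltW].
    apply: ge0_subset_integral => //.
    + by apply: mf1 => // r /=; rewrite !in_itv /= andbT => /andP[/ltW].
    + by move=> r _; rewrite lee_fin sqr_ge0.
    + by move=> r /=; rewrite !in_itv /= => /andP[-> h2]; rewrite (le_trans h2).
  have I2 : (\int[mu]_(r in `[0%R, t]) ((f2 r) ^+ 2)%:E <= (e / 8)%:E)%E.
    rewrite /f2 (subst w t0 mrst).
    apply: (@le_trans _ _ (\int[mu]_(u in `[0%R, U]) ((rst u - a (G u w.1)) ^+ 2)%:E)%E).
      apply: ge0_subset_integral => //.
      + apply: (eq_measurable_fun (gg w.1 rst)); last exact: measurable_funTS (gg_meas w.1 mrst).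
        by move=> u; rewrite inE /= in_itv /= => /andP[u0 _]; rewrite /gg max_l.
      + by move=> r _; rewrite lee_fin sqr_ge0.
      + by move=> r /=; rewrite !in_itv /= => /andP[-> h2]; rewrite (le_trans h2) // mU.
    rewrite (sp_fun_right_step (h n) w.1 U0) leNgt; apply/negP => lt; apply: nA1.
    by have [_] := hA1 n; apply.
  have I3 : (\int[mu]_(s in `[0%R, t]) ((sp_fun K s w - a (X s w) * Y2 s w.2) ^+ 2)%:E <=
      2%:E * \int[mu]_(r in `[0%R, t]) ((f1 r) ^+ 2)%:E + 2%:E * \int[mu]_(r in `[0%R, t]) ((f2 r) ^+ 2)%:E)%E.
    have m1 := mf1 _ (measurable_itv `[0, t]) D0; have m2 := mf2 _ (measurable_itv `[0, t]) D0.
    rewrite -!ge0_integralZl_EFin //; last 2 first.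
    + by move=> r _; rewrite lee_fin sqr_ge0.
    + by move=> r _; rewrite lee_fin sqr_ge0.
    rewrite -ge0_integralD //; last 4 first.
    + by move=> r _; rewrite mule_ge0 // lee_fin sqr_ge0.
    + exact: measurable_funeM.
    + by move=> r _; rewrite mule_ge0 // lee_fin sqr_ge0.
    + exact: measurable_funeM.
    apply: ge0_le_integral => //.
    + by move=> r _; rewrite lee_fin sqr_ge0.
    + apply: (toD _ _ (fun r => sp_fun K r w - a (X (Num.max r 0) w) * Y2 (Num.max r 0) w.2)) => //.
        apply: measurable_funB => //; apply: measurable_funM => //; exact: measurableT_comp a_meas mX'.
      by move=> r r0; rewrite max_l.
    + by apply: emeasurable_funD; exact: measurable_funeM.
    + move=> r _; rewrite -!EFinM -EFinD lee_fin.
      rewrite (_ : _ - _ = f1 r + f2 r); last by rewrite /f1 /f2; ring.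
      by have := sqr_ge0 (f1 r - f2 r); rewrite !expr2; lra.
  have : (e%:E < e%:E)%E.
    apply: lt_le_trans hw _; apply: le_trans I3 _.
    apply: (@le_trans _ _ (2%:E * (e / 8)%:E + 2%:E * (e / 8)%:E)%E).
      apply: leeD; apply: lee_wpmul2l => //; apply: le_trans I1 _; by rewrite lee_fin.
    by rewrite -!EFinM -EFinD lee_fin; lra.
  by rewrite ltxx.
- have e2 : 0 < e / 2 by rewrite divr_gt0.
  have [A1 [hA1 cA1]] := hB _ e2; have [n0 hn0] := thr _ e2.
  have [E1 [mE1 PE1 hE1]] := ae_null eqM.
  have mE0 : measurable (Nn `|` E1) by exact: measurableU.
  have PE0 : P1 (Nn `|` E1) = 0%E by rewrite measureU0.
  pose A n := if (n < n0)%N then setT else ((A1 n `|` (Nn `|` E1)) `*` setT) `|` ~` S n.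
  have [mA cA] := cover_cvg n0 (fun n => proj1 (hA1 n)) cA1 mE0 PE0 mS PS.
  exists A; split => // n; split; first exact: mA.
  move=> w /= hw; rewrite /A; case: ltnP => [//|n0n]; apply: contrapT => /not_orP[nA /contrapT Sw].
  have nA1 : ~ A1 n w.1 by move=> h1; apply: nA; split => //; left.
  have nN : ~ Nn w.1 by move=> h1; apply: nA; split => //; right; left.
  have nE : ~ E1 w.1 by move=> h1; apply: nA; split => //; right; right.
  have [tn ie] := hn0 n n0n; have [_ _ hI _] := hS n; have [Vw {}hI] := hI w Sw.
  move: hw; rewrite ltNge => /negP; apply; apply: ge_ereal_sup => _ [s /= + <-].
  rewrite in_itv /= => /andP[s0 st]; rewrite lee_fin.
  have h1 := hI s; rewrite s0 (le_trans st tn) in h1; have {}h1 := h1 isT.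
  have h2 : `|sp_integral (h n) W0 (m s w.2) w.1 - M (m s w.2) w.1| <= e / 2.
    rewrite -lee_fin leNgt; apply/negP => lt; apply: nA1; have [_] := hA1 n; apply.
    apply: lt_le_trans lt _; apply: ereal_sup_ubound; exists (m s w.2) => //=.
    by rewrite in_itv /= m_ge0 // mU.
  have eW : sp_integral (h n) W (m s w.2) w.1 = sp_integral (h n) W0 (m s w.2) w.1.
    by rewrite /sp_integral; apply: eq_bigr => k _; rewrite !W_eq.
  have eM : X s w - X 0 w = M (m s w.2) w.1.
    have m0 : m 0 w.2 = 0 by exact: (proj1 (bm w.2)).
    by rewrite /X m0 (hE1 _ nE _ (m_ge0 w.2 s0)) addrAC subrr add0r.
  rewrite eM -(subrK (sp_integral (h n) W (m s w.2) w.1) (sp_integral _ _ _ _)).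
  rewrite -addrA (le_trans (ler_normD _ _)) //.
  rewrite {2}eW; have := le_trans h1 ie; lra.
Qed.

End Ito.

End TimeChange.

Section VolatilityModel.
Context {R : realType} {m : nat} {d1 d2 : measure_display}
  {O1 : measurableType d1} {O2 : measurableType d2}.
Variables (P1 : probability O1 R) (P2 : probability O2 R).

Let T := (O1 * O2)%type.
Let Pr := (P1 \x P2)%E.

Lemma ae_snd (E : O2 -> Prop) : {ae P2, forall w, E w} -> {ae Pr, forall w : T, E w.2}.
Proof.
move=> [A [mA A0 sub]]; exists (setT `*` A); split.
- exact: measurableX.
- have -> : Pr (setT `*` A) = (P1 setT * P2 A)%E by exact: product_measure1E.
  by rewrite A0 mule0.
- by move=> w h; split => //; exact: sub.
Qed.

Lemma natural_section (Y2 : R -> O2 -> R) s (A : set T) :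
  natural (fun t (w : T) => Y2 t w.2) s A -> forall w1, natural Y2 s (xsection A w1).
Proof.
move=> nA w1; have sN := natural_sigma_algebra Y2 s.
have := trace_sigma (fun w2 : O2 => (w1, w2)) sN (sigma_algebra_T sN).
set H := [set B | _] => sH; suff : H A.
  by rewrite /H /= setIT; apply: set_transport => w2; rewrite /xsection /= inE.
move: A nA; apply: generated_sub => // r; rewrite /= in_itv /= => /andP[r0 rs] D mD.
by rewrite /H /= setIT; exact: (natural_mem (Z := Y2) r0 rs mD).
Qed.

Variables (ys : 'I_m -> R) (Q : 'M[R]_m) (Y2 : R -> O2 -> R).
Hypothesis mcY : markov_chain P2 ys Q Y2.
Hypothesis pos : forall t i j, 0 <= t -> 0 <= expmx (t *: Q) i j.

Lemma markov_chain_snd : markov_chain Pr ys Q (fun t (w : T) => Y2 t w.2).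
Proof.
have [isQ rY mY rcY trY] := mcY; split => //.
- by move=> t w t0; exact: rY.
- by move=> t t0; exact: (measurableT_comp (mY t t0) measurable_snd).
- by move=> w t t0; exact: (rcY w.2 t t0).
move=> s t s0 t0 A nA i j; have st0 : 0 <= s + t by rewrite addr_ge0.
have mY' v : 0 <= v -> measurable_fun [set: T] (fun w : T => Y2 v w.2).
  by move=> v0; exact: (measurableT_comp (mY v v0) measurable_snd).
have meq v k : 0 <= v -> measurable [set w : T | Y2 v w.2 = ys k].
  move=> v0; have := mY' v v0 measurableT [set ys k] (measurable_set1 _).
  by rewrite setTI; apply.
have mA : measurable A by exact: natural_measurable mY' _ nA.
have e1 w1 : xsection (A `&` [set w : T | Y2 s w.2 = ys i]) w1 =
    xsection A w1 `&` [set w2 | Y2 s w2 = ys i].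
  by apply/seteqP; split => w2; rewrite /xsection /= !inE.
have e2 w1 : xsection (A `&` [set w : T | Y2 s w.2 = ys i] `&` [set w | Y2 (s + t) w.2 = ys j]) w1 =
    xsection A w1 `&` [set w2 | Y2 s w2 = ys i] `&` [set w2 | Y2 (s + t) w2 = ys j].
  by apply/seteqP; split => w2; rewrite /xsection /= !inE.
have mB : measurable (A `&` [set w : T | Y2 s w.2 = ys i]) by apply: measurableI => //; exact: meq.
have mB2 := measurableI _ _ mB (meq _ j st0).
apply: prod_xsection_scale => //; first exact: pos.
move=> w1; rewrite e1 e2.
exact: (trY s t s0 t0 _ (natural_section nA w1) i j).
Qed.

(** Stated for any chain independent of [G]: it serves for the chain started at [y'] and for the
    glued chain, after which uniqueness in law takes over. *)
Lemma time_change_model (F : R -> set (set O1)) (a : R -> R) (x y c C : R) (G : R -> O1 -> R) :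
  measurable_fun [set: R] a -> right_continuous_paths G -> sde_solution P1 F a x G ->
  0 < c -> c <= C -> gproc c C Y2 -> {ae P2, forall w, Y2 0 w = y} ->
  exists Fp, volatility_model Pr Fp a ys Q x y
    (fun t (w : T) => G (mclock (Y2 ^~ w.2) t) w.1) (fun t (w : T) => Y2 t w.2).
Proof.
move=> am rG [fF aG G0 [W bW iG]] c0 cC gY Y0.
have [N [F' [W' [[mN PN] [fF' FF'] bW' W'r W'e]]]] := regular_brownian fF bW.
have [V [mV PV stV]] := chain_stepwise mcY gY.
have aG' : adapted F' G by move=> t t0 D mD; apply: FF' => //; exact: aG.
have fT := tcF_filtration fF' c0 cC gY.
exists (tcF F' Y2); split => //.
- move=> t t0; have [/(_ t t0) sT _ _] := fT; apply/(submeasurableP _ sT).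
  apply: measurable_fun_pair.
    by apply/(submeasurableP _ sT); exact: (adapted_clocked fF' c0 cC gY rG aG' t0).
  by apply/(submeasurableP _ sT); exact: (adapted_chain fF' c0 cC gY t0).
- apply: filterS2 (ae_fst P2 G0) (ae_snd Y0) => w h1 h2; rewrite /pair_process h2.
  have -> : mclock (Y2 ^~ w.2) 0 = 0 by exact: (proj1 (mclock_bilip c0 cC (proj1 gY w.2))).
  by rewrite h1.
- exists (tcB W' Y2 V); split.
  + exact: (tcB_brownian fF' bW' W'r c0 cC gY mV PV stV).
  + exact: (tcB_independent fF' bW' W'r c0 cC gY mV PV stV).
  + exact: (time_change_ito fF' bW' W'r c0 cC gY mV PV stV FF' mN PN W'e rG aG' am iG).
- exact: markov_chain_snd.
Qed.

End VolatilityModel.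

(** * Immediate return to the current level *)

Section ItoDyadic.
Context {R : realType} {d : measure_display} {Omega : measurableType d}.
Variables (P : probability Omega R) (F : R -> set (set Omega)) (B : R -> Omega -> R).
Hypotheses (fF : filtration F) (bB : brownian_motion P F B).

Let aB : adapted F B. Proof. by have [] := bB. Qed.
Let mF t : 0 <= t -> F t `<=` measurable. Proof. by have [_ h _] := fF; exact: h. Qed.
Let sF t : 0 <= t -> sigma_algebra [set: Omega] (F t). Proof. by have [h _ _] := fF; exact: h. Qed.
Let incF s t : 0 <= s -> s <= t -> F s `<=` F t. Proof. by have [_ _ h] := fF; exact: h. Qed.
Let mB t : 0 <= t -> measurable_fun [set: Omega] (B t). Proof. exact: bm_measurable fF aB. Qed.

Definition simple_rate (h : simple_process F) (t : R) (w : Omega) : R :=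
  right_step (sp_time h) (sp_size h) (sp_coef h ^~ w) t.

Lemma simple_rate_adapted (h : simple_process F) : adapted F (simple_rate h).
Proof.
move=> t t0; apply/(submeasurableP _ (sF t0)); rewrite /simple_rate /right_step.
apply: measurable_sum => k; case: (leP (sp_time h k) t) => kt /=.
  apply: measurable_funM; last exact: measurable_cst.
  apply/(submeasurableP _ (sF t0)) => D mD; apply: (incF (sp_time_ge0 h k) kt).
  exact: (sp_coef_measurable h).
rewrite (_ : (fun w1 => _) = cst 0); first exact: measurable_cst.
by apply/funext => w1; rewrite mulr0.
Qed.

Lemma simple_rate_bound (h : simple_process F) : exists2 K, 0 <= K & forall t w, `|simple_rate h t w| <= K.
Proof.
have [K0 hK] := sp_coef_bounded h; pose K := Num.max K0 0.
exists ((sp_size h)%:R * K); first by rewrite mulr_ge0 // le_max lexx orbT.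
move=> u w1; rewrite /simple_rate /right_step (le_trans (ler_norm_sum _ _ _)) //.
apply: (@le_trans _ _ (\sum_(k < sp_size h) K)); last by rewrite sumr_const card_ord mulr_natl.
apply: ler_sum => k _; rewrite normrM; have h1 : `|sp_coef h k w1| <= K by rewrite /K le_max hK.
have K00 : 0 <= K by rewrite /K le_max lexx orbT.
by case: (sp_time h k <= u < sp_time h k.+1)%R; rewrite ?normr1 ?normr0 ?mulr1 ?mulr0.
Qed.

Lemma simple_rsum_cvg (h : simple_process F) w (N : nat) (e : R) :
  {within `[0, +oo[, continuous (B ^~ w)} -> 0 < e ->
  \forall j \near \oo, forall u, 0 <= u <= N%:R ->
    `|rsum j N (simple_rate h ^~ w) (B ^~ w) u - sp_integral h B u w| <= e.
Proof.
move=> cB e0; have [K K0 hK] := simple_rate_bound h.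
pose tk := sp_time h; pose sz := sp_size h.
have HK r : 0 <= r -> `|simple_rate h r w| <= K by move=> _; exact: hK.
have hH (s t : R) : 0 <= s -> s <= t ->
    (forall u, s <= u < t -> [seq tk k <= u | k <- iota 0 sz.+1] = [seq tk k <= s | k <- iota 0 sz.+1]) ->
    forall u, s <= u < t -> simple_rate h u w = simple_rate h s w.
  move=> s0 st hc u hu; rewrite /simple_rate /right_step; apply: eq_bigr => k _; have e1 := hc u hu.
  have f (i : nat) : (i <= sz)%N -> (tk i <= u) = (tk i <= s).
    by move=> iz; move/eq_in_map: e1 => /(_ i); rewrite mem_iota /= add0n ltnS iz => /(_ isT).
  by have kz := ltn_ord k; rewrite !(ltNge _ (tk _)) -/tk !f // ltnW.
have J0 : sp_integral h B 0 w = 0.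
  by rewrite /sp_integral big1 // => k _; rewrite !min_l ?sp_time_ge0 // subrr mulr0.
have hJ (s t : R) : 0 <= s -> s <= t ->
    (forall u, s <= u < t -> [seq tk k <= u | k <- iota 0 sz.+1] = [seq tk k <= s | k <- iota 0 sz.+1]) ->
    sp_integral h B t w - sp_integral h B s w = simple_rate h s w * (B t w - B s w).
  move=> s0 st hc.
  exact: (@step_sum_const R tk sz (B ^~ w) (sp_coef h ^~ w) (sp_time_le h) _ _ st hc).
have := rsum_cvg_uniform (y := fun t => [seq tk k <= t | k <- iota 0 sz.+1])
  (H := simple_rate h ^~ w) (b := B ^~ w) (K := K) (stepwise_marks tk _) cB HK hH hJ N e0.
by apply: filterS => j hj u hu; have := hj u hu; rewrite J0 subr0.
Qed.

Variables (X I : R -> Omega -> R).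
Hypothesis hI : ito_equation P F B I X.

(* Up to an event of small probability, [X] is approximated by a discrete martingale transform with small jumps. *)
Lemma ito_dyadic (j0 N : nat) (r : R) : 0 < r -> exists j (H : R -> Omega -> R) (S : set Omega),
  [/\ (j0 <= j)%N, adapted F H, measurable S, (P (~` S) <= r%:E)%E &
   forall w, S w -> [/\ {within `[0, +oo[, continuous (B ^~ w)},
     forall i : nat, (i < N * 2 ^ j)%N ->
       `|H (i%:R / 2 ^+ j) w * (B (i.+1%:R / 2 ^+ j) w - B (i%:R / 2 ^+ j) w)| <= r &
     forall u, 0 <= u <= N%:R -> `|rsum j N (H ^~ w) (B ^~ w) u - (X u w - X 0 w)| <= r] ].
Proof.
move=> r0; have r2 : 0 < r / 2 by rewrite divr_gt0.
have [M [_ _ [h hh]] eqM] := hI.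
have [_ /(_ _ r2)[A [hA cA]]] := hh N%:R (ler0n _ _).
have [_ _ cB _] := bB; have [E [mE PE hE]] := ae_null (filterI eqM cB).
have [n hn] : exists n, (P (A n) < (r / 2)%:E)%E.
  apply: contrapT => /forallNP hN; have : ((r / 2)%:E <= 0 :> \bar R)%E.
    apply: (cvge_ge _ cA); apply: nearW => n; rewrite leNgt; apply/negP; exact: hN.
  by rewrite lee_fin leNgt r2.
have [mA sA] := hA n; pose Hh := simple_rate (h n).
have [K K0 hK] := simple_rate_bound (h n).
have g0 (i k : nat) : 0 <= i%:R / 2 ^+ k :> R by rewrite divr_ge0.
have mH t : 0 <= t -> measurable_fun [set: Omega] (Hh t).
  by move=> t0 _ D mD; rewrite setTI; apply: (mF t0); exact: (@simple_rate_adapted (h n) t t0 D mD).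
pose J t w := sp_integral (h n) B t w.
have mJ t : 0 <= t -> measurable_fun [set: Omega] (J t).
  move=> t0; rewrite /J /sp_integral; apply: measurable_sum => k; apply: measurable_funM.
    move=> _ D mD; rewrite setTI; apply: (mF (sp_time_ge0 (h n) k)).
    exact: (sp_coef_measurable (h n)).
  by apply: measurable_funB; apply: mB; rewrite le_min t0 sp_time_ge0.
pose D j k i : set Omega := if i%:R / 2 ^+ k <= N%:R :> R then
  [set w | `|rsum j N (Hh ^~ w) (B ^~ w) (i%:R / 2 ^+ k) - J (i%:R / 2 ^+ k) w| <= r / 2] else setT.
(* Small single jumps of the transform hold for large [j] by uniform continuity of [B] on [[0, N]]
   and boundedness of the simple rate. *)
pose V j i : set Omega := if (i < N * 2 ^ j)%N then
  [set w | `|Hh (i%:R / 2 ^+ j) w * (B (i.+1%:R / 2 ^+ j) w - B (i%:R / 2 ^+ j) w)| <= r] else setT.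
pose U : set Omega := ~` E `&` ~` A n.
pose S j := U `&` (\bigcap_k \bigcap_i D j k i) `&` \bigcap_i V j i.
have mU : measurable U by apply: measurableI; exact: measurableC.
have mnorm (f : Omega -> R) e : measurable_fun [set: Omega] f -> measurable [set w | `|f w| <= e].
  move=> mf; have := mf measurableT _ (measurable_itv `[- e, e]).
  by rewrite setTI; apply: set_transport => w /=; rewrite in_itv /= ler_norml.
have mrs j t : 0 <= t -> measurable_fun [set: Omega] (fun w => rsum j N (Hh ^~ w) (B ^~ w) t).
  move=> t0; rewrite /rsum; apply: measurable_sum => i; apply: measurable_funM; first exact: mH.
  by apply: measurable_funB; apply: mB; rewrite le_min t0 g0.
have mD j k i : measurable (D j k i).
  by rewrite /D; case: ifP => // _; apply: mnorm; apply: measurable_funB; [exact: mrs|exact: mJ].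
have mV j i : measurable (V j i).
  rewrite /V; case: ifP => // _; apply: mnorm; apply: measurable_funM; first exact: mH.
  by apply: measurable_funB; exact: mB.
have mS j : measurable (S j).
  apply: measurableI; first apply: measurableI => //.
    by do 2 apply: bigcapT_measurable => ?.
  by apply: bigcapT_measurable.
have cS : P (S j) @[j --> \oo] --> P U.
  apply: cvg_prob => //; apply: aeW => w.
  have [Uw|nU] := pselect (U w); last first.
    by exists 0%N => // j _ /=; split => [[[h1 _] _]|h1]; exfalso; exact: nU.
  have [_ cw] := hE w (proj1 Uw).
  have a1 := simple_rsum_cvg (h n) N cw r2.
  have rK : 0 < r / (K + 1) by rewrite divr_gt0 // ltr_wpDl.
  have [dl dl0 hdl] := uniform_modulus cw (ler0n _ N) rK.
  apply: filterS2 a1 (pow2_small dl0) => j h1 h2; split => [[[hU _] _] //|_].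
  split; first (split => // k _ i _).
    by rewrite /D; case: ifP => // hki /=; apply: h1; rewrite g0 hki.
  move=> i _; rewrite /V; case: ifP => // iN /=; rewrite normrM.
  have i1 : i.+1%:R / 2 ^+ j <= N%:R :> R by rewrite -(grid_end j N) grid_le.
  have i2 : i%:R / 2 ^+ j <= N%:R :> R by rewrite -(grid_end j N) grid_le ltnW.
  have hb : `|B (i.+1%:R / 2 ^+ j) w - B (i%:R / 2 ^+ j) w| <= r / (K + 1).
    apply: hdl; rewrite ?g0 ?i1 ?i2 //.
    by rewrite -mulrBl -natrB // subSnn mul1r ger0_norm ?invr_ge0 // ltW.
  apply: (@le_trans _ _ (K * (r / (K + 1)))); first by rewrite ler_pM // hK.
  by rewrite mulrA ler_pdivrMr ?ltr_wpDl // mulrC ler_pM2l //; lra.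
have PU : (1 - (r / 2)%:E < P U)%E.
  have mE' := measurableC mE; have mA' := measurableC mA.
  have -> : P U = P (~` A n).
    by rewrite /U setIC prob_setI1 // probability_setC // PE sube0.
  rewrite probability_setC //; have := hn; have := fin_num_measure P (A n) mA => /fineK <-.
  by rewrite -!EFinB !lte_fin; lra.
have [j j1 j2] : exists2 j, (j0 <= j)%N & (1 - r%:E <= P (S j))%E.
  apply: contrapT => hN; have : (P U <= 1 - r%:E)%E.
    apply: (cvge_le _ cS); near=> j; rewrite leNgt; apply/negP => lt; apply: hN.
    by exists j; [near: j; exact: nbhs_infty_ge|exact: ltW].
  by rewrite leNgt (le_lt_trans _ PU) // -!EFinB lee_fin; lra.
exists j, Hh, (S j); split => //; first exact: simple_rate_adapted.
  rewrite probability_setC //; have := j2; have := fin_num_measure P (S j) (mS j) => /fineK <-.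
  by rewrite -!EFinB !lee_fin; lra.
move=> w [[[nE nA] hD] hV]; have [eqw cw] := hE w nE; split => //.
  by move=> i iN; have := hV i Logic.I; rewrite /V iN.
move=> u /andP[u0 uN].
have h1 : `|rsum j N (Hh ^~ w) (B ^~ w) u - J u w| <= r / 2.
  apply: (@within_dyadic R (fun u => rsum j N (Hh ^~ w) (B ^~ w) u - J u w) N%:R (r / 2)); last by rewrite u0.
    have wB x : 0 <= x -> {within `[0, +oo[, continuous (fun u => B (Num.min u x) w)}.
      by move=> x0; exact: (@within_stop R (B ^~ w) x x0 cw).
    apply: within_sub.
      apply: (@within_sum R (N * 2 ^ j) (fun i => Hh (i%:R / 2 ^+ j) w)
        (fun i u => B (Num.min u (i.+1%:R / 2 ^+ j)) w - B (Num.min u (i%:R / 2 ^+ j)) w)) => i.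
      by apply: within_sub; exact: wB.
    apply: (@within_sum R (sp_size (h n)) (sp_coef (h n) ^~ w)
      (fun k u => B (Num.min u (sp_time (h n) k.+1)) w - B (Num.min u (sp_time (h n) k)) w)) => k.
    by apply: within_sub; apply: wB; exact: sp_time_ge0.
  by move=> k i hki; have := hD k Logic.I i Logic.I; rewrite /D hki.
have h2 : `|J u w - M u w| <= r / 2.
  rewrite -lee_fin leNgt; apply/negP => lt; apply: nA; apply: sA.
  apply: lt_le_trans lt _; apply: ereal_sup_ubound; exists u => //=.
  by rewrite in_itv /= u0.
have -> : X u w - X 0 w = M u w by rewrite (eqw u u0) addrAC subrr add0r.
rewrite -(subrK (J u w) (rsum _ _ _ _ _)) -addrA (le_trans (ler_normD _ _)) //; lra.
Unshelve. all: by end_near. Qed.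

End ItoDyadic.

Section SameLaw.
Context {R : realType} {d1 d2 : measure_display} {O1 : measurableType d1} {O2 : measurableType d2}.
Variables (P1 : probability O1 R) (P2 : probability O2 R) (f1 : O1 -> R) (f2 : O2 -> R).
Hypotheses (m1 : measurable_fun [set: O1] f1) (m2 : measurable_fun [set: O2] f2).
Hypothesis e12 : forall C : set R, measurable C -> P1 (f1 @^-1` C) = P2 (f2 @^-1` C).

Lemma same_law_ge0_integral (phi : R -> \bar R) : measurable_fun [set: R] phi -> (forall z, 0 <= phi z)%E ->
  (\int[P1]_w phi (f1 w) = \int[P2]_w phi (f2 w))%E.
Proof.
move=> mphi phi0.
pose n1 := @pushmeasure R _ _ _ (measurableTypeR R) P1 _ m1.
pose n2 := @pushmeasure R _ _ _ (measurableTypeR R) P2 _ m2.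
have e1 : (\int[n1]_z phi z = \int[P1]_w phi (f1 w))%E.
  exact: (@ge0_integral_pushforward _ _ _ (measurableTypeR R) R f1 m1 P1 setT phi).
have e2 : (\int[n2]_z phi z = \int[P2]_w phi (f2 w))%E.
  exact: (@ge0_integral_pushforward _ _ _ (measurableTypeR R) R f2 m2 P2 setT phi).
rewrite -e1 -e2; apply: eq_measure_integral => C mC _; exact: e12.
Qed.

End SameLaw.

Section Bounded.
Context {R : realType} {d : measure_display} {Omega : measurableType d}.
Variables (P : probability Omega R).

Lemma bounded_integrable (f : Omega -> R) (K : R) : measurable_fun [set: Omega] f ->
  (forall w, `|f w| <= K) -> P.-integrable setT (fun w => (f w)%:E).
Proof.
move=> mf hK; apply: (@le_integrable _ _ _ P setT measurableT _ (fun _ => K%:E)) => //.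
- exact/measurable_EFinP.
- by move=> w _ /=; rewrite lee_fin [leRHS]ger0_norm ?(le_trans (normr_ge0 _) (hK w)).
- exact: finite_measure_integrable_cst.
Qed.

End Bounded.

(** * Martingale transforms that seldom climb before returning *)

Section Truncation.
Context {R : realType}.

(** Cut to 0 rather than to the boundary; all that matters is that [tr] is odd, bounded by [r], and
    the identity on small values. *)
Definition tr (r z : R) : R := if `|z| <= r then z else 0.

Lemma tr_opp r z : tr r (- z) = - tr r z.
Proof. by rewrite /tr normrN; case: ifP => //; rewrite oppr0. Qed.

Lemma tr_bound r z : 0 <= r -> `|tr r z| <= r.
Proof. by move=> r0; rewrite /tr; case: ifP => //; rewrite normr0. Qed.

Lemma measurable_tr r : measurable_fun [set: R] (tr r).
Proof.
apply: measurable_fun_ifT => //; apply: (measurable_fun_bool true).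
have := @normr_measurable R setT measurableT _ (measurable_itv `]-oo, r]).
by apply: set_transport => z /=; rewrite in_itv /=; split => -[].
Qed.

Context {d : measure_display} {Omega : measurableType d}.
Variables (P : probability Omega R) (F : R -> set (set Omega)) (B : R -> Omega -> R).
Hypotheses (fF : filtration F) (bB : brownian_motion P F B).

(** The increment is symmetric and independent of [psi], so the product has a symmetric law; an odd
    bounded function of it has mean 0. Truncation thus keeps the transform centred and bounds it
    everywhere. *)
Lemma odd_increment_zero (s t r : R) (psi : Omega -> R) : 0 <= s -> s < t -> 0 <= r ->
  submeasurable (F s) psi -> (\int[P]_w (tr r (psi w * (B t w - B s w)))%:E = 0)%E.
Proof.
move=> s0 st r0 mpsi; have [aB _ _ gB] := bB; have [sF mF incF] := fF.
have t0 := le_trans s0 (ltW st); have mB u : 0 <= u -> measurable_fun [set: Omega] (B u).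
  exact: bm_measurable fF aB.
pose U w := B t w - B s w; have mU : measurable_fun [set: Omega] U by apply: measurable_funB; exact: mB.
have mp : measurable_fun [set: Omega] psi by move=> _ D mD; rewrite setTI; apply: (mF s s0); exact: mpsi.
pose Nu : probability (measurableTypeR R) R := normal_prob 0 (Num.sqrt (t - s)).
have ts : 0 < Num.sqrt (t - s) by rewrite sqrtr_gt0 subr_gt0.
pose nu0 := @pushmeasure R _ _ _ (measurableTypeR R) P _ mp.
have h1 E : measurable E -> P (setT `&` psi @^-1` E) = ((1%:nng : {nonneg R})%:num%:E * nu0 E)%E.
  by move=> mE; rewrite setTI mul1e.
have hU E C : measurable E -> measurable C ->
    P (setT `&` psi @^-1` E `&` U @^-1` C) = (P (setT `&` psi @^-1` E) * Nu C)%E.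
  by move=> mE mC; rewrite setTI; exact: (gB s t s0 st _ (mpsi E mE) C mC).
have hN E C : measurable E -> measurable C ->
    P (setT `&` psi @^-1` E `&` (fun w => - U w) @^-1` C) = (P (setT `&` psi @^-1` E) * Nu C)%E.
  move=> mE mC; have mC' : measurable [set y | C (-1 * y)].
    have h : measurable_fun [set: R] (fun x : R => -1 * x) by exact: measurable_funM.
    by have := h measurableT C mC; rewrite setTI.
  have <- : Nu [set y | C (-1 * y)] = Nu C.
    have k0 : -1 != 0 :> R by rewrite oppr_eq0 oner_neq0.
    have sn0 : Num.sqrt (t - s) != 0 by rewrite gt_eqF.
    transitivity (normal_prob 0 (-1 * Num.sqrt (t - s)) C); first by rewrite (normal_scale k0 sn0 mC).
    by rewrite mulN1r normal_opp.
  rewrite -(hU E _ mE mC'); congr (P _); apply/seteqP; split => w /=; by rewrite mulN1r.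
have e12 (C : set R) : measurable C -> P ((fun w => psi w * U w) @^-1` C) = P ((fun w => - (psi w * U w)) @^-1` C).
  move=> mC; pose S : set (R * R) := [set p | C (p.1 * p.2)].
  have mS : measurable S.
    have h : measurable_fun [set: R * R] (fun p : R * R => p.1 * p.2) by exact: measurable_funM.
    by have := h measurableT C mC; rewrite setTI.
  have a1 := joint_law_scaled measurableT mp mU h1 hU mS.
  have a2 := joint_law_scaled measurableT mp (measurable_funN mU) h1 hN mS.
  have := etrans a1 (esym a2); rewrite !setTI => e; transitivity (P [set w | S (psi w, U w)]) => //.
  by rewrite e; congr (P _); apply/seteqP; split => w /=; rewrite /S /= mulrN.
have mpU : measurable_fun [set: Omega] (fun w => psi w * U w) by exact: measurable_funM.
have mq : measurable_fun [set: R] (fun z => (Num.max (tr r z) 0)%:E).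
  by apply/measurable_EFinP; apply: measurable_maxr => //; exact: measurable_tr.
have e := same_law_ge0_integral mpU (measurable_funN mpU) e12 mq _.
rewrite integralE -/U.
have -> : (\int[P]_w ((fun w => (tr r (psi w * U w))%:E)^\+ w) = \int[P]_w (Num.max (tr r (psi w * U w)) 0)%:E)%E.
  by apply: eq_integral => w _; rewrite funeposE -EFin_max.
have -> : (\int[P]_w ((fun w => (tr r (psi w * U w))%:E)^\- w) = \int[P]_w (Num.max (tr r (- (psi w * U w))) 0)%:E)%E.
  by apply: eq_integral => w _; rewrite funenegE -EFinN -EFin_max tr_opp.
rewrite -e; last by move=> z; rewrite lee_fin le_max lexx orbT.
apply: subee; apply/fin_numPlt; apply/andP; split.
  by apply: lt_le_trans (ltNyr 0) _; apply: integral_ge0 => w _; rewrite lee_fin le_max lexx orbT.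
apply: (@le_lt_trans _ _ (\int[P]_w (cst r%:E w))%E).
  apply: ge0_le_integral => //.
  - by move=> w _; rewrite lee_fin le_max lexx orbT.
  - exact: measurableT_comp mq mpU.
  - by move=> w _; rewrite lee_fin ge_max r0 andbT; exact: le_trans (ler_norm _) (tr_bound _ r0).
by rewrite integral_cst //; change (r%:E * P setT < +oo)%E; rewrite probability_setT mule1 ltry.
Qed.

End Truncation.

Section NoUpcrossing.
Context {R : realType} {d : measure_display} {Omega : measurableType d}.
Variables (P : probability Omega R) (F : R -> set (set Omega)) (B X I : R -> Omega -> R).
Hypotheses (fF : filtration F) (bB : brownian_motion P F B) (hI : ito_equation P F B I X).

Let sF t : 0 <= t -> sigma_algebra [set: Omega] (F t). Proof. by have [h _ _] := fF; exact: h. Qed.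
Let mF t : 0 <= t -> F t `<=` measurable. Proof. by have [_ h _] := fF; exact: h. Qed.
Let incF s t : 0 <= s -> s <= t -> F s `<=` F t. Proof. by have [_ _ h] := fF; exact: h. Qed.

Lemma rsum_succ j N (H b : R -> R) (i : nat) : (i < N * 2 ^ j)%N ->
  rsum j N H b (i.+1%:R / 2 ^+ j) - rsum j N H b (i%:R / 2 ^+ j) =
  H (i%:R / 2 ^+ j) * (b (i.+1%:R / 2 ^+ j) - b (i%:R / 2 ^+ j)).
Proof.
move=> iN; rewrite /rsum -sumrB (bigD1 (Ordinal iN)) //= big1 => [|l li].
  have h : i%:R / 2 ^+ j <= i.+1%:R / 2 ^+ j :> R by rewrite grid_le.
  by rewrite addr0 !minxx (min_r h) (min_l h) subrr mulr0 subr0.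
have {}li : (l : nat) != i by apply: contraNneq li => e; apply/eqP; apply: val_inj.
case: (ltngtP (l : nat) i) => h; last by rewrite h eqxx in li.
  by rewrite !min_r ?grid_le ?subrr // ltnW // ltnW.
by rewrite !min_l ?grid_le ?subrr ?mulr0 ?subrr // ltnW // ltnW.
Qed.

(* [U0] stands for [1_A (X_s - k)] with [k] known at time [s]: the process started below
   [eps] above the level [k] seldom climbs to [eta] before it reaches [k]. *)
Lemma no_upcrossing (n k l : nat) (A H : set Omega) (U0 : Omega -> R) (eps eta : R) :
  (k <= l)%N -> 0 <= eta -> 0 <= eps -> F (k%:R / 2 ^+ n) A -> submeasurable (F (k%:R / 2 ^+ n)) U0 ->
  (forall w, 0 <= U0 w <= eps) -> (forall w, ~ A w -> U0 w = 0) -> measurable H ->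
  (forall w, H w -> forall j i : nat, k%:R / 2 ^+ n <= i%:R / 2 ^+ j :> R -> i%:R / 2 ^+ j <= l%:R / 2 ^+ n :> R ->
     0 <= U0 w + (X (i%:R / 2 ^+ j) w - X (k%:R / 2 ^+ n) w)) ->
  (forall w, H w -> eta <= U0 w + (X (l%:R / 2 ^+ n) w - X (k%:R / 2 ^+ n) w)) ->
  (eta%:E * P H <= eps%:E * P A)%E.
Proof.
move=> kl eta0 eps0 FA mU0 U0b U0A mH hX hend.
have g0 (i j : nat) : 0 <= i%:R / 2 ^+ j :> R by rewrite divr_ge0.
have mA : measurable A := mF (g0 _ _) FA.
(* [3 * rho] is the depth to which the transform below can sink, and [eta * rho] pays for the
   exceptional event of probability at most [rho]. *)
suff main rho : 0 < rho -> (eta%:E * P H <= eps%:E * P A + (3 * rho + eta * rho)%:E)%E.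
  apply/lee_addgt0Pr => e e0; have r0 : 0 < e / (3 + eta) by rewrite divr_gt0 // ltr_wpDr.
  have := main _ r0; congr (_ <= _ + _%:E)%E; field; by rewrite gt_eqF // ltr_wpDr.
move=> rho0; have rho0' := ltW rho0.
have [j [Hh [S [nj aH mS PS hS]]]] := ito_dyadic fF bB hI n l rho0.
pose k0 := (k * 2 ^ (j - n))%N; pose l0 := (l * 2 ^ (j - n))%N.
have refine i : (i * 2 ^ (j - n))%:R / 2 ^+ j = i%:R / 2 ^+ n :> R.
  have e : (2 : R) ^+ j = 2 ^+ n * 2 ^+ (j - n) by rewrite -exprD subnKC.
  by rewrite e natrM natrX; field; rewrite !expf_neq0.
have kl0 : (k0 <= l0)%N by rewrite leq_mul2r kl orbT.
have l0N : (l0 <= l * 2 ^ j)%N by rewrite leq_mul2l leq_pexp2l ?leq_subr ?orbT.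
pose t i : R := (k0 + i)%:R / 2 ^+ j.
have t0 : t 0%N = k%:R / 2 ^+ n by rewrite /t addn0 refine.
have tS i : t i <= t i.+1 by rewrite /t grid_le addnS.
have tge0 i : 0 <= t i by exact: g0.
(* The gate freezes [V] once it falls below [- 2 rho]; as its steps are at most [rho],
   [V >= - 3 rho] everywhere. On [H] and [S] it never closes: there [X] stays above the level and
   [V] follows it within [2 rho], one [rho] at either end of the increment. *)
pose gate (v : R) : R := (- (2 * rho) <= v)%R%:R.
pose V := fix V i (w : Omega) : R := if i is i'.+1 then
  V i' w + tr rho (gate (V i' w) * Hh (t i') w * (B (t i'.+1) w - B (t i') w)) else U0 w.
have mgate : measurable_fun [set: R] gate.
  rewrite (_ : gate = \1_(`[- (2 * rho), +oo[%classic)) //.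
  by apply/funext => v; rewrite indicE; congr ((nat_of_bool _)%:R); apply/idP/idP; rewrite inE /= in_itv /= andbT.
have aB : adapted F B by have [] := bB.
have psi_sub i : submeasurable (F (t i)) (V i) ->
    submeasurable (F (t i)) (fun w => gate (V i w) * Hh (t i) w).
  move=> hV; apply/(submeasurableP _ (sF (tge0 i))); apply: measurable_funM.
    by apply: measurableT_comp => //; apply/(submeasurableP _ (sF (tge0 i))).
  by apply/(submeasurableP _ (sF (tge0 i))); exact: aH.
have up i (f : Omega -> R) : submeasurable (F (t i)) f -> submeasurable (F (t i.+1)) f.
  by move=> hf C mC; apply: (incF (tge0 i) (tS i)); exact: hf.
have Vsub i : submeasurable (F (t i)) (V i).
  elim: i => [|i IH]; first by rewrite t0; exact: mU0.
  apply/(submeasurableP _ (sF (tge0 i.+1))); apply: measurable_funD.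
    by apply/(submeasurableP _ (sF (tge0 i.+1))); exact: up.
  apply: (measurableT_comp (@measurable_tr R rho)); apply: measurable_funM.
    by apply/(submeasurableP _ (sF (tge0 i.+1))); apply: up; exact: psi_sub.
  apply/(submeasurableP _ (sF (tge0 i.+1))).
  exact: (bm_submeasurable fF aB (tge0 i) (tS i)).
have mV i : measurable_fun [set: Omega] (V i).
  by move=> _ C mC; rewrite setTI; apply: (mF (tge0 i)); exact: Vsub.
pose Z i w := tr rho (gate (V i w) * Hh (t i) w * (B (t i.+1) w - B (t i) w)).
have mZ i : measurable_fun [set: Omega] (Z i).
  have -> : Z i = (fun w => V i.+1 w - V i w) by apply/funext => w /=; rewrite /Z; ring.
  exact: measurable_funB.
have Zb i w : `|Z i w| <= rho by exact: tr_bound.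
have Vb i w : `|V i w| <= eps + i%:R * rho.
  elim: i => [|i IH]; first by rewrite mul0r addr0 ger0_norm; have /andP[] := U0b w.
  rewrite /= -/(V i w) -/(Z i w) (le_trans (ler_normD _ _)) // -natr1 mulrDl mul1r addrA lerD //.
have Vlow i w : - (3 * rho) <= V i w.
  elim: i => [|i IH] /=; first by have /andP[h _] := U0b w; lra.
  have := Zb i w; rewrite -/(V i w) -/(Z i w) ler_norml => /andP[h1 _].
  case: (leP (- (2 * rho)) (V i w)) => hv; first lra.
  have -> : Z i w = 0 by rewrite /Z /gate leNgt hv /= !mul0r /tr normr0 rho0'.
  by rewrite addr0.
have intV i : P.-integrable setT (fun w => (V i w)%:E) by exact: bounded_integrable (mV i) (Vb i).
have intZ i : P.-integrable setT (fun w => (Z i w)%:E) by exact: bounded_integrable (mZ i) (Zb i).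
have EV i : (\int[P]_w (V i w)%:E = \int[P]_w (U0 w)%:E)%E.
  elim: i => [//|i IH]; rewrite -IH.
  transitivity (\int[P]_w ((V i w)%:E + (Z i w)%:E))%E; first by apply: eq_integral.
  have -> := integralD_EFin measurableT (intV i) (intZ i); rewrite -[RHS]adde0; congr (_ + _)%E.
  apply: (odd_increment_zero fF bB (tge0 i) _ rho0' (psi_sub i (Vsub i))).
  by rewrite /t ltr_pM2r ?invr_gt0 // ltr_nat addnS.
have onHS w : H w -> S w -> forall i, (k0 + i <= l0)%N ->
    V i w = U0 w + (rsum j l (Hh ^~ w) (B ^~ w) (t i) - rsum j l (Hh ^~ w) (B ^~ w) (t 0%N)) /\
    U0 w + (X (t i) w - X (t 0%N) w) - 2 * rho <= V i w.
  move=> Hw Sw; have [_ hsm hrs] := hS w Sw.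
  have tl i : (k0 + i <= l0)%N -> 0 <= t i <= l%:R.
    by move=> h; rewrite tge0 /= /t -(grid_end j l) grid_le (leq_trans h).
  have low i : (k0 + i <= l0)%N ->
      V i w = U0 w + (rsum j l (Hh ^~ w) (B ^~ w) (t i) - rsum j l (Hh ^~ w) (B ^~ w) (t 0%N)) ->
      U0 w + (X (t i) w - X (t 0%N) w) - 2 * rho <= V i w.
    move=> il ->; have h00 : (k0 + 0 <= l0)%N by rewrite addn0.
    have := hrs _ (tl i il); have := hrs _ (tl 0%N h00); rewrite !ler_norml => /andP[a1 a2] /andP[a3 a4]; lra.
  elim=> [|i IH] il.
    have e : V 0%N w = U0 w + (rsum j l (Hh ^~ w) (B ^~ w) (t 0%N) - rsum j l (Hh ^~ w) (B ^~ w) (t 0%N)).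
      by rewrite subrr addr0.
    by split => //; exact: low.
  have il' : (k0 + i <= l0)%N by rewrite (leq_trans _ il) // addnS.
  have [e1 e2] := IH il'.
  have e : V i.+1 w = U0 w + (rsum j l (Hh ^~ w) (B ^~ w) (t i.+1) - rsum j l (Hh ^~ w) (B ^~ w) (t 0%N)).
    have iN : (k0 + i < l * 2 ^ j)%N by rewrite (leq_trans _ l0N) // -addnS.
    have V0 : - (2 * rho) <= V i w.
      apply: le_trans e2; rewrite -subr_ge0; have := hX w Hw j (k0 + i)%N; rewrite -/(t i) -t0.
      have -> : t 0%N <= t i by rewrite /t grid_le addn0 leq_addr.
      rewrite -(refine l) grid_le il' => /(_ isT isT); lra.
    rewrite /= -/(V i w) /gate V0 mul1r /tr; have := hsm _ iN; rewrite /t addnS => ->.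
    have := rsum_succ (Hh ^~ w) (B ^~ w) iN; rewrite /= => <-; rewrite e1 /t; ring.
  by split => //; exact: low.
have end_ge w : H w -> S w -> eta - 2 * rho <= V (l0 - k0)%N w.
  move=> Hw Sw; have := onHS w Hw Sw (l0 - k0)%N; rewrite subnKC // => /(_ (leqnn _))[_].
  have tend : t (l0 - k0)%N = l%:R / 2 ^+ n by rewrite /t subnKC // refine.
  by rewrite tend t0; have := hend w Hw; lra.
have fin D : measurable D -> P D = (fine (P D))%:E by move=> mD; rewrite fineK // fin_num_measure.
have indE D c : measurable D -> 0 <= c -> (c%:E * P D = \int[P]_w (c * \1_D w)%:E)%E.
  move=> mD c0; under eq_integral do rewrite EFinM.
  by rewrite ge0_integralZl_EFin // ?integral_indic ?setIT //; exact/measurable_EFinP.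
have mHS := measurableI _ _ mH mS.
have mind D c : measurable D -> measurable_fun [set: Omega] (fun w => (c * \1_D w)%:E).
  by move=> mD; apply/measurable_EFinP; apply: measurable_funM => //; exact: measurable_indic.
have hU : (\int[P]_w (U0 w)%:E <= eps%:E * P A)%E.
  rewrite indE //; apply: ge0_le_integral => //.
  - by move=> w _; rewrite lee_fin; have /andP[] := U0b w.
  - exact/measurable_EFinP/(mV 0%N).
  - exact: mind.
  - move=> w _; rewrite lee_fin indicE; case: (pselect (A w)) => Aw.
      by rewrite mem_set // mulr1; have /andP[] := U0b w.
    by rewrite U0A // memNset // mulr0.
(* Markov inequality for the nonnegative [V + 3 rho], which ends above [eta - 2 rho + 3 rho] on [H]
   and [S] and has constant mean. *)
have hV : ((eta + rho)%:E * P (H `&` S) <= \int[P]_w (U0 w)%:E + (3 * rho)%:E)%E.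
  have c0 : 0 <= eta + rho by rewrite addr_ge0.
  have -> : (\int[P]_w (U0 w)%:E + (3 * rho)%:E = \int[P]_w (V (l0 - k0)%N w + 3 * rho)%:E)%E.
    rewrite -(EV (l0 - k0)%N); under [RHS]eq_integral do rewrite EFinD.
    have -> := integralD_EFin measurableT (intV (l0 - k0)%N) (finite_measure_integrable_cst P (3 * rho) measurableT).
    congr (_ + _)%E; transitivity ((3 * rho)%:E * P setT)%E; first by rewrite probability_setT mule1.
    by rewrite -(integral_cst P measurableT (3 * rho)%:E).
  rewrite indE //; apply: ge0_le_integral => //.
  - by move=> w _; rewrite lee_fin mulr_ge0.
  - exact: mind.
  - by apply/measurable_EFinP; apply: measurable_funD.
  - move=> w _; rewrite lee_fin indicE; case: (pselect ((H `&` S) w)) => hw.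
      by rewrite mem_set // mulr1; have := end_ge w (proj1 hw) (proj2 hw); lra.
    by rewrite memNset // mulr0; have := Vlow (l0 - k0)%N w; lra.
have hH : (P H <= P (H `&` S) + rho%:E)%E.
  apply: (@le_trans _ _ (P ((H `&` S) `|` ~` S))).
    apply: le_measure; rewrite ?inE //; first by apply: measurableU => //; exact: measurableC.
    by move=> w Hw; case: (pselect (S w)) => Sw; [left|right].
  apply: le_trans (measureU2 _ mHS (measurableC mS)) _; exact: leeD2l.
have h1 := le_trans hV (leeD2r (3 * rho)%:E hU).
move: h1 hH; rewrite (fin H) // (fin A) // (fin (H `&` S)) //.
have : 0 <= fine (P (H `&` S)) by rewrite fine_ge0.
set p := fine _; set r := fine _; set s := fine _.
rewrite -!EFinM -!EFinD !lee_fin => p0 h1 h2.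
have := ler_wpM2l eta0 h2; have := mulr_ge0 rho0' p0; lra.
Qed.

End NoUpcrossing.

(** * Optional times and immediate return *)

Section OptionalTime.
Context {R : realType} {d : measure_display} {Omega : measurableType d}.
Variables (F : R -> set (set Omega)) (sigma : Omega -> \bar R).
Hypothesis fF : filtration F.
Hypothesis sigma0 : forall w, (0 <= sigma w)%E.
Hypothesis opt : forall t, 0 <= t -> F t [set w | (sigma w < t%:E)%E].

Let sF t : 0 <= t -> sigma_algebra [set: Omega] (F t). Proof. by have [h _ _] := fF; exact: h. Qed.
Let mF t : 0 <= t -> F t `<=` measurable. Proof. by have [_ h _] := fF; exact: h. Qed.
Let incF s t : 0 <= s -> s <= t -> F s `<=` F t. Proof. by have [_ _ h] := fF; exact: h. Qed.

(** [sigma] as far as it is known at time [s]; the default 0 is read only where [sigma] has not yet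
    occurred. *)
Definition before (s : R) (w : Omega) : R := if (sigma w < s%:E)%E then fine (sigma w) else 0.

Lemma fine_optional w : (sigma w < +oo)%E -> sigma w = (fine (sigma w))%:E.
Proof. by move=> h; rewrite fineK // fin_real // h (lt_le_trans (ltNyr 0)). Qed.

Lemma before_ge0 s w : 0 <= before s w.
Proof. by rewrite /before; case: ifP => // _; exact: fine_ge0. Qed.

Lemma before_le s w : 0 <= s -> before s w <= s.
Proof.
move=> s0; rewrite /before; case: ifP => // h.
by rewrite -lee_fin -fine_optional ?(lt_trans h) ?ltry // ltW.
Qed.

Lemma before_optional s : 0 <= s -> submeasurable (F s) (before s).
Proof.
move=> s0; apply/(submeasurableP _ (sF s0)).
apply: (measurability (@RGenInftyO.G R)) => [|/= _ [_ [t ->] <-]].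
  exact: RGenInftyO.measurableE.
rewrite setTI; apply/(submeasurable_set _ (sF s0)).
case: (leP t 0) => t0.
  rewrite (_ : _ @^-1` _ = ~` setT).
    exact: (sigma_algebra_C (sF s0) (sigma_algebra_T (sF s0))).
  apply/seteqP; split => w /=; rewrite in_itv //= => h; exfalso.
  by move: (lt_le_trans h t0); rewrite ltNge before_ge0.
case: (ltP s t) => st.
  rewrite (_ : _ @^-1` _ = setT); first exact: (sigma_algebra_T (sF s0)).
  by apply/seteqP; split => // w _ /=; rewrite in_itv /= (le_lt_trans _ st) ?before_le.
rewrite (_ : _ @^-1` _ = ~` ([set w | (sigma w < s%:E)%E] `&` ~` [set w | (sigma w < t%:E)%E])).
  apply: (sigma_algebra_C (sF s0)); apply: (sigma_algebra_I (sF s0)); first exact: opt.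
  by apply: (sigma_algebra_C (sF s0)); apply: (incF (ltW t0) st); apply: opt; exact: ltW.
apply/seteqP; split => w /=; rewrite in_itv /= /before.
  case: ifPn => [h|/negP h] ht; last by move=> [h' _]; apply: h.
  by move=> [_]; apply; rewrite fine_optional ?(lt_trans h) ?ltry // lte_fin.
move=> hn; case: ifP => // h; have hoo : (sigma w < +oo)%E by rewrite (lt_trans h) ?ltry.
by rewrite -lte_fin -fine_optional //; apply: contrapT => h2; apply: hn.
Qed.

Lemma jmeas_adapted_stopped (V : R -> Omega -> R) (t : R) :
  right_continuous_paths V -> adapted F V -> 0 <= t ->
  jmeas (fun s (w : g_sigma_algebraType (F t)) => V (Num.min s t) w).
Proof.
move=> rV aV t0; apply: jmeas_right_continuous => [s s0|w s s0].
  apply/(submeasurableP _ (sF t0)) => B mB.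
  have st0 : 0 <= Num.min s t by rewrite le_min s0.
  have st : Num.min s t <= t by rewrite ge_min lexx orbT.
  exact: (incF st0 st (aV _ st0 _ mB)).
case: (ltP s t) => st.
  apply: cvg_trans (rV w s s0).
  apply: near_eq_cvg; near=> u; rewrite min_l //; near: u.
  exact: nbhs_right_le.
by apply: cvg_near_cst; near=> u; rewrite min_r // (le_trans st) //; near: u; exact: nbhs_right_ge.
Unshelve. all: by end_near. Qed.

Lemma before_value (V : R -> Omega -> R) (s : R) : right_continuous_paths V -> adapted F V ->
  0 <= s -> submeasurable (F s) (fun w => V (before s w) w).
Proof.
move=> rV aV s0; have jW := jmeas_adapted_stopped rV aV s0.
have mb : measurable_fun [set: g_sigma_algebraType (F s)] (before s : g_sigma_algebraType (F s) -> R).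
  by apply/(submeasurableP _ (sF s0)); exact: before_optional.
have := jmeas_random jW mb (before_ge0 s); move=> /(submeasurableP _ (sF s0)) h D mD.
have := h D mD; congr (F s _); apply/seteqP; split => w /=; by rewrite min_l ?before_le.
Qed.

Lemma optional_finite_measurable : measurable [set w | (sigma w < +oo)%E].
Proof.
rewrite (_ : [set w | _] = \bigcup_n [set w | (sigma w < n%:R%:E)%E]).
  by apply: bigcupT_measurable => n; apply: (mF (ler0n _ n)); exact: opt.
apply/seteqP; split => w /= => [h|[n _] /= h]; last by rewrite (lt_trans h) ?ltry.
exists (Num.trunc (fine (sigma w))).+1 => //=.
by rewrite fine_optional // lte_fin truncnS_gt.
Qed.

Lemma fine_optional_measurable : measurable_fun [set: Omega] (fun w => fine (sigma w)).
Proof.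
apply: (measurability (@RGenInftyO.G R)) => [|/= _ [_ [t ->] <-]].
  exact: RGenInftyO.measurableE.
rewrite setTI; case: (leP t 0) => t0.
  rewrite (_ : _ @^-1` _ = set0) //; apply/seteqP; split => w //=; rewrite in_itv /= => h.
  by move: (lt_le_trans h t0); rewrite ltNge fine_ge0.
rewrite (_ : _ @^-1` _ = [set w | (sigma w < t%:E)%E] `|` ~` [set w | (sigma w < +oo)%E]).
  apply: measurableU; first by apply: (mF (ltW t0)); apply: opt; exact: ltW.
  by apply: measurableC; exact: optional_finite_measurable.
apply/seteqP; split => w /=; rewrite in_itv /=.
  move=> h; case: (pselect (sigma w < +oo)%E) => hf; last by right.
  by left; rewrite fine_optional // lte_fin.
move=> [h|/negP]; first by rewrite -lte_fin -fine_optional // (lt_trans h) ?ltry.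
by rewrite -leNgt leye_eq => /eqP ->.
Qed.

End OptionalTime.

Section Opposite.
Context {R : realType} {d : measure_display} {Omega : measurableType d}.
Variables (P : probability Omega R) (F : R -> set (set Omega)) (B X I : R -> Omega -> R).
Hypotheses (fF : filtration F) (bB : brownian_motion P F B) (hI : ito_equation P F B I X).

(** With [ito_opp] it allows the one-sided return to be applied to [- X]; the symmetry of the normal
    law is the point. *)
Lemma brownian_opp : brownian_motion P F (fun t w => - B t w).
Proof.
have [aB B0 cB gB] := bB; have [sF mF incF] := fF; split.
- move=> t t0; apply/(submeasurableP _ (sF t t0)); apply: measurable_funN.
  by apply/(submeasurableP _ (sF t t0)); exact: aB.
- by apply: filterS B0 => w ->; rewrite oppr0.
- apply: filterS cB => w; set f := fun t => B t w; move=> /subspace_continuousP cw.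
  by apply/subspace_continuousP => t ht; apply: cvgN; exact: cw.
- move=> s t s0 st A FA C mC.
  have mC' : measurable [set y | C (-1 * y)].
    have h : measurable_fun [set: R] (fun x : R => -1 * x) by exact: measurable_funM.
    by have := h measurableT C mC; rewrite setTI.
  have k0 : -1 != 0 :> R by rewrite oppr_eq0 oner_neq0.
  have sn0 : Num.sqrt (t - s) != 0 by rewrite gt_eqF // sqrtr_gt0 subr_gt0.
  rewrite -normal_opp -mulN1r normal_scale // -(gB s t s0 st A FA _ mC').
  congr (P (_ `&` _)); apply/seteqP; split => w /=; rewrite mulN1r; congr C; ring.
Qed.

Lemma ito_opp : ito_equation P F (fun t w => - B t w) I (fun t w => - X t w).
Proof.
have [M [pI fin [h hh]] eqM] := hI; exists (fun t w => - M t w).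
  split => //; exists h => t t0; have [h1 h2] := hh t t0; split => // e e0.
  have [A [hA cA]] := h2 e e0; exists A; split => // n; have [mA sA] := hA n; split => //.
  apply: subset_trans sA => w /=; congr (_ < ereal_sup _)%E; apply: eq_imagel => s _.
  rewrite /sp_integral; congr (_%:E); rewrite -[in RHS]normrN; congr `|_|.
  rewrite opprB addrC -sumrN; congr (_ + _); rewrite ?opprK //.
  by apply: eq_bigr => k _; ring.
by apply: filterS eqM => w hw t t0; rewrite (hw t t0); ring.
Qed.

End Opposite.

Section Return.
Context {R : realType} {d : measure_display} {Omega : measurableType d}.
Variables (P : probability Omega R) (F : R -> set (set Omega)) (B X I : R -> Omega -> R) (sigma : Omega -> \bar R).
Hypotheses (fF : filtration F) (bB : brownian_motion P F B) (hI : ito_equation P F B I X).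
Hypotheses (rX : right_continuous_paths X) (aX : adapted F X).
Hypothesis sigma0 : forall w, (0 <= sigma w)%E.
Hypothesis opt : forall t, 0 <= t -> F t [set w | (sigma w < t%:E)%E].

Let sF t : 0 <= t -> sigma_algebra [set: Omega] (F t). Proof. by have [h _ _] := fF; exact: h. Qed.
Let mF t : 0 <= t -> F t `<=` measurable. Proof. by have [_ h _] := fF; exact: h. Qed.
Let incF s t : 0 <= s -> s <= t -> F s `<=` F t. Proof. by have [_ _ h] := fF; exact: h. Qed.
Let mX t : 0 <= t -> measurable_fun [set: Omega] (X t).
Proof. by move=> t0 _ D mD; rewrite setTI; apply: (mF t0); exact: aX. Qed.
Let jX : jmeas X. Proof. exact: jmeas_right_continuous. Qed.
Let s w : R := fine (sigma w).
Let s0 w : 0 <= s w. Proof. exact: fine_ge0. Qed.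
Let ms : measurable_fun [set: Omega] s. Proof. exact: (fine_optional_measurable fF sigma0 opt). Qed.
Let kap w := X (s w) w.
Let mkap : measurable_fun [set: Omega] kap. Proof. exact: (jmeas_random jX ms s0). Qed.
Let i2 p : R := (2 ^+ p)^-1.
Let i2_gt0 p : 0 < i2 p. Proof. by rewrite invr_gt0 exprn_gt0. Qed.
Let i2S p : i2 p = 2 * i2 p.+1. Proof. by rewrite /i2 exprS; field; rewrite expf_neq0. Qed.
Let i2_le p n : (p <= n)%N -> i2 n <= i2 p.
Proof. by move=> pn; rewrite lef_pV2 ?posrE ?exprn_gt0 // ler_eXn2l // ltr1n. Qed.

Let mle (f h : Omega -> R) : measurable_fun [set: Omega] f -> measurable_fun [set: Omega] h ->
  measurable [set w | f w <= h w].
Proof.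
move=> mf mh; have := measurable_funB mh mf measurableT (measurable_itv `[0, +oo[).
by rewrite setTI; apply: set_transport => w /=; rewrite in_itv /= andbT subr_ge0.
Qed.

Let mlt (f h : Omega -> R) : measurable_fun [set: Omega] f -> measurable_fun [set: Omega] h ->
  measurable [set w | f w < h w].
Proof.
move=> mf mh; have := measurable_funB mh mf measurableT (measurable_itv `]0, +oo[).
by rewrite setTI; apply: set_transport => w /=; rewrite in_itv /= andbT subr_gt0.
Qed.

Let window p : set Omega := [set w | (sigma w < +oo)%E] `&`
  \bigcap_j \bigcap_i [set w | s w < i%:R / 2 ^+ j -> i%:R / 2 ^+ j <= s w + i2 p -> kap w <= X (i%:R / 2 ^+ j) w].

(** Checked at half the window only, which leaves room for replacing [sigma] by the next grid time;
    the factor 2 leaves room for the error of that replacement. *)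
Let stay p eta : set Omega := window p `&` [set w | kap w + 2 * eta <= X (s w + i2 p.+1) w].

Let g0 (i j : nat) : 0 <= i%:R / 2 ^+ j :> R. Proof. by rewrite divr_ge0. Qed.

Let mstay p eta : measurable (stay p eta).
Proof.
apply: measurableI; first apply: measurableI.
- exact: (optional_finite_measurable fF sigma0 opt).
- apply: bigcapT_measurable => j; apply: bigcapT_measurable => i.
  rewrite (_ : [set w | _] = ~` [set w | s w < i%:R / 2 ^+ j] `|` (~` [set w | i%:R / 2 ^+ j <= s w + i2 p] `|`
      [set w | kap w <= X (i%:R / 2 ^+ j) w])).
    apply: measurableU; first by apply: measurableC; exact: mlt.
    apply: measurableU; first by apply: measurableC; apply: mle => //; exact: measurable_funD.
    by apply: mle => //; exact: mX.
  apply/seteqP; split => w /= => [h|]; last by case=> [h1 /h1|[h1 _ /h1|]].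
  case: (pselect (s w < i%:R / 2 ^+ j)) => h1; last by left.
  case: (pselect (i%:R / 2 ^+ j <= s w + i2 p)) => h2; last by right; left.
  by right; right; exact: h.
- apply: mle; first exact: measurable_funD.
  apply: (jmeas_random jX) => [|w]; first exact: measurable_funD.
  by rewrite addr_ge0 // ltW.
Qed.

Let cell n k : set Omega := [set w | (sigma w < (k.+1%:R / 2 ^+ n)%:E)%E] `&`
  ~` [set w | (sigma w < (k%:R / 2 ^+ n)%:E)%E].

Let cellF n k : F (k.+1%:R / 2 ^+ n) (cell n k).
Proof.
apply: (sigma_algebra_I (sF _)) => //; first exact: opt.
apply: (sigma_algebra_C (sF _)) => //; apply: (incF (g0 k n)); first by rewrite grid_le.
exact: opt.
Qed.

Let cellE n k w : cell n k w -> [/\ (sigma w < +oo)%E, k%:R / 2 ^+ n <= s w & s w < k.+1%:R / 2 ^+ n].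
Proof.
move=> [/= h1 /negP]; rewrite -leNgt => h2; have hoo : (sigma w < +oo)%E by rewrite (lt_trans h1) ?ltry.
have e : (s w)%:E = sigma w := esym (fine_optional sigma0 hoo).
by split => //; [rewrite -lee_fin e|rewrite -lte_fin e].
Qed.

Let in_cell n w : (sigma w < +oo)%E -> cell n (Num.trunc (s w * 2 ^+ n)) w.
Proof.
move=> hoo; rewrite /cell /= (fine_optional sigma0 hoo) !lte_fin; split; first exact: gup_gt.
by apply/negP; rewrite -leNgt; exact: gdn_le.
Qed.

(** [stay] as seen from the first grid time after [sigma], in the cell where [sigma] lies: there [X]
    is at most [eps] above the level, and it climbs by [eta] without going below. *)
Let hit n p eta eps k : set Omega := stay p eta `&` cell n k `&`
  [set w | X (k.+1%:R / 2 ^+ n) w <= kap w + eps] `&`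
  [set w | kap w + eta <= X (k.+1%:R / 2 ^+ n + i2 p.+1) w].

Let cell_triv n : trivIset setT (cell n).
Proof.
apply/trivIsetP => k k' _ _ kk'; apply/seteqP; split => // w [/cellE[_ h1 h2] /cellE[_ h3 h4]].
move/eqP: kk'; apply; apply/eqP; rewrite eqn_leq; apply/andP; split; rewrite -ltnS.
  by have := le_lt_trans h1 h4; rewrite ltr_pM2r ?invr_gt0 // ltr_nat.
by have := le_lt_trans h3 h2; rewrite ltr_pM2r ?invr_gt0 // ltr_nat.
Qed.

Let mhit n p eta eps k : measurable (hit n p eta eps k).
Proof.
have h : 0 <= k.+1%:R / 2 ^+ n + i2 p.+1 by rewrite addr_ge0 // ltW.
apply: measurableI; first apply: measurableI; first apply: measurableI => //.
- exact: (mF (g0 _ _) (cellF n k)).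
- apply: mle; [exact: mX|exact: measurable_funD].
- by apply: mle; [exact: measurable_funD|exact: mX].
Qed.

(** The level [X_sigma] is known at the end of the cell, so [no_upcrossing] applies from that grid
    time, [U0] being the clipped height above the level. *)
Let hit_small n p eta eps k : (p.+1 <= n)%N -> 0 < eta -> 0 < eps ->
  (eta%:E * P (hit n p eta eps k) <= eps%:E * P (cell n k))%E.
Proof.
move=> pn eta0 eps0; pose t : R := k.+1%:R / 2 ^+ n.
have t0 : 0 <= t by exact: g0.
pose bf w := before sigma t w.
pose U0 w := \1_(cell n k) w * Num.min (Num.max (X t w - X (bf w) w) 0) eps.
(* The grid index of half a window after [t]. Since [n >= p + 1], this end still lies within the
   full window after [sigma]. *)
pose l := (k.+1 + 2 ^ (n - p.+1))%N.
have lE : l%:R / 2 ^+ n = t + i2 p.+1 :> R.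
  rewrite /l /t natrD mulrDl natrX; congr (_ + _); rewrite /i2.
  have -> : (2 : R) ^+ n = 2 ^+ p.+1 * 2 ^+ (n - p.+1) by rewrite -exprD subnKC.
  by field; rewrite !expf_neq0.
have onhit w : hit n p eta eps k w -> U0 w = X t w - kap w /\
    forall i j : nat, t <= i%:R / 2 ^+ j :> R -> i%:R / 2 ^+ j <= l%:R / 2 ^+ n :> R -> kap w <= X (i%:R / 2 ^+ j) w.
  move=> [[[[[_ W] _] cw] h1] _]; have [hoo c1 c2] := cellE cw; rewrite -/t in c2.
  have W' (i j : nat) : t <= i%:R / 2 ^+ j :> R -> i%:R / 2 ^+ j <= l%:R / 2 ^+ n :> R -> kap w <= X (i%:R / 2 ^+ j) w.
    move=> r1 r2; apply: (W j Logic.I i Logic.I); first exact: lt_le_trans r1.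
    apply: le_trans r2 _; rewrite lE (i2S p); have := i2_le pn.
    have : t = k%:R / 2 ^+ n + i2 n by rewrite /t -natr1 mulrDl mul1r.
    by move: c1; lra.
  split => //; rewrite /U0 indicE mem_set // mul1r.
  have -> : bf w = s w.
    by rewrite /bf /before; have [/= -> _] := cw.
  have : kap w <= X t w by apply: W' => //; rewrite lE lerDl ltW.
  move=> h2; rewrite max_l ?subr_ge0 // min_l //; move: h1; rewrite /= -/t /kap; lra.
apply: (no_upcrossing (k := k.+1) (l := l) (U0 := U0) (n := n) fF bB hI) => //.
- by rewrite /l leq_addr.
- exact: ltW.
- exact: ltW.
- apply/(submeasurableP _ (sF t0)); apply: measurable_funM.
    apply: measurable_indic; apply/(submeasurable_set _ (sF t0)); exact: cellF.
  apply: measurable_minr => //; apply: measurable_maxr => //; apply: measurable_funB.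
    by apply/(submeasurableP _ (sF t0)); exact: aX.
  by apply/(submeasurableP _ (sF t0)); exact: (before_value fF sigma0 opt rX aX t0).
- move=> w; rewrite /U0 indicE; case: (w \in _); rewrite ?mul0r ?mul1r; last by rewrite lexx ltW.
  by rewrite le_min le_max lexx orbT (ltW eps0) /= ge_min lexx orbT.
- by move=> w nw; rewrite /U0 indicE memNset // mul0r.
- move=> w hw j i r1 r2; have [-> W] := onhit w hw; rewrite -/t addrC addrA subrK subr_ge0.
  exact: W.
- move=> w hw; have [-> W] := onhit w hw; have [_ /=] := hw; rewrite lE -/t; lra.
Qed.

Let hits n p eta eps : (p.+1 <= n)%N -> 0 < eta -> 0 < eps ->
  (eta%:E * P (\bigcup_k hit n p eta eps k) <= eps%:E)%E.
Proof.
move=> pn eta0 eps0.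
have th : trivIset setT (hit n p eta eps).
  apply/trivIsetP => k k' _ _ kk'; apply/seteqP; split => // w [[[[_ h1] _] _] [[[_ h2] _] _]].
  by have /trivIsetP/(_ k k' Logic.I Logic.I kk') := @cell_triv n; rewrite -subset0; apply.
have mh k : measurable (hit n p eta eps k) by exact: mhit.
have mc k : measurable (cell n k) := mF (g0 _ _) (cellF n k).
have -> := measure_semi_bigcup P mh th (bigcupT_measurable _ mh).
rewrite -nneseriesZl //; apply: (@le_trans _ _ (\sum_(k <oo) eps%:E * P (cell n k))%E).
  apply: lee_nneseries => [k _ _|k _]; last exact: hit_small.
  by rewrite mule_ge0 // lee_fin ltW.
rewrite nneseriesZl //; have <- := measure_semi_bigcup P mc (@cell_triv n) (bigcupT_measurable _ mc).
rewrite -[leRHS]mule1; apply: lee_wpmul2l; first by rewrite lee_fin ltW.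
by apply: probability_le1; exact: bigcupT_measurable.
Qed.

(** By right continuity [stay] lies in the union of the [hit] over cells for all large [n], and the
    cells being disjoint the bounds add up to [eps / eta]. *)
Let stay_null p eta : 0 < eta -> P (stay p eta) = 0%E.
Proof.
move=> eta0; apply/eqP; rewrite eq_le measure_ge0 andbT; apply/lee_addgt0Pr => e e0; rewrite add0e.
(* The choice [eps = eta * e] makes the summed bound equal to [e]. *)
have ee0 : 0 < eta * e by rewrite mulr_gt0.
pose En n := \bigcup_k hit n p eta (eta * e) k.
have cE : P (En n) @[n --> \oo] --> P (stay p eta).
  apply: cvg_prob => [n| |]; first by apply: bigcupT_measurable => k; exact: mhit.
    exact: mstay.
  apply: aeW => w; case: (pselect (stay p eta w)) => hw; last first.
    by exists 0%N => // n _; split => // -[k _ [[[h _] _] _]].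
  have [[hoo _] h2] := hw.
  have /cvgrPdist_lt/(_ _ ee0) := @rX w (s w) (s0 w); rewrite near_withinE => -[r1 /= r10 hr1].
  have sp : 0 <= s w + i2 p.+1 by rewrite addr_ge0 // ltW.
  have /cvgrPdist_lt/(_ _ eta0) := @rX w (s w + i2 p.+1) sp; rewrite near_withinE => -[r2 /= r20 hr2].
  apply: filterS2 (pow2_small r10) (pow2_small r20) => n n1 n2; split => // _.
  exists (Num.trunc (s w * 2 ^+ n)) => //; rewrite /hit -/(gup n (s w)).
  have u1 := gup_gt n (s w); have u2 := gup_le n (s0 w).
  have a1 : `|kap w - X (gup n (s w)) w| < eta * e.
    by apply: hr1 => //=; rewrite ltr_norml; lra.
  have a2 : `|X (s w + i2 p.+1) w - X (gup n (s w) + i2 p.+1) w| < eta.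
    by apply: hr2; [rewrite /= ltr_norml; lra|rewrite ltrD2r].
  split; first (split; first by split => //; exact: in_cell).
    by move: a1; rewrite /= ltr_norml; lra.
  by move: a2 h2; rewrite /= ltr_norml; lra.
apply: (cvge_le _ cE); near=> n; rewrite -(lee_pmul2l (x := eta%:E)) ?lte_fin // -EFinM.
by apply: hits => //; near: n; exact: nbhs_infty_ge.
Unshelve. all: by end_near. Qed.

(** If [X] exceeded [X_sigma] throughout a short interval after [sigma], it would be strictly above
    at half of a dyadic window, hence in one of countably many null events [stay]. *)
Lemma return_below : {ae P, forall w, (sigma w < +oo)%E -> forall e, 0 < e ->
  exists2 r, fine (sigma w) < r < fine (sigma w) + e & X r w <= X (fine (sigma w)) w}.
Proof.
have : {ae P, forall w, forall p m : nat, ~ stay p (m.+1%:R^-1) w}.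
  apply: ae_foralln => p; apply: ae_foralln => m; exists (stay p (m.+1%:R^-1)); split.
  - exact: mstay.
  - by apply: stay_null; rewrite invr_gt0.
  - by move=> w /= /contrapT.
apply: filterS => w hw hoo e e0; apply: contrapT => nr.
have [p _ hp] := pow2_small e0; have {}hp := hp p (leqnn p); rewrite -/(i2 p) in hp.
have nr' r : s w < r -> r <= s w + i2 p -> kap w < X r w.
  move=> r1 r2; rewrite ltNge; apply/negP => h; apply: nr; exists r => //.
  by rewrite r1 (le_lt_trans r2) // ltrD2l.
have hk : kap w < X (s w + i2 p.+1) w by apply: nr'; have := i2_gt0 p.+1; rewrite ?(i2S p); lra.
pose dl := (X (s w + i2 p.+1) w - kap w) / 2.
have dl0 : 0 < dl by rewrite divr_gt0 // subr_gt0.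
have [m _ hm] := near_infty_natSinv_lt (PosNum dl0).
apply: (hw p m); split; first split => //.
  by move=> j _ i _ /= r1 r2; apply: ltW; exact: nr'.
have h : m.+1%:R^-1 < dl := hm m (leqnn m).
rewrite /=; move: h; rewrite /dl; set z : R := (m.+1%:R)^-1; lra.
Qed.

End Return.

(* The integral is a supremum over simple functions below, hence monotone without measurability. *)
Lemma integral_mono {R : realType} {d : measure_display} {Omega : measurableType d}
    (mu : {measure set Omega -> \bar R}) (f h : Omega -> \bar R) :
  (forall w, 0 <= f w)%E -> (forall w, f w <= h w)%E -> (\int[mu]_w f w <= \int[mu]_w h w)%E.
Proof.
move=> f0 fh; have h0 w : (0 <= h w)%E by exact: le_trans (fh w).
rewrite !ge0_integralTE //; apply: ereal_sup_le => _ [k /= kf <-]; exists k => //= w.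
exact: le_trans (kf w) (fh w).
Qed.

Section ExactReturn.
Context {R : realType} {d : measure_display} {Omega : measurableType d}.
Variables (P : probability Omega R) (F : R -> set (set Omega)) (B X I : R -> Omega -> R).
Hypotheses (fF : filtration F) (bB : brownian_motion P F B) (hI : ito_equation P F B I X).

(** Riemann sums against a continuous path are continuous. Along infinitely many [n], almost surely,
    they are within [2 ^ - n] of the increments of [X] on [[0, N]], so [X] is continuous as a
    uniform limit. *)
Lemma ito_continuous : {ae P, forall w, {within `[0, +oo[, continuous X ^~ w}}.
Proof.
have r0 n : 0 < (2 ^+ n)^-1 :> R by rewrite invr_gt0 exprn_gt0.
have /choice[S hS] (q : nat * nat) : exists S : set Omega, [/\ measurable S, (P (~` S) <= ((2 ^+ q.2)^-1)%:E)%E &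
    forall w, S w -> exists b : R -> R, {within `[0, +oo[, continuous b} /\
      forall u, 0 <= u <= q.1%:R -> `|b u - (X u w - X 0 w)| <= (2 ^+ q.2)^-1].
  have [j [H [S [_ _ mS PS hS]]]] := ito_dyadic fF bB hI 0 q.1 (r0 q.2).
  exists S; split => // w Sw; have [cw _ hw] := hS w Sw.
  exists (rsum j q.1 (H ^~ w) (B ^~ w)); split => //.
  apply: (@within_sum R (q.1 * 2 ^ j) (fun i => H (i%:R / 2 ^+ j) w)
    (fun i u => B (Num.min u (i.+1%:R / 2 ^+ j)) w - B (Num.min u (i%:R / 2 ^+ j)) w)) => i.
  by apply: within_sub; apply: (@within_stop R (B ^~ w)) => //; rewrite divr_ge0.
have : {ae P, forall w, forall N n0 : nat, exists2 n, (n0 <= n)%N & S (N, n) w}.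
  apply: ae_foralln => N; apply: ae_foralln => n0.
  pose C := \bigcap_(n in [set n | (n0 <= n)%N]) ~` S (N, n).
  have mC : measurable C.
    apply: bigcap_measurable => [|n _]; first by exists n0 => /=.
    by apply: measurableC; have [] := hS (N, n).
  exists C; split => //; last first.
    by move=> w /= hw n n0n Sw; apply: hw; exists n.
  apply/eqP; rewrite eq_le measure_ge0 andbT; apply/lee_addgt0Pr => e e0; rewrite add0e.
  have [p _ hp] := pow2_small e0; have hp' := hp _ (leq_maxr n0 p).
  have [mS PS _] := hS (N, maxn n0 p).
  apply: (@le_trans _ _ (P (~` S (N, maxn n0 p)))).
    apply: le_measure; rewrite ?inE //; first exact: measurableC.
    by move=> w; apply; rewrite /= leq_maxl.
  by apply: le_trans PS _; rewrite lee_fin ltW.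
apply: filterS => w hw; apply: near_within => p e p0 e0; have e3 : 0 < e / 3 by rewrite divr_gt0.
have [n0 _ hn0] := pow2_small e3; pose N := (Num.trunc p).+2.
have [n n0n Sw] := hw N n0; have [_ _ /(_ w Sw)[b [cb hb]]] := hS (N, n).
have [r rp hr] := within_near cb p0 e3.
have pN : p + 1 <= N%:R by rewrite /N -natr1 lerD2r ltW // truncnS_gt.
exists (Num.min r 1); first by rewrite lt_min rp ltr01.
move=> x x0; rewrite lt_min => /andP[h1 h2].
have xN : x <= N%:R by apply: le_trans pN; move: h2; rewrite ltr_norml; lra.
have := hn0 n n0n => /= hn.
have := hr x x0 h1; have := hb x; have := hb p; rewrite /= p0 x0 xN (le_trans _ pN) ?lerDl //=.
move=> /(_ isT) a1 /(_ isT) a2 a3.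
move: a1 a2 a3; rewrite !ler_norml => /andP[a1 a1'] /andP[a2 a2'] /andP[a3 a3']; apply/andP; split; lra.
Qed.

Variable sigma : Omega -> \bar R.
Hypotheses (rX : right_continuous_paths X) (aX : adapted F X).
Hypothesis sigma0 : forall w, (0 <= sigma w)%E.
Hypothesis opt : forall t, 0 <= t -> F t [set w | (sigma w < t%:E)%E].

(** [X] comes at or below the level, and at or above it, arbitrarily soon after [sigma]; the
    intermediate value theorem gives equality. *)
Lemma exact_return : {ae P, forall w, (sigma w < +oo)%E -> forall e, 0 < e ->
  exists2 r, fine (sigma w) < r < fine (sigma w) + e & X r w = X (fine (sigma w)) w}.
Proof.
have [sF _ _] := fF.
have rN : right_continuous_paths (fun t w => - X t w) by move=> w t t0; apply: cvgN; exact: rX.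
have aN : adapted F (fun t w => - X t w).
  move=> t t0; apply/(submeasurableP _ (sF t t0)); apply: measurable_funN.
  by apply/(submeasurableP _ (sF t t0)); exact: aX.
have h1 := return_below fF bB hI rX aX sigma0 opt.
have h2 := return_below fF (brownian_opp fF bB) (ito_opp hI) rN aN sigma0 opt.
apply: filterS3 ito_continuous h1 h2 => w cw a1 a2 hoo e e0.
have [r1 /andP[r11 r12] x1] := a1 hoo e e0; have [r2 /andP[r21 r22]] := a2 hoo e e0.
rewrite lerN2 => x2; set s := fine _ in r11 r12 r21 r22 x1 x2 *.
have s0 : 0 <= s by exact: fine_ge0.
have cab (a b : R) : 0 <= a -> {within `[a, b], continuous (X ^~ w)}.
  move=> a0; apply: (@continuous_subspaceW _ _ `[a, b]%classic `[0, +oo[%classic (X ^~ w)) cw.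
  by move=> u /=; rewrite !in_itv /= andbT => /andP[au _]; exact: le_trans au.
case: (leP r1 r2) => r12'.
  have [|c] := IVT r12' (cab r1 r2 (le_trans s0 (ltW r11))) (v := X s w).
    by rewrite ge_min x1 /= le_max x2 orbT.
  rewrite in_itv /= => /andP[c1 c2] cE; exists c => //.
  by rewrite (lt_le_trans r11) // (le_lt_trans c2).
have [|c] := IVT (ltW r12') (cab r2 r1 (le_trans s0 (ltW r21))) (v := X s w).
  by rewrite ge_min x1 orbT /= le_max x2.
rewrite in_itv /= => /andP[c1 c2] cE; exists c => //.
by rewrite (lt_le_trans r21) // (le_lt_trans c2).
Qed.

End ExactReturn.

(** * Stopping times at which the level is regained *)

Section FirstReturn.
Context {R : realType} {d : measure_display} {Omega : measurableType d}.
Variables (G : R -> set (set Omega)) (X : R -> Omega -> R) (sigma : Omega -> \bar R) (n : nat).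
Hypothesis fG : filtration G.
Hypotheses (rX : right_continuous_paths X) (aX : adapted G X).
Hypothesis sigma0 : forall w, (0 <= sigma w)%E.
Hypothesis opt : forall t, 0 <= t -> G t [set w | (sigma w < t%:E)%E].

Let sG t : 0 <= t -> sigma_algebra [set: Omega] (G t). Proof. by have [h _ _] := fG; exact: h. Qed.
Let incG s t : 0 <= s -> s <= t -> G s `<=` G t. Proof. by have [_ _ h] := fG; exact: h. Qed.
Let k w := X (fine (sigma w)) w.
Let g0 (i j : nat) : 0 <= i%:R / 2 ^+ j :> R. Proof. by rewrite divr_ge0. Qed.

(** Equivalent to [gup n sigma <= t]. An optional time is known only strictly after it occurs, so
    the search for the return starts at the next grid time, when the level is known. *)
Definition started t : set Omega := [set w | (sigma w < (gdn n t)%:E)%E].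

(* [t] is at least the dyadic time [gup n (sigma w)] and the level [X_sigma] has been
   reached, or approached, between that time and [t]. *)
Definition returned t : set Omega := started t `&`
  ([set w | X t w = k w] `|` \bigcap_i \bigcup_j \bigcup_l [set w | [/\ l%:R / 2 ^+ j <= t,
     started (l%:R / 2 ^+ j) w & `|X (l%:R / 2 ^+ j) w - k w| < i.+1%:R^-1] ]).

Let gdn_mono (s t : R) : s <= t -> gdn n s <= gdn n t.
Proof. by move=> st; rewrite /gdn ler_pM2r ?invr_gt0 ?exprn_gt0 // ler_nat le_truncn // ler_pM2r ?exprn_gt0. Qed.

Let started_mono (s t : R) w : s <= t -> started s w -> started t w.
Proof. by move=> st h; apply: lt_le_trans h _; rewrite lee_fin gdn_mono. Qed.

Let started_lt t w : 0 <= t -> started t w -> (sigma w < t%:E)%E.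
Proof. by move=> t0 h; apply: lt_le_trans h _; rewrite lee_fin gdn_le. Qed.

Let startedG t : 0 <= t -> G t (started t).
Proof. by move=> t0; apply: (incG (gdn_ge0 n t) (gdn_le n t0)); apply: opt; exact: gdn_ge0. Qed.

Lemma returned_measurable t : 0 <= t -> G t (returned t).
Proof.
move=> t0; have sGt := sG t0; pose bk w := X (before sigma t w) w.
have mbk : measurable_fun [set: g_sigma_algebraType (G t)] (bk : g_sigma_algebraType (G t) -> R).
  by apply/(submeasurableP _ sGt); exact: (before_value fG sigma0 opt rX aX t0).
have mXs s : 0 <= s -> s <= t -> measurable_fun [set: g_sigma_algebraType (G t)] (X s : g_sigma_algebraType (G t) -> R).
  by move=> s0 st; apply/(submeasurableP _ sGt) => C mC; apply: (incG s0 st); exact: aX.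
have bkE w : started t w -> bk w = k w.
  by move=> st; rewrite /bk /before (started_lt t0 st).
pose D i j l : set Omega := if l%:R / 2 ^+ j <= t :> R then started (l%:R / 2 ^+ j) `&`
  [set w | `|X (l%:R / 2 ^+ j) w - bk w| < i.+1%:R^-1] else set0.
have e : returned t = started t `&` ([set w | X t w = bk w] `|` \bigcap_i \bigcup_j \bigcup_l D i j l).
  apply/seteqP; split => w [st h]; split => //; have e1 := bkE w st.
    case: h => [/= ->|h]; [by left|right => i _].
    have [j _ [l _ [lt sl hl]]] := h i Logic.I; exists j => //; exists l => //.
    by rewrite /D lt; split => //=; rewrite e1.
  case: h => [/= ->|h]; [by left|right => i _].
  have [j _ [l _ hl]] := h i Logic.I; exists j => //; exists l => //.
  by move: hl; rewrite /D; case: ifP => // lt [sl /=]; rewrite e1.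
rewrite e; apply: (sigma_algebra_I sGt); first exact: startedG.
apply/(submeasurable_set _ sGt); apply: measurableU.
  have := measurable_funB (mXs t t0 (lexx t)) mbk measurableT (measurable_set1 0).
  rewrite setTI; apply: set_transport => w /=; split => [/eqP|->]; last by rewrite subrr.
  by rewrite subr_eq0 => /eqP.
apply: bigcapT_measurable => i; apply: bigcupT_measurable => j; apply: bigcupT_measurable => l.
rewrite /D; case: ifP => // lt; apply: measurableI.
  by apply/(submeasurable_set _ sGt); apply: (incG (g0 l j) lt); exact: startedG.
have := measurable_funB (mXs _ (g0 l j) lt) mbk measurableT (measurable_itv `](- i.+1%:R^-1), i.+1%:R^-1[).
by rewrite setTI; apply: set_transport => w /=; rewrite in_itv /= ltr_norml.
Qed.

Lemma returned_mono s t w : 0 <= s -> s <= t -> returned s w -> returned t w.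
Proof.
move=> s0; rewrite le_eqVlt => /orP[/eqP -> //|st] [hs h]; split; first exact: started_mono (ltW st) hs.
right => i _; case: h => [/= hX|h].
  have i0 : 0 < (i.+1%:R^-1 : R) by rewrite invr_gt0.
  have /cvgrPdist_lt/(_ _ i0) := @rX w s s0; rewrite near_withinE => -[r /= r0 hr].
  have m0 : 0 < Num.min r (t - s) by rewrite lt_min r0 subr_gt0.
  have [j _ hj] := pow2_small m0; have {}hj := hj j (leqnn j); rewrite lt_min in hj; have /andP[j1 j2] := hj.
  have u1 := gup_gt j s; have u2 := gup_le j s0.
  exists j => //; exists (Num.trunc (s * 2 ^+ j)).+1 => //; rewrite -/(gup j s); split; first lra.
    exact: started_mono (ltW u1) hs.
  by rewrite distrC -hX; apply: hr => //=; rewrite ltr_norml; lra.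
have [j _ [l _ [lt sl hl]]] := h i Logic.I; exists j => //; exists l => //; split => //.
exact: le_trans (ltW st).
Qed.

Definition first_return (w : Omega) : \bar R :=
  ereal_inf [set t%:E | t in [set t | 0 <= t /\ returned t w] ].

Lemma first_return_ge w : (sigma w <= first_return w)%E.
Proof.
by apply: le_ereal_inf_tmp => _ [t [t0 [/(started_lt t0) h _]] <-]; exact: ltW.
Qed.

(** Right continuity closes the set of times counted in [returned] from the right, so the infimum is
    attained. This is what makes [first_return] a stopping time and not merely an optional one. *)
Lemma first_return_le t w : 0 <= t -> ((first_return w <= t%:E)%E <-> returned t w).
Proof.
move=> t0; split=> [h|h]; last by apply: ereal_inf_lbound; exists t.
have later u : t < u -> returned u w.
  move=> tu; have : (first_return w < u%:E)%E by apply: le_lt_trans h _; rewrite lte_fin.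
  move=> /ereal_inf_lt[_ [v [v0 hv] <-]]; rewrite lte_fin => vu; exact: returned_mono (ltW vu) hv.
(* [gdn n] does not change before the next grid time, so [started] passes down to the limit [t]. *)
have gE u : t <= u -> u < gup n t -> gdn n u = gdn n t.
  move=> tu ut; rewrite /gdn; congr (_%:R / _); apply: truncn_def.
  rewrite -ltr_pdivlMr ?exprn_gt0 // ut andbT; apply: le_trans (_ : t * 2 ^+ n <= _).
    by rewrite truncn_le mulr_ge0 // exprn_ge0.
  by rewrite ler_pM2r ?exprn_gt0.
have ng := gup_gt n t.
have st : started t w.
  have m1 : t <= (t + gup n t) / 2 by lra.
  have m2 : (t + gup n t) / 2 < gup n t by lra.
  have [] := later ((t + gup n t) / 2) ltac:(lra); by rewrite /started /= gE.
split => //; case: (pselect (X t w = k w)) => hX; first by left.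
right => i _; apply: contrapT => hn.
have c0 : 0 < `|X t w - k w| / 2 by rewrite divr_gt0 // normr_gt0 subr_eq0; apply/eqP.
have /cvgrPdist_lt/(_ _ c0) := @rX w t t0; rewrite near_withinE => -[r /= r0 hr].
have far u : t <= u -> u < t + r -> `|X t w - k w| / 2 < `|X u w - k w|.
  rewrite le_eqVlt => /orP[/eqP <- _|tu ur]; first by lra.
  have : `|X t w - X u w| < `|X t w - k w| / 2 by apply: hr => //=; rewrite ltr_norml; lra.
  have := ler_normD (X t w - X u w) (X u w - k w); rewrite addrA subrK; lra.
have tu : t < t + r / 2 by lra.
have [_ [hu|hu]] := later _ tu.
  by have := far (t + r / 2) (ltW tu) ltac:(lra); rewrite hu subrr normr0; lra.
have m0 : 0 < Num.min (i.+1%:R^-1) (`|X t w - k w| / 2) by rewrite lt_min c0 invr_gt0 ltr0n.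
have [i' _ hi'] := near_infty_natSinv_lt (PosNum m0).
have {}hi' : i'.+1%:R^-1 < Num.min (i.+1%:R^-1) (`|X t w - k w| / 2) := hi' i' (leqnn i').
rewrite lt_min in hi'; have /andP[b1 b2] := hi'.
have [j _ [l _ [lu sl hl]]] := hu i' Logic.I.
case: (leP (l%:R / 2 ^+ j) t) => lt.
  by apply: hn; exists j => //; exists l => //; split => //; exact: lt_trans b1.
have h2 : l%:R / 2 ^+ j < t + r by apply: le_lt_trans lu _; lra.
by have := lt_trans (far _ (ltW lt) h2) (lt_trans hl b2); rewrite ltxx.
Qed.

Lemma first_return_stopping : stopping_time G first_return.
Proof.
split=> [w|t t0]; first exact: le_trans (first_return_ge w).
have := returned_measurable t0; apply: set_transport => w /=.
by split => /(first_return_le w t0).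
Qed.

(** If [X] differed from the level at that time, continuity would push all approximate returns back
    before [t - r], and the return would have been recorded by then. *)
Lemma first_return_value w : {within `[0, +oo[, continuous X ^~ w} -> (first_return w < +oo)%E ->
  X (fine (first_return w)) w = k w.
Proof.
move=> cw foo; have f0 := proj1 first_return_stopping w.
pose t := fine (first_return w); have tE : t%:E = first_return w by rewrite fineK // fin_real // foo (lt_le_trans (ltNyr 0)).
have t0 : 0 <= t by exact: fine_ge0.
have [st [//|h]] : returned t w by apply/(first_return_le w t0); rewrite tE.
rewrite -/t; apply: contrapT => hX.
have c0 : 0 < `|X t w - k w| / 2 by rewrite divr_gt0 // normr_gt0 subr_eq0; apply/eqP.
have [r r0 hr] := within_near cw t0 c0.
have close i : exists v, [/\ 0 <= v, v <= t - r, started v w & exists j l : nat, v = l%:R / 2 ^+ j /\ `|X v w - k w| < i.+1%:R^-1].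
  have m0 : 0 < Num.min (i.+1%:R^-1) (`|X t w - k w| / 2) by rewrite lt_min c0 invr_gt0 ltr0n.
  have [i' _ hi'] := near_infty_natSinv_lt (PosNum m0).
  have {}hi' : i'.+1%:R^-1 < Num.min (i.+1%:R^-1) (`|X t w - k w| / 2) := hi' i' (leqnn i').
  rewrite lt_min in hi'; have /andP[b1 b2] := hi'.
  have [j _ [l _ [lu sl hl]]] := h i' Logic.I.
  exists (l%:R / 2 ^+ j); split => //; last by exists j, l; split => //; exact: lt_trans b1.
  rewrite leNgt; apply/negP => lt.
  have := lt_trans hl b2; have := hr (l%:R / 2 ^+ j) (g0 l j); move: lt lu; set v : R := l%:R / 2 ^+ j => v1 v2 h1 h2.
  have a1 : `|X v w - X t w| <= `|X t w - k w| / 2 by apply: h1; rewrite ltr_norml; apply/andP; split; lra.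
  rewrite distrC in a1.
  have := ler_normD (X t w - X v w) (X v w - k w); rewrite addrA subrK; move: a1 h2.
  by set x1 := `|_|; set x2 := `|_|; set x3 := `|_|; lra.
have [v0 [v00 v0t sv _]] := close 0%N.
have tr0 : 0 <= t - r by exact: le_trans v0t.
have : returned (t - r) w.
  split; first exact: started_mono v0t sv.
  right => i _; have [v [_ vt sv' [j [l [ve hv]]]]] := close i; exists j => //; exists l => //.
  by rewrite -ve.
by move=> /(first_return_le w tr0); rewrite -tE lee_fin; lra.
Qed.

Lemma first_return_before w r : 0 <= r -> X r w = k w -> started r w -> (first_return w <= r%:E)%E.
Proof. by move=> r0 hX sr; apply/(first_return_le w r0); split => //; left. Qed.

End FirstReturn.

(** * Rewards at optional times *)

Section OptionalReward.
Context {R : realType} {d : measure_display} {Omega : measurableType d}.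
Variables (P : probability Omega R) (F : R -> set (set Omega)) (a : R -> R) (X Y : R -> Omega -> R).
Variables (q : R) (g : R -> R) (T : \bar R).
Hypotheses (fF : filtration F) (aXY : adapted F (pair_process X Y)) (hXY : volatility_equation P F a X Y).
Hypotheses (rX : right_continuous_paths X) (mg : measurable_fun [set: R] g) (T0 : (0 <= T)%E).
Hypothesis h0 : (\int[P]_w sup_reward X q g T w < +oo)%E.
Variable sigma : Omega -> \bar R.
Hypothesis sigma0 : forall w, (0 <= sigma w)%E.
Hypothesis opt : forall t, 0 <= t -> natural (pair_process X Y) t [set w | (sigma w < t%:E)%E].
Hypothesis sigmaT : {ae P, forall w, (sigma w <= T)%E /\ (sigma w < +oo)%E}.

Let G := natural (pair_process X Y).

Let GF t : 0 <= t -> G t `<=` F t.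
Proof.
have [sF _ incF] := fF; move=> t0; apply: generated_sub; first exact: sF.
move=> r /=; rewrite in_itv /= => /andP[r0 rt] C mC; apply: (incF r t r0 rt); exact: aXY.
Qed.

Let fG : filtration G.
Proof.
have [_ mF _] := fF; split=> [t _|t t0|s t _ st]; first exact: natural_sigma_algebra.
  by move=> A /(GF t0); exact: mF.
exact: natural_mono.
Qed.

Let aXG : adapted G X.
Proof.
move=> t t0 C mC; have := natural_mem (Z := pair_process X Y) t0 (lexx t) (measurableX mC measurableT).
by apply: set_transport => w /=; split => [[]|].
Qed.

Let aXF : adapted F X. Proof. by move=> t t0 C mC; apply: (GF t0); exact: aXG. Qed.

Let jX : jmeas X.
Proof.
have [_ mF _] := fF; apply: jmeas_right_continuous => // t t0 _ C mC; rewrite setTI.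
by apply: (mF t t0); exact: aXF.
Qed.

(** The horizon [T] makes the stopping time admissible, the bound [n] makes it finite. *)
Let cap (n : nat) : \bar R := Order.min T n%:R%:E.
Let tau n w : \bar R := Order.min (first_return X sigma n w) (cap n).

Let cap0 n : (0 <= cap n)%E. Proof. by rewrite le_min T0 lee_fin /=. Qed.
Let tau0 n w : (0 <= tau n w)%E.
Proof. by rewrite le_min cap0 andbT; exact: (proj1 (first_return_stopping n fG rX aXG sigma0 opt)). Qed.
Let tau_le n w : (tau n w <= n%:R%:E)%E. Proof. by rewrite !ge_min lexx !orbT. Qed.
Let tauT n w : (tau n w <= T)%E. Proof. by rewrite !ge_min lexx orbT. Qed.

Let tau_stopping n : stopping_time G (tau n).
Proof.
have [_ st] := first_return_stopping n fG rX aXG sigma0 opt.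
split=> [w|t t0]; first exact: tau0.
case: (leP (cap n) t%:E) => ct.
  have := sigma_algebra_T (natural_sigma_algebra (pair_process X Y) t); apply: set_transport => w /=.
  by split => // _; rewrite ge_min ct orbT.
have := st t t0; apply: set_transport => w /=; rewrite ge_min (leNgt (cap n)) ct orbF; exact: iff_refl.
Qed.

Let tau_fin n w : tau n w = (fine (tau n w))%:E.
Proof. by rewrite fineK // fin_real // (lt_le_trans (ltNyr 0)) ?tau0 // (le_lt_trans (tau_le n w)) ?ltry. Qed.

Let s n w : R := fine (tau n w).
Let s0 n w : 0 <= s n w. Proof. exact: fine_ge0. Qed.

Let ms n : measurable_fun [set: Omega] (s n).
Proof.
have [sG mG incG] := fG; have := stopping_min sG incG (tau_stopping n) (ler0n R n).
move=> h _ C mC; rewrite setTI; apply: (mG n%:R (ler0n _ _)); have := h C mC.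
by apply: set_transport => w /=; rewrite min_l.
Qed.

Let f n w : R := expR (- q * s n w) * g (X (s n w) w).
Let f_lim w : R := expR (- q * fine (sigma w)) * g (X (fine (sigma w)) w).

Let reward_measurable (r : Omega -> R) : measurable_fun [set: Omega] r -> (forall w, 0 <= r w) ->
  measurable_fun [set: Omega] (fun w => expR (- q * r w) * g (X (r w) w)).
Proof.
move=> mr r0; apply: measurable_funM.
  by apply: measurableT_comp; [exact: measurable_expR|exact: measurable_funM].
by apply: (measurableT_comp mg); exact: (jmeas_random jX mr r0).
Qed.

Let reward_le n : (reward P X q g (tau n) <= value P X Y q g T)%E.
Proof.
apply: ereal_sup_ubound; exists (tau n) => //; split; [exact: tau_stopping|exact: tauT|].
by apply: aeW => w; rewrite tau_fin ltry.
Qed.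

Let f_dom n w : (`|f n w|%:E <= sup_reward X q g T w)%E.
Proof.
apply: ereal_sup_ubound; exists (s n w) => /=; first by rewrite s0 -tau_fin.
by rewrite /f normrM ger0_norm // expR_ge0.
Qed.

(** [g] has no continuity: the argument of [g] is equal to [X_sigma] from some [n] on, and only the
    discount factor converges. *)
Let f_cvg : {ae P, forall w, f n w @[n --> \oo] --> f_lim w}.
Proof.
have [B [bB _ hI]] := hXY.
have optF t : 0 <= t -> F t [set w | (sigma w < t%:E)%E] by move=> t0; apply: (GF t0); exact: opt.
apply: filterS3 (ito_continuous fF bB hI) (exact_return fF bB hI rX aXF sigma0 optF) sigmaT => w cw ret [sT soo].
have sE := fine_optional sigma0 soo; pose u := fine (sigma w); have u0 : 0 <= u by exact: fine_ge0.
have after n : (sigma w <= first_return X sigma n w)%E by exact: first_return_ge.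
(* At the horizon no return after [sigma] is possible; there the cap itself makes the stopping time
   equal to [sigma]. *)
have [sTe|sTn] := eqVneq (sigma w) T.
  apply: cvg_near_cst; near=> n; rewrite /f /f_lim; suff -> : s n w = u by [].
  have E : cap n = sigma w.
    by rewrite /cap -sTe min_l // sE lee_fin; apply/ltW; near: n; exact: nbhs_infty_gtr.
  by rewrite /s /tau E min_r // after.
have sT' : (sigma w < T)%E by rewrite lt_neqAle sTn.
have [e e0 eT] : exists2 e, 0 < e & ((u + e)%:E < T)%E.
  move: sT'; rewrite sE -/u; case: (T) => [t| |] //=; last by exists 1 => //; rewrite ltry.
  rewrite lte_fin => ut; exists ((t - u) / 2); first by rewrite divr_gt0 // subr_gt0.
  by rewrite lte_fin; lra.
have near_u e1 : 0 < e1 -> \forall n \near \oo, (first_return X sigma n w <= (u + e1)%:E)%E.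
  move=> e10; have [r /andP[r1 r2] rX'] := ret soo e1 e10; rewrite -/u in r1 r2 rX'.
  have ru : 0 < r - u by rewrite subr_gt0.
  apply: filterS (pow2_small ru) => n hn.
  have r0 : 0 <= r by exact: le_trans u0 (ltW r1).
  apply: (le_trans (y := r%:E)); last by rewrite lee_fin ltW.
  apply: (first_return_before rX r0) => //.
  rewrite /started /= sE lte_fin -/u; have := gup_gt n r; rewrite gupE; lra.
have tauE : \forall n \near \oo, [/\ tau n w = first_return X sigma n w & (first_return X sigma n w < +oo)%E].
  near=> n; have h : (first_return X sigma n w <= (u + e)%:E)%E by near: n; exact: near_u.
  have hn : u + e <= n%:R by apply/ltW; near: n; exact: nbhs_infty_gtr.
  split; last by rewrite (le_lt_trans h) ?ltry.
  rewrite /tau min_l // /cap le_min (le_trans h (ltW eT)) /=.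
  by apply: le_trans h _; rewrite lee_fin.
have sc : s n w @[n --> \oo] --> u.
  apply/cvgrPdist_le => e1 e10; near=> n.
  have [E _] : [/\ tau n w = first_return X sigma n w & (first_return X sigma n w < +oo)%E] by near: n.
  have h : (first_return X sigma n w <= (u + e1)%:E)%E by near: n; exact: near_u.
  have := after n; rewrite -E in h *; rewrite sE tau_fin -/(s n w) -/u lee_fin => h1.
  by rewrite tau_fin -/(s n w) lee_fin in h; rewrite ler_norml; apply/andP; split; lra.
have ec : expR (- q * s n w) @[n --> \oo] --> expR (- q * u).
  by apply: continuous_cvg; [exact: continuous_expR|exact: cvgMr].
have c2 : expR (- q * s n w) * g (X u w) @[n --> \oo] --> f_lim w by apply: cvgM; [exact: ec|exact: cvg_cst].
apply: cvg_trans c2; apply: near_eq_cvg; near=> n.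
have [E foo] : [/\ tau n w = first_return X sigma n w & (first_return X sigma n w < +oo)%E] by near: n.
by rewrite /f /s E (first_return_value fG rX aXG sigma0 opt cw foo).
Unshelve. all: by end_near. Qed.

Lemma optional_reward :
  (\int[P]_w (expR (- q * fine (sigma w)) * g (X (fine (sigma w)) w))%:E <= value P X Y q g T)%E.
Proof.
have mf n : measurable_fun [set: Omega] (fun w => (f n w)%:E).
  by apply/measurable_EFinP; exact: (reward_measurable (ms n) (s0 n)).
have msig : measurable_fun [set: Omega] (fun w => fine (sigma w)).
  exact: (fine_optional_measurable fG sigma0 opt).
have ml : measurable_fun [set: Omega] (fun w => (f_lim w)%:E).
  by apply/measurable_EFinP; apply: (reward_measurable msig) => w; exact: fine_ge0.
(* A countable supremum is measurable, whereas [sup_reward] ranges over all real times;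
   [integral_mono] compares their integrals nevertheless. *)
pose M w : \bar R := esups (fun n => `|f n w|%:E) 0.
have mM : measurable_fun [set: Omega] M.
  apply: measurable_fun_esups => n; apply/measurable_EFinP; apply: measurableT_comp => //.
  exact: (reward_measurable (ms n) (s0 n)).
have fM n w : (`|f n w|%:E <= M w)%E by apply: ereal_sup_ubound; exists n.
have M0 w : (0 <= M w)%E by apply: le_trans (fM 0%N w); rewrite lee_fin.
have iM : P.-integrable setT M.
  apply/integrableP; split => //; apply: le_lt_trans h0.
  under eq_integral do rewrite gee0_abs //.
  by apply: integral_mono => // w; apply: ge_ereal_sup => _ [n _ <-]; exact: f_dom.
have := @dominated_convergence _ _ _ P setT measurableT (fun n w => (f n w)%:E) (fun w => (f_lim w)%:E) M mf ml.
case.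
- by apply: filterS f_cvg => w h _; apply/cvg_EFin; [near=> n|exact: h].
- exact: iM.
- by apply: aeW => w n _ /=; exact: fM.
move=> _ _ c; apply: (cvge_le _ c); apply: nearW => n; exact: reward_le.
Unshelve. all: by end_near. Qed.

End OptionalReward.

(** * Functionals of the paths and uniqueness in law *)

Section Paths.
Context {R : realType} {dE : measure_display} {E : measurableType dE}.

Definition path_sigma (I : set R) : set (set (R -> E)) :=
  <<s [set A | exists t (C : set E), [/\ I t, measurable C & A = [set w : R -> E | C (w t)] ] ]>>.

Lemma path_sigma_measurable (A : set (R -> E)) : path_sigma `[0, +oo[ A -> path_measurable A.
Proof.
apply: smallest_sub; first exact: smallest_sigma_algebra.
move=> _ [t [C [+ mC ->]]]; rewrite /= in_itv /= andbT => t0.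
by apply: sub_sigma_algebra; exists t, C.
Qed.

(** Membership in such a set depends on the coordinates in [I] only: for [I = [0, t]], on the past
    up to [t]. *)
Lemma path_agree (I : set R) (B : set (R -> E)) (p p' : R -> E) : path_sigma I B ->
  (forall t, I t -> p t = p' t) -> (B p <-> B p').
Proof.
move=> sB e; suff : path_sigma I `<=` [set B : set (R -> E) | B p <-> B p'] by apply.
apply: smallest_sub; last by move=> _ [t [C [It _ ->]]] /=; rewrite e.
split => //= [A h|A h]; first by split=> -[_ n]; split=> // /h.
by split=> -[k _ /(h k) hk]; exists k.
Qed.

Context {d : measure_display} {Omega : measurableType d}.

Lemma path_pull (I : set R) (G : set (set Omega)) (Z : R -> Omega -> E) (B : set (R -> E)) :
  sigma_algebra [set: Omega] G -> (forall t, I t -> submeasurable G (Z t)) -> path_sigma I B ->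
  G [set w | B (Z ^~ w)].
Proof.
move=> sG hZ; have := trace_sigma (fun w => Z ^~ w) sG (sigma_algebra_T sG).
set H := [set B | _] => sH; suff sub : path_sigma I `<=` H by move=> /sub; rewrite /H /= setIT.
apply: smallest_sub => // _ [t [C [It mC ->]]]; rewrite /H /= setIT; exact: hZ.
Qed.

(** Events of a process come from sets of paths; a stopping time thus becomes a functional
    applicable to other processes. *)
Lemma path_rep (I : set R) (Z : R -> Omega -> E) (A : set Omega) : generated I Z A ->
  exists2 B, path_sigma I B & A = [set w | B (Z ^~ w)].
Proof.
have sP : sigma_algebra [set: R -> E] (path_sigma I) by exact: smallest_sigma_algebra.
have [p0 pC pU] := sP.
suff sub : generated I Z `<=` [set A | exists2 B, path_sigma I B & A = [set w | B (Z ^~ w)] ] by move=> /sub.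
apply: generated_sub => [|t It C mC]; last first.
  by exists [set w : R -> E | C (w t)] => //; apply: sub_sigma_algebra; exists t, C.
split=> [|A' [B sB ->]|A' hA]; first by exists set0.
  by exists (setT `\` B); first exact: pC.
have /choice[B hB] : forall i, exists B, path_sigma I B /\ A' i = [set w | B (Z ^~ w)].
  by move=> i; have [B h1 h2] := hA i; exists B.
exists (\bigcup_i B i); first by apply: pU => i; exact: (proj1 (hB i)).
by apply/seteqP; split => w [i _ hi]; exists i => //; have [_ e] := hB i; move: hi; rewrite e.
Qed.

End Paths.

Section FunctionalLaw.
Context {R : realType} {dE : measure_display} {E : measurableType dE}.
Context {d1 d2 : measure_display} {O1 : measurableType d1} {O2 : measurableType d2}.
Variables (P1 : probability O1 R) (P2 : probability O2 R) (Z1 : R -> O1 -> E) (Z2 : R -> O2 -> E).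
Hypotheses (mZ1 : forall t, 0 <= t -> measurable_fun [set: O1] (Z1 t)).
Hypotheses (mZ2 : forall t, 0 <= t -> measurable_fun [set: O2] (Z2 t)).
Hypothesis law12 : same_law P1 Z1 P2 Z2.

(* A space carrying both processes, so that an event of the joint process is the
   preimage of one and the same set of paths under each of the two. *)
Definition either (t : R) (w : O1 * O2 * bool) : E := if w.2 then Z1 t w.1.1 else Z2 t w.1.2.

Definition either_sigma := generated `[0, +oo[ either.

Let inhabited_prob (d : measure_display) (O : measurableType d) (P : probability O R) : exists w : O, True.
Proof.
apply: contrapT => /forallNP h; have := probability_setT P.
rewrite (_ : setT = set0) ?measure0; last by apply/seteqP; split => // w _; exact: (h w).
by move=> /eqP; rewrite lt_eqF ?lte_fin.
Qed.

(** Clocks and merging are measurable along regular paths, whereas [same_law] is about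
    product-measurable sets of all paths. Here one product-measurable set represents [Phi] along
    both processes at once. *)
Lemma functional_rep (Phi : set (R -> E)) : generated `[0, +oo[ either [set w | Phi (either ^~ w)] ->
  exists2 B, path_sigma `[0, +oo[ B &
    (forall w, Phi (Z1 ^~ w) <-> B (Z1 ^~ w)) /\ (forall w, Phi (Z2 ^~ w) <-> B (Z2 ^~ w)).
Proof.
move=> /path_rep[B sB e]; exists B => //; have [w1 _] := inhabited_prob P1; have [w2 _] := inhabited_prob P2.
split=> w.
  by have := congr1 (@^~ (w, w2, true)) e; rewrite /= /either /= => <-.
by have := congr1 (@^~ (w1, w, false)) e; rewrite /= /either /= => <-.
Qed.

Lemma functional_law (Phi : set (R -> E)) : generated `[0, +oo[ either [set w | Phi (either ^~ w)] ->
  P1 [set w | Phi (Z1 ^~ w)] = P2 [set w | Phi (Z2 ^~ w)].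
Proof.
move=> /functional_rep[B sB [e1 e2]].
have -> : [set w | Phi (Z1 ^~ w)] = [set w | B (Z1 ^~ w)] by apply/seteqP; split => w /e1.
have -> : [set w | Phi (Z2 ^~ w)] = [set w | B (Z2 ^~ w)] by apply/seteqP; split => w /e2.
exact: law12 (path_sigma_measurable sB).
Qed.

Variable phi : (R -> E) -> R.
Hypothesis mphi : measurable_fun [set: g_sigma_algebraType either_sigma]
  (fun w : g_sigma_algebraType either_sigma => phi (either ^~ w)).

Let gen (C : set R) : measurable C -> generated `[0, +oo[ either [set w | C (phi (either ^~ w))].
Proof.
move=> mC; have := mphi measurableT mC; rewrite setTI.
move=> h; have sE : sigma_algebra [set: O1 * O2 * bool] either_sigma by exact: smallest_sigma_algebra.
exact: (proj2 (submeasurable_set [set w | C (phi (either ^~ w))] sE) h).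
Qed.

Lemma functional_measurable1 : measurable_fun [set: O1] (fun w => phi (Z1 ^~ w)).
Proof.
move=> _ C mC; rewrite setTI; have [B sB [e1 _]] := @functional_rep (fun p => C (phi p)) (gen mC).
have : measurable [set w | B (Z1 ^~ w)].
  apply: path_pull sB => [|t]; first exact: sigma_algebra_measurable.
  by rewrite /= in_itv /= andbT => t0 D mD; rewrite -[X in measurable X]setTI; exact: mZ1.
by apply: set_transport => w; apply: iff_sym; exact: e1.
Qed.

Lemma functional_measurable2 : measurable_fun [set: O2] (fun w => phi (Z2 ^~ w)).
Proof.
move=> _ C mC; rewrite setTI; have [B sB [_ e2]] := @functional_rep (fun p => C (phi p)) (gen mC).
have : measurable [set w | B (Z2 ^~ w)].
  apply: path_pull sB => [|t]; first exact: sigma_algebra_measurable.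
  by rewrite /= in_itv /= andbT => t0 D mD; rewrite -[X in measurable X]setTI; exact: mZ2.
by apply: set_transport => w; apply: iff_sym; exact: e2.
Qed.

Lemma functional_law_integral (f : R -> \bar R) : measurable_fun [set: R] f -> (forall z, 0 <= f z)%E ->
  (\int[P1]_w f (phi (Z1 ^~ w)) = \int[P2]_w f (phi (Z2 ^~ w)))%E.
Proof.
move=> mf f0; apply: same_law_ge0_integral => //; [exact: functional_measurable1|exact: functional_measurable2|].
move=> C mC; exact: (@functional_law (fun p => C (phi p)) (gen mC)).
Qed.

End FunctionalLaw.

Section Theta.
Context {R : realType} {T : Type}.
Variable B : nat -> nat -> set T.

(** Recovers a stopping time from its events: [B j i] stands for the paths on which it has occurred
    by [i / 2 ^ j]. *)
Definition theta (p : T) : \bar R :=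
  ereal_inf [set r%:E | r in [set r : R | exists j i : nat, r = i%:R / 2 ^+ j /\ B j i p] ].

Lemma theta_ge0 p : (0 <= theta p)%E.
Proof. by apply: le_ereal_inf_tmp => _ [_ [j [i [-> _]]] <-]; rewrite lee_fin divr_ge0. Qed.

Lemma theta_lt p (t : R) : (theta p < t%:E)%E <-> exists j i : nat, i%:R / 2 ^+ j < t /\ B j i p.
Proof.
split=> [/ereal_inf_lt[_ [_ [j [i [-> h]]] <-]]|[j [i [h1 h2]]]].
  by rewrite lte_fin => h'; exists j, i.
apply: le_lt_trans (_ : _ < t%:E)%E; first by apply: ereal_inf_lbound; exists (i%:R / 2 ^+ j); [exists j, i|].
by rewrite lte_fin.
Qed.

Lemma theta_le p j i : B j i p -> (theta p <= (i%:R / 2 ^+ j)%:E)%E.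
Proof. by move=> h; apply: ereal_inf_lbound; exists (i%:R / 2 ^+ j) => //; exists j, i. Qed.

Lemma theta_stopping (tau : \bar R) p : (0 <= tau)%E ->
  (forall j i : nat, B j i p <-> (tau <= (i%:R / 2 ^+ j)%:E)%E) -> theta p = tau.
Proof.
move=> tau0 hB; apply/eqP; rewrite eq_le; apply/andP; split; last first.
  by apply: le_ereal_inf_tmp => _ [_ [j [i [-> /hB h]]] <-].
case: tau tau0 hB => [s| |] // s0 hB; last by rewrite leey.
rewrite lee_fin in s0; apply/lee_addgt0Pr => e e0.
have [n _ hn] := pow2_small e0; have {}hn := hn n (leqnn n).
apply: (@le_trans _ _ (gup n s)%:E).
  by apply: theta_le; apply/hB; rewrite lee_fin ltW // gup_gt.
by rewrite -EFinD lee_fin; have := gup_le n s0; move: hn => /=; lra.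
Qed.

End Theta.

Section Retime.
Context {R : realType}.
Variables (c C : R).
Hypotheses (c0 : 0 < c) (cC : c <= C).
Variable B : nat -> nat -> set (R -> R * R).

(** The lower model as computed from the upper model [p] and a lower path [z]. *)
Definition glue (z : R -> R) (p : R -> R * R) (s : R) : R * R :=
  ((p (rho z (fun t => (p t).2) s)).1, glued z (fun t => (p t).2) s).

(** The stopping time of the lower model is evaluated on the glued path, in lower time, and then
    carried to upper time by [rho]. *)
Definition retime (z : R -> R) (p : R -> R * R) : \bar R :=
  if theta B (glue z p) is r%:E then (rho z (fun t => (p t).2) r)%:E else +oo%E.

Lemma theta_glue_retime z p r : theta B (glue z p) = r%:E -> retime z p = (rho z (fun t => (p t).2) r)%:E.
Proof. by rewrite /retime => ->. Qed.

Variables (z : R -> R) (gz : gpath c C z).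

Lemma retime_ge0 p : gpath c C (fun t => (p t).2) -> (0 <= retime z p)%E.
Proof.
move=> gp; rewrite /retime; have := theta_ge0 (R := R) B (glue z p); case: (theta (R := R) B (glue z p)) => [r| |] //.
by rewrite !lee_fin; exact: (rho_ge0 c0 cC gz gp).
Qed.

Lemma retime_lt p t : gpath c C (fun t => (p t).2) -> 0 <= t ->
  (retime z p < t%:E)%E <-> exists j i : nat, rho z (fun t => (p t).2) (i%:R / 2 ^+ j) < t /\ B j i (glue z p).
Proof.
move=> gp t0; set y := fun t => (p t).2.
have rl s : 0 <= s -> (rho z y s < t) = (s < lclock z y t) by move=> s0; exact: (rho_lt c0 cC gz gp s0 t0).
have -> : (retime z p < t%:E)%E = (theta B (glue z p) < (lclock z y t)%:E)%E.
  rewrite /retime; have := theta_ge0 (R := R) B (glue z p); case: (theta (R := R) B (glue z p)) => [r| |] //.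
  by rewrite !lte_fin lee_fin => r0; exact: rl.
rewrite theta_lt; split=> -[j [i [h1 h2]]]; exists j, i; split => //.
  by rewrite rl // divr_ge0.
by rewrite -rl // divr_ge0.
Qed.

End Retime.

Section RetimeMeasurable.
Context {R : realType} {d : measure_display} {O : measurableType d}.
Variables (c C : R).
Hypotheses (c0 : 0 < c) (cC : c <= C).
Variable B : nat -> nat -> set (R -> R * R).
Hypothesis sB : forall j i : nat, path_sigma `[0, i%:R / 2 ^+ j] (B j i).
Variables (X Y : R -> O -> R).
Hypotheses (rX : right_continuous_paths X) (mX : forall t, 0 <= t -> measurable_fun [set: O] (X t)).

Let g0 (i j : nat) : 0 <= i%:R / 2 ^+ j :> R. Proof. by rewrite divr_ge0. Qed.

Let jX : jmeas X. Proof. exact: jmeas_right_continuous. Qed.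

Lemma measurable_filtration : filtration (fun _ : R => @measurable _ O).
Proof.
have h : sigma_algebra [set: O] (@measurable _ O) by exact: sigma_algebra_measurable.
by split=> [t _|t _|s t _ _]; [exact: h|exact: subset_refl|exact: subset_refl].
Qed.

Lemma payoff_measurable (q : R) (g : R -> R) (s : O -> \bar R) : measurable_fun [set: R] g ->
  (forall w, 0 <= s w)%E -> (forall t : R, 0 <= t -> measurable [set w | (s w < t%:E)%E]) ->
  measurable_fun [set: O] (fun w => expR (- q * fine (s w)) * g (X (fine (s w)) w)).
Proof.
move=> mg s0 ms.
have mf := fine_optional_measurable measurable_filtration s0 ms.
apply: measurable_funM.
  by apply: measurableT_comp; [exact: measurable_expR|exact: measurable_funM].
by apply: (measurableT_comp mg); apply: (jmeas_random jX mf) => w; exact: fine_ge0.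
Qed.

Lemma theta_measurable (mY : forall t, 0 <= t -> measurable_fun [set: O] (Y t)) (t : R) : 0 <= t ->
  measurable [set w | (theta B (pair_process X Y ^~ w) < t%:E)%E].
Proof.
move=> t0; rewrite (_ : [set w | _] = \bigcup_j \bigcup_i (if i%:R / 2 ^+ j < t :> R
    then [set w | B j i (pair_process X Y ^~ w)] else set0)).
  apply: bigcupT_measurable => j; apply: bigcupT_measurable => i; case: ifP => // _.
  apply: (path_pull (sigma_algebra_measurable _) _ (@sB j i)) => s.
  rewrite /= in_itv /= => /andP[s0 _] D mD; rewrite -[X in measurable X]setTI.
  by apply: (measurable_fun_pair (mX s0) (mY _ s0)).
apply/seteqP; split => w /=.
  by move=> /theta_lt[j [i [h1 h2]]]; exists j => //; exists i => //; rewrite h1.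
by move=> [j _ [i _]]; case: ifP => // h1 h2; apply/theta_lt; exists j, i.
Qed.

Lemma retime_measurable (Z : R -> O -> R) (t : R) : gproc c C Y -> gproc c C Z -> 0 <= t ->
  measurable [set w | (retime B (Z ^~ w) (pair_process X Y ^~ w) < t%:E)%E].
Proof.
move=> gY gZ t0; have jr := jmeas_rho c0 cC gZ gY.
pose Gl s w := (X (rho (Z ^~ w) (Y ^~ w) s) w, glued (Z ^~ w) (Y ^~ w) s).
have mGl s : 0 <= s -> measurable_fun [set: O] (Gl s).
  move=> s0; apply: measurable_fun_pair; last exact: (proj2 (gproc_glued c0 cC gZ gY)).
  apply: (jmeas_random jX) => [|w]; first exact: jmeas_section s0 jr.
  exact: (rho_ge0 c0 cC (proj1 gZ w) (proj1 gY w)).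
have hlt w := @retime_lt R c C c0 cC B (Z ^~ w) (proj1 gZ w) (pair_process X Y ^~ w) t (proj1 gY w) t0.
rewrite (_ : [set w | _] = \bigcup_j \bigcup_i ([set w | rho (Z ^~ w) (Y ^~ w) (i%:R / 2 ^+ j) < t] `&`
    [set w | B j i (Gl ^~ w)])).
  apply: bigcupT_measurable => j; apply: bigcupT_measurable => i; apply: measurableI.
    have := jmeas_section (g0 i j) jr measurableT (measurable_itv `]-oo, t[).
    by rewrite setTI; apply: set_transport => w /=; rewrite in_itv.
  apply: (path_pull (sigma_algebra_measurable _) _ (@sB j i)) => s.
  rewrite /= in_itv /= => /andP[s0 _] D mD; rewrite -[X in measurable X]setTI; exact: mGl.
apply/seteqP; split => w /=.
  by move=> /(hlt w)[j [i [h1 h2]]]; exists j => //; exists i.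
by move=> [j _ [i _ [h1 h2]]]; apply/(hlt w); exists j, i.
Qed.

Hypothesis gY : gproc c C Y.
Variables (z : R -> R) (gz : gpath c C z).

Let N := natural (pair_process X Y).

Let fN : filtration N.
Proof.
split=> [t _|t _|s t _ st]; [exact: natural_sigma_algebra| |exact: natural_mono].
by apply: natural_measurable => s s0; apply: measurable_fun_pair; [exact: mX|exact: (proj2 gY)].
Qed.

Let aX : adapted N X.
Proof.
move=> t t0 D mD; have := natural_mem (Z := pair_process X Y) t0 (lexx t) (measurableX mD measurableT).
by apply: set_transport => w /=; split => [[]|].
Qed.

Let aY s t : 0 <= s -> s <= t -> submeasurable (N t) (Y s).
Proof.
move=> s0 st D mD; have := natural_mem (Z := pair_process X Y) s0 st (measurableX measurableT mD).
by apply: set_transport => w /=; split => [[]|].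
Qed.

(* On [rho v < t] the glued path up to time [v] is a functional of the paths stopped at [t]. *)
Lemma retime_optional t : 0 <= t -> N t [set w | (retime B z (pair_process X Y ^~ w) < t%:E)%E].
Proof.
move=> t0; have [/(_ t t0) sN _ _] := fN; pose O' := g_sigma_algebraType (N t).
have gS : gproc c C (fun s (w : O') => stopped t (Y ^~ w) s).
  by apply: stopped_gproc => // [w|s s0 st]; [exact: (proj1 gY)|exact: aY].
have gZ : gproc c C (fun s (_ : O') => z s) by split => // s s0; exact: measurable_cst.
have jr := jmeas_rho c0 cC gZ gS.
have jS := jmeas_adapted_stopped fN rX aX t0.
pose Gl s (w : O') := (X (Num.min (rho z (stopped t (Y ^~ w)) s) t) w, glued z (stopped t (Y ^~ w)) s).
have mGl s : 0 <= s -> measurable_fun [set: O'] (Gl s).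
  move=> s0; apply: measurable_fun_pair; last exact: (proj2 (gproc_glued c0 cC gZ gS)).
  apply: (jmeas_random jS) => [|w]; first exact: jmeas_section s0 jr.
  exact: (rho_ge0 c0 cC gz (proj1 gS w)).
have ev j i : N t ([set w | rho z (Y ^~ w) (i%:R / 2 ^+ j) < t] `&`
    [set w | B j i (glue z (pair_process X Y ^~ w))]).
  set v : R := i%:R / 2 ^+ j; have v0 : 0 <= v := g0 i j.
  have : N t ([set w | v < lclock z (Y ^~ w) t] `&` [set w | B j i (Gl ^~ w)]).
    apply: (sigma_algebra_I sN).
      have hl : submeasurable (N t) (fun w => lclock z (Y ^~ w) t).
        by apply: (lclock_submeasurable c0 cC sN t0 _ _ gz) => // [w|s s0 st]; [exact: (proj1 gY)|exact: aY].
      have := hl _ (measurable_itv `]v, +oo[).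
      by apply: set_transport => w /=; rewrite in_itv /= andbT.
    apply/(submeasurable_set _ sN).
    apply: (path_pull (Omega := O') (sigma_algebra_measurable _) _ (@sB j i)) => s.
    rewrite /= in_itv /= => /andP[s0 _] D mD; rewrite -[X in measurable X]setTI; exact: mGl.
  apply: set_transport => w /=.
  have gy := proj1 gY w; have gs := proj1 gS w.
  have ag s : 0 <= s <= t -> Y s w = stopped t (Y ^~ w) s.
    by move=> /andP[_ st]; rewrite /stopped min_l.
  have vE := rho_lt c0 cC gz gy v0 t0.
  suff hB : rho z (Y ^~ w) v < t -> (B j i (Gl ^~ w) <-> B j i (glue z (pair_process X Y ^~ w))).
    rewrite -vE; split => -[h1 h2]; (split; first exact: h1).
      exact: (proj1 (hB h1) h2).
    exact: (proj2 (hB h1) h2).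
  move=> vt; apply: (path_agree (@sB j i)) => s; rewrite /= in_itv /= => /andP[s0 sv].
  have r0 := rho_ge0 c0 cC gz gy s0.
  have rt : rho z (Y ^~ w) s <= t.
    apply: le_trans (ltW vt); rewrite (rho_le c0 cC gz gy s0 (rho_ge0 c0 cC gz gy v0)).
    by rewrite (rhoK c0 cC gz gy v0).
  have rE : rho z (stopped t (Y ^~ w)) s = rho z (Y ^~ w) s.
    rewrite -[in LHS](rhoK c0 cC gz gy s0) (lclock_local z ag rt).
    exact: (lclockK c0 cC gz gs r0).
  have e1 : X (Num.min (rho z (stopped t (Y ^~ w)) s) t) w = X (rho z (Y ^~ w) s) w by rewrite rE (min_l rt).
  have e2 : glued z (stopped t (Y ^~ w)) s = glued z (Y ^~ w) s.
    rewrite /glued rE; apply/esym; apply: (low_local z ag); exact: (introT andP (conj r0 rt)).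
  exact: (congr2 pair e1 e2).
have bU (A : nat -> set O) : (forall k, N t (A k)) -> N t (\bigcup_k A k) by case: sN => _ _; apply.
have hlt w := @retime_lt R c C c0 cC B z gz (pair_process X Y ^~ w) t (proj1 gY w) t0.
have := bU _ (fun j => bU _ (ev j)); apply: set_transport => w; split.
  by move=> [j _ [i _ [h1 h2]]]; apply: (proj2 (hlt w)); exists j, i.
by move=> /(proj1 (hlt w))[j [i [h1 h2]]]; exists j => //; exists i.
Qed.

End RetimeMeasurable.

(** * Freezing the lower path *)

Section Rotation.
Context {R : realType} {dA dB dC : measure_display}.
Context {A : measurableType dA} {B : measurableType dB} {C : measurableType dC}.
Variables (PA : probability A R) (PB : probability B R) (PC : probability C R).

Lemma measurable_rotate : measurable_fun [set: (A * B) * C] (fun w : (A * B) * C => (w.1.1, (w.1.2, w.2))).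
Proof.
apply: measurable_fun_pair; first exact: measurableT_comp measurable_fst measurable_fst.
apply: measurable_fun_pair; last exact: measurable_snd.
exact: measurableT_comp measurable_snd measurable_fst.
Qed.

Let measurable_rotate' : measurable_fun [set: (A * C) * B] (fun w : (A * C) * B => (w.1.1, (w.2, w.1.2))).
Proof.
apply: measurable_fun_pair; first exact: measurableT_comp measurable_fst measurable_fst.
apply: measurable_fun_pair; first exact: measurable_snd.
exact: measurableT_comp measurable_snd measurable_fst.
Qed.

Variable F : A * (B * C) -> \bar R.
Hypotheses (mF : measurable_fun [set: A * (B * C)] F) (F0 : forall w, (0 <= F w)%E).

Lemma rotate_measurable :
  measurable_fun [set: C] (fun c => \int[(PA \x PB)%E]_w F (w.1, (w.2, c)))%E.
Proof.
pose F2 (w : (A * B) * C) := F (w.1.1, (w.1.2, w.2)).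
have m2 : measurable_fun [set: (A * B) * C] F2 by exact: measurableT_comp mF measurable_rotate.
have F20 w : (0 <= F2 w)%E by exact: F0.
have := measurable_fun_fubini_tonelli_G (m1 := ((PA \x PB)%E : probability (A * B)%type R)) F2 m2 F20; exact.
Qed.

(** Brings the lower path to the outermost integral: for each fixed lower path the inner integral is
    a reward in the upper model. *)
Lemma rotate_tonelli : (\int[(PA \x (PB \x PC))]_w F w =
  \int[PC]_c \int[(PA \x PB)]_w F (w.1, (w.2, c)))%E.
Proof.
pose H (p : A * C) := (\int[PB]_b F (p.1, (b, p.2)))%E.
have mH : measurable_fun [set: A * C] H.
  pose F2 (w : (A * C) * B) := F (w.1.1, (w.2, w.1.2)).
  have m2 : measurable_fun [set: (A * C) * B] F2 by exact: measurableT_comp mF measurable_rotate'.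
  have F20 w : (0 <= F2 w)%E by exact: F0.
  by have := measurable_fun_fubini_tonelli_F (m2 := PB) F2 m2 F20; exact.
have H0 p : (0 <= H p)%E by exact: integral_ge0.
transitivity (\int[PA]_a \int[PC]_c H (a, c))%E.
  transitivity (\int[PA]_a fubini_F ((PB \x PC)%E : probability (B * C)%type R) F a)%E.
    exact: (@fubini_tonelli1 _ _ A (B * C)%type R PA ((PB \x PC)%E : probability (B * C)%type R) F mF F0).
  apply: eq_integral => a _.
  exact: (@fubini_tonelli2 _ _ B C R PB PC (fun q => F (a, q)) (measurableT_comp mF (measurable_pair1 a))).
rewrite fubini_tonelli //; apply: eq_integral => c _.
rewrite (@fubini_tonelli1 _ _ A B R PA PB (fun w => F (w.1, (w.2, c)))) //.
apply: (measurableT_comp mF); apply: measurable_fun_pair; first exact: measurable_fst.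
by apply: measurable_fun_pair; [exact: measurable_snd|exact: measurable_cst].
Qed.

End Rotation.

Lemma ae_rotate {R : realType} {dA dB dC : measure_display}
    {A : measurableType dA} {B : measurableType dB} {C : measurableType dC}
    (PA : probability A R) (PB : probability B R) (PC : probability C R) (E : A * (B * C) -> Prop) :
  {ae (PA \x (PB \x PC))%E, forall w, E w} ->
  {ae PC, forall c, {ae (PA \x PB)%E, forall w, E (w.1, (w.2, c))}}.
Proof.
move=> [N [mN N0 sub]]; pose F w : \bar R := (\1_N w)%:E.
have mF : measurable_fun [set: A * (B * C)] F by apply/measurable_EFinP; exact: measurable_indic.
have F0 w : (0 <= F w)%E by rewrite lee_fin.
have ei := @integral_indic _ _ R ((PA \x ((PB \x PC)%E : probability (B * C)%type R))%E : probability (A * (B * C))%type R) setT measurableT N mN.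
rewrite setIT in ei; have e := etrans (esym (rotate_tonelli PA PB PC mF F0)) (etrans ei N0).
have mK := rotate_measurable PA PB mF F0.
have : (\int[PC]_(c in setT) `|\int[(PA \x PB)]_w F (w.1, (w.2, c))|)%E = 0%E.
  by rewrite -[RHS]e; apply: eq_integral => c _; rewrite gee0_abs // integral_ge0.
move=> /(ae_eq_integral_abs PC measurableT mK); apply: filterS => c /(_ Logic.I) hc.
pose Nc := [set w : A * B | N (w.1, (w.2, c))].
have mNc : measurable Nc.
  have m : measurable_fun [set: A * B] (fun w : A * B => (w.1, (w.2, c))).
    apply: measurable_fun_pair; first exact: measurable_fst.
    by apply: measurable_fun_pair; [exact: measurable_snd|exact: measurable_cst].
  by have := m measurableT N mN; rewrite setTI.
exists Nc; split => //; last by move=> w nE; apply: sub.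
have en := @integral_indic _ _ R ((PA \x PB)%E : probability (A * B)%type R) setT measurableT Nc mNc.
by rewrite setIT in en; exact: etrans (esym en) hc.
Qed.

Section PairLaw.
Context {R : realType} {d1 d2 : measure_display} {O1 : measurableType d1} {O2 : measurableType d2}.
Variables (P1 : probability O1 R) (P2 : probability O2 R).
Variables (X1 Y1 : R -> O1 -> R) (X2 Y2 : R -> O2 -> R).
Hypotheses (mX1 : forall t, 0 <= t -> measurable_fun [set: O1] (X1 t))
  (mY1 : forall t, 0 <= t -> measurable_fun [set: O1] (Y1 t))
  (mX2 : forall t, 0 <= t -> measurable_fun [set: O2] (X2 t))
  (mY2 : forall t, 0 <= t -> measurable_fun [set: O2] (Y2 t)).
Hypotheses (rX1 : right_continuous_paths X1) (rX2 : right_continuous_paths X2).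
Hypothesis law12 : same_law P1 (pair_process X1 Y1) P2 (pair_process X2 Y2).

Definition eitherX (t : R) (w : O1 * O2 * bool) : R := if w.2 then X1 t w.1.1 else X2 t w.1.2.
Definition eitherY (t : R) (w : O1 * O2 * bool) : R := if w.2 then Y1 t w.1.1 else Y2 t w.1.2.

Definition either_pair := generated `[0, +oo[ (pair_process eitherX eitherY).
Definition either_space := g_sigma_algebraType either_pair.

Let eitherE : either (pair_process X1 Y1) (pair_process X2 Y2) = pair_process eitherX eitherY.
Proof.
by apply/funext => t; apply/funext => w; rewrite /either /pair_process /eitherX /eitherY; case: w.2.
Qed.

Let sE : sigma_algebra [set: O1 * O2 * bool] either_pair.
Proof. exact: smallest_sigma_algebra. Qed.

Let mE t : 0 <= t -> measurable_fun [set: either_space] (pair_process eitherX eitherY t : either_space -> R * R).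
Proof.
move=> t0; apply/(submeasurableP _ sE) => D mD; apply: generated_mem => //.
by rewrite /= in_itv /= t0.
Qed.

Lemma eitherX_measurable t : 0 <= t -> measurable_fun [set: either_space] (eitherX t : either_space -> R).
Proof. by move=> t0; exact: (measurableT_comp measurable_fst (mE t0)). Qed.

Lemma eitherY_measurable t : 0 <= t -> measurable_fun [set: either_space] (eitherY t : either_space -> R).
Proof. by move=> t0; exact: (measurableT_comp measurable_snd (mE t0)). Qed.

Lemma eitherX_right_continuous : right_continuous_paths (eitherX : R -> either_space -> R).
Proof. by move=> [[w1 w2] [|]] t t0; rewrite /eitherX /=; [exact: rX1|exact: rX2]. Qed.

Lemma eitherY_gproc c C : (forall w, gpath c C (Y1 ^~ w)) -> (forall w, gpath c C (Y2 ^~ w)) ->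
  gproc c C (eitherY : R -> either_space -> R).
Proof.
by move=> g1 g2; split=> [[[w1 w2] [|]]|t t0]; [exact: g1|exact: g2|exact: eitherY_measurable].
Qed.

Variable s : (R -> R * R) -> \bar R.
Hypothesis s0 : forall w, (0 <= s (pair_process eitherX eitherY ^~ w))%E.
Hypothesis ms : forall t : R, 0 <= t ->
  measurable ([set w | (s (pair_process eitherX eitherY ^~ w) < t%:E)%E] : set either_space).
Variables (q : R) (g : R -> R) (T : \bar R).
Hypothesis mg : measurable_fun [set: R] g.

Definition payoff (p : R -> R * R) : R := expR (- q * fine (s p)) * g (p (fine (s p))).1.

Let mX1Y1 t : 0 <= t -> measurable_fun [set: O1] (pair_process X1 Y1 t).
Proof. by move=> t0; apply: measurable_fun_pair; [exact: mX1|exact: mY1]. Qed.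

Let mX2Y2 t : 0 <= t -> measurable_fun [set: O2] (pair_process X2 Y2 t).
Proof. by move=> t0; apply: measurable_fun_pair; [exact: mX2|exact: mY2]. Qed.

Lemma pair_law_integral (f : R -> \bar R) : measurable_fun [set: R] f -> (forall z, 0 <= f z)%E ->
  (\int[P1]_w f (payoff (pair_process X1 Y1 ^~ w)) = \int[P2]_w f (payoff (pair_process X2 Y2 ^~ w)))%E.
Proof.
move=> mf f0; apply: (functional_law_integral mX1Y1 mX2Y2 law12) => //.
rewrite /either_sigma eitherE.
exact: (payoff_measurable eitherX_right_continuous eitherX_measurable q mg s0 ms).
Qed.

(** The almost sure properties of an exercise rule that have to survive the change of probability
    space. *)
Definition good (p : R -> R * R) : Prop :=
  [/\ (s p <= T)%E, (s p < +oo)%E & 0 <= g (p (fine (s p))).1].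

Lemma pair_law_good : {ae P1, forall w, good (pair_process X1 Y1 ^~ w)} ->
  {ae P2, forall w, good (pair_process X2 Y2 ^~ w)}.
Proof.
move=> h; pose fs (w : either_space) := fine (s (pair_process eitherX eitherY ^~ w)).
have mfs : measurable_fun [set: either_space] fs.
  exact: (@fine_optional_measurable R _ either_space _ _ measurable_filtration s0 ms).
have moo := @optional_finite_measurable R _ either_space _ _ measurable_filtration s0 ms.
have mT : measurable [set r : R | (r%:E <= T)%E].
  case: T => [u| |].
  - by rewrite (_ : [set r : R | _] = `]-oo, u]%classic) //; apply/seteqP; split => r /=; rewrite in_itv /= lee_fin.
  - by rewrite (_ : [set r : R | _] = setT) //; apply/seteqP; split => r //= _; rewrite leey.
  - by rewrite (_ : [set r : R | _] = set0) //; apply/seteqP; split => r.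
have jE := jmeas_right_continuous eitherX_measurable eitherX_right_continuous.
have mgX : measurable_fun [set: either_space] (fun w => g (eitherX (fs w) w)).
  by apply: (measurableT_comp mg); apply: (jmeas_random jE mfs) => w; exact: fine_ge0.
have mgood : measurable ([set w | good (pair_process eitherX eitherY ^~ w)] : set either_space).
  have m1 := mfs measurableT _ mT; rewrite setTI in m1.
  have m2 := mgX measurableT _ (measurable_itv `[0, +oo[); rewrite setTI in m2.
  have := measurableI _ _ (measurableI _ _ moo m1) m2; apply: set_transport => w; split.
    move=> [[h1 h2] h3]; split => //; last by move: h3; rewrite /= in_itv /= andbT.
    by rewrite (fine_optional s0 h1).
  move=> [h1 h2 h3]; split; last by rewrite /= in_itv /= andbT.
  by split => //=; rewrite -(fine_optional s0 h2).
have gen : generated `[0, +oo[ (either (pair_process X1 Y1) (pair_process X2 Y2))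
    [set w | good (either (pair_process X1 Y1) (pair_process X2 Y2) ^~ w)].
  by rewrite eitherE; apply/(submeasurable_set _ sE).
have [D sD [e1 e2]] := functional_rep P1 P2 gen.
have mD1 : measurable [set w | D (pair_process X1 Y1 ^~ w)].
  apply: (path_pull (sigma_algebra_measurable _) _ sD) => t; rewrite /= in_itv /= andbT => t0 U mU.
  by rewrite -[X in measurable X]setTI; exact: mX1Y1.
have mD2 : measurable [set w | D (pair_process X2 Y2 ^~ w)].
  apply: (path_pull (sigma_algebra_measurable _) _ sD) => t; rewrite /= in_itv /= andbT => t0 U mU.
  by rewrite -[X in measurable X]setTI; exact: mX2Y2.
have p1 : P1 [set w | D (pair_process X1 Y1 ^~ w)] = 1%E.
  by apply: ae_prob1 => //; apply: filterS h => w /e1.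
have p2 := law12 (path_sigma_measurable sD); rewrite p1 in p2.
exists (~` [set w | D (pair_process X2 Y2 ^~ w)]); split; first exact: measurableC.
  by rewrite probability_setC // -p2 subee.
by move=> w /= ng hD; apply: ng; apply/e2.
Qed.

End PairLaw.

(** * Comparison of the two initial states *)

Lemma glued0 {R : realType} (c C : R) (z y : R -> R) : 0 < c -> c <= C -> gpath c C z -> gpath c C y ->
  glued z y 0 = z 0.
Proof.
move=> c0 cC gz gy; have c2 : 0 < c ^+ 2 by rewrite exprn_gt0.
have r0 : rho z y 0 = 0.
  have := lclockK c0 cC gz gy (lexx 0).
  by rewrite (proj1 (lclock_bilip c0 cC gz gy)).
case: (boolP (merged z y (rho z y 0))) => [mg|nm]; last by exact: (glued_premerge c0 cC gz gy (lexx 0) nm).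
have psi0 : psi z y 0 = z 0.
  rewrite /psi (proj1 (mclock_bilip c0 cC gy)); congr z.
  have := pinvE c2 (mclock_bilip c0 cC gz) (lexx 0).
  by rewrite (proj1 (mclock_bilip c0 cC gz)).
rewrite /glued /low mg r0; move: mg; rewrite r0 => /mergedP[v [/andP[v0 v1] e]].
by have ve : v = 0 by [lra]; rewrite ve psi0 in e; rewrite e.
Qed.

Lemma ae_le_integral {R : realType} {d : measure_display} {T : measurableType d} (mu : {measure set T -> \bar R})
  (f h : T -> \bar R) : (forall w, 0 <= f w)%E -> (forall w, 0 <= h w)%E ->
  measurable_fun [set: T] f -> measurable_fun [set: T] h -> {ae mu, forall w, (f w <= h w)%E} ->
  (\int[mu]_w f w <= \int[mu]_w h w)%E.
Proof. by move=> f0 h0 mf mh le; apply: ae_ge0_le_integral => //; apply: filterS le => w. Qed.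

Lemma theta_ext {R : realType} {T T' : Type} (B : nat -> nat -> set T) (B' : nat -> nat -> set T') (p : T) (p' : T') :
  (forall j i : nat, B j i p <-> B' j i p') -> theta (R := R) B p = theta B' p'.
Proof.
move=> e; rewrite /theta; congr (ereal_inf _); apply/seteqP; split=> _ [r [j [i [-> h]]] <-];
  by exists (i%:R / 2 ^+ j) => //; exists j, i; split => //; apply/e.
Qed.

Section Comparison.
Context {R : realType} {m : nat} (ys : 'I_m -> R) (a : R -> R) (q : R) (T : \bar R) (g : R -> R).
Context {d : measure_display} {Omega : measurableType d}.
Variables (P : R * R -> probability Omega R) (X Y : R -> Omega -> R) (F : R -> set (set Omega)) (Q : 'M[R]_m).
Hypothesis ys_incr : forall i j : 'I_m, (i < j)%N -> ys i < ys j.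
Hypotheses (a_meas : measurable_fun [set: R] a) (q_gt0 : 0 < q) (T_ge0 : (0 <= T)%E).
Hypothesis g_meas : measurable_fun [set: R] g.
Hypotheses (X_rc : right_continuous_paths X) (Y_rc : right_continuous_paths Y).
Hypothesis XY_markov : strong_markov ([set: R] `*` range ys) P (pair_process X Y).
Hypothesis h0 : forall x y, range ys y -> (\int[P (x, y)]_w sup_reward X q g T w < +oo)%E.
Hypotheses (fF : filtration F) (aXY : adapted F (pair_process X Y)).
Hypothesis h1 : forall x y, range ys y -> volatility_equation (P (x, y)) F a X Y.
Hypothesis h2 : forall x y, range ys y -> markov_chain (P (x, y)) ys Q Y.
Hypothesis h4 : unique_volatility_law a ys Q.
Hypothesis h5 : skip_free Q.
Variables (c C : R).
Hypotheses (c0 : 0 < c) (cC : c <= C) (cysC : forall i, c <= ys i <= C).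
Context {dG : measure_display} {OG : measurableType dG}.
Variables (PG : probability OG R) (FG : R -> set (set OG)) (G : R -> OG -> R) (x y y' : R).
Hypotheses (G_rc : right_continuous_paths G) (sdeG : sde_solution PG FG a x G).
Hypotheses (y_in : range ys y) (y'_in : range ys y') (yy' : y <= y').

Let PU := P (x, y').
Let PL := P (x, y).
Let PUL : probability (Omega * Omega)%type R := (PU \x PL)%E.
Let PGUL : probability (OG * (Omega * Omega))%type R := (PG \x PUL)%E.

Let mX t : 0 <= t -> measurable_fun [set: Omega] (X t). Proof. move=> t0; exact: (X_measurable XY_markov t0). Qed.
Let mY t : 0 <= t -> measurable_fun [set: Omega] (Y t). Proof. move=> t0; exact: (Y_measurable XY_markov t0). Qed.
Let gYw w : gpath c C (Y ^~ w). Proof. exact: (Y_gpath Y_rc XY_markov cysC). Qed.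
Let gY : gproc c C Y. Proof. by split. Qed.
Let pos t i j : 0 <= t -> 0 <= expmx (t *: Q) i j. Proof. exact: (pt_ge0 XY_markov h2). Qed.

Let start v : range ys v -> {ae P (x, v), forall w, pair_process X Y 0 w = (x, v)}.
Proof. by move=> v_in; have [_ _ st _ _] := XY_markov; exact: (st (x, v)). Qed.

Let startY v : range ys v -> {ae P (x, v), forall w, Y 0 w = v}.
Proof. by move=> /start; apply: filterS => w [_ ->]. Qed.

Let model v : range ys v -> volatility_model (P (x, v)) F a ys Q x v X Y.
Proof. by move=> v_in; split => //; [exact: start|exact: h1|exact: h2]. Qed.

Let X1 t (w : OG * Omega) : R := G (mclock (Y ^~ w.2) t) w.1.
Let Y1 t (w : OG * Omega) : R := Y t w.2.
Let X2 t (w : OG * (Omega * Omega)) : R := G (mclock (glued_process Y ^~ w.2) t) w.1.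
Let Y2 t (w : OG * (Omega * Omega)) : R := glued_process Y t w.2.

Let gg : gproc c C (glued_process Y). Proof. exact: (glued_process_gproc Y_rc XY_markov c0 cC cysC). Qed.

(** The upper model may be taken to be [G] in the clock of the chain started at [y']. *)
Let law1 : same_law (PG \x PU)%E (pair_process X1 Y1) PU (pair_process X Y).
Proof.
have [F1 V1] := time_change_model (h2 x y'_in) pos a_meas G_rc sdeG c0 cC gY (startY y'_in).
exact: (h4 y'_in V1 (model y'_in)).
Qed.

(** The lower model may be taken to be [G] in the clock of the glued chain, which starts at [y] and
    obeys the same [Q]. *)
Let law2 : same_law PL (pair_process X Y) PGUL (pair_process X2 Y2).
Proof.
have mcg := glued_markov_chain (ys_inj ys_incr) Y_rc XY_markov h2 c0 cC cysC (z1 := (x, y')) (z2 := (x, y)) y'_in y_in.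
have st : {ae PUL, forall w, glued_process Y 0 w = y}.
  by apply: filterS (ae_snd PU (startY y_in)) => w e; rewrite /glued_process (glued0 c0 cC (gYw _) (gYw _)).
have [F2 V2] := time_change_model mcg pos a_meas G_rc sdeG c0 cC gg st.
exact: (h4 y_in (model y_in) V2).
Qed.

Let aG : adapted FG G. Proof. by have [] := sdeG. Qed.
Let mG t : 0 <= t -> measurable_fun [set: OG] (G t).
Proof. by have [[_ mFG _] _ _ _] := sdeG; move=> t0 _ D mD; rewrite setTI; apply: (mFG t t0); exact: aG. Qed.
Let jG : jmeas G. Proof. exact: jmeas_right_continuous. Qed.

Let rX1 : right_continuous_paths X1. Proof. exact: (clocked_right_continuous c0 cC gY G_rc). Qed.
Let rX2 : right_continuous_paths X2. Proof. exact: (clocked_right_continuous c0 cC gg G_rc). Qed.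
Let mX1 t : 0 <= t -> measurable_fun [set: OG * Omega] (X1 t).
Proof. by move=> t0; exact: (jmeas_section t0 (jmeas_clocked c0 cC gY jG)). Qed.
Let mX2 t : 0 <= t -> measurable_fun [set: OG * (Omega * Omega)] (X2 t).
Proof. by move=> t0; exact: (jmeas_section t0 (jmeas_clocked c0 cC gg jG)). Qed.
Let mY1 t : 0 <= t -> measurable_fun [set: OG * Omega] (Y1 t).
Proof. by move=> t0; exact: (measurableT_comp (mY t0) measurable_snd). Qed.
Let mY2 t : 0 <= t -> measurable_fun [set: OG * (Omega * Omega)] (Y2 t).
Proof. by move=> t0; exact: (measurableT_comp (proj2 gg t t0) measurable_snd). Qed.

Variable B : nat -> nat -> set (R -> R * R).
Hypothesis sB : forall j i : nat, path_sigma `[0, i%:R / 2 ^+ j] (B j i).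

(** Equality of laws is available for integrals of nonnegative functions; on good paths the payoff
    is its own positive part. *)
Let plus (r : R) : \bar R := (Num.max r 0)%:E.
Let mplus : measurable_fun [set: R] plus.
Proof. by apply/measurable_EFinP; exact: measurable_maxr. Qed.
Let plus0 r : (0 <= plus r)%E. Proof. by rewrite lee_fin le_max lexx orbT. Qed.

Let below (w : OG * (Omega * Omega)) : R -> R * R := pair_process X1 Y1 ^~ (w.1, w.2.1).
Let low_path (w : OG * (Omega * Omega)) : R -> R := Y ^~ w.2.2.

Let lower_law : (\int[PL]_w plus (payoff (theta B) q g (pair_process X Y ^~ w)) =
  \int[PGUL]_w plus (payoff (theta B) q g (pair_process X2 Y2 ^~ w)))%E.
Proof.
apply: (pair_law_integral mX mY mX2 mY2 X_rc rX2 law2) => // [w|t t0]; first exact: theta_ge0.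
apply: (theta_measurable sB _ _ t0) => s s0.
  exact: (@eitherX_measurable R _ _ _ _ X Y X2 Y2 s s0).
exact: (@eitherY_measurable R _ _ _ _ X Y X2 Y2 s s0).
Qed.

Let lower_good : {ae PL, forall w, good (theta B) g T (pair_process X Y ^~ w)} ->
  {ae PGUL, forall w, good (theta B) g T (pair_process X2 Y2 ^~ w)}.
Proof.
apply: (pair_law_good mX mY mX2 mY2 X_rc rX2 law2) => // [w|t t0]; first exact: theta_ge0.
apply: (theta_measurable sB _ _ t0) => s s0.
  exact: (@eitherX_measurable R _ _ _ _ X Y X2 Y2 s s0).
exact: (@eitherY_measurable R _ _ _ _ X Y X2 Y2 s s0).
Qed.

Section FixedLowerPath.
Variables (z : R -> R) (gz : gpath c C z).

Let ret0 w : (0 <= retime B z (pair_process (eitherX X1 X) (eitherY Y1 Y) ^~ w))%E.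
Proof.
apply: (retime_ge0 c0 cC B gz); have : gproc c C (eitherY Y1 Y : R -> either_space X1 Y1 X Y -> R).
  by apply: eitherY_gproc => u; exact: gYw.
by move=> [/(_ w)].
Qed.

Let ret_meas t : 0 <= t ->
  measurable ([set w | (retime B z (pair_process (eitherX X1 X) (eitherY Y1 Y) ^~ w) < t%:E)%E] : set (either_space X1 Y1 X Y)).
Proof.
move=> t0; apply: (retime_measurable (Z := fun t _ => z t) c0 cC sB _ _ _ _ t0).
- exact: eitherX_right_continuous.
- by move=> s s0; exact: (@eitherX_measurable R _ _ _ _ X1 Y1 X Y s s0).
- by apply: eitherY_gproc => u; exact: gYw.
- by split => // s s0; exact: measurable_cst.
Qed.

Let upper_law : (\int[(PG \x PU)%E]_w plus (payoff (retime B z) q g (pair_process X1 Y1 ^~ w)) =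
  \int[PU]_w plus (payoff (retime B z) q g (pair_process X Y ^~ w)))%E.
Proof. exact: (pair_law_integral mX1 mY1 mX mY rX1 X_rc law1 ret0 ret_meas). Qed.

(** For a fixed lower path the retimed rule is an optional time of the upper model, so
    [optional_reward] bounds its reward after the return to the original space. *)
Lemma upper_value : {ae (PG \x PU)%E, forall w, good (retime B z) g T (pair_process X1 Y1 ^~ w)} ->
  (\int[(PG \x PU)%E]_w plus (payoff (retime B z) q g (pair_process X1 Y1 ^~ w)) <= value PU X Y q g T)%E.
Proof.
move=> /(pair_law_good mX1 mY1 mX mY rX1 X_rc law1 ret0 ret_meas g_meas) gd; rewrite upper_law.
pose sigma w := retime B z (pair_process X Y ^~ w).
have s0 w : (0 <= sigma w)%E by exact: (@retime_ge0 R c C c0 cC B z gz (pair_process X Y ^~ w) (gYw w)).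
have opt t : 0 <= t -> natural (pair_process X Y) t [set w | (sigma w < t%:E)%E].
  by move=> t0; exact: (retime_optional c0 cC sB X_rc mX gY gz t0).
have ms (t : R) : 0 <= t -> measurable [set w | (sigma w < t%:E)%E].
  move=> t0; apply: (retime_measurable (Z := fun t _ => z t) c0 cC sB X_rc mX gY _ t0).
  by split => // s s0'; exact: measurable_cst.
have mp : measurable_fun [set: Omega] (fun w => expR (- q * fine (sigma w)) * g (X (fine (sigma w)) w)).
  exact: (payoff_measurable X_rc mX q g_meas s0 ms).
have sT : {ae PU, forall w, (sigma w <= T)%E /\ (sigma w < +oo)%E} by apply: filterS gd => w [].
apply: le_trans (optional_reward fF aXY (h1 x y'_in) X_rc g_meas T_ge0 (h0 x y'_in) s0 opt sT).
rewrite le_eqVlt; apply/orP; left; apply/eqP; apply: ae_eq_integral => //.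
- exact: measurableT_comp mplus mp.
- exact/measurable_EFinP.
- apply: filterS gd => w [_ _ gg0] _; rewrite /plus /payoff max_l //.
  by rewrite mulr_ge0 // expR_ge0.
Qed.

End FixedLowerPath.

(** On the common space the retimed rule stops at the same place and no later, hence pays at least
    as much; averaging over the lower path then uses [upper_value] for almost every frozen path. *)
Lemma retimed_le_value : {ae PL, forall w, good (theta B) g T (pair_process X Y ^~ w)} ->
  (\int[PL]_w plus (payoff (theta B) q g (pair_process X Y ^~ w)) <= value PU X Y q g T)%E.
Proof.
move=> gd; rewrite lower_law.
pose K w := plus (payoff (retime B (low_path w)) q g (below w)).
have XB_rc : right_continuous_paths (fun t (w : OG * (Omega * Omega)) => X1 t (w.1, w.2.1)).
  by move=> w t t0; exact: (@rX1 (w.1, w.2.1) t t0).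
have mproj : measurable_fun [set: OG * (Omega * Omega)] (fun w : OG * (Omega * Omega) => (w.1, w.2.1)).
  apply: measurable_fun_pair; first exact: measurable_fst.
  exact: measurableT_comp measurable_fst measurable_snd.
have mXB t : 0 <= t -> measurable_fun [set: OG * (Omega * Omega)] (fun w : OG * (Omega * Omega) => X1 t (w.1, w.2.1)).
  by move=> t0; exact: (measurableT_comp (mX1 t0) mproj).
have gYB : gproc c C (fun t (w : OG * (Omega * Omega)) => Y t w.2.1).
  split=> [w|t t0]; first exact: gYw.
  exact: (measurableT_comp (mY t0) (measurableT_comp measurable_fst measurable_snd)).
have gZB : gproc c C (fun t (w : OG * (Omega * Omega)) => Y t w.2.2).
  split=> [w|t t0]; first exact: gYw.
  exact: (measurableT_comp (mY t0) (measurableT_comp measurable_snd measurable_snd)).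
have s0 w : (0 <= retime B (low_path w) (below w))%E by exact: (@retime_ge0 R c C c0 cC B (low_path w) (gYw w.2.2) (below w) (gYw w.2.1)).
have ms (t : R) : 0 <= t -> measurable [set w | (retime B (low_path w) (below w) < t%:E)%E].
  by move=> t0; exact: (retime_measurable c0 cC sB XB_rc mXB gYB gZB t0).
have mK : measurable_fun [set: OG * (Omega * Omega)] K.
  exact: (measurableT_comp mplus (payoff_measurable XB_rc mXB q g_meas s0 ms)).
have K0 w : (0 <= K w)%E by exact: plus0.
have mth (t : R) : 0 <= t -> measurable [set w | (theta B (pair_process X2 Y2 ^~ w) < t%:E)%E].
  by move=> t0; exact: (theta_measurable sB mX2 mY2 t0).
have cross := ae_snd (P2 := PUL) PG (never_crosses ys_incr Y_rc XY_markov h2 h5 c0 cC cysC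
  (z1 := (x, y')) (z2 := (x, y)) y'_in y_in yy').
have key : {ae PGUL, forall w, good (retime B (low_path w)) g T (below w) /\
    (plus (payoff (theta B) q g (pair_process X2 Y2 ^~ w)) <= K w)%E}.
  apply: filterS2 (lower_good gd) cross => w [thT thoo g0] cr.
  have g1 := gYw w.2.1; have g2 := gYw w.2.2.
  (* The upper model read at [rho s] is the lower model at [s]: both are [G] at the same driving
     clock, by [mclock_glued]. *)
  have same s : 0 <= s -> glue (low_path w) (below w) s = pair_process X2 Y2 s w.
    by move=> s0'; rewrite /pair_process /X2 /glued_process (mclock_glued c0 cC g2 g1 s0').
  have thE : theta (R := R) B (glue (low_path w) (below w)) = theta B (pair_process X2 Y2 ^~ w).
    apply: (@theta_ext R _ _ B B) => j i; apply: (path_agree (@sB j i)) => s.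
    by rewrite /= in_itv /= => /andP[s0' _]; exact: same.
  have th0 := theta_ge0 (R := R) B (pair_process X2 Y2 ^~ w).
  pose r : R := fine (theta B (pair_process X2 Y2 ^~ w)).
  have rE : theta B (pair_process X2 Y2 ^~ w) = r%:E by rewrite /r fineK // ge0_fin_numE.
  have r0 : 0 <= r by exact: fine_ge0.
  have reE : retime B (low_path w) (below w) = (rho (low_path w) (Y ^~ w.2.1) r)%:E.
    by apply: theta_glue_retime; rewrite thE.
  pose s := rho (low_path w) (Y ^~ w.2.1) r.
  (* Upper time does not exceed lower time, since almost surely the paths do not cross before
     merging. *)
  have sr : s <= r by exact: (rho_le_id c0 cC g2 g1 cr r0).
  have XE : (below w s).1 = (pair_process X2 Y2 r w).1 by rewrite -(same r r0).
  have g0' : 0 <= g (below w s).1 by rewrite XE; move: g0; rewrite -/r.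
  split.
    split; rewrite reE ?ltry //; apply: le_trans thT; by rewrite rE lee_fin.
  have -> : K w = plus (expR (- q * s) * g (below w s).1) by rewrite /K /payoff reE.
  have -> : payoff (theta B) q g (pair_process X2 Y2 ^~ w) = expR (- q * r) * g (below w s).1.
    by rewrite XE.
  rewrite /plus lee_fin !max_l ?mulr_ge0 ?expR_ge0 //.
  by rewrite ler_wpM2r // ler_expR !mulNr lerN2 ler_pM2l.
have mJ : measurable_fun [set: OG * (Omega * Omega)] (fun w => plus (payoff (theta B) q g (pair_process X2 Y2 ^~ w))).
  apply: (measurableT_comp mplus); apply: (payoff_measurable rX2 mX2 q g_meas _ mth) => w.
  exact: theta_ge0.
have J0 w : (0 <= plus (payoff (theta B) q g (pair_process X2 Y2 ^~ w)))%E by exact: plus0.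
apply: (@le_trans _ _ (\int[PGUL]_w K w)%E).
  by apply: (ae_le_integral J0 K0 mJ mK); apply: filterS key => w [].
rewrite (rotate_tonelli PG PU PL mK K0).
have mI := rotate_measurable PG PU mK K0.
have bound : {ae PL, forall w, (\int[(PG \x PU)%E]_v K (v.1, (v.2, w)) <= value PU X Y q g T)%E}.
  have key1 : {ae PGUL, forall w, good (retime B (low_path w)) g T (below w)}.
    by apply: filterS key => w [].
  apply: filterS (ae_rotate (PA := PG) (PB := PU) (PC := PL) key1) => w hw.
  exact: (upper_value (gYw w) hw).
(* Were the value negative, the almost sure bound on nonnegative integrals would fail everywhere.
   The sign is needed to integrate the constant bound. *)
have v0 : (0 <= value PU X Y q g T)%E.
  rewrite leNgt; apply/negP => vn; have [N [mN PN sub]] := bound.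
  have NT : N = setT.
    apply/seteqP; split => // w _; apply: sub => /= h.
    have := le_lt_trans h vn; rewrite ltNge integral_ge0 //.
  by move: PN; rewrite NT probability_setT => /eqP; rewrite gt_eqF // lte_fin.
apply: (@le_trans _ _ (\int[PL]_w cst (value PU X Y q g T) w)%E).
  apply: (ae_le_integral _ _ mI _ bound) => // w.
  by apply: integral_ge0 => v _; exact: K0.
by rewrite integral_cst // [X in (_ * X)%E](_ : _ = 1%E) ?mule1 //; exact: probability_setT.
Qed.

End Comparison.

Theorem theorem2p5 (R : realType)
  (m : nat) (ys : 'I_m -> R)
  (ys_incr : forall i j : 'I_m, (i < j)%N -> ys i < ys j)
  (ys_gt0 : forall i, 0 < ys i)
  (a : R -> R) (a_meas : measurable_fun [set: R] a)
  (q : R) (q_gt0 : 0 < q)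
  (T : \bar R) (T_ge0 : (0 <= T)%E)
  (g : R -> R) (g_meas : measurable_fun [set: R] g)
  (g_ge0 : exists z, 0 <= g z)
  (d : measure_display) (Omega : measurableType d)
  (P : R * R -> probability Omega R) (X Y : R -> Omega -> R)
  (X_rc : right_continuous_paths X) (Y_rc : right_continuous_paths Y)
  (XY_markov : strong_markov ([set: R] `*` range ys) P (pair_process X Y))
  (h0 : forall x y, range ys y ->
     (\int[P (x, y)]_omega sup_reward X q g T omega < +oo)%E)
  (F : R -> set (set Omega)) (F_filtration : filtration F)
  (XY_adapted : adapted F (pair_process X Y))
  (h1 : forall x y, range ys y -> volatility_equation (P (x, y)) F a X Y)
  (Q : 'M[R]_m)
  (h2 : forall x y, range ys y -> markov_chain (P (x, y)) ys Q Y)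
  (h3 : weakly_unique_strong_markov_sde a)
  (h4 : unique_volatility_law a ys Q)
  (h5 : skip_free Q)
  (x y : R) (y_in : range ys y)
  (value_eq : value (P (x, y)) X Y q g T = value_ge0 (P (x, y)) X Y q g T) :
  forall y', range ys y' -> y <= y' ->
    (value (P (x, y)) X Y q g T <= value (P (x, y')) X Y q g T)%E.
Proof.
(* Only rules with nonnegative payoff remain; for a negative payoff, earlier exercise would be a
   loss. *)
move=> y' y'_in yy'; rewrite value_eq.
apply: ge_ereal_sup => _ [tau [[[tau0 st] tauT tauoo] tg] <-].
have [c [C [c0 cC cysC]]] := states_bounds ys_gt0.
have [[dG [OG [PG [G [rG _ sdeG]]]]] _] := h3; have [FG sde] := sdeG x.
(* Each event that [tau] has occurred by a dyadic time is written as a set of paths depending on the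
   past up to that time, so that [theta] gives back [tau]. *)
have /choice[B hB] : forall ji : nat * nat, exists B : set (R -> R * R),
    path_sigma `[0, ji.2%:R / 2 ^+ ji.1] B /\
    [set w | (tau w <= (ji.2%:R / 2 ^+ ji.1)%:E)%E] = [set w | B (pair_process X Y ^~ w)].
  move=> ji; have r0 : 0 <= ji.2%:R / 2 ^+ ji.1 :> R by rewrite divr_ge0.
  by have [B sB e] := path_rep (st _ r0); exists B.
have sB (j i : nat) : path_sigma `[0, i%:R / 2 ^+ j] (B (j, i)) by exact: (proj1 (hB (j, i))).
pose B2 j i := B (j, i).
have thE w : theta B2 (pair_process X Y ^~ w) = tau w.
  apply: theta_stopping => // j i.
  by have := congr1 (@^~ w) (proj2 (hB (j, i))); rewrite /B2 /= => ->.
have gd : {ae P (x, y), forall w, good (theta B2) g T (pair_process X Y ^~ w)}.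
  by apply: filterS2 tauoo tg => w h1' h2'; rewrite /good thE; split.
have mX := X_measurable XY_markov; have mY := Y_measurable XY_markov.
have mp : measurable_fun [set: Omega] (fun w => expR (- q * fine (tau w)) * g (X (fine (tau w)) w)).
  apply: (payoff_measurable X_rc mX q g_meas tau0) => t t0.
  rewrite (_ : [set w | _] = [set w | (theta B2 (pair_process X Y ^~ w) < t%:E)%E]); first exact: (theta_measurable sB mX mY t0).
  by apply/seteqP; split=> w; rewrite /= thE.
apply: le_trans (retimed_le_value ys_incr a_meas q_gt0 T_ge0 g_meas X_rc Y_rc XY_markov h0
  F_filtration XY_adapted h1 h2 h4 h5 c0 cC cysC rG sde y_in y'_in yy' sB gd).
(* The reward of [tau] equals the integral of the positive part, because [g] is almost surely
   nonnegative at [tau]. *)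
rewrite le_eqVlt; apply/orP; left; apply/eqP; apply: ae_eq_integral => //.
- exact/measurable_EFinP.
- apply/measurable_EFinP; apply: measurable_maxr => //.
  by apply: eq_measurable_fun mp => w _; rewrite /payoff thE.
- apply: filterS tg => w gg0 _; rewrite /payoff thE max_l //.
  by rewrite mulr_ge0 // expR_ge0.
Qed.
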